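(* Let $n\geq 3$ be an integer and let $g=e^{2u}|dx|^2$ be a smooth, complete conformal metric on $\mathbb{R}^n$ with finite total Q-curvature. Suppose that the scalar curvature satisfies $R_g\geq -C$ on $\mathbb{R}^n$ for some constant $C>0$. Then $$u(x)=\frac{2}{(n-1)!|\mathbb{S}^n|}\int_{\mathbb{R}^n}\log\frac{|y|}{|x-y|}Q(y)e^{nu(y)}\,dy+P(x),$$ where $P$ is a polynomial of even degree with $\deg(P)\leq n-1$, and $P(x)\geq -C'\log(|x|+2)$ for all $x\in\mathbb{R}^n$, for some constant $C'>0$.
   Context: The Q-curvature $Q$ of $g=e^{2u}|dx|^2$ is defined by $(-\Delta)^{n/2}u=Qe^{nu}$ on $\mathbb{R}^n$; for odd $n$, $(-\Delta)^{n/2}:=(-\Delta)^{1/2}\circ(-\Delta)^{(n-1)/2}$, with the assumption $(-\Delta)^{(n-1)/2}u\in L_{1/2}(\mathbb{R}^n):=\{\varphi\in L^1_{loc}: \int\frac{|\varphi|}{1+|x|^{n+1}}<\infty\}$ and $(-\Delta)^{1/2}f(x)=C(n)\,\mathrm{P.V.}\int\frac{f(x)-f(y)}{|x-y|^{n+1}}dy$ (i.e. Fourier multiplier $|\xi|$). Finite total Q-curvature means $Q$ is well defined and $Qe^{nu}\in L^1(\mathbb{R}^n)$. $|\mathbb{S}^n|$ is the volume of the standard unit $n$-sphere. The scalar curvature is $R_g=2(n-1)e^{-2u}\big(-\Delta u-\frac{n-2}{2}|\nabla u|^2\big)$. A constant polynomial is regarded as having even degree $0$. *)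

(* Defs.v *)
From HB Require Import structures.
From mathcomp Require Import all_boot all_order all_algebra.
From mathcomp Require Import all_classical all_reals all_analysis.
From mathcomp Require mpoly.
Set Implicit Arguments. Unset Strict Implicit. Unset Printing Implicit Defensive.
Import Order.TTheory GRing.Theory Num.Theory.
Import numFieldNormedType.Exports.
Local Open Scope classical_set_scope.
Local Open Scope ring_scope.

Section Defs.
Variable R : realType.
Variable n : nat.

Definition vec := 'rV[R]_n.

(* Euclidean norm |x| (the library norm on 'rV is the sup-norm). *)
Definition enorm (x : vec) : R := Num.sqrt (\sum_i (x ord0 i) ^+ 2).

Definition partial (i : 'I_n) (f : vec -> R) : vec -> R :=
  fun x => 'D_('e_i) f x.
Definition iterD (s : seq 'I_n) (f : vec -> R) : vec -> R := foldr partial f s.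

Definition smooth (f : vec -> R) : Prop :=
  forall s : seq 'I_n, continuous (iterD s f) /\
    forall (i : 'I_n) (x : vec), derivable (iterD s f) x 'e_i.

Definition lap (f : vec -> R) : vec -> R := fun x => \sum_i partial i (partial i f) x.
Definition neglap_pow (k : nat) (f : vec -> R) : vec -> R :=
  iter k (fun g x => - lap g x) f.

(* Lebesgue integral over R^n, written as the iterated one-dimensional Lebesgue
   integral over the coordinates x_{n-1}, ..., x_0 (Fubini-Tonelli). *)
Definition set_coord (x : vec) (k : nat) (t : R) : vec :=
  \row_j (if (j : nat) == k then t else x ord0 j).
Fixpoint iint (k : nat) (F : vec -> \bar R) (x : vec) : \bar R :=
  match k with
  | 0 => F x
  | k'.+1 => (\int[@lebesgue_measure R]_t iint k' F (set_coord x k' t))%E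
  end.
Definition intRn (F : vec -> \bar R) : \bar R := iint n F 0.

Definition L1 (f : vec -> R) : Prop := (intRn (fun x => (`|f x|)%:E) < +oo)%E.

Definition Lhalf (f : vec -> R) : Prop :=
  (intRn (fun x => (`|f x| / (1 + enorm x ^+ n.+1))%:E) < +oo)%E.

(* normalising constant of (-Delta)^{1/2} for odd n:
   C(n) = Gamma((n+1)/2) / pi^((n+1)/2) = ((n-1)/2)! / pi^((n+1)/2) *)
Definition Chalf : R := ((n.-1./2)`!)%:R / pi ^+ (n.+1./2).

Definition halflap_trunc (f : vec -> R) (x : vec) (eps : R) : R :=
  Chalf * fine (intRn (fun y =>
    ((if eps < enorm (x - y) then 1 else 0) *
       ((f x - f y) / enorm (x - y) ^+ n.+1))%:E)).

Definition halflap (f : vec -> R) (x : vec) : R :=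
  lim (halflap_trunc f x @ at_right 0).

Definition Qlap (u : vec -> R) : vec -> R :=
  if odd n then halflap (neglap_pow n./2 u) else neglap_pow n./2 u.

Definition Q_well_defined (u : vec -> R) : Prop :=
  odd n -> Lhalf (neglap_pow n./2 u) /\
           forall x, cvg (halflap_trunc (neglap_pow n./2 u) x @ at_right 0).

Definition Qcurv (u : vec -> R) (x : vec) : R := expR (- (n%:R * u x)) * Qlap u x.

Definition finite_total_Q (u : vec -> R) : Prop :=
  Q_well_defined u /\ L1 (fun x => Qcurv u x * expR (n%:R * u x)).

Definition scal (u : vec -> R) (x : vec) : R :=
  2 * (n%:R - 1) * expR (- (2 * u x)) *
  (- lap u x - (n%:R - 2) / 2 * \sum_i (partial i u x) ^+ 2).

Definition C1_curve (gam : R -> vec) : Prop :=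
  (forall t, derivable gam t 1) /\ continuous (fun t => 'D_1 gam t).
Definition glength (u : vec -> R) (gam : R -> vec) : R :=
  fine (\int[@lebesgue_measure R]_(t in `[0%R, 1%R]) (expR (u (gam t)) * enorm ('D_1 gam t))%:E)%E.
Definition gdist (u : vec -> R) (x y : vec) : R :=
  inf [set l | exists gam, [/\ C1_curve gam, gam 0 = x, gam 1 = y & l = glength u gam]].
Definition complete_metric (u : vec -> R) : Prop :=
  forall s : nat -> vec,
    (forall e : R, 0 < e -> exists N, forall k m, (N <= k)%N -> (N <= m)%N -> gdist u (s k) (s m) < e) ->
    exists l, forall e : R, 0 < e -> exists N, forall k, (N <= k)%N -> gdist u (s k) l < e.

(* total degree of a polynomial in n variables (0 for the zero polynomial) *)
Definition pdeg (P : mpoly.mpoly n R) : nat := (\max_(m <- mpoly.msupp P) mpoly.mdeg m)%N.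
Definition peval (P : mpoly.mpoly n R) (x : vec) : R := mpoly.meval (fun i => x ord0 i) P.

End Defs.

(* |S^k|, volume of the unit k-sphere: |S^0| = 2, |S^1| = 2 pi,
   |S^{k+2}| = 2 pi / (k+1) |S^k|   (= 2 pi^{(k+1)/2} / Gamma((k+1)/2)) *)
Fixpoint sphere_vol {R : realType} (k : nat) : R :=
  match k with
  | 0 => 2
  | 1 => 2 * pi
  | (k'.+1 as k1).+1 => 2 * pi / k1%:R * sphere_vol k'
  end.

(* Main.v *)
Require Import Defs.
From HB Require Import structures.
From mathcomp Require Import all_boot all_order all_algebra.
From mathcomp Require Import all_classical all_reals all_analysis.
From mathcomp Require mpoly.
Import (canonicals, coercions) mpoly.
From mathcomp Require Import measurable_realfun finmap.
From mathcomp Require Import ring lra zify.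
Set Implicit Arguments. Unset Strict Implicit. Unset Printing Implicit Defensive.
Import Order.TTheory GRing.Theory Num.Theory.
Import numFieldNormedType.Exports.
Local Open Scope classical_set_scope.
Local Open Scope ring_scope.

(** In the even case the Q-curvature density is [f = (-Delta)^(n/2) u], in the odd
    case [f = (-Delta)^(1/2) F] with [F = (-Delta)^((n-1)/2) u]; in both cases [f]
    is integrable.  The logarithmic potential [v] of [f] satisfies the same equation
    as [u]: its iterated Laplacians are Riesz potentials of [f], the last one being
    the fundamental solution.  For odd [n] the step from [f] back to [F] is the
    identity "[F] minus the Riesz potential of order one of [f] is constant", proved
    by pairing with Poisson kernels, whose semigroup law is derived from Gaussian
    superposition and a Cauchy-Schlomilch integral.  Hence [u - v] is polyharmonic.

    The scalar curvature bound gives [u >= - K ln (|x| + 2)] by a maximum principle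
    for [exp ((n-2) u / 2)], and ball averages of [v] grow at most
    logarithmically, so [u - v] has averages bounded below; a Liouville theorem for
    polyharmonic functions (reproducing ball averages) makes it a polynomial [P].
    Averaging over small balls then gives [P >= - C ln (|x| + 2)], which forces the
    top-degree part to be nonnegative along suitable monomial curves and the degree
    to be even. *)


(** No polar coordinates or surface measures occur. Spherical means are replaced by means against
    [r^-n (1 - |z|^2 / r^2)_+^N], because the [r]-derivative of this bump is a multiple of the
    Laplacian of the bump with [N + 1]. Singular powers are limits of [(|z|^2 + e)^p], whose
    Laplacians are explicit and dominated uniformly in [e]; at the critical power a term of constant
    mass survives and produces the Dirac mass.

    In odd dimension [F] is only known to be integrable against [|z|^-(n+1)] at infinity. Poisson
    kernels decay at exactly this rate, and by the semigroup law their half-Laplacian is minus their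
    derivative in the height [t]. Hence a regularised order-one potential of [f] minus a multiple of
    the Poisson extension of [F] does not depend on [t]: height 0 gives the combination wanted, and
    letting [t] grow shows that it takes the same value at any two points.

    The constant [2 / ((n-1)! |S^n|)] is the reciprocal of the product of the factors picked up
    between the logarithm and the fundamental solution. *)

Definition vec_display : measure_display.
Proof. exact: default_measure_display. Qed.

(** * Measurable structure on row vectors, generated by the coordinates *)

Section vec_measurable.
Variables (R : realType) (n : nat).

Let coors : 'I_n -> 'rV[R]_n -> R := fun i x => x ord0 i.

Let vec_set0 : g_sigma_preimage coors set0.
Proof. exact: sigma_algebra0. Qed.

Let vec_setC A : g_sigma_preimage coors A -> g_sigma_preimage coors (~` A).
Proof. exact: sigma_algebraC. Qed.

Let vec_bigcup (F : _^nat) : (forall i, g_sigma_preimage coors (F i)) ->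
  g_sigma_preimage coors (\bigcup_i (F i)).
Proof. exact: sigma_algebra_bigcup. Qed.

HB.instance Definition _ := @isMeasurable.Build vec_display
  'rV[R]_n (g_sigma_preimage coors) vec_set0 vec_setC vec_bigcup.

End vec_measurable.

(** * Iterated integrals and the Lebesgue measure they define *)

Section vec_measurable_fun.
Context {R : realType} {n : nat}.
Notation V := 'rV[R]_n.

Lemma measurable_coord (i : 'I_n) :
  measurable_fun setT (fun x : V => x ord0 i).
Proof.
move=> _ Y mY; rewrite setTI; apply: sub_sigma_algebra => /=.
rewrite -bigcup_seq/=; exists i => /=; first by rewrite mem_index_enum.
by exists Y => //; rewrite setTI.
Qed.

Lemma measurable_vecP d (T : measurableType d) (f : T -> V) :
  (forall i, measurable_fun setT (fun x => f x ord0 i)) -> measurable_fun setT f.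
Proof.
move=> mf.
have H : forall A, g_sigma_preimage (fun (i : 'I_n) (x : V) => x ord0 i) A -> measurable (f @^-1` A).
  apply: smallest_sub.
    split => /=.
    - by rewrite preimage_set0.
    - by move=> A mA; rewrite setTD preimage_setC; exact: measurableC.
    - by move=> F mF; rewrite preimage_bigcup; exact: bigcup_measurable.
  move=> A; rewrite -bigcup_seq/= => -[i _ [B mB <-]].
  by rewrite setTI -comp_preimage -[X in measurable X]setTI; exact: mf.
by move=> _ A mA; rewrite setTI; exact: H.
Qed.

(** Joint measurability in the base point and the new coordinate is what lets Tonelli be applied one
    coordinate at a time. *)
Lemma measurable_set_coord (k : nat) :
  measurable_fun setT (fun p : V * measurableTypeR R => set_coord p.1 k p.2).
Proof.
apply: measurable_vecP => i.
have [ik|ik] := boolP (i == k :> nat).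
  rewrite [X in measurable_fun _ X](_ : _ = snd); first exact: measurable_snd.
  by apply/funext => p; rewrite mxE ik.
rewrite [X in measurable_fun _ X](_ : _ = (fun x : V => x ord0 i) \o fst).
  exact: (measurableT_comp (measurable_coord i) measurable_fst).
by apply/funext => p; rewrite mxE (negbTE ik).
Qed.

Lemma measurable_iint (F : V -> \bar R) k :
  measurable_fun setT F -> (forall x, 0 <= F x)%E ->
  measurable_fun setT (iint k F) /\ (forall x, 0 <= iint k F x)%E.
Proof.
move=> mF F0; elim: k => [//|k [mk k0]]; split; last first.
  by move=> x /=; apply: integral_ge0.
apply: (@measurable_fun_fubini_tonelli_F _ _ V (measurableTypeR R) R
  (@lebesgue_measure R) (fun p => iint k F (set_coord p.1 k p.2))) => //.
exact: (measurableT_comp mk (measurable_set_coord k)).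
Qed.

Lemma iint_line_measurable (F : V -> \bar R) k x :
  measurable_fun setT F ->
  measurable_fun setT (fun t : measurableTypeR R => F (set_coord x k t)).
Proof.
move=> mF.
apply: (measurableT_comp mF).
exact: (measurableT_comp (measurable_set_coord k) (measurable_pair1 x)).
Qed.

Lemma iint_series (F : nat -> V -> \bar R) k x :
  (forall i, measurable_fun setT (F i)) -> (forall i x, 0 <= F i x)%E ->
  (iint k (fun x => \sum_(i <oo) F i x) x = \sum_(i <oo) iint k (F i) x)%E.
Proof.
move=> mF F0; elim: k x => [//|k IH] x /=.
under eq_integral do rewrite IH.
apply: integral_nneseries => // i.
- exact: (iint_line_measurable k x (proj1 (measurable_iint k (mF i) (F0 i)))).
- by move=> t _; apply: (proj2 (measurable_iint k (mF i) (F0 i))).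
Qed.

Lemma le_iint (F G : V -> \bar R) k x :
  measurable_fun setT F -> (forall x, 0 <= F x)%E ->
  measurable_fun setT G ->
  (forall x, F x <= G x)%E -> (iint k F x <= iint k G x)%E.
Proof.
move=> mF F0 mG FG.
have G0 y : (0 <= G y)%E by apply: le_trans (FG y).
elim: k x => [//|k IH] x /=.
apply: ge0_le_integral => //.
- by move=> t _; apply: (proj2 (measurable_iint k mF F0)).
- exact: (iint_line_measurable k x (proj1 (measurable_iint k mF F0))).
- exact: (iint_line_measurable k x (proj1 (measurable_iint k mG G0))).
Qed.

Lemma iint_lim (F : nat -> V -> \bar R) k x :
  (forall i, measurable_fun setT (F i)) -> (forall i x, 0 <= F i x)%E ->
  (forall x, {homo F^~ x : n m / (n <= m)%N >-> (n <= m)%E}) ->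
  (iint k (fun x => limn (F^~ x)) x = limn (fun i => iint k (F i) x))%E.
Proof.
move=> mF F0 ndF; elim: k x => [//|k IH] x /=.
under eq_integral do rewrite IH.
rewrite (@monotone_convergence _ (measurableTypeR R) R lebesgue_measure setT measurableT
  (fun i t => iint k (F i) (set_coord x k t)))//.
- by move=> i; exact: (iint_line_measurable k x (proj1 (measurable_iint k (mF i) (F0 i)))).
- by move=> i t _; apply: (proj2 (measurable_iint k (mF i) (F0 i))).
- move=> t _ i j ij; apply: le_iint => // y; exact: ndF.
Qed.

Lemma iint0 k x : iint k (fun _ : V => 0%E) x = 0%E.
Proof.
elim: k x => [//|k IH] x /=.
by under eq_integral do rewrite IH; rewrite integral0.
Qed.

Lemma eq_iint (F G : V -> \bar R) k x : F =1 G -> iint k F x = iint k G x.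
Proof. by move=> /funext ->. Qed.

(** Lebesgue measure on [R^n], defined by the iterated integral itself: on indicators it agrees with
    [intRn] by definition, and sigma-additivity is monotone convergence inside each coordinate
    integral. *)
Definition volm (A : set V) : \bar R := intRn (fun x => (\1_A x)%:E).

Let volm0 : volm set0 = 0%E.
Proof.
rewrite /volm /intRn -[RHS](iint0 n 0); apply: eq_iint => x.
by rewrite indicE in_set0.
Qed.

Let volm_ge0 A : (0 <= volm A)%E.
Proof.
have H k x : (0 <= iint k (fun x => (\1_A x)%:E) x)%E.
  elim: k x => [x|k IH x] /=; first by rewrite lee_fin.
  by apply: integral_ge0 => t _; exact: IH.
exact: H.
Qed.

Let volm_sigma_additive : semi_sigma_additive volm.
Proof.
move=> F mF tF mUF.
have -> : volm (\bigcup_n F n) = (\sum_(i <oo) volm (F i))%E.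
  rewrite /volm /intRn -(@iint_series (fun i x => (\1_(F i) x)%:E)).
  - by apply: eq_iint => x; rewrite indic_bigcup.
  - by move=> i; exact/measurable_EFinP/measurable_indic.
  - by move=> i x; rewrite lee_fin.
exact: is_cvg_nneseries.
Qed.

HB.instance Definition _ := isMeasure.Build _ _ _ volm
  volm0 volm_ge0 volm_sigma_additive.

End vec_measurable_fun.

(** * Agreement of the iterated integral with the integral against [volm] *)

Section integral_volm.
Context {R : realType} {n : nat}.
Notation V := 'rV[R]_n.
Local Open Scope ereal_scope.

Lemma iintD (F G : V -> \bar R) k x :
  measurable_fun setT F -> (forall x, 0 <= F x) ->
  measurable_fun setT G -> (forall x, 0 <= G x) ->
  iint k (fun x => F x + G x) x = iint k F x + iint k G x.
Proof.
move=> mF F0 mG G0; elim: k x => [//|k IH] x /=.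
under eq_integral do rewrite IH.
rewrite (@ge0_integralD _ (measurableTypeR R) R lebesgue_measure setT measurableT)//.
- by move=> t _; apply: (proj2 (measurable_iint k mF F0)).
- exact: (iint_line_measurable k x (proj1 (measurable_iint k mF F0))).
- by move=> t _; apply: (proj2 (measurable_iint k mG G0)).
- exact: (iint_line_measurable k x (proj1 (measurable_iint k mG G0))).
Qed.

Lemma iintZl (c : R) (F : V -> \bar R) k x : (0 <= c)%R ->
  measurable_fun setT F -> (forall x, 0 <= F x) ->
  iint k (fun x => c%:E * F x) x = c%:E * iint k F x.
Proof.
move=> c0 mF F0; elim: k x => [//|k IH] x /=.
under eq_integral do rewrite IH.
rewrite (@ge0_integralZl_EFin _ (measurableTypeR R) R lebesgue_measure setT measurableT)//.
- by move=> t _; apply: (proj2 (measurable_iint k mF F0)).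
- exact: (iint_line_measurable k x (proj1 (measurable_iint k mF F0))).
Qed.

Import HBNNSimple.

Lemma integral_volm_nnsfun (h : {nnsfun V >-> R}) :
  \int[volm]_x (h x)%:E = intRn (fun x => (h x)%:E).
Proof.
(* Measurability and nonnegativity travel along the induction because additivity of [iint] asks for
   both. *)
pose P (F : V -> R) := [/\ measurable_fun setT F, (forall x, 0 <= F x)%R &
  \int[volm]_x (F x)%:E = intRn (fun x => (F x)%:E)].
suff: P h by case.
pose g (r : R) x : R := (r * \1_(h @^-1` [set r]) x)%R.
have -> : (h : V -> R) = (fun x => \sum_(r <- fset_set (range h)) g r x)%R.
  by apply/funext => x; rewrite fimfunE fsbig_finite.
suff H : forall s, {in s, forall r, 0 <= r}%R -> P (fun x => \sum_(r <- s) g r x)%R.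
  apply: H => r; rewrite in_fset_set // => /set_mem[y _ <-]; exact: fun_ge0.
elim=> [_|i r IHr ir0].
  split => [|x|]; first by under eq_fun do rewrite big_nil; exact: measurable_cst.
    by rewrite big_nil.
  under eq_integral do rewrite big_nil; rewrite integral0 /intRn.
  rewrite -[LHS](@iint0 R n n 0%R); apply: eq_iint => x.
  by rewrite big_nil.
have i0 : (0 <= i)%R by apply: ir0; rewrite mem_head.
have [mr r0 IH] : P (fun x => \sum_(r <- r) g r x)%R.
  by apply: IHr => z zr; apply: ir0; rewrite in_cons zr orbT.
have mA : measurable (h @^-1` [set i]).
  by rewrite -[X in measurable X]setTI; exact: measurable_funP.
have mi : measurable_fun setT (g i).
  by apply: measurable_funM => //; exact: measurable_indic.
have gi0 x : (0 <= g i x)%R by rewrite mulr_ge0.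
have Pi : \int[volm]_x (g i x)%:E = intRn (fun x => (g i x)%:E).
  rewrite /g; under eq_integral do rewrite EFinM.
  rewrite ge0_integralZl_EFin//; last first.
    exact/measurable_EFinP/measurable_indic.
  rewrite integral_indic// setIT /= /volm /intRn -iintZl//.
  exact/measurable_EFinP/measurable_indic.
split.
- by under eq_fun do rewrite big_cons; exact: measurable_funD.
- by move=> x; rewrite big_cons addr_ge0.
- under eq_integral do rewrite big_cons EFinD.
  rewrite ge0_integralD//.
  + rewrite Pi IH /intRn -iintD.
    * by apply: eq_iint => x; rewrite big_cons EFinD.
    * exact/measurable_EFinP.
    * by move=> x; rewrite lee_fin.
    * exact/measurable_EFinP.
    * by move=> x; rewrite lee_fin.
  + by move=> x _; rewrite lee_fin.
  + exact/measurable_EFinP.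
  + by move=> x _; rewrite lee_fin.
  + exact/measurable_EFinP.
Qed.

(** Both sides pass to the monotone limit of simple functions, on which they agree. *)
Lemma integral_volm (F : V -> \bar R) :
  measurable_fun setT F -> (forall x, 0 <= F x) ->
  \int[volm]_x F x = intRn F.
Proof.
move=> mF F0.
pose a := nnsfun_approx measurableT mF.
have aF x : F x = limn (fun i => (a i x)%:E).
  by apply/esym/cvg_lim => //; apply: cvg_nnsfun_approx.
have nda x i j : (i <= j)%N -> (a i x)%:E <= (a j x)%:E.
  by move=> ij; rewrite lee_fin; apply/lefP: x; exact: nd_nnsfun_approx.
rewrite (eq_integral (fun x => limn (fun i => (a i x)%:E))); last by move=> x _; exact: aF.
rewrite (@monotone_convergence _ V R volm setT measurableT (fun i x => (a i x)%:E)).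
- rewrite /intRn (eq_iint _ _ aF) (@iint_lim _ _ (fun i x => (a i x)%:E)).
  + by congr (limn _); apply/funext => i; exact: integral_volm_nnsfun.
  + by move=> i; exact/measurable_EFinP.
  + by move=> i x; rewrite lee_fin.
  + by move=> x i j ij; exact: nda.
- by move=> i; exact/measurable_EFinP.
- by move=> i x _; rewrite lee_fin.
- by move=> x _ i j ij; exact: nda.
Qed.

Lemma measurable_iint_signed (F : V -> \bar R) k :
  measurable_fun setT F -> measurable_fun setT (iint k F).
Proof.
move=> mF; elim: k => [//|k IH] /=.
pose G := fun p : V * measurableTypeR R => iint k F (set_coord p.1 k p.2).
have mG : measurable_fun setT G by exact: (measurableT_comp IH (measurable_set_coord k)).
have -> : (fun x : V => \int[@lebesgue_measure R]_t iint k F (set_coord x k t)) =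
  (fun x => \int[@lebesgue_measure R]_t G^\+ (x, t) - \int[@lebesgue_measure R]_t G^\- (x, t)).
  by apply/funext => x; rewrite [LHS]integralE; congr (_ - _); apply: eq_integral => t _;
    rewrite ?funeposE ?funenegE.
apply: emeasurable_funB.
- apply: (@measurable_fun_fubini_tonelli_F _ _ V (measurableTypeR R) R
    (@lebesgue_measure R) G^\+) => //; exact: measurable_funepos.
- apply: (@measurable_fun_fubini_tonelli_F _ _ V (measurableTypeR R) R
    (@lebesgue_measure R) G^\-) => //; exact: measurable_funeneg.
Qed.

(** A signed iterated integral splits into positive and negative parts only where the inner
    integrals are finite. Finiteness of the iterated integral of the absolute value is assumed at
    the point [x] alone; it gives finiteness of the inner ones for almost every value of the next
    coordinate, which is enough for the induction. *)
Lemma iint_posneg (F : V -> \bar R) k x : measurable_fun setT F ->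
  iint k (fun x => `|F x|) x < +oo -> iint k F x = iint k F^\+ x - iint k F^\- x.
Proof.
move=> mF.
have mA : measurable_fun setT (fun x => `|F x|) by exact: measurableT_comp.
have mP : measurable_fun setT F^\+ by exact: measurable_funepos.
have mN : measurable_fun setT F^\- by exact: measurable_funeneg.
have A0 y : 0 <= `|F y| by [].
have P0 y : 0 <= F^\+ y by exact: funepos_ge0.
have N0 y : 0 <= F^\- y by exact: funeneg_ge0.
elim: k x => [|k IH] x /=.
  by move=> _; rewrite [in LHS](funeposneg F).
set A := (fun t => iint k (fun x => `|F x|) (set_coord x k t)) => Afin.
have mAt := iint_line_measurable k x (proj1 (measurable_iint k mA A0)).
have mPt := iint_line_measurable k x (proj1 (measurable_iint k mP P0)).
have mNt := iint_line_measurable k x (proj1 (measurable_iint k mN N0)).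
have iA0 y := proj2 (measurable_iint k mA A0) y.
have iP0 y := proj2 (measurable_iint k mP P0) y.
have iN0 y := proj2 (measurable_iint k mN N0) y.
have intA : (@lebesgue_measure R).-integrable setT A.
  apply/integrableP; split => //.
  suff -> : (fun t => `|A t|) = A by [].
  by apply/funext => t; rewrite gee0_abs//; exact: iA0.
have PA y : iint k F^\+ y <= iint k (fun x => `|F x|) y.
  by apply: le_iint => // z; rewrite funeposE ge_max lee_abs abse_ge0.
have NA y : iint k F^\- y <= iint k (fun x => `|F x|) y.
  by apply: le_iint => // z; rewrite funenegE ge_max -abseN lee_abs abse_ge0.
have intP : (@lebesgue_measure R).-integrable setT (fun t => iint k F^\+ (set_coord x k t)).
  apply: le_integrable intA => // t _.
  by rewrite (gee0_abs (iP0 _)) (gee0_abs (iA0 _)); exact: PA.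
have intN : (@lebesgue_measure R).-integrable setT (fun t => iint k F^\- (set_coord x k t)).
  apply: le_integrable intA => // t _.
  by rewrite (gee0_abs (iN0 _)) (gee0_abs (iA0 _)); exact: NA.
rewrite -(@integralB _ (measurableTypeR R) R lebesgue_measure setT)//.
apply: ae_eq_integral => //.
- exact: (iint_line_measurable k x (measurable_iint_signed k mF)).
- exact: emeasurable_funB.
apply: filterS (integrable_ae measurableT intA) => t /(_ I) At _; apply: IH.
by rewrite ltey_eq; move: At; rewrite /A => ->.
Qed.

(** Bridge, for signed integrands, between the integral of the statement and integration theory. *)
Lemma intRn_integral (F : V -> \bar R) :
  measurable_fun setT F -> intRn (fun x => `|F x|) < +oo ->
  volm.-integrable setT F /\ intRn F = \int[volm]_x F x.
Proof.
move=> mF Ffin; have mA : measurable_fun setT (fun x => `|F x|) by exact: measurableT_comp.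
have iF : volm.-integrable setT F by apply/integrableP; split; rewrite ?integral_volm.
split => //; rewrite integralE /intRn iint_posneg// !integral_volm//.
- exact: measurable_funeneg.
- exact: measurable_funepos.
Qed.

Lemma intRn_integrable (F : V -> \bar R) :
  volm.-integrable setT F -> intRn F = \int[volm]_x F x.
Proof.
move=> /integrableP[mF iF]; apply (intRn_integral mF).
rewrite -integral_volm//; exact: measurableT_comp.
Qed.

End integral_volm.

(** * Invariance of Lebesgue measure under translations and reflections *)

Section measure_preserving.
Context d (T : measurableType d) {R : realType} (mu : {measure set T -> \bar R}).
Variable phi : T -> T.
Hypothesis mphi : measurable_fun setT phi.
Hypothesis muphi : forall A, measurable A -> mu (phi @^-1` A) = mu A.

Lemma ge0_integral_preserving (f : T -> \bar R) :
  measurable_fun setT f -> (forall x, 0 <= f x)%E ->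
  (\int[mu]_x f (phi x) = \int[mu]_x f x)%E.
Proof.
move=> mf f0.
have /= <- := @ge0_integral_pushforward _ _ _ _ _ phi mphi mu setT f measurableT mf (fun x _ => f0 x).
by apply: eq_measure_integral => A mA _; rewrite /= /pushforward muphi.
Qed.

Lemma integral_preserving (f : T -> \bar R) : mu.-integrable setT f ->
  mu.-integrable setT (f \o phi) /\ (\int[mu]_x f (phi x) = \int[mu]_x f x)%E.
Proof.
move=> fi; have mf : measurable_fun setT f by case/integrableP : fi.
have fi' : mu.-integrable setT (f \o phi).
  apply/integrableP; split; first exact: measurableT_comp.
  rewrite /= (@ge0_integral_preserving (fun x => `|f x|%E))//.
    by move/integrableP : fi => [].
  exact: measurableT_comp.
split => //.
rewrite integralE [RHS]integralE; congr (_ - _)%E.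
  rewrite -(@ge0_integral_preserving f^\+%E).
  - by apply: eq_integral => x _; rewrite !funeposE.
  - exact: measurable_funepos.
  - by move=> x; exact: funepos_ge0.
rewrite -(@ge0_integral_preserving f^\-%E).
- by apply: eq_integral => x _; rewrite !funenegE.
- exact: measurable_funeneg.
- by move=> x; exact: funeneg_ge0.
Qed.

End measure_preserving.

Section lebesgue_invariance.
Context {R : realType}.
Local Open Scope ereal_scope.
Notation leb := (@lebesgue_measure R).

(** The pushforward agrees with Lebesgue measure on half-open intervals, which determine it. *)
Lemma lebesgue_measureD (a : R) (A : set R) : measurable A ->
  leb ((fun t : measurableTypeR R => (t + a)%R : measurableTypeR R) @^-1` A) = leb A.
Proof.
move=> mA.
suff /(_ A mA) : forall A, measurable A ->
    leb A = pushforward leb (fun t : measurableTypeR R => (t + a)%R : measurableTypeR R) A.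
  by move->.
have mp : measurable_fun setT (fun t : measurableTypeR R => (t + a)%R : measurableTypeR R).
  exact: measurable_funD.
apply: lebesgue_measure_unique => //= _ [[b c]] _ <-.
rewrite /pushforward /=.
rewrite (_ : _ @^-1` _ = `](b - a)%R, (c - a)%R]%classic); last first.
  by apply/seteqP; split => t /=; rewrite !in_itv/= ltrBlDr lerBrDr.
rewrite !lebesgue_measure_itv/= !lte_fin ltrD2r; case: ifP => // _.
by rewrite -!EFinB; congr (_%:E); ring.
Qed.

Lemma ge0_lebesgue_integralD (a : R) (f : R -> \bar R) :
  measurable_fun setT f -> (forall x, 0 <= f x) ->
  \int[leb]_t f (t + a)%R = \int[leb]_t f t.
Proof.
move=> mf f0; apply: (@ge0_integral_preserving _ (measurableTypeR R) R leb
  (fun t => t + a)%R) => //; first exact: measurable_funD.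
exact: lebesgue_measureD.
Qed.

Lemma ge0_lebesgue_integralN (f : R -> \bar R) :
  measurable_fun setT f -> (forall x, 0 <= f x) ->
  \int[leb]_t f (- t)%R = \int[leb]_t f t.
Proof.
move=> mf f0; apply: (@ge0_integral_preserving _ (measurableTypeR R) R leb
  -%R) => // A mA; exact: lebesgue_measureN.
Qed.

End lebesgue_invariance.

Section vec_invariance.
Context {R : realType} {n : nat}.
Notation V := 'rV[R]_n.
Local Open Scope ereal_scope.
Notation leb := (@lebesgue_measure R).

(** [iint k] overwrites the coordinates of index below [k], so the base point matters only through
    the others; for [k = n] it does not matter at all. *)
Lemma iint_tail (F : V -> \bar R) k (x y : V) :
  (forall i : 'I_n, (k <= i)%N -> x ord0 i = y ord0 i) -> iint k F x = iint k F y.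
Proof.
elim: k x y => [|k IH] x y xy /=.
  by congr F; apply/rowP => i; exact: xy.
apply: eq_integral => t _; apply: IH => i ki; rewrite !mxE.
by case: eqP => // /eqP ik; apply: xy; rewrite ltn_neqAle eq_sym ik.
Qed.

Lemma intRn_eq (F : V -> \bar R) x : intRn F = iint n F x.
Proof. by apply: iint_tail => i; rewrite leqNgt ltn_ord. Qed.

Lemma measurable_vecD (a : V) : measurable_fun setT (fun x : V => (x + a)%R).
Proof.
apply: measurable_vecP => i; under eq_fun do rewrite mxE.
by apply: measurable_funD => //; exact: measurable_coord.
Qed.

Lemma measurable_vecN : measurable_fun setT (fun x : V => (- x)%R).
Proof.
apply: measurable_vecP => i; under eq_fun do rewrite mxE.
by apply: measurableT_comp => //; exact: measurable_coord.
Qed.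

Lemma iint_shift (F : V -> \bar R) k (a x : V) :
  measurable_fun setT F -> (forall x, 0 <= F x) -> (k <= n)%N ->
  iint k (fun y => F (y + a)%R) x = iint k F (x + a)%R.
Proof.
move=> mF F0; elim: k x => [//|k IH] x kn /=.
under eq_integral do rewrite IH 1?ltnW//.
rewrite -(@ge0_lebesgue_integralD R (a ord0 (Ordinal kn))
  (fun t => iint k F (set_coord (x + a)%R k t))).
- apply: eq_integral => t _; apply: iint_tail => i _; rewrite !mxE.
  by case: eqP => // ik; congr (_ + a _ _)%R; apply/val_inj.
- exact: (iint_line_measurable k _ (proj1 (measurable_iint k mF F0))).
- by move=> t; apply: (proj2 (measurable_iint k mF F0)).
Qed.

Lemma iint_opp (F : V -> \bar R) k (x : V) :
  measurable_fun setT F -> (forall x, 0 <= F x) ->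
  iint k (fun y => F (- y)%R) x = iint k F (- x)%R.
Proof.
move=> mF F0; elim: k x => [//|k IH] x /=.
under eq_integral do rewrite IH.
rewrite -(@ge0_lebesgue_integralN R (fun t => iint k F (set_coord (- x)%R k t))).
- apply: eq_integral => t _; apply: iint_tail => i _; rewrite !mxE.
  by case: eqP.
- exact: (iint_line_measurable k _ (proj1 (measurable_iint k mF F0))).
- by move=> t; apply: (proj2 (measurable_iint k mF F0)).
Qed.

Lemma volm_shift (a : V) A : measurable A ->
  @volm R n ((fun x : V => (x + a)%R) @^-1` A) = volm A.
Proof.
move=> mA; have mI : measurable_fun setT (fun x : V => (\1_A x : R)%:E).
  exact/measurable_EFinP/measurable_indic.
have H := @iint_shift _ n a 0%R mI _ (leqnn _).
by rewrite /volm (intRn_eq (fun y => (\1_A y)%:E) (0 + a)%R) -H// => x; rewrite lee_fin.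
Qed.

Lemma volm_opp A : measurable A ->
  @volm R n ((fun x : V => (- x)%R) @^-1` A) = volm A.
Proof.
move=> mA; have mI : measurable_fun setT (fun x : V => (\1_A x : R)%:E).
  exact/measurable_EFinP/measurable_indic.
have H := @iint_opp _ n 0%R mI.
by rewrite /volm (intRn_eq (fun y => (\1_A y)%:E) (- 0)%R) -H// => x; rewrite lee_fin.
Qed.

(** Each integration replaces one factor by its integral; cubes and Gaussians are the instances
    used. *)
Lemma iint_prod (g : 'I_n -> R -> R) (I : 'I_n -> R) k (x : V) :
  (forall i, measurable_fun setT (g i)) -> (forall i t, 0 <= g i t)%R ->
  (forall i, \int[leb]_t (g i t)%:E = (I i)%:E) -> (k <= n)%N ->
  iint k (fun y => (\prod_i g i (y ord0 i))%:E) x =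
  (\prod_(i < n) (if (i < k)%N then I i else g i (x ord0 i)))%:E.
Proof.
move=> mg g0 gI; have I0 i : (0 <= I i)%R.
  by rewrite -lee_fin -gI; apply: integral_ge0 => t _; rewrite lee_fin.
elim: k x => [x _|k IH x kn] /=; first by congr (_%:E); apply: eq_bigr.
under eq_integral do rewrite IH 1?ltnW//.
pose j := Ordinal kn.
have E t : (\prod_(i < n) (if (i < k)%N then I i else g i (set_coord x k t ord0 i)) =
   (\prod_(i < n | i != j) (if (i < k.+1)%N then I i else g i (x ord0 i))) * g j t)%R.
  rewrite (bigD1 j)//= ltnn mxE eqxx mulrC; congr (_ * _)%R.
  apply: eq_bigr => i ij; have ik : (i == k :> nat) = false.
    by apply/negbTE; apply: contra ij => /eqP ik; apply/eqP/val_inj.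
  by rewrite !mxE ltnS (ltn_neqAle i k) ik.
under eq_integral do rewrite E EFinM.
rewrite (@ge0_integralZl_EFin _ (measurableTypeR R) R leb setT measurableT).
- by rewrite gI -EFinM; congr (_%:E); rewrite [RHS](bigD1 j)//= ltnSn mulrC.
- by move=> t _; rewrite lee_fin; exact: g0.
- apply/measurable_EFinP; exact: mg.
- by apply: prodr_ge0 => i _; case: ifP.
Qed.

Lemma intRn_prod (g : 'I_n -> R -> R) (I : 'I_n -> R) :
  (forall i, measurable_fun setT (g i)) -> (forall i t, 0 <= g i t)%R ->
  (forall i, \int[leb]_t (g i t)%:E = (I i)%:E) ->
  \int[@volm R n]_x (\prod_i g i (x ord0 i))%:E = (\prod_i I i)%:E.
Proof.
move=> mg g0 gI; rewrite integral_volm.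
- rewrite /intRn (iint_prod _ mg g0 gI (leqnn n)); congr (_%:E).
  by apply: eq_bigr => i _; rewrite ltn_ord.
- apply/measurable_EFinP; apply: measurable_prod => i _.
  by apply: measurableT_comp => //; exact: measurable_coord.
- by move=> x; rewrite lee_fin prodr_ge0.
Qed.

Lemma volm_sigma_finite : sigma_finite setT (@volm R n).
Proof.
pose K (N : nat) : set V := [set x | forall i, `|x ord0 i| <= N%:R]%R.
have KE N x : (\1_(K N) x = \prod_i (\1_`[- N%:R, N%:R]%classic (x ord0 i) : R))%R.
  rewrite indicE; have [xK|xK] := boolP (x \in K N).
    rewrite big1// => i _; rewrite indicE mem_set//=.
    by move: xK => /set_mem /(_ i); rewrite ler_norml in_itv.
  have [i xi] : exists i, (N%:R < `|x ord0 i|)%R.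
    apply: contrapT => /forallNP H; move/negP : xK; apply; apply/mem_set => i.
    by rewrite leNgt; apply/negP; exact: H.
  rewrite (bigD1 i)//= indicE memNset ?mul0r//= in_itv/=.
  by rewrite -ler_norml leNgt xi.
have mg (N : nat) : measurable_fun setT (\1_`[- N%:R, N%:R]%classic : R -> R)%R.
  exact: measurable_indic.
exists K => [|N].
  apply/esym; rewrite -subTset => x _; exists (Num.truncn (\sum_i `|x ord0 i|)%R).+1 => //.
  move=> i; apply/ltW; apply: (@le_lt_trans _ _ (\sum_i `|x ord0 i|)%R); last exact: truncnS_gt.
  by rewrite (bigD1 i)//= lerDl sumr_ge0.
have mK : measurable (K N).
  pose F := (fun x : V => \prod_i (\1_`[- N%:R, N%:R]%classic (x ord0 i) : R))%R.
  have mF : measurable_fun setT F.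
    apply: measurable_prod => i _; apply: measurableT_comp => //; exact: measurable_coord.
  rewrite (_ : K N = setT `&` F @^-1` [set 1%R]); first exact: mF.
  apply/seteqP; split => x /=; rewrite /F -KE indicE.
    by move=> xK; rewrite mem_set.
  case: (boolP (x \in K N)) => [/set_mem//|_ [_ /eqP]]; by rewrite eq_sym oner_eq0.
split => //.
have -> : volm (K N) = \int[@volm R n]_x (\1_(K N) x)%:E.
  by rewrite integral_indic// setIT.
under eq_integral do rewrite KE.
rewrite (@intRn_prod (fun _ => \1_`[- N%:R, N%:R]%classic)%R (fun _ => N%:R - (- N%:R))%R).
- by rewrite ltry.
- by [].
- by [].
- move=> _; rewrite integral_indic//= setIT lebesgue_measure_itv/= lte_fin.
  case: ltP => // NN; congr (_%:E); apply/esym/eqP.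
  by rewrite eq_le subr_le0 NN subr_ge0 (le_trans _ (ler0n _ _))// oppr_le0.
Qed.

HB.instance Definition _ := @isSigmaFinite.Build _ _ _ (@volm R n) volm_sigma_finite.

End vec_invariance.

(** * Calculus of real-valued integrable functions, with Fubini *)

Notation ig mu f := (mu.-integrable setT (EFin \o f)).

Section real_integral.
Context d (T : measurableType d) {R : realType} (mu : {measure set T -> \bar R}).
Implicit Types f g : T -> R.

Lemma ig_measurable f : ig mu f -> measurable_fun setT f.
Proof. by case/integrableP => /measurable_EFinP. Qed.

Lemma ig_le g f : ig mu g -> measurable_fun setT f ->
  (forall x, `|f x| <= g x) -> ig mu f.
Proof.
move=> gi mf fg; apply: (le_integrable measurableT _ _ gi).
  exact/measurable_EFinP.
by move=> x _ /=; rewrite lee_fin (le_trans (fg x))// ler_norm.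
Qed.

Lemma ig_cst0 : ig mu (fun _ => 0 : R).
Proof. exact: integrable0. Qed.

Lemma igD f g : ig mu f -> ig mu g -> ig mu (fun x => f x + g x).
Proof. by move=> fi gi; have := integrableD measurableT fi gi. Qed.

Lemma igB f g : ig mu f -> ig mu g -> ig mu (fun x => f x - g x).
Proof. by move=> fi gi; have := integrableB measurableT fi gi. Qed.

Lemma igZl (c : R) f : ig mu f -> ig mu (fun x => c * f x).
Proof. by move=> fi; have := integrableZl measurableT c fi. Qed.

Lemma igZr (c : R) f : ig mu f -> ig mu (fun x => f x * c).
Proof. by move=> fi; under eq_fun do rewrite mulrC; exact: igZl. Qed.

Lemma igN f : ig mu f -> ig mu (fun x => - f x).
Proof. by move=> fi; have := integrableN fi. Qed.

Lemma ig_abs f : ig mu f -> ig mu (fun x => `|f x|).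
Proof. by move=> fi; have := integrable_norm fi. Qed.

Lemma ig_sum (I : Type) (s : seq I) (f : I -> T -> R) :
  (forall i, ig mu (f i)) -> ig mu (fun x => \sum_(i <- s) f i x).
Proof.
move=> fi; elim: s => [|i s IH].
  by under eq_fun do rewrite big_nil; exact: ig_cst0.
by under eq_fun do rewrite big_cons; exact: igD.
Qed.

Lemma RintD f g : ig mu f -> ig mu g ->
  \int[mu]_x (f x + g x) = \int[mu]_x f x + \int[mu]_x g x.
Proof. exact: RintegralD. Qed.

Lemma RintB f g : ig mu f -> ig mu g ->
  \int[mu]_x (f x - g x) = \int[mu]_x f x - \int[mu]_x g x.
Proof. exact: RintegralB. Qed.

Lemma RintZl (c : R) f : ig mu f -> \int[mu]_x (c * f x) = c * \int[mu]_x f x.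
Proof. exact: RintegralZl. Qed.

Lemma RintZr (c : R) f : ig mu f -> \int[mu]_x (f x * c) = \int[mu]_x f x * c.
Proof. exact: RintegralZr. Qed.

Lemma Rint_zero : \int[mu]_x (0 : R) = 0.
Proof. by rewrite /Rintegral integral0. Qed.

Lemma RintN f : ig mu f -> \int[mu]_x (- f x) = - \int[mu]_x f x.
Proof.
move=> fi; rewrite -mulN1r -RintZl//; apply: eq_Rintegral => x _; exact/esym/mulN1r.
Qed.

Lemma Rint_sum (I : Type) (s : seq I) (f : I -> T -> R) :
  (forall i, ig mu (f i)) ->
  \int[mu]_x (\sum_(i <- s) f i x) = \sum_(i <- s) \int[mu]_x f i x.
Proof.
move=> fi; elim: s => [|i s IH].
  by under eq_Rintegral do rewrite big_nil; rewrite Rint_zero big_nil.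
under eq_Rintegral do rewrite big_cons.
by rewrite RintD// ?IH ?big_cons//; exact: ig_sum.
Qed.

Lemma Rint_le f g : ig mu f -> ig mu g -> (forall x, f x <= g x) ->
  \int[mu]_x f x <= \int[mu]_x g x.
Proof. by move=> fi gi fg; apply: le_Rintegral. Qed.

Lemma Rint_ge0 f : (forall x, 0 <= f x) -> 0 <= \int[mu]_x f x.
Proof. by move=> f0; apply: Rintegral_ge0. Qed.

Lemma Rint_norm_le f g : measurable_fun setT f -> ig mu g ->
  (forall x, `|f x| <= g x) -> `|\int[mu]_x f x| <= \int[mu]_x g x.
Proof.
move=> mf gi fg; have fi := ig_le gi mf fg.
apply: (le_trans (le_normr_Rintegral measurableT fi)).
by apply: Rint_le => //; exact: ig_abs.
Qed.

Lemma Rint_EFin f : ig mu f -> (\int[mu]_x (f x)%:E = (\int[mu]_x f x)%:E)%E.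
Proof. by move=> fi; rewrite /Rintegral fineK//; exact: integrable_fin_num. Qed.

Lemma ig_ge0 f (c : R) : measurable_fun setT f -> (forall x, 0 <= f x) ->
  (\int[mu]_x (f x)%:E <= c%:E)%E -> ig mu f.
Proof.
move=> mf f0 fc; apply/integrableP; split; first exact/measurable_EFinP.
under eq_integral do rewrite /= ger0_norm//.
exact: le_lt_trans fc (ltry _).
Qed.

Lemma Rint_dct (f_ : nat -> T -> R) f g :
  (forall k, measurable_fun setT (f_ k)) -> ig mu g ->
  (forall k x, `|f_ k x| <= g x) -> (forall x, f_ ^~ x @ \oo --> f x) ->
  ig mu f /\ (fun k => \int[mu]_x f_ k x) @ \oo --> \int[mu]_x f x.
Proof.
move=> mf gi fg ff.
have mlim : measurable_fun setT f by apply: (measurable_fun_cvg mf) => x _; exact: ff.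
have [fi _ fcvg] : [/\ mu.-integrable setT (EFin \o f),
  [sequence \int[mu]_x `|(f_ n x)%:E - (f x)%:E|]_n @ \oo --> 0%E &
  [sequence \int[mu]_x (f_ n x)%:E]_n @ \oo --> \int[mu]_x (f x)%:E]%E.
  apply: (@dominated_convergence _ T R mu setT measurableT
    (fun k x => (f_ k x)%:E) (EFin \o f) (EFin \o g)) => //.
  - by move=> k; exact/measurable_EFinP.
  - exact/measurable_EFinP.
  - apply: aeW => x _; apply: cvg_EFin; first exact: nearW.
    exact: ff.
  - by apply: aeW => x k _; rewrite lee_fin.
split => //.
by apply: fine_cvg; rewrite -Rint_EFin.
Qed.

Lemma eq_Rint f g : f =1 g -> \int[mu]_x f x = \int[mu]_x g x.
Proof. by move=> fg; apply: eq_Rintegral. Qed.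

Lemma ig_ext f g : f =1 g -> ig mu f -> ig mu g.
Proof. by move=> /funext ->. Qed.

Lemma ig_mulb f (h : T -> R) (c : R) : ig mu f -> measurable_fun setT h ->
  (forall x, `|h x| <= c) -> ig mu (fun x => h x * f x).
Proof.
move=> fi mh hc; apply: (ig_le (igZl c (ig_abs fi))).
  by apply: measurable_funM => //; exact: ig_measurable.
by move=> x; rewrite normrM ler_wpM2r.
Qed.

End real_integral.

Section real_fubini.
Context d1 d2 (T1 : measurableType d1) (T2 : measurableType d2) {R : realType}.
Variables (m1 : {sigma_finite_measure set T1 -> \bar R})
          (m2 : {sigma_finite_measure set T2 -> \bar R}).
Implicit Type f : T1 * T2 -> R.

Lemma ig_fubini1 f : ig (m1 \x m2)%E f -> ig m1 (fun x => \int[m2]_y f (x, y)).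
Proof.
move=> fi; have Fi := integrable_fubini_F fi.
apply: (le_integrable measurableT _ _ Fi).
  apply/measurable_EFinP.
  have := measurable_int _ Fi.
  by move=> mF; apply: (measurableT_comp _ mF).
by move=> x _ /=; rewrite /Rintegral /fubini_F/=; case: (\int[m2]_y _)%E => [r||] /=; [exact: lexx|exact: leey|exact: leey].
Qed.

Lemma integrable_fubini_G (f : T1 * T2 -> \bar R) :
  (m1 \x m2)%E.-integrable setT f -> m2.-integrable setT (fubini_G m1 f).
Proof.
move=> fi; have mf := measurable_int _ fi.
apply/integrableP; split; first exact: (measurable_fubini_G fi).
apply: le_lt_trans ((integrable21ltyP _ _ mf).1 fi).
apply: ge0_le_integral => //.
- exact: (measurableT_comp _ (measurable_fubini_G fi)).
- apply: (@measurable_fun_fubini_tonelli_G _ _ T1 T2 R m1 (fun z => `|f z|)%E) => //.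
  exact: measurableT_comp.
- move=> y _; apply: le_abse_integral => //.
  exact: (measurableT_comp mf (measurable_pair2 y)).
Qed.

Lemma ig_fubini2 f : ig (m1 \x m2)%E f -> ig m2 (fun y => \int[m1]_x f (x, y)).
Proof.
move=> fi; have Fi := integrable_fubini_G fi.
apply: (le_integrable measurableT _ _ Fi).
  apply/measurable_EFinP.
  have := measurable_int _ Fi.
  by move=> mF; apply: (measurableT_comp _ mF).
by move=> x _ /=; rewrite /Rintegral /fubini_G/=; case: (\int[m1]_x _)%E => [r||] /=; [exact: lexx|exact: leey|exact: leey].
Qed.

(** A section may fail to be integrable on a null set of parameters, where [fine] can replace an
    infinite integral by 0; hence the almost-everywhere comparison. *)
Lemma Rint_prod1 f : ig (m1 \x m2)%E f ->
  \int[(m1 \x m2)%E]_z f z = \int[m1]_x \int[m2]_y f (x, y).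
Proof.
move=> fi; rewrite [in LHS]/Rintegral -integral12_prod_meas1// [in RHS]/Rintegral.
congr fine; apply: ae_eq_integral => //.
- exact: measurable_int _ (integrable_fubini_F fi).
- exact: measurable_int _ (ig_fubini1 fi).
- have := ae_integrable1 fi; apply: filterS => x xi _.
  by rewrite /= /fubini_F -Rint_EFin.
Qed.

Lemma Rint_prod2 f : ig (m1 \x m2)%E f ->
  \int[(m1 \x m2)%E]_z f z = \int[m2]_y \int[m1]_x f (x, y).
Proof.
move=> fi; rewrite [in LHS]/Rintegral -integral21_prod_meas1// [in RHS]/Rintegral.
congr fine; apply: ae_eq_integral => //.
- exact: measurable_int _ (integrable_fubini_G fi).
- exact: measurable_int _ (ig_fubini2 fi).
- have := ae_integrable2 fi; apply: filterS => x xi _.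
  by rewrite /= /fubini_G -Rint_EFin.
Qed.

Lemma Rint_fubini f : ig (m1 \x m2)%E f ->
  \int[m1]_x \int[m2]_y f (x, y) = \int[m2]_y \int[m1]_x f (x, y).
Proof. by move=> fi; rewrite -Rint_prod1// Rint_prod2. Qed.

Lemma ig_prod2 f (g : T2 -> R) : measurable_fun setT f ->
  (forall y, ig m1 (fun x => f (x, y))) -> ig m2 g ->
  (forall y, \int[m1]_x `|f (x, y)| <= g y) -> ig (m1 \x m2)%E f.
Proof.
move=> mf fi gi fg; apply/integrable21ltyP; first exact/measurable_EFinP.
apply: (@le_lt_trans _ _ (\int[m2]_x (g x)%:E)%E).
  apply: ge0_le_integral => //.
  - by move=> x _; apply: integral_ge0.
  - apply: (@measurable_fun_fubini_tonelli_G _ _ T1 T2 R m1 (fun z => `|(f z)%:E|)%E) => //.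
    by apply: measurableT_comp => //; exact/measurable_EFinP.
  - by case/integrableP : gi.
  - move=> x _; apply: le_trans (_ : _ <= (\int[m1]_y `|f (y, x)|)%:E)%E _; last by rewrite lee_fin.
    by rewrite -Rint_EFin//; exact: ig_abs.
by rewrite Rint_EFin// ltry.
Qed.

End real_fubini.

(** * Euclidean norm, and measurability of continuous functions *)

Section geometry.
Context {R : realType} {n : nat}.
Notation V := 'rV[R]_n.
Implicit Types x y z : V.

Definition nsq x : R := \sum_i x ord0 i ^+ 2.
Definition dotv x y : R := \sum_i x ord0 i * y ord0 i.

Lemma nsq_ge0 x : 0 <= nsq x.
Proof. by apply: sumr_ge0 => i _; exact: sqr_ge0. Qed.

Lemma enormE x : enorm x = Num.sqrt (nsq x). Proof. by []. Qed.

Lemma enorm_ge0 x : 0 <= enorm x. Proof. exact: sqrtr_ge0. Qed.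

Lemma sqr_enorm x : enorm x ^+ 2 = nsq x.
Proof. by rewrite sqr_sqrtr// nsq_ge0. Qed.

Lemma nsqD x y : nsq (x + y) = nsq x + 2 * dotv x y + nsq y.
Proof.
rewrite /nsq /dotv mulr_sumr -!big_split; apply: eq_bigr => i _ /=.
by rewrite !mxE; ring.
Qed.

Lemma nsqN x : nsq (- x) = nsq x.
Proof. by apply: eq_bigr => i _; rewrite mxE sqrrN. Qed.

Lemma enormN x : enorm (- x) = enorm x.
Proof. by rewrite !enormE nsqN. Qed.

Lemma nsqZ (c : R) x : nsq (c *: x) = c ^+ 2 * nsq x.
Proof. by rewrite /nsq mulr_sumr; apply: eq_bigr => i _; rewrite mxE exprMn. Qed.

Lemma enormZ (c : R) x : enorm (c *: x) = `|c| * enorm x.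
Proof. by rewrite !enormE nsqZ sqrtrM ?sqr_ge0// sqrtr_sqr. Qed.

Lemma dotvNr x y : dotv x (- y) = - dotv x y.
Proof. by rewrite /dotv -sumrN; apply: eq_bigr => i _; rewrite mxE mulrN. Qed.

Lemma dotvZr (c : R) x y : dotv x (c *: y) = c * dotv x y.
Proof. by rewrite /dotv mulr_sumr; apply: eq_bigr => i _; rewrite mxE mulrCA. Qed.

Lemma nsqB x y : nsq (x - y) = nsq x - 2 * dotv x y + nsq y.
Proof. by rewrite nsqD dotvNr nsqN mulrN. Qed.

Lemma enorm0 : enorm (0 : V) = 0.
Proof.
by rewrite enormE /nsq big1 ?sqrtr0// => i _; rewrite mxE expr0n.
Qed.

Lemma nsq0_eq0 x : nsq x = 0 -> x = 0.
Proof.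
move=> /eqP; rewrite psumr_eq0; last by move=> i _; exact: sqr_ge0.
move=> /allP x0; apply/rowP => i; rewrite mxE; apply/eqP.
by have := x0 i (mem_index_enum i); rewrite sqrf_eq0.
Qed.

Lemma enorm_eq0 x : enorm x = 0 -> x = 0.
Proof.
by move=> x0; apply: nsq0_eq0; rewrite -sqr_enorm x0 expr0n.
Qed.

Lemma enorm_gt0 x : x != 0 -> 0 < enorm x.
Proof.
by move=> x0; rewrite lt_neqAle enorm_ge0 andbT eq_sym; apply: contra x0 => /eqP/enorm_eq0 ->.
Qed.

(** Cauchy-Schwarz, from the nonnegative square of the component of [x] orthogonal to [y]. *)
Lemma dotv_le x y : `|dotv x y| <= enorm x * enorm y.
Proof.
have [->|y0] := eqVneq y 0.
  by rewrite enorm0 mulr0 /dotv big1 ?normr0// => i _; rewrite mxE mulr0.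
have Y0 : 0 < nsq y by rewrite -sqr_enorm exprn_gt0// enorm_gt0.
rewrite -(@ler_pXn2r _ 2) ?nnegrE ?mulr_ge0 ?enorm_ge0//.
rewrite real_normK ?num_real// exprMn !sqr_enorm.
have := mulr_ge0 (nsq_ge0 (x - (dotv x y / nsq y) *: y)) (ltW Y0).
rewrite nsqB dotvZr nsqZ.
have -> : (nsq x - 2 * (dotv x y / nsq y * dotv x y) + (dotv x y / nsq y) ^+ 2 * nsq y) * nsq y
   = nsq x * nsq y - dotv x y ^+ 2 by field; rewrite gt_eqF.
by rewrite subr_ge0.
Qed.

Lemma enormD x y : enorm (x + y) <= enorm x + enorm y.
Proof.
rewrite -(@ler_pXn2r _ 2) ?nnegrE ?addr_ge0 ?enorm_ge0//.
rewrite sqrrD !sqr_enorm nsqD mulr2n.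
have := le_trans (ler_norm _) (dotv_le x y); lra.
Qed.

Lemma enormBC x y : enorm (x - y) = enorm (y - x).
Proof. by rewrite -enormN opprB. Qed.

Lemma enormB_ge x y : enorm x - enorm y <= enorm (x - y).
Proof. by rewrite lerBlDr -{1}(subrK y x) enormD. Qed.

Lemma coord_le_enorm x i : `|x ord0 i| <= enorm x.
Proof.
rewrite -(@ler_pXn2r _ 2) ?nnegrE ?enorm_ge0// sqr_enorm real_normK ?num_real//.
by rewrite /nsq (bigD1 i)//= lerDl sumr_ge0// => j _; exact: sqr_ge0.
Qed.

Lemma enorm_le_sum x : enorm x <= \sum_i `|x ord0 i|.
Proof.
have S0 : 0 <= \sum_i `|x ord0 i| by apply: sumr_ge0.
rewrite -(@ler_pXn2r _ 2) ?nnegrE ?enorm_ge0// sqr_enorm expr2 mulr_suml.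
apply: ler_sum => i _; rewrite -real_normK ?num_real// expr2.
by apply: ler_wpM2l => //; rewrite (bigD1 i)//= lerDl sumr_ge0.
Qed.

Lemma coord_le_norm x i : `|x ord0 i| <= `|x|.
Proof.
by rewrite {2}/Num.norm/= mx_normrE; apply/bigmax_geP; right => /=; exists (ord0, i).
Qed.

Lemma norm_le_coord x (e : R) : 0 <= e -> (forall i, `|x ord0 i| <= e) -> `|x| <= e.
Proof.
move=> e0 xe; rewrite {1}/Num.norm/= mx_normrE; apply/bigmax_leP; split => // -[i j] _ /=.
by rewrite ord1.
Qed.

Lemma norm_le_enorm x : `|x| <= enorm x.
Proof. by apply: norm_le_coord; [exact: enorm_ge0|exact: coord_le_enorm]. Qed.

Lemma enorm_le_norm x : enorm x <= n%:R * `|x|.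
Proof.
apply: (le_trans (enorm_le_sum x)).
apply: (@le_trans _ _ (\sum_(i < n) `|x|)); first by apply: ler_sum => i _; exact: coord_le_norm.
by rewrite sumr_const card_ord mulr_natl.
Qed.

Lemma continuous_coord (i : 'I_n) : continuous (fun x : V => x ord0 i).
Proof. exact: coord_continuous. Qed.

Lemma near_norm x (d : R) : 0 < d -> \forall y \near x, `|x - y| < d.
Proof. by move=> d0; have := nbhsx_ballx x d d0; rewrite -ball_normE. Qed.

Lemma continuous_at_near (f : V -> R) x :
  (forall e : R, 0 < e -> \forall y \near x, `|f x - f y| <= e) <-> {for x, continuous f}.
Proof.
split=> [H|fc e e0]; first by apply/(@cvgrPdist_le _ _ _ (nbhs x) (nbhs_filter x)).
by have /(@cvgrPdist_le _ _ _ (nbhs x) (nbhs_filter x))/(_ _ e0) := fc.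
Qed.

Lemma continuous_enorm : continuous (fun x : V => enorm x).
Proof.
move=> x; apply/continuous_at_near => e e0.
have e1 : 0 < e / n.+1%:R by rewrite divr_gt0// ltr0n.
apply: filterS (near_norm x e1) => y /ltW xy.
have H : enorm (x - y) <= e.
  apply: (le_trans (enorm_le_norm _)).
  apply: (@le_trans _ _ (n%:R * (e / n.+1%:R))); first by rewrite ler_wpM2l.
  rewrite mulrCA; apply: ler_piMr; first exact: ltW.
  by rewrite ler_pdivrMr ?ltr0n// mul1r ler_nat.
have := enormB_ge x y; have := enormB_ge y x; rewrite (enormBC y x) ler_distl => h1 h2.
apply/andP; split; lra.
Qed.

(** The sigma-algebra is generated by the coordinates, not by open sets. So [f] is written as the
    pointwise limit of its values at points rounded down to the grid of mesh [1 / (k + 1)]; each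
    approximation is constant on countably many measurable cells. *)
Lemma measurable_continuous (f : V -> R) : continuous f -> measurable_fun setT f.
Proof.
move=> fc.
pose q (k : nat) (z : 'rV[int]_n) : V := \row_i ((z ord0 i)%:~R / k.+1%:R).
pose fl (k : nat) x : 'rV[int]_n := \row_i Num.floor (k.+1%:R * x ord0 i).
apply: (@measurable_fun_cvg _ _ _ setT (fun k x => f (q k (fl k x)))).
  move=> k _ B mB; rewrite setTI.
  have mA (z : 'rV[int]_n) : measurable [set x : V | fl k x = z].
    have -> : [set x | fl k x = z] = \bigcap_(i in [set: 'I_n])
       ((fun x : V => x ord0 i) @^-1` `[(z ord0 i)%:~R / k.+1%:R, (z ord0 i + 1)%:~R / k.+1%:R[%classic).
      apply/seteqP; split => x /=.
        move=> <- i _ /=; rewrite mxE in_itv/=.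
        rewrite ler_pdivrMr ?ltr0n// ltr_pdivlMr ?ltr0n// mulrC.
        by rewrite floor_le floorD1_gt.
      move=> H; apply/rowP => i; rewrite mxE; apply: floor_def.
      have := H i I; rewrite /= in_itv/=.
      by rewrite ler_pdivrMr ?ltr0n// ltr_pdivlMr ?ltr0n// mulrC.
    apply: fin_bigcap_measurable => // i _.
    by rewrite -[X in measurable X]setTI; apply: measurable_coord.
  have -> : (fun x => f (q k (fl k x))) @^-1` B = \bigcup_j
      (if choice.unpickle j is Some z then
         if `[< B (f (q k z)) >] then [set x : V | fl k x = z] else set0 else set0).
    apply/seteqP; split => x /=.
      by move=> Bx; exists (choice.pickle (fl k x)) => //; rewrite choice.pickleK asboolT.
    move=> [j _]; case: (choice.unpickle j) => // z; case: asboolP => // Bz /= -> //.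
  apply: bigcup_measurable => j _; case: (choice.unpickle j) => // z; by case: ifP.
move=> x _; have H : (fun k => q k (fl k x)) @ \oo --> x; last exact: (cvg_comp _ _ H (fc x)).
apply/cvgrPdist_le => e e0.
have /cvgrPdist_le/(_ _ e0) : @harmonic R @ \oo --> (0 : R) by exact: cvg_harmonic.
apply: filterS => k; rewrite /= sub0r normrN ger0_norm ?invr_ge0// => ke.
apply: norm_le_coord; first exact: ltW.
move=> i; rewrite !mxE; apply: le_trans ke.
rewrite -[X in `|X - _|](mulKf (_ : k.+1%:R != 0 :> R)) ?pnatr_eq0// mulrC -mulrBl.
rewrite normrM (ger0_norm (_ : 0 <= k.+1%:R^-1)) ?invr_ge0//.
rewrite -[leRHS]mul1r ler_pM2r ?invr_gt0 ?ltr0n//.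
rewrite ger0_norm ?subr_ge0 ?floor_le// lerBlDr addrC.
have := floorD1_gt (k.+1%:R * x ord0 i).
by rewrite intrD => /ltW.
Qed.

Lemma measurable_enorm : measurable_fun setT (fun x : V => enorm x).
Proof. exact: measurable_continuous continuous_enorm. Qed.

Lemma measurable_vecD2 d (T : measurableType d) (f g : T -> V) :
  measurable_fun setT f -> measurable_fun setT g ->
  measurable_fun setT (fun t => f t + g t).
Proof.
move=> mf mg; apply: measurable_vecP => i; under eq_fun do rewrite mxE.
apply: measurable_funD.
- exact: (measurableT_comp (measurable_coord i) mf).
- exact: (measurableT_comp (measurable_coord i) mg).
Qed.

Lemma measurable_vecB2 d (T : measurableType d) (f g : T -> V) :
  measurable_fun setT f -> measurable_fun setT g ->
  measurable_fun setT (fun t => f t - g t).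
Proof.
move=> mf mg; apply: measurable_vecD2 => //.
exact: (measurableT_comp measurable_vecN mg).
Qed.

Lemma ig_shift (f : V -> R) a : ig volm f -> ig volm (fun x => f (x + a)).
Proof.
by move=> fi; have [] := integral_preserving (measurable_vecD a) (volm_shift a) fi.
Qed.

Lemma Rint_shift (f : V -> R) a : ig volm f ->
  \int[volm]_x f (x + a) = \int[volm]_x f x.
Proof.
move=> fi; have [_ H] := integral_preserving (measurable_vecD a) (volm_shift a) fi.
by rewrite /Rintegral -H.
Qed.

Lemma ig_opp (f : V -> R) : ig volm f -> ig volm (fun x => f (- x)).
Proof.
by move=> fi; have [] := integral_preserving measurable_vecN volm_opp fi.
Qed.

Lemma Rint_opp (f : V -> R) : ig volm f -> \int[volm]_x f (- x) = \int[volm]_x f x.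
Proof.
move=> fi; have [_ H] := integral_preserving measurable_vecN volm_opp fi.
by rewrite /Rintegral -H.
Qed.

Lemma ig_reflect (f : V -> R) a : ig volm f -> ig volm (fun x => f (a - x)).
Proof.
move=> /ig_opp/(ig_shift (- a)); apply: ig_ext => x; by rewrite opprD opprK addrC.
Qed.

Lemma Rint_reflect (f : V -> R) a : ig volm f ->
  \int[volm]_x f (a - x) = \int[volm]_x f x.
Proof.
move=> fi; rewrite -[RHS]Rint_opp// -[RHS](Rint_shift (- a)); last exact: ig_opp.
by apply: eq_Rint => x; rewrite opprD opprK addrC.
Qed.

End geometry.

(** * Directional derivatives *)

Section derivative_tools.
Context {R : realType}.

Lemma is_derive_line (V : normedModType R) (f : V -> R) (x v : V) (t df : R) :
  is_derive (x + t *: v) v f df <-> is_derive t 1 (fun s : R => f (x + s *: v)) df.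
Proof.
have E : (fun h : R => h^-1 *: ((f \o shift (x + t *: v)) (h *: v) - f (x + t *: v))) =
    (fun h : R => h^-1 *: (((fun s : R => f (x + s *: v)) \o shift t) (h *: (1 : R)) - f (x + t *: v))).
  by apply/funext => h /=; rewrite addrCA -scalerDl [h *: 1]mulr1.
by split => -[d1 d2]; split; [move: d1; rewrite /derivable E|move: d2; rewrite /derive E|
   move: d1; rewrite /derivable E|move: d2; rewrite /derive E].
Qed.

Lemma is_derive1_chain (f g : R -> R) (x df dg : R) :
  is_derive x 1 f df -> is_derive (f x) 1 g dg ->
  is_derive x 1 (fun y => g (f y)) (dg * df).
Proof.
move=> [f1 f2] [g1 g2].
have F : differentiable f x := (derivable1_diffP f x).1 f1.
have G : differentiable g (f x) := (derivable1_diffP g (f x)).1 g1.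
have E : (g \o f)^`()%classic x = dg * df by rewrite (derive1_comp f1 g1) !derive1E f2 g2.
split; last by rewrite -derive1E; exact: E.
exact: (derivable1_diffP (g \o f) x).2 (differentiable_comp F G).
Qed.

(** Restricting to the line through [x] in the direction [v] reduces the claim to one variable, so
    [f] is only asked to be derivable in that direction. *)
Lemma is_derive_chain (V : normedModType R) (f : V -> R) (g : R -> R) (x v : V) (df dg : R) :
  is_derive x v f df -> is_derive (f x) 1 g dg ->
  is_derive x v (fun y => g (f y)) (dg * df).
Proof.
have {1}<- : x + 0 *: v = x by rewrite scale0r addr0.
have {3}<- : x + 0 *: v = x by rewrite scale0r addr0.
move=> /is_derive_line Hf Hg; apply/is_derive_line.
apply: (@is_derive1_chain (fun s : R => f (x + s *: v))) => //.
by rewrite scale0r addr0.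
Qed.

Lemma is_derive_ext (V : normedModType R) (f g : V -> R) (x v : V) (d e : R) :
  f =1 g -> d = e -> is_derive x v f d -> is_derive x v g e.
Proof. by move=> /funext -> ->. Qed.

Lemma is_derive_affine (V : normedModType R) (f : V -> R) (x a v : V) (d : R) :
  is_derive (a - x) v f d -> is_derive x v (fun y => f (a - y)) (- d).
Proof.
have {1}-> : a - x = a - x + (- 0) *: v by rewrite oppr0 scale0r addr0.
move=> /is_derive_line H.
have {1}-> : x = x + 0 *: v by rewrite scale0r addr0.
apply/is_derive_line.
have N : is_derive (0 : R) 1 -%R (-1) by have := is_deriveN (is_derive_id (0 : R) 1).
apply: is_derive_ext (is_derive1_chain N H); last by rewrite mulrN1.
by move=> s; rewrite opprD addrA scaleNr.
Qed.

Lemma is_derive_near_val (V : normedModType R) (f : V -> R) (x v : V) (d : R) :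
  is_derive x v f d -> 'D_v f x = d.
Proof. by case. Qed.

Lemma MVT0 (f df : R -> R) (b : R) : (forall t : R, is_derive t 1 f (df t)) ->
  exists2 s, `|s| <= `|b| & f b - f 0 = df s * b.
Proof.
move=> fd.
have fc a c : {within `[a, c], continuous f}.
  by apply: derivable_within_continuous => t _; case: (fd t).
have [b0|b0|->] := ltgtP b 0.
- have [c + E] := MVT b0 (fun t _ => fd t) (fc _ _).
  rewrite in_itv/= => /andP[bc c0]; exists c; last first.
    by apply: oppr_inj; rewrite opprB E sub0r mulrN.
  by rewrite !ltr0_norm// lerN2 ltW.
- have [c + E] := MVT b0 (fun t _ => fd t) (fc _ _).
  rewrite in_itv/= => /andP[c0 cb]; exists c; last by rewrite E subr0.
  by rewrite !gtr0_norm// ltW.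
- by exists 0; rewrite ?normr0// subrr mulr0.
Qed.

End derivative_tools.

(** * Functions of class C^k *)

Section Ck.
Context {R : realType} {n : nat}.
Notation V := 'rV[R]_n.
Implicit Types (f g : V -> R) (x y z : V).

(** Continuity at every order and derivability along the coordinate axes; increments are later
    controlled by moving along one coordinate at a time, so this is the form in which regularity is
    consumed. *)
Fixpoint Ck (k : nat) f : Prop := continuous f /\
  match k with
  | 0 => True
  | k'.+1 => forall i : 'I_n, (forall x, derivable f x 'e_i) /\ Ck k' (partial i f)
  end.

Lemma Ck_cont k f : Ck k f -> continuous f. Proof. by case: k => [|k] []. Qed.

Lemma Ck_le k l f : (l <= k)%N -> Ck k f -> Ck l f.
Proof.
elim: k l f => [|k IH] [|l] f //=; first by move=> _ [].
rewrite ltnS => lk [fc H]; split => // i; have [H1 H2] := H i; split => //; exact: IH H2.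
Qed.

Lemma Ck_partial k f i : Ck k.+1 f -> Ck k (partial i f).
Proof. by move=> [_ /(_ i) []]. Qed.

Lemma Ck_derivable k f i x : Ck k.+1 f -> is_derive x 'e_i f (partial i f x).
Proof. by move=> [_ /(_ i) [H _]]; exact: derivableP. Qed.

Lemma smooth_Ck k f : smooth f -> Ck k f.
Proof.
move=> sf; have H (s : seq 'I_n) : Ck k (Defs.iterD s f).
  elim: k s => [|k IH] s /=; first by split => //; exact: (proj1 (sf s)).
  split; first exact: (proj1 (sf s)).
  by move=> i; split; [exact: (proj2 (sf s) i)|exact: (IH (i :: s))].
exact: (H [::]).
Qed.

Lemma partialE f (df : 'I_n -> V -> R) i :
  (forall x, is_derive x 'e_i f (df i x)) -> partial i f = df i.
Proof. by move=> fd; apply/funext => x; rewrite /partial; case: (fd x). Qed.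

Lemma Ck_intro k f (df : 'I_n -> V -> R) : continuous f ->
  (forall i x, is_derive x 'e_i f (df i x)) -> (forall i, Ck k (df i)) -> Ck k.+1 f.
Proof.
move=> fc fd dfk; split => // i; split; first by move=> x; case: (fd i x).
by rewrite (partialE (fd i)).
Qed.

Lemma partialD f g i x : derivable f x 'e_i -> derivable g x 'e_i ->
  is_derive x 'e_i (fun y => f y + g y) (partial i f x + partial i g x).
Proof. by move=> /derivableP df /derivableP dg; exact: is_deriveD. Qed.

Lemma contD f g : continuous f -> continuous g -> continuous (fun x => f x + g x).
Proof. by move=> fc gc x; apply: (@cvgD _ _ _ _ (nbhs_filter x)); [exact: fc|exact: gc]. Qed.

Lemma contM f g : continuous f -> continuous g -> continuous (fun x => f x * g x).
Proof. by move=> fc gc x; apply: (@cvgM _ _ _ (nbhs_filter x)); [exact: fc|exact: gc]. Qed.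

Lemma contN f : continuous f -> continuous (fun x => - f x).
Proof. by move=> fc x; apply: (@cvgN _ _ _ _ (nbhs_filter x)); exact: fc. Qed.

Lemma contB f g : continuous f -> continuous g -> continuous (fun x => f x - g x).
Proof. by move=> fc gc; apply: contD => //; exact: contN. Qed.

Lemma cont_cst (c : R) : continuous (fun _ : V => c).
Proof. exact: cst_continuous. Qed.

Lemma cont_comp (g : R -> R) f : continuous f -> continuous g -> continuous (fun x => g (f x)).
Proof. by move=> fc gc x; apply: (@continuous_comp _ _ _ f g); [exact: fc|exact: gc]. Qed.

Lemma cont_sum (I : Type) (s : seq I) (F : I -> V -> R) :
  (forall i, continuous (F i)) -> continuous (fun x => \sum_(i <- s) F i x).
Proof.
move=> Fc; elim: s => [|i s IH].
  by under eq_fun do rewrite big_nil; exact: cont_cst.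
by under eq_fun do rewrite big_cons; exact: contD.
Qed.

Lemma CkD k f g : Ck k f -> Ck k g -> Ck k (fun x => f x + g x).
Proof.
elim: k f g => [|k IH] f g Cf Cg.
  by split => //; apply: contD; [exact: Ck_cont Cf|exact: Ck_cont Cg].
apply: (@Ck_intro k _ (fun i x => partial i f x + partial i g x)).
- by apply: contD; [exact: Ck_cont Cf|exact: Ck_cont Cg].
- by move=> i x; apply: partialD; apply: ex_derive; [exact: Ck_derivable Cf|exact: Ck_derivable Cg].
- by move=> i; apply: IH; exact: Ck_partial.
Qed.

Lemma CkM k f g : Ck k f -> Ck k g -> Ck k (fun x => f x * g x).
Proof.
elim: k f g => [|k IH] f g Cf Cg.
  by split => //; apply: contM; [exact: Ck_cont Cf|exact: Ck_cont Cg].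
apply: (@Ck_intro k _ (fun i x => f x * partial i g x + g x * partial i f x)).
- by apply: contM; [exact: Ck_cont Cf|exact: Ck_cont Cg].
- by move=> i x; apply: is_deriveM; [exact: Ck_derivable Cf|exact: Ck_derivable Cg].
- move=> i; apply: CkD.
    by apply: IH; [exact: Ck_le (leqnSn k) Cf|exact: Ck_partial].
  by apply: IH; [exact: Ck_le (leqnSn k) Cg|exact: Ck_partial].
Qed.

Lemma Ck_cst k (c : R) : Ck k (fun _ => c).
Proof.
elim: k c => [|k IH] c; first by split => //; exact: cont_cst.
apply: (@Ck_intro k _ (fun i x => 0)) => //; exact: cont_cst.
Qed.

Lemma CkZ k (c : R) f : Ck k f -> Ck k (fun x => c * f x).
Proof. by move=> Cf; apply: CkM => //; exact: Ck_cst. Qed.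

Lemma CkN k f : Ck k f -> Ck k (fun x => - f x).
Proof.
by move=> Cf; have -> : (fun x => - f x) = (fun x => -1 * f x);
  [apply/funext => x; rewrite mulN1r|exact: CkZ].
Qed.

Lemma CkB k f g : Ck k f -> Ck k g -> Ck k (fun x => f x - g x).
Proof. by move=> Cf Cg; apply: CkD => //; exact: CkN. Qed.

Lemma Ck_sum k (I : Type) (s : seq I) (F : I -> V -> R) :
  (forall i, Ck k (F i)) -> Ck k (fun x => \sum_(i <- s) F i x).
Proof.
move=> Fc; elim: s => [|i s IH].
  by under eq_fun do rewrite big_nil; exact: Ck_cst.
by under eq_fun do rewrite big_cons; exact: CkD.
Qed.

Lemma is_derive_coord (i j : 'I_n) x :
  is_derive x 'e_i (fun y : V => y ord0 j) ((i == j)%:R).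
Proof.
have {1}-> : x = x + 0 *: 'e_i by rewrite scale0r addr0.
apply/is_derive_line.
have D1 : is_derive (0 : R) 1 (cst (x ord0 j)) 0 by exact: is_derive_cst.
have D2 : is_derive (0 : R) 1 (cst ((i == j)%:R : R)) 0 by exact: is_derive_cst.
have D3 := is_deriveD D1 (is_deriveM (is_derive_id (0 : R) 1) D2).
apply: is_derive_ext D3.
- by move=> s; rewrite !mxE eqxx /= eq_sym.
- by rewrite add0r scaler0 add0r /cst; exact: mulr1.
Qed.

Lemma Ck_coord k j : Ck k (fun y : V => y ord0 j).
Proof.
case: k => [|k]; first by split => //; exact: continuous_coord.
apply: (@Ck_intro k _ (fun i x => (i == j)%:R)); first exact: continuous_coord.
- by move=> i x; exact: is_derive_coord.
- by move=> i; exact: Ck_cst.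
Qed.

Lemma is_derive_nsq i x : is_derive x 'e_i (fun y : V => nsq y) (2 * x ord0 i).
Proof.
have H : is_derive x 'e_i (\sum_(j < n) (fun y : V => y ord0 j * y ord0 j))
   (\sum_(j < n) (x ord0 j *: (i == j)%:R + x ord0 j *: (i == j)%:R)).
  by apply: is_derive_sum => j; apply: is_deriveM; exact: is_derive_coord.
move: H; apply: is_derive_ext.
  by move=> y; rewrite fct_sumE; apply: eq_bigr => j _.
rewrite (bigD1 i)//= eqxx big1 ?addr0; last first.
  by move=> j; rewrite eq_sym => /negbTE ->; rewrite scaler0 addr0.
by change (x ord0 i * 1 + x ord0 i * 1 = 2 * x ord0 i); ring.
Qed.

Lemma continuous_nsq : continuous (fun x : V => nsq x).
Proof.
apply: cont_sum => i; under eq_fun do rewrite expr2.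
by apply: contM; exact: continuous_coord.
Qed.

(* [g' k] is the k-th derivative of the radial profile. *)
Lemma cont_radial (g : R -> R) : (forall t, 0 <= t -> {for t, continuous g}) ->
  continuous (fun x : V => g (nsq x)).
Proof.
move=> gc x; apply: (@continuous_comp _ _ _ (fun x : V => nsq x) g).
  exact: continuous_nsq.
exact/gc/nsq_ge0.
Qed.

Lemma Ck_radial k (g : nat -> R -> R) :
  (forall j t, (j <= k)%N -> 0 <= t -> {for t, continuous (g j)}) ->
  (forall j (t : R), (j < k)%N -> 0 <= t -> is_derive t 1 (g j) (g j.+1 t)) ->
  Ck k (fun x => g 0%N (nsq x)).
Proof.
elim: k g => [|k IH] g gc gd.
  by split => //; apply: cont_radial => t t0; exact: gc.
apply: (@Ck_intro k _ (fun i x => g 1%N (nsq x) * (2 * x ord0 i))).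
- by apply: cont_radial => t t0; exact: gc.
- move=> i x; apply: is_derive_chain; first exact: is_derive_nsq.
  by apply: gd => //; exact: nsq_ge0.
- move=> i; apply: CkM; last by apply: CkZ; exact: Ck_coord.
  by apply: (IH (fun j => g j.+1)) => [j t jk t0|j t jk t0]; [exact: gc|exact: gd].
Qed.

Lemma lap_radial (g : nat -> R -> R) x :
  (forall j (t : R), (j < 2)%N -> 0 <= t -> is_derive t 1 (g j) (g j.+1 t)) ->
  lap (fun x => g 0%N (nsq x)) x = 2 * n%:R * g 1%N (nsq x) + 4 * nsq x * g 2 (nsq x).
Proof.
move=> gd; rewrite /lap.
have gd0 j (y : V) : (j < 2)%N -> is_derive (nsq y) 1 (g j) (g j.+1 (nsq y)).
  by move=> j2; apply: gd => //; exact: nsq_ge0.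
have E i : partial i (fun x => g 0%N (nsq x)) = (fun x => g 1%N (nsq x) * (2 * x ord0 i)).
  apply: (@partialE _ (fun i x => g 1%N (nsq x) * (2 * x ord0 i))) => y.
  by apply: is_derive_chain; [exact: is_derive_nsq|exact: gd0].
have P i : partial i (partial i (fun x => g 0%N (nsq x))) x =
    g 1%N (nsq x) * 2 + (2 * x ord0 i) * (g 2 (nsq x) * (2 * x ord0 i)).
  rewrite E; apply: is_derive_near_val; apply: is_deriveM.
    by apply: is_derive_chain; [exact: is_derive_nsq|exact: gd0].
  have C2 : is_derive x 'e_i (cst (2 : R) : V -> R) 0 by exact: is_derive_cst.
  apply: is_derive_ext (is_deriveM C2 (is_derive_coord i i x)) => //.
  by rewrite eqxx scaler0 addr0; exact: mulr1.
under eq_bigr do rewrite P.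
rewrite big_split /= sumr_const card_ord; congr (_ + _).
  by rewrite -mulr_natl; ring.
transitivity (\sum_i 4 * g 2 (nsq x) * x ord0 i ^+ 2).
  by apply: eq_bigr => i _; ring.
by rewrite -mulr_sumr -/(nsq x); ring.
Qed.

End Ck.

(** * First and second increments *)

Section increments.
Context {R : realType} {n : nat}.
Notation V := 'rV[R]_n.
Implicit Types (f g : V -> R) (x y z : V).

Lemma line_MVT f i x (t : R) : (forall y, derivable f y 'e_i) ->
  exists2 s, `|s| <= `|t| & f (x + t *: 'e_i) - f x = t * partial i f (x + s *: 'e_i).
Proof.
move=> fd.
have H (s : R) : is_derive s 1 (fun s : R => f (x + s *: 'e_i)) (partial i f (x + s *: 'e_i)).
  exact: (is_derive_line f x 'e_i s _).1 (derivableP (fd (x + s *: 'e_i))).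
have [s st] := MVT0 t H; rewrite scale0r addr0 => E.
by exists s => //; rewrite E mulrC.
Qed.

Definition vtrunc z (k : nat) : V := \row_i (if (i < k)%N then z ord0 i else 0).

Lemma vtruncS z k (kn : (k < n)%N) :
  vtrunc z k.+1 = vtrunc z k + z ord0 (Ordinal kn) *: 'e_(Ordinal kn).
Proof.
apply/rowP => i; rewrite !mxE eqxx /=.
have [->|ik] := eqVneq i (Ordinal kn); first by rewrite /= ltnSn ltnn mulr1 add0r.
rewrite mulr0 addr0 ltnS leq_eqVlt; have -> // : (i == k :> nat) = false.
by apply/negbTE; apply: contra ik => /eqP ik; apply/eqP/val_inj.
Qed.

(* Moving from [x] to [x + z] one coordinate at a time. *)
Lemma path_MVT f x z : (forall i y, derivable f y 'e_i) ->
  exists xi : 'I_n -> V, (forall i j, `|(xi i - x) ord0 j| <= `|z ord0 j|) /\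
    f (x + z) - f x = \sum_i z ord0 i * partial i f (xi i).
Proof.
move=> fd.
have H (i : 'I_n) : exists y, (forall j, `|(y - x) ord0 j| <= `|z ord0 j|) /\
    f (x + vtrunc z i.+1) - f (x + vtrunc z i) = z ord0 i * partial i f y.
  have [s st E] := line_MVT (x + vtrunc z i) (z ord0 i) (fd i).
  exists (x + vtrunc z i + s *: 'e_i); split.
    move=> j; rewrite !mxE eqxx /=; have [->|ji] := eqVneq j i.
      by rewrite ltnn addr0 mulr1 addrAC subrr add0r.
    by rewrite mulr0 addr0 addrAC subrr add0r; case: ifP; rewrite ?normr0.
  have iE : Ordinal (ltn_ord i) = i by apply/val_inj.
  by rewrite (vtruncS z (ltn_ord i)) iE addrA.
have [xi xiP] := choice H.
exists xi; split; first by move=> i; have [] := xiP i.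
have <- : \sum_(i < n) (f (x + vtrunc z i.+1) - f (x + vtrunc z i)) = f (x + z) - f x.
  rewrite -(big_mkord xpredT (fun i => f (x + vtrunc z i.+1) - f (x + vtrunc z i))).
  rewrite telescope_sumr//; congr (f _ - f _).
    by congr (_ + _); apply/rowP => i; rewrite mxE ltn_ord.
  by rewrite -[RHS]addr0; congr (_ + _); apply/rowP => i; rewrite !mxE.
by apply: eq_bigr => i _; have [_] := xiP i.
Qed.

Lemma enorm_le_coords x y : (forall j, `|x ord0 j| <= `|y ord0 j|) -> enorm x <= enorm y.
Proof.
move=> xy; rewrite !enormE ler_wsqrtr// /nsq; apply: ler_sum => i _.
by rewrite -(real_normK (num_real (x _ _))) -[leRHS](real_normK (num_real (y _ _))) lerXn2r ?nnegrE.
Qed.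

Lemma incr_le f x z (M : R) : (forall i y, derivable f y 'e_i) ->
  (forall i y, enorm (y - x) <= enorm z -> `|partial i f y| <= M) ->
  `|f (x + z) - f x| <= n%:R * M * enorm z.
Proof.
move=> fd fM; have [xi [xi1 ->]] := path_MVT x z fd.
apply: le_trans (ler_norm_sum _ _ _) _.
apply: (@le_trans _ _ (\sum_(i < n) M * enorm z)).
  apply: ler_sum => i _; rewrite normrM mulrC ler_pM//.
    by apply: fM; apply: enorm_le_coords => j; exact: xi1.
  exact: coord_le_enorm.
by rewrite sumr_const card_ord -(mulr_natl (M * enorm z)) mulrA.
Qed.

Lemma incr2_le f x z (M : R) : 0 <= M -> Ck 2 f ->
  (forall i j y, enorm (y - x) <= enorm z -> `|partial j (partial i f) y| <= M) ->
  `|2 * f x - f (x + z) - f (x - z)| <= 2 * n%:R ^+ 2 * M * enorm z ^+ 2.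
Proof.
move=> M0 fC fM.
have fd i y : derivable f y 'e_i by have [] := Ck_derivable i y fC.
(* First-order expansion along [w]. It is used for [z] and [- z], where the linear terms cancel. *)
have half w : enorm w = enorm z ->
   `|f (x + w) - f x - \sum_i w ord0 i * partial i f x| <= n%:R ^+ 2 * M * enorm z ^+ 2.
  move=> wz; have [xi [xi1 ->]] := path_MVT x w fd.
  rewrite -sumrB; apply: le_trans (ler_norm_sum _ _ _) _.
  apply: (@le_trans _ _ (\sum_(i < n) enorm z * (n%:R * M * enorm z))).
    apply: ler_sum => i _; rewrite -mulrBr normrM ler_pM//.
      by rewrite -wz; exact: coord_le_enorm.
    have xw : enorm (xi i - x) <= enorm z by rewrite -wz; exact: enorm_le_coords.
    have C1 := Ck_partial i fC.
    rewrite -[X in partial i f X - _](subrKC x).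
    apply: (@le_trans _ _ (n%:R * M * enorm (xi i - x))).
      apply: incr_le; first by move=> j y; have [] := Ck_derivable j y C1.
      by move=> j y yx; apply: fM; exact: le_trans xw.
    by rewrite ler_wpM2l// mulr_ge0.
  by rewrite sumr_const card_ord -(mulr_natl (enorm z * _)) le_eqVlt; apply/orP; left; apply/eqP; ring.
have h1 := half z erefl; have h2 := half (- z) (enormN z).
have sN : \sum_i (- z) ord0 i * partial i f x = - \sum_i z ord0 i * partial i f x.
  by rewrite -sumrN; apply: eq_bigr => i _; rewrite mxE mulNr.
rewrite sN opprK in h2.
rewrite -normrN; have -> : - (2 * f x - f (x + z) - f (x - z)) =
   (f (x + z) - f x - \sum_i z ord0 i * partial i f x) + (f (x - z) - f x + \sum_i z ord0 i * partial i f x) by ring.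
apply: le_trans (ler_normD _ _) _.
by apply: le_trans (lerD h1 h2) _; rewrite le_eqVlt; apply/orP; left; apply/eqP; ring.
Qed.

Lemma bounded_on_ball f (r : R) : continuous f ->
  exists M, 0 <= M /\ forall x, enorm x <= r -> `|f x| <= M.
Proof.
move=> fc.
pose B : set V := [set x | enorm x <= r].
have cB : compact B.
  apply: bounded_closed_compact.
    exists r; split; first exact: num_real.
    move=> r' rr' x /= Bx; apply: le_trans (ltW rr').
    exact: le_trans (norm_le_enorm _) Bx.
  apply: (@closed_comp _ _ (fun x : V => enorm x) [set t | t <= r]).
    by move=> x _; exact: continuous_enorm.
  exact: closed_le.
have := @continuous_compact _ _ f B (continuous_subspaceT fc) cB.
move=> /compact_bounded [M0 [_ M0P]].
exists (`|M0| + 1); split; first by rewrite addr_ge0.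
move=> x xr; apply: M0P; last by exists x.
by rewrite (le_lt_trans (ler_norm _))// ltrDl.
Qed.

End increments.

(** * Integration by parts for compactly supported functions *)

Section compact_support.
Context {R : realType} {n : nat}.
Notation V := 'rV[R]_n.
Implicit Types (f g : V -> R) (x y z : V).

Definition csupp (r : R) f := forall x, r < enorm x -> f x = 0.

Lemma csuppM r f g : csupp r f -> csupp r (fun x => g x * f x).
Proof. by move=> fr x xr; rewrite fr ?mulr0. Qed.

Lemma csupp_partial r f i : csupp r f -> csupp r (partial i f).
Proof.
move=> fr x xr; rewrite /partial (@near_eq_derive _ _ _ f (cst 0)) ?derive_cst//.
have xr' : 0 < enorm x - r by rewrite subr_gt0.
have := (continuous_at_near (fun x : V => enorm x) x).2 (@continuous_enorm _ _ x) _ (divr_gt0 xr' (ltr0n _ 2)).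
apply: filterS => y; rewrite ler_distl => /andP[h1 h2].
by apply: fr; move: h1 h2 xr'; lra.
Qed.

Lemma csupp_bounded r f : continuous f -> csupp r f -> exists M, 0 <= M /\ forall x, `|f x| <= M.
Proof.
move=> fc fr; have [M [M0 HM]] := bounded_on_ball r fc.
exists M; split => // x; have [|xr] := leP (enorm x) r; first exact: HM.
by rewrite fr ?normr0.
Qed.

Lemma ig_cube (r : R) : ig (@volm R n) (fun x => \prod_i \1_`[- `|r|, `|r|]%classic (x ord0 i)).
Proof.
apply: (@ig_ge0 _ _ _ _ _ (\prod_(i < n) (`|r| - (- `|r|)))).
- apply: measurable_prod => i _; apply: measurableT_comp => //; exact: measurable_coord.
- by move=> x; apply: prodr_ge0 => i _; rewrite indicE.
- rewrite (@intRn_prod _ _ (fun _ => \1_`[- `|r|, `|r|]%classic)%R (fun _ => `|r| - (- `|r|))%R).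
  + exact: lexx.
  + by [].
  + by move=> i t; rewrite indicE.
  + move=> _; rewrite integral_indic//= setIT lebesgue_measure_itv/= lte_fin.
    case: ltP => // NN; congr (_%:E); apply/esym/eqP.
    by rewrite eq_le subr_le0 NN subr_ge0 (le_trans _ (normr_ge0 r))// oppr_le0.
Qed.

Lemma ig_bounded_supp r f (M : R) : measurable_fun setT f -> csupp r f ->
  (forall x, `|f x| <= M) -> ig volm f.
Proof.
move=> mf fr fM; apply: (ig_le (igZl M (ig_cube r)) mf) => x.
have M0 : 0 <= M by apply: le_trans (fM x).
have [xr|xr] := leP (enorm x) r; last first.
  by rewrite fr// normr0 mulr_ge0// prodr_ge0// => i _; rewrite indicE.
rewrite big1 ?mulr1// => i _; rewrite indicE mem_set//= in_itv/= -ler_norml.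
apply: le_trans (coord_le_enorm _ _) _; apply: le_trans xr (ler_norm _).
Qed.

Lemma ig_csupp r f : continuous f -> csupp r f -> ig volm f.
Proof.
move=> fc fr; have [M [_ HM]] := csupp_bounded fc fr.
by apply: ig_bounded_supp fr HM; exact: measurable_continuous.
Qed.

Lemma enorm_delta (i : 'I_n) : enorm ('e_i : V) = 1.
Proof.
rewrite enormE /nsq (bigD1 i)//= mxE !eqxx /= expr1n big1 ?addr0 ?sqrtr1// => j ji.
by rewrite mxE (negbTE ji) andbF expr0n.
Qed.

(* Translation invariance makes the integral of every difference quotient vanish. *)
Lemma Rint_partial0 r f i : Ck 1 f -> csupp r f -> \int[volm]_x partial i f x = 0.
Proof.
move=> fC fr; have fc := Ck_cont fC.
have fi := ig_csupp fc fr.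
have dc : continuous (partial i f) := Ck_cont (Ck_partial i fC).
have dr := csupp_partial i fr.
have [M [M0 HM]] := csupp_bounded dc dr.
pose q (k : nat) x : R := k.+1%:R * (f (x + (k.+1%:R^-1) *: 'e_i) - f x).
have fd y : derivable f y 'e_i by have [] := Ck_derivable i y fC.
have qi k : \int[volm]_x q k x = 0.
  rewrite /q RintZl ?RintB ?Rint_shift ?subrr ?mulr0//; first exact: ig_shift.
  by apply: igB => //; exact: ig_shift.
have mq k : measurable_fun setT (q k).
  apply: measurable_funM => //; apply: measurable_funB; last exact: ig_measurable fi.
  exact: ig_measurable (ig_shift _ fi).
have qE k x : exists2 s, `|s| <= k.+1%:R^-1 & q k x = partial i f (x + s *: 'e_i).
  have [s + E] := line_MVT x (k.+1%:R^-1) fd.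
  rewrite (ger0_norm (_ : 0 <= k.+1%:R^-1)) ?invr_ge0// => sk; exists s => //.
  by rewrite /q E mulrA mulfV ?mul1r// pnatr_eq0.
(* The steps are at most 1, so all difference quotients vanish outside the ball of radius [|r| + 1],
   and one cube dominates them. *)
pose b x : R := M * \prod_i \1_`[- `|(`|r| + 1)|, `|(`|r| + 1)|]%classic (x ord0 i).
have qb k x : `|q k x| <= b x.
  rewrite /b; have [s sk ->] := qE k x.
  have s1 : `|s| <= 1.
    by apply: le_trans sk _; rewrite invf_le1 ?ler1n ?ltr0n.
  have [xr|xr] := leP (enorm x) (`|r| + 1).
    rewrite big1 ?mulr1// => j _; rewrite indicE mem_set//= in_itv/= -ler_norml.
    by apply: le_trans (coord_le_enorm _ _) _; apply: le_trans xr (ler_norm _).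
  rewrite dr ?normr0; first by rewrite mulr_ge0// prodr_ge0// => j _; rewrite indicE.
  have := enormB_ge x (- (s *: 'e_i)); rewrite opprK enormN enormZ enorm_delta mulr1.
  have := ler_norm r; lra.
have H0 : (fun k => \int[volm]_x q k x) @ \oo --> (0 : R).
  by under eq_fun do rewrite qi; exact: cvg_cst.
suff qc : forall x, q ^~ x @ \oo --> partial i f x.
  have [_ H] := Rint_dct mq (igZl _ (ig_cube _)) qb qc.
  exact: cvg_unique _ H H0.
move=> x; apply/cvgrPdist_le => e e0.
have [d d0 Hd] : exists2 d, 0 < d & forall y, `|x - y| < d -> `|partial i f x - partial i f y| <= e.
  have /nbhs_ballP[d d0 Hd] := (continuous_at_near (partial i f) x).2 (dc x) e e0.
  by exists d => // y xy; apply: Hd; rewrite -ball_normE.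
have : @harmonic R @ \oo --> (0 : R) by exact: cvg_harmonic.
move=> /cvgrPdist_lt/(_ _ d0); apply: filterS => k /=.
rewrite sub0r normrN ger0_norm ?invr_ge0// => kd.
have [s sk ->] := qE k x; apply: Hd.
rewrite opprD addrA subrr add0r normrN normrZ.
apply: le_lt_trans kd; apply: le_trans sk.
rewrite -[leRHS]mulr1 ler_wpM2l//; apply: le_trans (norm_le_enorm _) _.
by rewrite enorm_delta.
Qed.

(** Green's second identity: the difference of the integrands is the divergence of
    [f grad g - g grad f], which has compact support because [g] has. *)
Lemma Rint_lap_sym r f g : Ck 2 f -> Ck 2 g -> csupp r g ->
  \int[volm]_x (f x * lap g x) = \int[volm]_x (g x * lap f x).
Proof.
move=> fC gC gr.
have fC1 := Ck_le (leqnSn 1) fC; have gC1 := Ck_le (leqnSn 1) gC.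
pose psi i x : R := f x * partial i g x - g x * partial i f x.
have pC i : Ck 1 (psi i).
  by apply: CkB; apply: CkM; [exact: fC1|exact: Ck_partial gC|exact: gC1|exact: Ck_partial fC].
have pr i : csupp r (psi i).
  by move=> x xr; rewrite /psi gr// (csupp_partial i gr xr)// mulr0 mul0r subrr.
have dp i x : partial i (psi i) x = f x * partial i (partial i g) x - g x * partial i (partial i f) x.
  apply: is_derive_near_val.
  have D1 := is_deriveM (Ck_derivable i x fC) (Ck_derivable i x (Ck_partial i gC)).
  have D2 := is_deriveM (Ck_derivable i x gC) (Ck_derivable i x (Ck_partial i fC)).
  apply: is_derive_ext (is_deriveB D1 D2) => //.
  rewrite /GRing.scale/=.
  move: (f x) (g x) (partial i f x) (partial i g x) => a b c d.
  move: (partial i (partial i f) x) (partial i (partial i g) x) => e h; ring.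
have pi i : ig volm (partial i (psi i)).
  by apply: ig_csupp (csupp_partial i (pr i)); exact: Ck_cont (Ck_partial i (pC i)).
have lc h : Ck 2 h -> continuous (lap h).
  move=> hC; apply: cont_sum => i; exact: Ck_cont (Ck_partial i (Ck_partial i hC)).
have lr : csupp r (lap g).
  by move=> x xr; rewrite /lap big1// => i _; apply: (csupp_partial i (csupp_partial i gr)).
have i1 : ig volm (fun x => f x * lap g x).
  apply: (@ig_csupp r); last exact: csuppM.
  by apply: contM; [exact: Ck_cont fC|exact: lc].
have i2 : ig volm (fun x => g x * lap f x).
  apply: (@ig_csupp r); last by move=> x xr; rewrite gr// mul0r.
  by apply: contM; [exact: Ck_cont gC|exact: lc].
apply: subr0_eq; rewrite -(RintB i1 i2).
have -> : (fun x => f x * lap g x - g x * lap f x) = (fun x => \sum_i partial i (psi i) x).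
  apply/funext => x; rewrite /lap !mulr_sumr -sumrB; apply: eq_bigr => i _.
  by rewrite dp.
rewrite Rint_sum// big1// => i _.
exact: Rint_partial0 (pC i) (pr i).
Qed.

End compact_support.

Section derive_under_integral.
Context d (Y : measurableType d) {R : realType} (mu : {measure set Y -> \bar R}).

Lemma is_derive_Rint (f df : R -> Y -> R) (G : Y -> R) (a u v : R) :
  u < a -> a < v ->
  (forall x, u < x -> x < v -> ig mu (f x)) ->
  (forall x y, u < x -> x < v -> is_derive x 1 (f ^~ y) (df x y)) ->
  (forall x y, u < x -> x < v -> `|df x y| <= G y) -> ig mu G ->
  is_derive a 1 (fun x => \int[mu]_y f x y) (\int[mu]_y df a y).
Proof.
move=> ua av fi fd dG Gi.
have I (x : R) : `]u, v[%classic x -> u < x /\ x < v by rewrite /= in_itv/= => /andP[].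
have Ia : `]u, v[%classic a by rewrite /= in_itv/= ua av.
have dE x y : `]u, v[%classic x -> partial1of2 f x y = df x y.
  by move=> /I[ux xv]; rewrite partial1of2E; have [_ ->] := fd x y ux xv.
have := @cvg_differentiation_under_integral R _ Y mu f setT measurableT a u v Ia
  (fun x Ix => let: conj ux xv := I x Ix in fi x ux xv)
  (fun x y Ix _ => let: conj ux xv := I x Ix in ex_derive (is_derive := fd x y ux xv))
  (fun y => `|G y|) (fun y => normr_ge0 _) (ig_abs Gi) _.
have H : forall x y, `]u, v[%classic x -> [set: Y] y -> `|partial1of2 f x y| <= `|G y|.
  move=> x y Ix _; rewrite (dE _ _ Ix); have [ux xv] := I x Ix.
  exact: le_trans (dG x y ux xv) (ler_norm _).
move=> /(_ H).
have -> : \int[mu]_y partial1of2 f a y = \int[mu]_y df a y by apply: eq_Rint => y; exact: dE.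
move=> C.
have E : (fun h : R => h^-1 *: (((fun x => \int[mu]_y f x y) \o shift a) (h *: (1 : R)) - \int[mu]_y f a y)) =
  (fun h : R => h^-1 *: (\int[mu]_y f (h + a) y - \int[mu]_y f a y)).
  by apply/funext => h /=; rewrite [h *: 1]mulr1.
split; first by rewrite /derivable E; apply/cvg_ex; exists (\int[mu]_y df a y).
by rewrite /derive E; exact: cvg_lim C.
Qed.

End derive_under_integral.

(** * The averaging kernels [r^-n (1 - |z|^2 / r^2)_+^N] *)

Section truncated_power.
Context {R : realType}.

(** The truncated power [t_+^N]; for [N = 0] it is constantly 1, also at negative [t]. *)
Definition tp (N : nat) (t : R) : R := Num.max t 0 ^+ N.

Lemma tp_ge0 N t : 0 <= tp N t.
Proof. by rewrite exprn_ge0// le_max lexx orbT. Qed.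

Lemma tp_pos N t : 0 <= t -> tp N t = t ^+ N.
Proof. by move=> t0; rewrite /tp max_l. Qed.

Lemma tp_neg N t : t <= 0 -> tp N.+1 t = 0.
Proof. by move=> t0; rewrite /tp max_r// expr0n. Qed.

Lemma tp_le1 N t : t <= 1 -> tp N t <= 1.
Proof. by move=> t1; rewrite /tp exprn_ile1// ?le_max ?lexx ?orbT// ge_max t1 ler01. Qed.

Lemma continuous_tp N : continuous (tp N).
Proof.
move=> t; apply: (@continuous_comp _ _ _ (fun t : R => Num.max t 0) (fun t : R => t ^+ N)).
  by apply: (@continuous_max _ _ id (cst 0)) => //; exact: cst_continuous.
exact: exprn_continuous.
Qed.

Lemma is_derive_tp N (t : R) : is_derive t 1 (tp N.+2) (N.+2%:R * tp N.+1 t).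
Proof.
have D (s : R) : is_derive s 1 (fun s : R => s ^+ N.+2) (N.+2%:R * s ^+ N.+1).
  have := is_deriveX N.+2 (is_derive_id s (1 : R)).
  by apply: is_derive_ext => [y|]; [rewrite exprfctE|exact: mulr1].
have [t0|t0|->] := ltgtP t 0.
- rewrite (tp_neg _ (ltW t0)) mulr0.
  have D0 : is_derive t 1 (cst (0 : R)) (0 : R) by exact: is_derive_cst.
  apply: (near_eq_is_derive _ D0).
  by near=> s; rewrite tp_neg// ltW//; near: s; exact: lt_nbhsl.
- rewrite (tp_pos _ (ltW t0)).
  apply: (near_eq_is_derive _ (D t)).
  by near=> s; rewrite tp_pos// ltW//; near: s; exact: lt_nbhsr.
- rewrite tp_neg// mulr0.
  (* At 0 the difference quotient of [tp N.+2] is exactly [tp N.+1], which is continuous and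
     vanishes there. *)
  have C : (fun h : R => h^-1 *: ((tp N.+2 \o shift 0) (h *: (1 : R)) - tp N.+2 0)) @ 0^' --> (0 : R).
    have -> : (fun h : R => h^-1 *: ((tp N.+2 \o shift 0) (h *: (1 : R)) - tp N.+2 0)) = tp N.+1.
      apply/funext => h /=; rewrite [h *: 1]mulr1 addr0 (tp_neg N.+1 (lexx 0)) subr0.
      have [h0|h0] := leP h 0; first by rewrite !tp_neg// scaler0.
      by rewrite !tp_pos ?ltW// [LHS]/GRing.scale/= exprS mulrA mulVf ?mul1r// gt_eqF.
    by have /continuous_withinNx := @continuous_tp N.+1 0; rewrite (tp_neg N (lexx 0)).
  by split; [apply/cvg_ex; exists 0|exact: cvg_lim C].
Unshelve. all: by end_near. Qed.

End truncated_power.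

Section ball_kernel.
Context {R : realType} {n : nat}.
Notation V := 'rV[R]_n.
Implicit Types (f g h : V -> R) (x y z : V).

(** Unlike the indicator of a ball, this bump is as smooth as [N] allows, and changing its radius
    amounts to applying a Laplacian to the next one ([is_derive_kb]). The factor [r^-n] makes its
    mass independent of [r]. *)
Definition kb (N : nat) (r : R) z : R := r^-1 ^+ n * tp N (1 - nsq z / r ^+ 2).

Lemma kb_ge0 N r z : 0 < r -> 0 <= kb N r z.
Proof. by move=> r0; rewrite mulr_ge0 ?tp_ge0// exprn_ge0// invr_ge0 ltW. Qed.

Lemma kb_csupp N r : 0 < r -> csupp r (kb N.+1 r).
Proof.
move=> r0 x xr; rewrite /kb tp_neg ?mulr0// subr_le0 ler_pdivlMr ?exprn_gt0// mul1r -sqr_enorm.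
by rewrite lerXn2r ?nnegrE ?enorm_ge0 ?ltW.
Qed.

Lemma kb_le N r z : 0 < r -> kb N r z <= r^-1 ^+ n.
Proof.
move=> r0; have r0' := ltW r0; rewrite /kb -[leRHS]mulr1.
apply: ler_wpM2l; first by rewrite exprn_ge0// invr_ge0.
by rewrite tp_le1// lerBlDr lerDl divr_ge0 ?nsq_ge0 ?exprn_ge0.
Qed.

(* Successive derivatives in [t = nsq z] of the profile of [kb]. *)
Definition kbd (N : nat) (r : R) (j : nat) (t : R) : R :=
  r^-1 ^+ n * ((- (r ^- 2)) ^+ j * (N ^_ j)%:R) * tp (N - j) (1 - t / r ^+ 2).

Lemma kbd0 N r z : kbd N r 0 (nsq z) = kb N r z.
Proof. by rewrite /kbd /kb expr0 ffactn0 mulr1 mulr1 subn0. Qed.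

Lemma is_derive_kbd N r j (t : R) : (j.+1 < N)%N ->
  is_derive t 1 (kbd N r j) (kbd N r j.+1 t).
Proof.
move=> jN.
have D1 : is_derive t 1 (fun t : R => 1 - t / r ^+ 2) (- (r ^- 2)).
  have D := is_deriveB (is_derive_cst (1 : R) t (1 : R))
      (is_deriveM (is_derive_id t (1 : R)) (is_derive_cst (r ^- 2 : R) t (1 : R))).
  apply: is_derive_ext D => //.
  by rewrite sub0r scaler0 add0r; congr (- _); exact: mulr1.
have [M NM] : exists M, (N - j)%N = M.+2 by exists (N - j).-2; lia.
have D2 := is_derive1_chain D1 (is_derive_tp M _).
have D3 := is_deriveM (is_derive_cst (r^-1 ^+ n * ((- (r ^- 2)) ^+ j * (N ^_ j)%:R)) t (1 : R)) D2.
apply: is_derive_ext D3.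
  by move=> s; rewrite /kbd NM.
rewrite scaler0 addr0 /kbd ffactnSr natrM (exprS (- r ^- 2) j).
have -> : (N - j.+1)%N = M.+1 by lia.
rewrite NM /GRing.scale/= /cst; ring.
Qed.

Lemma continuous_kbd N r j : continuous (kbd N r j).
Proof.
move=> t; apply: (@cvgM _ _ _ (nbhs_filter t)); first exact: cvg_cst.
apply: (@continuous_comp _ _ _ (fun t : R => 1 - t / r ^+ 2) (tp (N - j))); last exact: continuous_tp.
apply: cvgB; first exact: cvg_cst.
by apply: cvgM; [exact: cvg_id|exact: cvg_cst].
Qed.

Lemma Ck_kb k N r : (k < N)%N -> Ck k (kb N r).
Proof.
move=> kN; have -> : kb N r = (fun z => kbd N r 0 (nsq z)) by apply/funext => z; rewrite kbd0.
apply: Ck_radial => [j t _ _|j t jk _]; first exact: continuous_kbd.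
by apply: is_derive_kbd; lia.
Qed.

Lemma lap_kb N r z : (1 < N)%N -> r != 0 ->
  lap (kb N.+1 r) z = (2 * N.+1%:R / r ^+ 2) * r^-1 ^+ n *
    (2 * N%:R * (nsq z / r ^+ 2) * tp N.-1 (1 - nsq z / r ^+ 2) - n%:R * tp N (1 - nsq z / r ^+ 2)).
Proof.
move=> N1 r0.
have -> : kb N.+1 r = (fun z => kbd N.+1 r 0 (nsq z)) by apply/funext => y; rewrite kbd0.
rewrite (@lap_radial R n (kbd N.+1 r) z (fun j t jk _ => is_derive_kbd r t (leq_trans jk N1 : (j.+1 < N.+1)%N))).
rewrite /kbd expr1 sqrrN ffactn1 !ffactnS ffactn0 muln1 subSS subn0 !natrM.
have -> : (N.+1 - 2)%N = N.-1 by lia.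
move: (tp N _) (tp N.-1 _) (r^-1 ^+ n) => a b c.
by field.
Qed.

(** Both sides are the same combination of two consecutive truncated powers. The identity turns a
    change of radius into a Laplacian, which a weak equation can see. *)
Lemma is_derive_kb N (r : R) z : (1 < N)%N -> 0 < r ->
  is_derive r 1 (fun r : R => kb N r z) (r / (2 * N.+1%:R) * lap (kb N.+1 r) z).
Proof.
move=> N1 r0.
have rn0 : r != 0 by rewrite gt_eqF.
have Dinv : is_derive r 1 (fun r : R => r^-1) (- r ^- 2).
  have := is_deriveV rn0 (is_derive_id r (1 : R)).
  by apply: is_derive_ext => //; exact: mulr1.
have DX (f : R -> R) (df : R) k : is_derive r 1 f df ->
    is_derive r 1 (fun r => f r ^+ k) (k%:R * f r ^+ k.-1 * df).
  move=> D; have := is_deriveX k D.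
  by apply: is_derive_ext => // y; rewrite exprfctE.
have [M NM] : exists M, N = M.+2 by exists N.-2; lia.
have D1 : is_derive r 1 (fun r : R => 1 - nsq z * r^-1 ^+ 2) (2 * nsq z * r^-1 ^+ 3).
  have D := is_deriveB (is_derive_cst (1 : R) r (1 : R))
    (is_deriveM (is_derive_cst (nsq z : R) r (1 : R)) (DX _ _ 2 Dinv)).
  apply: is_derive_ext D => //.
  by rewrite sub0r scaler0 addr0 /GRing.scale/= /cst expr1; field.
have D2 := is_derive1_chain D1 (is_derive_tp M _).
have D3 := is_deriveM (DX _ _ n Dinv) D2.
apply: is_derive_ext D3.
  by move=> s; rewrite /kb NM -(exprVn s 2).
rewrite lap_kb// NM /= -exprVn /GRing.scale/=.
move: (tp M.+2 _) (tp M.+1 _) => a b.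
have E : n%:R * r^-1 ^+ n.-1 * - r^-1 ^+ 2 = - n%:R * r^-1 ^+ n * r^-1.
  by case: (n) => [|m]; rewrite ?mul0r ?oppr0 ?mul0r//= !exprS expr0; ring.
have p0 : M.+3%:R != 0 :> R by rewrite pnatr_eq0.
rewrite E; move: (M.+3%:R) (M.+2%:R) p0 (r^-1 ^+ n) => p q p0 w; field.
by rewrite rn0 p0.
Qed.

End ball_kernel.

(** * Local integrability and weak Laplacians *)

Section local_integrability.
Context {R : realType} {n : nat}.
Notation V := 'rV[R]_n.
Implicit Types (f g h : V -> R) (x y z : V).

Definition inb (r : R) y : R := if enorm y <= r then 1 else 0.

Lemma inb1 r y : enorm y <= r -> inb r y = 1. Proof. by rewrite /inb => ->. Qed.

Lemma inb0 r y : r < enorm y -> inb r y = 0.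
Proof. by rewrite /inb leNgt => ->. Qed.

Lemma inb_ge0 r y : 0 <= inb r y. Proof. by rewrite /inb; case: ifP. Qed.

Lemma norm_inb r y : `|inb r y| <= 1.
Proof. by rewrite /inb; case: ifP; rewrite ?normr1 ?normr0. Qed.

Definition loc_ig h := measurable_fun setT h /\
  forall r : R, ig volm (fun y => inb r y * h y).

Lemma measurable_inb (r : R) : measurable_fun setT (fun y : V => inb r y).
Proof.
apply: (measurableT_comp (f := fun t : R => if t <= r then 1 else 0 : R)); last exact: measurable_enorm.
have -> : (fun t : R => if t <= r then 1 else 0 : R) = \1_(`]-oo, r]%classic).
  by apply/funext => t; rewrite indicE mem_setE in_itv/=; case: ifP.
exact: measurable_indic.
Qed.

Lemma ball_csupp (r : R) h : csupp r (fun y => inb r y * h y).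
Proof. by move=> x xr; rewrite inb0// mul0r. Qed.

Lemma ig_ball (r : R) : ig volm (fun y : V => inb r y).
Proof.
apply: (@ig_bounded_supp _ _ r _ 1); first exact: measurable_inb.
  by move=> x xr; rewrite inb0.
exact: norm_inb.
Qed.

Lemma loc_ig_cont h : continuous h -> loc_ig h.
Proof.
move=> hc; split; first exact: measurable_continuous.
move=> r; have [M [M0 HM]] := bounded_on_ball r hc.
apply: (@ig_bounded_supp _ _ r _ M).
- by apply: measurable_funM; [exact: measurable_inb|exact: measurable_continuous].
- exact: ball_csupp.
- move=> x; case: (leP (enorm x) r) => xr; last by rewrite inb0// mul0r normr0.
  by rewrite inb1// mul1r; exact: HM.
Qed.

Lemma loc_igB f g : loc_ig f -> loc_ig g -> loc_ig (fun x => f x - g x).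
Proof.
move=> [mf fi] [mg gi]; split; first exact: measurable_funB.
by move=> r; apply: ig_ext (igB (fi r) (gi r)) => x; rewrite mulrBr.
Qed.

Lemma loc_igZ (c : R) f : loc_ig f -> loc_ig (fun x => c * f x).
Proof.
move=> [mf fi]; split; first exact: measurable_funM.
by move=> r; apply: ig_ext (igZl c (fi r)) => x; rewrite mulrCA.
Qed.

Lemma loc_ig_abs f : loc_ig f -> loc_ig (fun x => `|f x|).
Proof.
move=> [mf fi]; split; first exact: measurableT_comp.
move=> r; apply: ig_ext (ig_abs (fi r)) => x; rewrite normrM.
by rewrite ger0_norm ?inb_ge0.
Qed.

Lemma loc_ig_mul r h k (M : R) : loc_ig h -> measurable_fun setT k -> csupp r k ->
  (forall x, `|k x| <= M) -> ig volm (fun x => h x * k x).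
Proof.
move=> [mh hi] mk kr kM; apply: ig_ext (ig_mulb (hi r) mk kM) => x.
have [xr|xr] := leP (enorm x) r; first by rewrite inb1// mul1r mulrC.
by rewrite (kr x xr) mul0r mulr0.
Qed.

Lemma loc_ig_mulc r h k : loc_ig h -> continuous k -> csupp r k ->
  ig volm (fun x => h x * k x).
Proof.
move=> hi kc kr; have [M [_ HM]] := csupp_bounded kc kr.
by apply: (loc_ig_mul hi _ kr HM); exact: measurable_continuous.
Qed.

Lemma csupp_reflect r f x : csupp r f -> csupp (r + enorm x) (fun y => f (x - y)).
Proof.
move=> fr y; rewrite -ltrBrDr => H; apply: fr; apply: lt_le_trans H _.
by rewrite enormBC; exact: enormB_ge.
Qed.

Lemma continuous_reflect f x : continuous f -> continuous (fun y => f (x - y)).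
Proof.
move=> fc y; apply: (@continuous_comp _ _ _ (fun y : V => x - y) f); last exact: fc.
apply: (@cvgB _ _ _ _ (nbhs_filter y)); first exact: cvg_cst.
exact: cvg_id.
Qed.

Lemma is_derive_reflect f df x y i : is_derive (x - y) 'e_i f df ->
  is_derive y 'e_i (fun y => f (x - y)) (- df).
Proof. exact: is_derive_affine. Qed.

Lemma Ck_reflect k f x : Ck k f -> Ck k (fun y => f (x - y)).
Proof.
elim: k f => [|k IH] f fC.
  by split => //; apply: continuous_reflect; exact: Ck_cont fC.
apply: (@Ck_intro _ _ k _ (fun i y => - partial i f (x - y))).
- by apply: continuous_reflect; exact: Ck_cont fC.
- by move=> i y; apply: is_derive_reflect; exact: Ck_derivable fC.
- by move=> i; apply: CkN; apply: IH; exact: Ck_partial.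
Qed.

Lemma lap_reflect f x y : Ck 2 f -> lap (fun y => f (x - y)) y = lap f (x - y).
Proof.
move=> fC; apply: eq_bigr => i _.
have E : partial i (fun y => f (x - y)) = (fun y => - partial i f (x - y)).
  apply: (@partialE _ _ _ (fun i y => - partial i f (x - y))) => z.
  by apply: is_derive_reflect; exact: Ck_derivable fC.
rewrite E; apply: is_derive_near_val.
have D := is_derive_reflect (Ck_derivable i (x - y) (Ck_partial i fC)).
by apply: is_derive_ext (is_deriveN D) => //; exact: opprK.
Qed.

Lemma lap_cont f : Ck 2 f -> continuous (lap f).
Proof.
move=> hC; apply: cont_sum => i; exact: Ck_cont (Ck_partial i (Ck_partial i hC)).
Qed.

Lemma csupp_lap r f : csupp r f -> csupp r (lap f).
Proof.
by move=> fr x xr; rewrite /lap big1// => i _; apply: (csupp_partial i (csupp_partial i fr)).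
Qed.

(** Four derivatives are what the bumps [kb N] with [N > 4] provide; they are the test functions
    behind the ball averages. *)
Definition testfun f := Ck 4 f /\ exists r : R, csupp r f.

(* [- lap h = h'] in the weak sense. *)
Definition wlap h h' := forall k, testfun k ->
  \int[volm]_y (h y * lap k y) = - \int[volm]_y (h' y * k y).

Lemma wlap_smooth h : Ck 2 h -> wlap h (fun y => - lap h y).
Proof.
move=> hC k [kC [r kr]]; have kC2 : Ck 2 k by exact: Ck_le kC.
rewrite (Rint_lap_sym hC kC2 kr) -RintN.
  by apply: eq_Rint => y; rewrite mulNr opprK mulrC.
apply: (@ig_csupp _ _ r).
  by apply: contM; [apply: contN; exact: lap_cont|exact: Ck_cont kC].
by move=> x xr; rewrite kr ?mulr0.
Qed.

Lemma wlapB f f' g g' : loc_ig f -> loc_ig f' -> loc_ig g -> loc_ig g' ->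
  wlap f f' -> wlap g g' -> wlap (fun x => f x - g x) (fun x => f' x - g' x).
Proof.
move=> fi fi' gi gi' wf wg k kt; have [kC [r kr]] := kt.
have kc := Ck_cont kC; have lc := lap_cont (Ck_le (isT : (2 <= 4)%N) kC).
have lr := csupp_lap kr.
have := wf k kt; have := wg k kt.
under [X in _ -> _ -> X = _]eq_Rint do rewrite mulrBl.
under [X in _ -> _ -> _ = - X]eq_Rint do rewrite mulrBl.
rewrite !RintB; try (by apply: loc_ig_mulc; eauto).
by move=> -> ->; rewrite opprB opprK addrC.
Qed.

End local_integrability.

(** * Ball averages of polyharmonic functions *)

Lemma cvg_seq_sum {R : realType} (I : Type) (s : seq I) (F : I -> nat -> R) (l : I -> R) :
  (forall i, F i @ \oo --> l i) -> (fun k => \sum_(i <- s) F i k) @ \oo --> \sum_(i <- s) l i.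
Proof.
move=> Fl; elim: s => [|i s IH].
  by under eq_fun do rewrite big_nil; rewrite big_nil; exact: cvg_cst.
by under eq_fun do rewrite big_cons; rewrite big_cons; exact: cvgD.
Qed.

Section ball_averages.
Context {R : realType} {n : nat}.
Notation V := 'rV[R]_n.
Implicit Types (f g h : V -> R) (x y z : V).

(** Not normalised: a constant is sent to itself times [kmass N]. *)
Definition avgk N h x (r : R) : R := \int[volm]_y (h y * kb N r (x - y)).

Lemma kb_reflect_csupp N (r : R) x : 0 < r -> csupp (r + enorm x) (fun y => kb N.+1 r (x - y)).
Proof. by move=> r0; apply: csupp_reflect; exact: kb_csupp. Qed.

Lemma kb_testfun N (r : R) x : (4 < N)%N -> 0 < r -> testfun (fun y => kb N r (x - y)).
Proof.
case: N => // N N4 r0; split; first by apply: Ck_reflect; exact: Ck_kb.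
by exists (r + enorm x); exact: kb_reflect_csupp.
Qed.

Lemma continuous_kb N (r : R) x : continuous (fun y => kb N.+1 r (x - y)).
Proof. by apply: continuous_reflect; exact: (Ck_cont (@Ck_kb _ _ 0 N.+1 r isT)). Qed.

Lemma ig_avgk N h x (r : R) : loc_ig h -> 0 < r -> ig volm (fun y => h y * kb N.+1 r (x - y)).
Proof.
move=> hi r0; apply: (loc_ig_mulc hi); first exact: continuous_kb.
exact: kb_reflect_csupp.
Qed.

Lemma norm_lap_kb N (r : R) z : (1 < N)%N -> 0 < r ->
  `|r / (2 * N.+1%:R) * lap (kb N.+1 r) z| <= (2 * N%:R + n%:R) * r^-1 ^+ n.+1.
Proof.
move=> N1 r0; have rn0 : r != 0 by rewrite gt_eqF.
rewrite lap_kb//; set q := nsq z / r ^+ 2; set c := r^-1 ^+ n.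
have p0 : N.+1%:R != 0 :> R by rewrite pnatr_eq0.
have -> : r / (2 * N.+1%:R) * (2 * N.+1%:R / r ^+ 2 * c * (2 * N%:R * q * tp N.-1 (1 - q) - n%:R * tp N (1 - q)))
  = (2 * N%:R * (q * tp N.-1 (1 - q)) - n%:R * tp N (1 - q)) * (r^-1 * c).
  move: (tp _ _) (tp _ _) (N.+1%:R) p0 => a b p p0; field.
  by rewrite rn0 p0.
have c0 : 0 <= r^-1 * c by rewrite mulr_ge0 ?exprn_ge0// invr_ge0 ltW.
rewrite normrM exprS -/c (ger0_norm c0) ler_wpM2r//.
have q0 : 0 <= q by rewrite divr_ge0 ?nsq_ge0// exprn_ge0// ltW.
apply: le_trans (ler_normB _ _) _; rewrite lerD//.
  rewrite normrM ger0_norm ?mulr_ge0// -[leRHS]mulr1 ler_wpM2l ?mulr_ge0//.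
  have [q1|q1] := leP q 1.
    rewrite (ger0_norm (mulr_ge0 q0 (tp_ge0 _ _))); apply: mulr_ile1 => //; first exact: tp_ge0.
    by rewrite tp_le1// lerBlDr lerDl.
  case: (N) N1 => [|[|M]] //= _; rewrite tp_neg ?mulr0 ?normr0//.
  by rewrite subr_le0 ltW.
rewrite normrM ger0_norm// -[leRHS]mulr1 ler_wpM2l// ger0_norm ?tp_ge0//.
by rewrite tp_le1// lerBlDr lerDl.
Qed.

(** By [is_derive_kb] the derivative of the kernel is a Laplacian, which the weak equation moves
    onto [h]; the index [N] grows by one at each use. *)
Lemma is_derive_avgk N h h' x (r : R) : (4 < N)%N -> loc_ig h -> wlap h h' -> 0 < r ->
  is_derive r 1 (avgk N h x) (- (r / (2 * N.+1%:R)) * avgk N.+1 h' x r).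
Proof.
move=> N4 hi w r0.
have N1 : (1 < N)%N by exact: leq_trans N4.
have [M NM] : exists M, N = M.+1 by exists N.-1; rewrite prednK// (leq_trans _ N4).
have kt : testfun (fun y => kb N.+1 r (x - y)) by apply: kb_testfun => //; exact: ltnW.
have lE (s : R) y : lap (fun y => kb N.+1 s (x - y)) y = lap (kb N.+1 s) (x - y).
  by apply: lap_reflect; apply: Ck_kb; lia.
have Ci (s : R) : 0 < s -> ig volm (fun y => h y * lap (kb N.+1 s) (x - y)).
  move=> s0; apply: (loc_ig_mulc (r := s + enorm x) hi).
    by apply: continuous_reflect; apply: lap_cont; apply: Ck_kb; lia.
  by apply: csupp_reflect; apply: csupp_lap; exact: kb_csupp.
have -> : - (r / (2 * N.+1%:R)) * avgk N.+1 h' x r =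
    \int[volm]_y (h y * (r / (2 * N.+1%:R) * lap (kb N.+1 r) (x - y))).
  rewrite mulNr -mulrN /avgk -(w _ kt) -RintZl; last first.
    by apply: ig_ext (Ci r r0) => y; rewrite lE.
  by apply: eq_Rint => y; rewrite lE; exact: mulrCA.
have r2 : 0 < r / 2 by rewrite divr_gt0.
set C := (2 * N%:R + n%:R) * (r / 2)^-1 ^+ n.+1.
apply: (@is_derive_Rint _ _ _ _ (fun r y => h y * kb N r (x - y))
  (fun r y => h y * (r / (2 * N.+1%:R) * lap (kb N.+1 r) (x - y)))
  (fun y => C * `|inb (2 * r + enorm x) y * h y|) r (r / 2) (2 * r)).
- by rewrite ltr_pdivrMr// ltr_pMr// ltr1n.
- by rewrite ltr_pMl// ltr1n.
- move=> s rs _; rewrite NM; apply: ig_avgk => //; exact: lt_trans rs.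
- move=> s y rs sr; have s0 : 0 < s by exact: lt_trans rs.
  have D := is_deriveM (is_derive_cst (h y : R) s (1 : R)) (is_derive_kb (x - y) N1 s0).
  by apply: is_derive_ext D => //; rewrite scaler0 addr0.
- move=> s y rs sr; have s0 : 0 < s by exact: lt_trans rs.
  have [yr|yr] := leP (enorm y) (2 * r + enorm x); last first.
    rewrite inb0// mul0r normr0 mulr0 (_ : lap _ _ = 0) ?mulr0 ?normr0//.
    apply: (@csupp_reflect _ _ s (lap (kb N.+1 s)) x) => //; first by apply: csupp_lap; exact: kb_csupp.
    by apply: le_lt_trans yr; rewrite lerD2r ltW.
  rewrite inb1// mul1r normrM mulrC ler_wpM2r//.
  apply: le_trans (norm_lap_kb _ N1 s0) _; rewrite ler_wpM2l ?addr_ge0 ?mulr_ge0//.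
  have s0' := ltW s0; have r2' := ltW r2; rewrite lerXn2r ?nnegrE ?invr_ge0//.
  by rewrite lef_pV2 ?posrE// ltW.
- apply: igZl; apply: ig_abs; have [_] := hi; exact.
Qed.

Lemma derive0_const (f : R -> R) : (forall t : R, 0 < t -> is_derive t 1 f 0) ->
  forall s t, 0 < s -> 0 < t -> f s = f t.
Proof.
move=> fd.
have H (s t : R) : 0 < s -> s < t -> f s = f t.
  move=> s0 st.
  have fd' (u : R) : u \in `]s, t[%R -> is_derive u 1 f ((fun=> 0) u).
    by rewrite in_itv/= => /andP[su _]; apply: fd; exact: lt_trans su.
  have fc : {within `[s, t], continuous f}.
    apply: derivable_within_continuous => u; rewrite in_itv/= => /andP[su _].
    by have [] := fd u (lt_le_trans s0 su).
  have [c _] := MVT st fd' fc; rewrite mul0r => /eqP; rewrite subr_eq0 => /eqP ->.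
  by [].
move=> s t s0 t0; have [st|ts|->//] := ltgtP s t; first exact: H.
by apply/esym; exact: H.
Qed.

Lemma is_derive_powc (c : R) k (t : R) :
  is_derive t 1 (fun t : R => c * t ^+ k.+1) (c * (k.+1%:R * t ^+ k)).
Proof.
have D := is_deriveM (is_derive_cst (c : R) t (1 : R)) (is_deriveX k.+1 (is_derive_id t (1 : R))).
apply: is_derive_ext D.
  by move=> s; rewrite exprfctE.
by rewrite scaler0 addr0 /GRing.scale/= mulr1.
Qed.

(* If the iterated weak Laplacians of [h 0] vanish after [m] steps, its ball
   averages are polynomials of degree less than [m] in [r ^ 2]. *)
Lemma avgk_poly m N (h : nat -> V -> R) x : (4 < N)%N ->
  (forall j, (j < m)%N -> loc_ig (h j)) ->
  (forall j, (j < m)%N -> wlap (h j) (h j.+1)) ->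
  (forall y, h m y = 0) ->
  exists a : nat -> R, forall r, 0 < r ->
    avgk N (h 0%N) x r = \sum_(i < m) a i * r ^+ (2 * i).
Proof.
elim: m N h => [|m IH] N h N4 hi hw h0.
  exists (fun=> 0) => r r0; rewrite big_ord0 /avgk -[RHS](@Rint_zero _ V R volm).
  by apply: eq_Rint => y; rewrite h0 mul0r.
have [a Ha] := IH N.+1 (fun j => h j.+1) (ltnW N4) (fun j jm => hi j.+1 jm) (fun j jm => hw j.+1 jm) h0.
(* Coefficients of the primitive of [- r / (2 (N + 1)) * a i * r^(2 i)]. *)
pose b i : R := - a i / (4 * N.+1%:R * i.+1%:R).
pose Q (r : R) := \sum_(i < m) b i * r ^+ (2 * i).+2.
have DQ (r : R) : is_derive r 1 Q (\sum_(i < m) b i * ((2 * i).+2%:R * r ^+ (2 * i).+1)).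
  have := is_derive_sum (fun i : 'I_m => is_derive_powc (b i) (2 * i).+1 r).
  by apply: is_derive_ext => // s; rewrite fct_sumE.
have D (r : R) : 0 < r -> is_derive r 1 (fun r => avgk N (h 0%N) x r - Q r) 0.
  move=> r0; have D1 := is_derive_avgk x N4 (hi 0%N isT) (hw 0%N isT) r0.
  apply: is_derive_ext (is_deriveB D1 (DQ r)) => //.
  rewrite Ha// mulr_sumr -sumrB big1// => i _.
  have E2 : ((2 * i).+2%:R : R) = 2 * i.+1%:R by rewrite -natrM mulnS.
  rewrite /b E2 exprS.
  have p1 : N.+1%:R != 0 :> R by rewrite pnatr_eq0.
  have p2 : i.+1%:R != 0 :> R by rewrite pnatr_eq0.
  move: (N.+1%:R) (i.+1%:R : R) p1 p2 => p q p1 p2; field.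
  by rewrite p1 p2.
exists (fun i => if i is i'.+1 then b i' else avgk N (h 0%N) x 1 - Q 1) => r r0.
rewrite big_ord_recl /= muln0 expr0 mulr1.
have := derive0_const D r0 ltr01 => <-.
rewrite -addrA -[LHS]addr0; congr (_ + _); apply/eqP; rewrite eq_sym addrC subr_eq0; apply/eqP.
by apply: eq_bigr => i _; rewrite /bump/= add1n mulnS.
Qed.

Definition kmass N : R := \int[volm]_(z in [set: V]) kb N 1 z.

Lemma loc_ig_cst (c : R) : loc_ig (fun _ : V => c).
Proof. by apply: loc_ig_cont; exact: cont_cst. Qed.

(** The constant 1 is harmonic, so [avgk_poly] with [m = 1] makes its averages independent of
    [r]. *)
Lemma Rint_kb N (r : R) x : (4 < N)%N -> 0 < r ->
  \int[volm]_y kb N r (x - y) = kmass N.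
Proof.
move=> N4 r0; pose h (j : nat) : V -> R := if j is 0 then cst 1 else cst 0.
have [M NM] : exists M, N = M.+1 by exists N.-1; rewrite prednK// (leq_trans _ N4).
have hw j : (j < 1)%N -> wlap (h j) (h j.+1).
  case: j => // _; rewrite /h.
  have := wlap_smooth (@Ck_cst R n 2 1); congr wlap; apply/funext => y.
  rewrite /lap big1 ?oppr0// => i _; apply: is_derive_near_val.
  have -> : partial i (fun=> 1) = (fun _ : V => 0) :> (V -> R).
    by apply: (@partialE _ _ _ (fun _ _ => 0)) => z; exact: is_derive_cst.
  exact: is_derive_cst.
have hl j : (j < 1)%N -> loc_ig (h j) by case: j => // _; exact: loc_ig_cst.
have [a Ha] := avgk_poly x N4 hl hw (fun=> erefl).
have E s : 0 < s -> \int[volm]_y kb N s (x - y) = a 0%N.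
  move=> s0; have := Ha s s0; rewrite big_ord_recl big_ord0 addr0 muln0 expr0 mulr1 => <-.
  by apply: eq_Rint => y; rewrite /h /= mul1r.
rewrite (E r r0) -(E 1 ltr01) /kmass Rint_reflect// NM.
apply: ig_csupp; last exact: (kb_csupp M ltr01).
exact: (Ck_cont (@Ck_kb _ _ 0 M.+1 1 isT)).
Qed.

Lemma kmass_gt0 N : 0 < kmass N.+1.
Proof.
(* On the cube of half-side [s] one has [nsq x <= 1 / 2], so the kernel is at least [2^-(N+1)]
   there. *)
pose s : R := (2 * n.+1%:R)^-1.
have s0 : 0 < s by rewrite invr_gt0 mulr_gt0// ltr0n.
have Nn0 : 0 < n.+1%:R :> R by rewrite ltr0n.
pose g : V -> R := fun x => \prod_i \1_`[- `|s|, `|s|]%classic (x ord0 i).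
have gi : ig volm g := ig_cube s.
have ki : ig volm (kb N.+1 1 : V -> R).
  apply: ig_csupp; last exact: (kb_csupp N ltr01).
  exact: (Ck_cont (@Ck_kb _ _ 0 N.+1 1 isT)).
have gv : \int[volm]_x g x = (2 * s) ^+ n.
  have -> : (2 * s) ^+ n = \prod_(i < n) (s - (- s)).
    by rewrite prodr_const card_ord; congr (_ ^+ _); ring.
  rewrite /Rintegral /g (@intRn_prod _ _ (fun _ => \1_`[- `|s|, `|s|]%classic)%R (fun _ => s - (- s))%R)//.
  move=> _; rewrite integral_indic//= setIT lebesgue_measure_itv/= lte_fin (gtr0_norm s0).
  by rewrite gt0_cp.
apply: (@lt_le_trans _ _ (2^-1 ^+ N.+1 * (2 * s) ^+ n)).
  by rewrite mulr_gt0 ?exprn_gt0// mulr_gt0.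
rewrite -gv -RintZl//; apply: Rint_le => //; first exact: igZl.
move=> x; have [xs|xs] := pselect (forall i, `|x ord0 i| <= s); last first.
  have -> : g x = 0.
    have [i xi] : exists i, s < `|x ord0 i|.
      by apply: contrapT => /forallNP H; apply: xs => i; rewrite leNgt; apply/negP; exact: H.
    rewrite /g (bigD1 i)//= indicE memNset ?mul0r//= in_itv/= (gtr0_norm s0).
    by rewrite -ler_norml leNgt xi.
  by rewrite mulr0 kb_ge0.
have g1 : g x <= 1.
  by rewrite /g big1// => i _; rewrite indicE mem_set//= in_itv/= (gtr0_norm s0) -ler_norml.
apply: (@le_trans _ _ (2^-1 ^+ N.+1)).
  by rewrite -[leRHS]mulr1 ler_wpM2l ?exprn_ge0.
have q2 : nsq x <= 2^-1.
  apply: (@le_trans _ _ (\sum_(i < n) s ^+ 2)).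
    apply: ler_sum => i _; rewrite -(real_normK (num_real (x ord0 i))) lerXn2r ?nnegrE//.
    exact: ltW.
  rewrite sumr_const card_ord -(mulr_natl (s ^+ 2)).
  apply: (@le_trans _ _ (n.+1%:R * s ^+ 2)); first by rewrite ler_wpM2r ?sqr_ge0// ler_nat.
  have -> : n.+1%:R * s ^+ 2 = 2^-1 * s by rewrite /s; move: Nn0; move: (n.+1%:R : R) => p p0; field; lra.
  rewrite -[leRHS]mulr1 ler_wpM2l// /s invf_le1 ?mulr_gt0//.
  have : 1 <= n.+1%:R :> R by rewrite ler1n.
  lra.
rewrite /kb !(expr1n, invr1, mul1r, mulr1) tp_pos; last by lra.
by rewrite lerXn2r ?nnegrE//; lra.
Qed.

Lemma avgk_cvg0 N h x : (4 < N)%N -> continuous h ->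
  forall e : R, 0 < e -> exists d : R, 0 < d /\ forall r, 0 < r -> r < d ->
    `|avgk N h x r - h x * kmass N| <= e.
Proof.
move=> N4 hc e e0.
have [M NM] : exists M, N = M.+1 by exists N.-1; rewrite prednK// (leq_trans _ N4).
have m0 : 0 < kmass N by rewrite NM; exact: kmass_gt0.
have /nbhs_ballP[d d0 Hd] := (continuous_at_near h x).2 (hc x) _ (divr_gt0 e0 m0).
exists d; split => // r r0 rd.
have hi := loc_ig_cont hc.
have i1 : ig volm (fun y => h y * kb N r (x - y)) by rewrite NM; exact: ig_avgk.
have i2 : ig volm (fun y => kb N r (x - y)).
  have := ig_avgk M x (loc_ig_cst 1) r0; rewrite -NM; apply: ig_ext => y; exact: mul1r.
rewrite -(Rint_kb x N4 r0) -RintZl// -RintB//; last exact: igZl.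
have -> : e = \int[volm]_y (e / kmass N * kb N r (x - y)).
  by rewrite RintZl// Rint_kb// divfK// gt_eqF.
apply: Rint_norm_le.
- by apply: ig_measurable (igB i1 (igZl (h x) i2)).
- exact: igZl.
move=> y; rewrite -mulrBl normrM (ger0_norm (kb_ge0 _ _ r0)).
have [yr|yr] := leP (enorm (x - y)) r.
  rewrite ler_wpM2r ?kb_ge0// distrC; apply: Hd.
  by rewrite -ball_normE /=; apply: le_lt_trans (norm_le_enorm _) _; exact: le_lt_trans yr rd.
by rewrite NM (kb_csupp M r0 yr) !mulr0.
Qed.

(** The Vandermonde matrix with nodes [1, 4, ..., m^2] is invertible. The weights recover the value
    at 0 of a polynomial of degree below [m] in [r^2] from its values at the radii
    [r, 2 r, ..., m r]. *)
Lemma lagrange0 m : exists lam : 'I_m -> R, forall i, (i < m)%N ->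
  \sum_(k < m) lam k * (k.+1%:R ^+ 2) ^+ i = (i == 0%N)%:R.
Proof.
pose a : 'rV[R]_m := \row_k (k.+1%:R ^+ 2).
have U : Vandermonde m a \in unitmx.
  rewrite unitmxE det_Vandermonde unitfE; apply/prodf_neq0 => i _; apply/prodf_neq0 => j ij.
  rewrite !mxE subr_eq0 gt_eqF// ltrXn2r ?nnegrE// ltr_nat//.
pose lam : 'cV[R]_m := invmx (Vandermonde m a) *m (\col_i (i == 0 :> nat)%:R).
exists (fun k => lam k ord0) => i im.
have : Vandermonde m a *m lam = \col_i (i == 0 :> nat)%:R by rewrite mulKVmx.
move=> /matrixP/(_ (Ordinal im) ord0); rewrite !mxE /= => <-.
by apply: eq_bigr => k _; rewrite !mxE mulrC.
Qed.

(** The averages are a polynomial in [r^2] whose constant term is, by letting [r] tend to 0, the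
    value at the centre times [kmass N]. The weights of [lagrange0] extract this term from radii
    that may be arbitrarily large. *)
Lemma reproducing m N (h : nat -> V -> R) : (4 < N)%N -> (0 < m)%N -> continuous (h 0%N) ->
  (forall j, (j < m)%N -> loc_ig (h j)) ->
  (forall j, (j < m)%N -> wlap (h j) (h j.+1)) ->
  (forall y, h m y = 0) ->
  exists lam : 'I_m -> R, forall x (r : R), 0 < r ->
    h 0%N x * kmass N = \sum_(k < m) lam k * avgk N (h 0%N) x (k.+1%:R * r).
Proof.
move=> N4 m0 hc hi hw h0; have [lam Hlam] := lagrange0 m.
exists lam => x r r0; have [a Ha] := avgk_poly x N4 hi hw h0.
have -> : h 0%N x * kmass N = a 0%N.
  have C1 : (fun k => avgk N (h 0%N) x k.+1%:R^-1) @ \oo --> h 0%N x * kmass N.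
    apply/cvgrPdist_le => e e0; have [d [d0 Hd]] := avgk_cvg0 x N4 hc e0.
    have : @harmonic R @ \oo --> (0 : R) by exact: cvg_harmonic.
    move=> /cvgrPdist_lt/(_ _ d0); apply: filterS => k /=.
    rewrite sub0r normrN ger0_norm ?invr_ge0// => kd.
    by rewrite distrC; apply: Hd => //; rewrite invr_gt0.
  have C2 : (fun k => avgk N (h 0%N) x k.+1%:R^-1) @ \oo --> a 0%N.
    have -> : (fun k : nat => avgk N (h 0%N) x k.+1%:R^-1) = (fun k => \sum_(i < m) a i * (@harmonic R k) ^+ (2 * i)).
      by apply/funext => k; rewrite Ha// invr_gt0.
    have -> : a 0%N = \sum_(i < m) a i * 0 ^+ (2 * i).
      rewrite (bigD1 (Ordinal m0))//= muln0 expr0 mulr1 big1 ?addr0// => i i0.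
      rewrite expr0n muln_eq0 /=; case: eqP => [i00|]; last by rewrite mulr0.
      by move: i0; rewrite (_ : i = Ordinal m0) ?eqxx//; apply/val_inj.
    apply: cvg_seq_sum => i; apply: cvgM; first exact: cvg_cst.
    exact: (cvg_comp (@harmonic R) (fun t : R => t ^+ (2 * i)) (@cvg_harmonic R)
      (@exprn_continuous R (2 * i) 0)).
  exact: cvg_unique C1 C2.
transitivity (\sum_(k < m) \sum_(i < m) a i * r ^+ (2 * i) * (lam k * (k.+1%:R ^+ 2) ^+ i)).
  rewrite exchange_big /=; under eq_bigr do rewrite -mulr_sumr Hlam ?ltn_ord//.
  rewrite (bigD1 (Ordinal m0))//= muln0 expr0 !mulr1 big1 ?addr0// => i i0.
  case: eqP => [i00|]; last by rewrite mulr0.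
  by move: i0; rewrite (_ : i = Ordinal m0) ?eqxx//; apply/val_inj.
apply: eq_bigr => k _; rewrite Ha ?mulr_gt0// mulr_sumr; apply: eq_bigr => i _.
by rewrite (exprMn _ (k.+1%:R) r) (exprM (k.+1%:R) 2 i); ring.
Qed.

End ball_averages.

(** * Taylor expansion of truncated powers *)

Section truncated_taylor.
Context {R : realType}.
Implicit Types a b q : R.

Lemma ler_sum_widen (F : nat -> R) (k m : nat) : (k <= m)%N -> (forall i, (i < m)%N -> 0 <= F i) ->
  \sum_(i < k) F i <= \sum_(i < m) F i.
Proof.
move=> km F0; rewrite (big_ord_widen m F km) [leRHS](bigID (fun i : 'I_m => (i < k)%N))/= lerDl.
by apply: sumr_ge0 => i _; exact: F0.
Qed.

Lemma sum_binomial N : \sum_(i < N.+1) 'C(N, i)%:R = 2 ^+ N :> R.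
Proof.
have := exprDn (1 : R) 1 N; rewrite (_ : 1 + 1 = 2) // => ->.
by apply: eq_bigr => i _; rewrite !expr1n mulr1.
Qed.

(** The kink does no harm: when [a] and [a + b] have opposite signs, the positive one is at most
    [|b|], so every term is [O(|b|^N)]. When both are nonnegative this is the binomial formula. *)
Lemma tp_taylor N d a b : (d <= N)%N -> a <= 1 -> `|b| <= 1 ->
  `|tp N (a + b) - \sum_(i < d) 'C(N, i)%:R * tp (N - i) a * b ^+ i| <= 2 ^+ N * `|b| ^+ d.
Proof.
move=> dN a1 b1.
have bN : `|b| ^+ N <= `|b| ^+ d by rewrite ler_wiXn2l.
have p2 : 1 <= 2 ^+ N :> R by rewrite exprn_ege1// ler1n.
have [a0|a0] := ltP a 0.
  rewrite big1; last first.
    move=> i _; have -> : (N - i = (N - i.+1).+1)%N by have := ltn_ord i; lia.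
    by rewrite (tp_neg _ (ltW a0)) mulr0 mul0r.
  rewrite subr0 ger0_norm ?tp_ge0//; apply: (@le_trans _ _ (`|b| ^+ N)); last first.
    by apply: le_trans bN _; rewrite ler_peMl// exprn_ge0.
  rewrite /tp lerXn2r ?nnegrE ?normr_ge0 ?le_max ?lexx ?orbT// ge_max normr_ge0 andbT.
  by apply: le_trans (ler_norm b); rewrite gerDr ltW.
have E i : (i < d)%N -> tp (N - i) a = a ^+ (N - i) by move=> _; rewrite tp_pos.
have [ab|ab] := ltP (a + b) 0.
  have ab' : a <= `|b|.
    by rewrite ler0_norm; lra.
  have -> : tp N (a + b) = (N == 0%N)%:R.
    by case: (N) => [|M]; rewrite ?(tp_neg _ (ltW ab))// /tp expr0.
  have [N0|N0] := eqVneq N 0%N.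
    move: dN; rewrite N0 leqn0 => /eqP ->; rewrite big_ord0 subr0 normr1 !expr0 mulr1//.
  rewrite sub0r normrN; apply: le_trans (ler_norm_sum _ _ _) _.
  apply: (@le_trans _ _ (\sum_(i < d) 'C(N, i)%:R * `|b| ^+ d)).
    apply: ler_sum => i _; rewrite -mulrA normrM normr_nat ler_wpM2l// normrM.
    rewrite E// normrX normrX (ger0_norm a0); apply: le_trans bN.
    have := ltn_ord i => id_.
    rewrite -[in leRHS](subnK (leq_trans (ltnW id_) dN)) exprD ler_wpM2r ?exprn_ge0//.
    by rewrite lerXn2r ?nnegrE.
  rewrite -mulr_suml ler_wpM2r ?exprn_ge0// -sum_binomial.
  by apply: (ler_sum_widen (F := fun i => 'C(N, i)%:R)) => //; exact: leqW.
rewrite (tp_pos _ ab) exprDn -(subnKC (leqW dN)) big_split_ord/=.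
rewrite (eq_bigr (fun i : 'I_d => 'C(N, i)%:R * tp (N - i) a * b ^+ i)); last first.
  by move=> i _; rewrite E// -mulr_natl mulrA.
rewrite addrAC subrr add0r; apply: le_trans (ler_norm_sum _ _ _) _.
apply: (@le_trans _ _ (\sum_(i < N.+1 - d) 'C(N, d + i)%:R * `|b| ^+ d)).
  apply: ler_sum => i _; rewrite normrMn -[leLHS]mulr_natl ler_wpM2l// normrM !normrX.
  rewrite exprD mulrCA ler_piMr ?exprn_ge0// mulr_ile1 ?exprn_ge0 ?exprn_ile1//.
  by rewrite ger0_norm.
rewrite -mulr_suml ler_wpM2r ?exprn_ge0// -sum_binomial -[in leRHS](subnKC (leqW dN)) big_split_ord/=.
by rewrite lerDr sumr_ge0.
Qed.

(** [A] has order 1 and [B] order 2 in the small quantity [q], so [A^(i-l) B^l] has order [i + l];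
    terms of order at least [d] go into the error. *)
Lemma tp_taylor2 N d a (A B : R) q : (d <= N)%N -> a <= 1 -> q <= 2^-1 ->
  `|A| <= q -> `|B| <= q ^+ 2 ->
  `|tp N (a + (A + B)) - \sum_(i < d) \sum_(l < i.+1 | (i + l < d)%N)
       'C(N, i)%:R * tp (N - i) a * ('C(i, l)%:R * (A ^+ (i - l) * B ^+ l))| <=
    (2 * 2 ^+ N * 2 ^+ d) * q ^+ d.
Proof.
move=> dN a1 q2 Aq Bq.
have q0 : 0 <= q by apply: le_trans Aq.
have q1 : q <= 1 by lra.
have qq : q ^+ 2 <= q by rewrite expr2 ler_piMr.
have bq : `|A + B| <= 2 * q by apply: le_trans (ler_normD _ _) _; lra.
have b1 : `|A + B| <= 1 by lra.
have T := tp_taylor dN a1 b1.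
pose S1 := \sum_(i < d) 'C(N, i)%:R * tp (N - i) a * (A + B) ^+ i.
rewrite -(subrKA S1) (_ : 2 * 2 ^+ N * 2 ^+ d * q ^+ d = 2 ^+ N * 2 ^+ d * q ^+ d + 2 ^+ N * 2 ^+ d * q ^+ d); last by ring.
apply: le_trans (ler_normD _ _) _; apply: lerD.
  apply: le_trans T _; rewrite -mulrA -exprMn ler_wpM2l ?exprn_ge0//.
  by rewrite lerXn2r ?nnegrE// mulr_ge0.
rewrite /S1 -sumrB; apply: le_trans (ler_norm_sum _ _ _) _.
apply: (@le_trans _ _ (\sum_(i < d) 'C(N, i)%:R * (2 ^+ d * q ^+ d))); last first.
  rewrite -mulr_suml -mulrA ler_wpM2r ?mulr_ge0 ?exprn_ge0// -sum_binomial.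
  by apply: (ler_sum_widen (F := fun i => 'C(N, i)%:R)) => //; exact: leqW.
apply: ler_sum => i _.
rewrite -mulr_sumr -mulrBr -mulrA normrM normr_nat ler_wpM2l// normrM.
rewrite ger0_norm ?tp_ge0// -[leRHS]mul1r.
apply: ler_pM; rewrite ?normr_ge0 ?tp_ge0//; first exact: tp_le1.
have -> : (A + B) ^+ i = \sum_(l < i.+1) 'C(i, l)%:R * (A ^+ (i - l) * B ^+ l).
  by rewrite exprDn; apply: eq_bigr => l _; rewrite -[LHS]mulr_natl.
rewrite (bigID (fun l : 'I_i.+1 => (i + l < d)%N))/= addrAC subrr add0r.
apply: le_trans (ler_norm_sum _ _ _) _.
apply: (@le_trans _ _ (\sum_(l < i.+1 | ~~ (i + l < d)%N) 'C(i, l)%:R * q ^+ d)).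
  apply: ler_sum => l; rewrite -leqNgt => dl; rewrite normrM normr_nat ler_wpM2l//.
  rewrite normrM !normrX; apply: (@le_trans _ _ (q ^+ (i - l) * (q ^+ 2) ^+ l)).
    by apply: ler_pM; rewrite ?exprn_ge0// lerXn2r ?nnegrE// exprn_ge0.
  rewrite -exprM -exprD; apply: ler_wiXn2l => //; first by have := ltn_ord l; lia.
rewrite -mulr_suml ler_wpM2r ?exprn_ge0//.
apply: (@le_trans _ _ (\sum_(l < i.+1) 'C(i, l)%:R)).
  by rewrite [leRHS](bigID (fun l : 'I_i.+1 => (i + l < d)%N))/= lerDr sumr_ge0.
rewrite sum_binomial; by rewrite ler_weXn2l ?ler1n// ltnW.
Qed.

End truncated_taylor.

(** * Polynomial functions of bounded degree *)

Section polynomial_functions.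
Context {R : realType} {n : nat}.
Notation V := 'rV[R]_n.
Implicit Types (f g h : V -> R) (x y z : V) (D : nat).

Definition Pol D f := exists P : mpoly.mpoly n R, (pdeg P <= D)%N /\ forall x, f x = peval P x.

Lemma pdeg_leP (P : mpoly.mpoly n R) D :
  (pdeg P <= D)%N <-> forall m, m \in mpoly.msupp P -> (mpoly.mdeg m <= D)%N.
Proof.
split; first by move=> /bigmax_leqP_seq H m mP; exact: H.
by move=> H; apply/bigmax_leqP_seq => m mP _; exact: H.
Qed.

Lemma Pol_ext D f g : Pol D f -> (forall x, g x = f x) -> Pol D g.
Proof. by move=> [P [PD fP]] gf; exists P; split => // x; rewrite gf. Qed.

Lemma Pol_le D D' f : (D <= D')%N -> Pol D f -> Pol D' f.
Proof. by move=> DD [P [PD fP]]; exists P; split => //; exact: leq_trans DD. Qed.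

Lemma Pol_cst D (c : R) : Pol D (fun=> c).
Proof.
exists (mpoly.mpolyC n c); split; last by move=> x; rewrite /peval mpoly.mevalC.
apply/pdeg_leP => m; rewrite mpoly.msuppC; case: ifP => // _; rewrite inE => /eqP ->.
by rewrite mpoly.mdeg0.
Qed.

Lemma PolD D f g : Pol D f -> Pol D g -> Pol D (fun x => f x + g x).
Proof.
move=> [P [/pdeg_leP PD fP]] [Q [/pdeg_leP QD gQ]]; exists (P + Q); split.
  by apply/pdeg_leP => m /mpoly.msuppD_le; rewrite mem_cat => /orP[]; [exact: PD|exact: QD].
by move=> x; rewrite /peval mpoly.mevalD fP gQ.
Qed.

Lemma PolM D D' f g : Pol D f -> Pol D' g -> Pol (D + D') (fun x => f x * g x).
Proof.
move=> [P [/pdeg_leP PD fP]] [Q [/pdeg_leP QD gQ]]; exists (P * Q); split.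
  apply/pdeg_leP => m /mpoly.msuppM_le /allpairsP[[m1 m2] /= [m1P m2Q ->]].
  by rewrite mpoly.mdegD leq_add ?PD ?QD.
by move=> x; rewrite /peval mpoly.mevalM fP gQ.
Qed.

Lemma PolZ D (c : R) f : Pol D f -> Pol D (fun x => c * f x).
Proof. by move=> fD; rewrite -[D]add0n; exact: PolM (Pol_cst 0 c) fD. Qed.

Lemma Pol_sum D (I : Type) (r : seq I) (F : I -> V -> R) (p : pred I) :
  (forall i, p i -> Pol D (F i)) -> Pol D (fun x => \sum_(i <- r | p i) F i x).
Proof.
move=> H; elim: r => [|i r IH].
  by apply: Pol_ext (Pol_cst D 0) _ => x; rewrite big_nil.
case: (boolP (p i)) => pi.
  by apply: Pol_ext (PolD (H i pi) IH) _ => x; rewrite big_cons pi.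
by apply: Pol_ext IH _ => x; rewrite big_cons (negbTE pi).
Qed.

Lemma Pol_coord i : Pol 1 (fun x => x ord0 i).
Proof.
exists (mpoly.mpolyX R (mpoly.mnm1 i)); split; last by move=> x; rewrite /peval mpoly.mevalXU.
by apply/pdeg_leP => m; rewrite mpoly.msuppX inE => /eqP ->; rewrite mpoly.mdeg1.
Qed.

Lemma PolX D k f : Pol D f -> Pol (k * D) (fun x => f x ^+ k).
Proof.
move=> fD; elim: k => [|k IH]; first by apply: Pol_ext (Pol_cst _ 1) _ => x; rewrite expr0.
by apply: Pol_ext (PolM fD IH) _ => x; rewrite exprS.
Qed.

Lemma Pol_dotv y : Pol 1 (fun x => dotv x y).
Proof.
by apply: Pol_sum => i _; apply: Pol_ext (PolZ (y ord0 i) (Pol_coord i)) _ => x; rewrite mulrC.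
Qed.

Lemma Pol_nsq : Pol 2 (fun x => nsq x).
Proof. by apply: Pol_sum => i _; apply: Pol_ext (PolX 2 (Pol_coord i)) _ => x. Qed.

(** Greedy Lagrange interpolation. A function not reproduced by the current nodes has a point where
    its residual is nonzero; this point becomes a node and the dual functions are corrected there,
    remaining in the linear class [S]. *)
Lemma interpolation (T : eqType) (X : Type) (F : T -> X -> R) (S : (X -> R) -> Prop) (x0 : X) :
  S (fun=> 0) -> (forall t, S (F t)) ->
  (forall f g : X -> R, S f -> S g -> forall a, S (fun x : X => f x + a * g x)) ->
  forall s : seq T, exists K (p : nat -> X) (L : nat -> X -> R), (forall i, S (L i)) /\
    forall t, t \in s -> forall x : X, F t x = \sum_(i < K) F t (p i) * L i x.
Proof.
move=> S0 SF SD; elim=> [|t s [K [p [L [LS H]]]]]; first by exists 0%N, (fun=> x0), (fun _ _ => 0).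
pose g (x : X) := F t x - \sum_(i < K) F t (p i) * L i x.
have SL m (c : nat -> R) : S (fun x : X => \sum_(i < m) c i * L i x).
  elim: m => [|m IH]; first by under eq_fun do rewrite big_ord0.
  by under eq_fun do rewrite big_ord_recr/=; exact: SD.
have Sg : S g.
  have -> : g = (fun x : X => F t x + -1 * \sum_(i < K) F t (p i) * L i x).
    by apply/funext => x; rewrite mulN1r.
  exact: SD (SF t) (SL K (fun i => F t (p i))) _.
have [[y gy]|g0] := pselect (exists y : X, g y != 0); last first.
  exists K, p, L; split => // t'; rewrite inE => /predU1P[->|/H//] x.
  by apply/eqP; rewrite -subr_eq0; apply: contrapT => gx; apply: g0; exists x; exact/negP.
pose L0 (x : X) := g x / g y.
pose p' i := if i == K then y else p i.
pose L' i (x : X) := if i == K then L0 x else L i x - L i y * L0 x.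
have E (phi : X -> R) (x : X) : \sum_(i < K.+1) phi (p' i) * L' i x =
    \sum_(i < K) phi (p i) * L i x + (phi y - \sum_(i < K) phi (p i) * L i y) * L0 x.
  rewrite big_ord_recr/= /p' /L' eqxx mulrBl [in RHS]addrCA addrC; congr (_ + _).
  rewrite mulr_suml -sumrN -big_split; apply: eq_bigr => i _ /=.
  by rewrite (ltn_eqF (ltn_ord i)) mulrBr mulrA.
exists K.+1, p', L'; split.
  move=> i; rewrite /L'; case: (i == K).
    have -> : L0 = (fun x : X => 0 + (g y)^-1 * g x) by apply/funext => x; rewrite add0r mulrC.
    exact: SD.
  have -> : (fun x : X => L i x - L i y * L0 x) = (fun x : X => L i x + (- (L i y / g y)) * g x).
    by apply/funext => x; rewrite /L0 mulNr mulrAC mulrA.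
  exact: SD.
move=> t'; rewrite inE => /predU1P[->|t's] x; rewrite E; last first.
  by rewrite -(H _ t's) -(H _ t's y) subrr mul0r addr0.
by rewrite -/(g y) mulrCA divff// mulr1 /g addrC subrK.
Qed.

(** Monomials of degree at most [D] form a finite family, to which [interpolation] applies. A
    polynomial thus depends linearly on finitely many of its values, which is why pointwise limits
    and parameter integrals are again polynomials. *)
Lemma Pol_interp D : exists K (p : nat -> V) (L : nat -> V -> R), (forall i, Pol D (L i)) /\
  forall f, Pol D f -> forall x, f x = \sum_(i < K) f (p i) * L i x.
Proof.
pose F (m : mpoly.bmultinom n D.+1) (x : V) := peval (mpoly.mpolyX R (mpoly.bmnm m)) x.
have [|m|f g fD gD a|K [p [L [LD H]]]] :=
    @interpolation _ V F (Pol D) 0 _ _ _ (enum {: mpoly.bmultinom n D.+1}).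
- exact: Pol_cst.
- exists (mpoly.mpolyX R (mpoly.bmnm m)); split => //; apply/pdeg_leP => m'.
  by rewrite mpoly.msuppX inE => /eqP ->; rewrite -ltnS; exact: mpoly.bmdeg.
- by apply: PolD => //; exact: PolZ.
exists K, p, L; split => // f [P [/pdeg_leP PD fP]] x.
have E y : f y = \sum_(m <- mpoly.msupp P) mpoly.mcoeff m P * peval (mpoly.mpolyX R m) y.
  rewrite fP /peval mpoly.mevalE; apply: eq_bigr => m _; by rewrite mpoly.mevalX.
under eq_bigr do rewrite E mulr_suml.
rewrite E exchange_big/= !big_seq; apply: eq_bigr => m mP.
have mD : (mpoly.mdeg m < D.+1)%N by rewrite ltnS PD.
have := H (mpoly.BMultinom mD); rewrite mem_enum => /(_ isT x).
rewrite /F /= => ->; rewrite mulr_sumr; apply: eq_bigr => i _; exact: mulrA.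
Qed.

Lemma Pol_lim D (f_ : nat -> V -> R) f : (forall k, Pol D (f_ k)) ->
  (forall x, (fun k => f_ k x) @ \oo --> f x) -> Pol D f.
Proof.
move=> fD fc; have [K [p [L [LD H]]]] := Pol_interp D.
have LP : Pol D (fun x => \sum_(i < K) f (p i) * L i x) by apply: Pol_sum => i _; exact: PolZ.
apply: (Pol_ext LP) => x.
have C : (fun k => \sum_(i < K) f_ k (p i) * L i x) @ \oo --> \sum_(i < K) f (p i) * L i x.
  apply: (cvg_seq_sum (F := fun (i : 'I_K) k => f_ k (p i) * L i x)) => i.
  apply: cvgM; [exact: fc|exact: cvg_cst].
rewrite -(cvg_lim (@Rhausdorff R) (fc x)) -(cvg_lim (@Rhausdorff R) C); congr (lim (_ @ \oo)).
by apply/funext => k; rewrite -(H _ (fD k)).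
Qed.

Lemma Pol_Rint D (F : V -> V -> R) : (forall y, Pol D (F^~ y)) -> (forall x, ig volm (F x)) ->
  Pol D (fun x => \int[volm]_y F x y).
Proof.
move=> FD Fi; have [K [p [L [LD H]]]] := Pol_interp D.
have LP : Pol D (fun x => \sum_(i < K) (\int[volm]_y F (p i) y) * L i x).
  by apply: Pol_sum => i _; exact: PolZ.
apply: (Pol_ext LP) => x; under eq_Rint do rewrite (H _ (FD _)).
rewrite Rint_sum => [|i]; last exact: igZr.
by apply: eq_bigr => i _; rewrite RintZr.
Qed.

End polynomial_functions.

(** * Liouville theorem for polyharmonic functions *)

Section liouville.
Context {R : realType} {n : nat}.
Notation V := 'rV[R]_n.
Implicit Types (f g : V -> R) (x y z : V) (h : nat -> V -> R).

Lemma cont_sum_cond (I : Type) (s : seq I) (p : pred I) (F : I -> V -> R) :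
  (forall i, continuous (F i)) -> continuous (fun x => \sum_(i <- s | p i) F i x).
Proof.
move=> Fc; under eq_fun do rewrite big_mkcond.
by apply: cont_sum => i; case: (p i) => //; exact: cont_cst.
Qed.

Lemma contX f k : continuous f -> continuous (fun x => f x ^+ k).
Proof. by move=> fc; apply: (@cont_comp _ _ (fun t : R => t ^+ k)) => //; exact: exprn_continuous. Qed.

(* The Taylor polynomial at [x = 0], of total degree below [d] in [x], of the
   kernel [kb N r (x - y)]. *)
Definition kbT (N d : nat) (r : R) x y : R := r^-1 ^+ n *
  \sum_(i < d) \sum_(l < i.+1 | (i + l < d)%N)
    'C(N, i)%:R * tp (N - i) (1 - nsq y / r ^+ 2) *
     ('C(i, l)%:R * ((2 / r ^+ 2 * dotv x y) ^+ (i - l) * (- r ^- 2 * nsq x) ^+ l)).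

Lemma Pol_kbT N d r y : Pol d (fun x => kbT N d.+1 r x y).
Proof.
apply: PolZ; apply: Pol_sum => i _; apply: Pol_sum => l il; apply: PolZ; apply: PolZ.
apply: (@Pol_le _ _ ((i - l) * 1 + l * 2)); first by have := ltn_ord l; lia.
by apply: PolM; apply: PolX; apply: PolZ; [exact: Pol_dotv|exact: Pol_nsq].
Qed.

Lemma continuous_kbT N d r x : continuous (kbT N d r x).
Proof.
apply: contM; first exact: cont_cst.
apply: cont_sum => i; apply: cont_sum_cond => l; apply: contM.
  apply: contM; first exact: cont_cst.
  apply: (@cont_comp _ _ (tp (N - i))); last exact: continuous_tp.
  by apply: contB; [exact: cont_cst|apply: contM; [exact: continuous_nsq|exact: cont_cst]].
apply: contM; first exact: cont_cst.
apply: contM; last exact: cont_cst.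
by apply: contX; apply: contM; [exact: cont_cst|apply: cont_sum => j; apply: contM; [exact: cont_cst|exact: continuous_coord]].
Qed.

Lemma csupp_kbT N d r x : 0 < r -> (d <= N)%N -> csupp r (kbT N d r x).
Proof.
move=> r0 dN y yr; rewrite /kbT big1 ?mulr0// => i _; rewrite big1// => l _.
have -> : (N - i = (N - i.+1).+1)%N by have := ltn_ord i; lia.
rewrite tp_neg ?mulr0 ?mul0r// subr_le0 ler_pdivlMr ?exprn_gt0// mul1r -sqr_enorm.
by rewrite lerXn2r ?nnegrE ?enorm_ge0 ?ltW.
Qed.

Lemma kbT_le N d r x y : 0 < r -> 8 * enorm x <= r -> (0 < d <= N)%N ->
  `|kb N r (x - y) - kbT N d r x y| <=
    r^-1 ^+ n * (2 * 2 ^+ N * 2 ^+ d * (4 * enorm x / r) ^+ d) * inb (2 * r) y.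
Proof.
move=> r0 xr /andP[d0 dN]; have x0 := enorm_ge0 x; have y0 := enorm_ge0 y.
have [yr|yr] := leP (enorm y) (2 * r); last first.
  rewrite inb0// mulr0 (csupp_kbT _ r0 dN); last by apply: lt_trans yr; lra.
  case: (N) dN => [|M] dN; first by move: d0 dN; case: (d).
  rewrite kb_csupp ?subrr ?normr0// -enormN opprB; apply: lt_le_trans (enormB_ge _ _); lra.
have rn : 0 <= r^-1 ^+ n by rewrite exprn_ge0// invr_ge0 ltW.
rewrite inb1// mulr1 /kb /kbT -mulrBr normrM (ger0_norm rn).
rewrite ler_wpM2l ?exprn_ge0 ?invr_ge0 ?(ltW r0)//.
have r2 : 0 < r ^+ 2 by rewrite exprn_gt0.
(* The small quantity is [q = 4 |x| / r <= 1 / 2]. Since [|y| <= 2 r], the part [A], linear in [x],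
   is at most [q], and the quadratic part [B] is at most [q^2]. *)
set a := 1 - nsq y / r ^+ 2; set A := 2 / r ^+ 2 * dotv x y; set B := - r ^- 2 * nsq x.
have -> : 1 - nsq (x - y) / r ^+ 2 = a + (A + B) by rewrite nsqB /a /A /B; ring.
apply: tp_taylor2 => //.
- by rewrite /a gerBl divr_ge0 ?nsq_ge0// ltW.
- by rewrite ler_pdivrMr//; lra.
- rewrite /A normrM ger0_norm ?divr_ge0 ?(ltW r2)//.
  apply: (@le_trans _ _ (2 / r ^+ 2 * (enorm x * (2 * r)))).
    rewrite ler_wpM2l ?divr_ge0 ?(ltW r2)//; apply: le_trans (dotv_le _ _) _.
    by rewrite ler_wpM2l.
  rewrite le_eqVlt; apply/orP; left; apply/eqP; field; exact: lt0r_neq0.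
- have r2' : 0 <= r ^- 2 by rewrite invr_ge0 ltW.
  rewrite /B mulNr normrN ger0_norm ?mulr_ge0 ?nsq_ge0//.
  rewrite -sqr_enorm mulrC -expr_div_n lerXn2r ?nnegrE ?divr_ge0 ?mulr_ge0 ?(ltW r0)//.
  by rewrite ler_wpM2r ?invr_ge0 ?(ltW r0)//; lra.
Qed.

(** Replacing the kernel by its Taylor polynomial costs [r^-(n + d)] times the mass of [|f|] on the
    ball of radius [2 r], hence [O(r^(p - n - d))] with [p < n + d]. *)
Lemma avgk_kbT N d f x (p : nat) (C : R) : (0 < d <= N)%N -> loc_ig f ->
  (p < n + d)%N ->
  (forall r : R, 1 <= r -> \int[volm]_y (inb r y * `|f y|) <= C * r ^+ p) ->
  exists K : R, forall r, 1 <= r -> 8 * enorm x <= r ->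
    `|avgk N f x r - \int[volm]_y (f y * kbT N d r x y)| <= K / r.
Proof.
move=> /andP[d0 dN] fi pd fC.
have C0 : 0 <= C.
  by have := fC 1 (lexx 1); rewrite expr1n mulr1; apply: le_trans; apply: Rint_ge0 => y; rewrite mulr_ge0 ?inb_ge0.
have x0 := enorm_ge0 x.
pose E : R := 2 * 2 ^+ N * 2 ^+ d * (4 * enorm x) ^+ d.
have E0 : 0 <= E by rewrite !mulr_ge0 ?exprn_ge0// mulr_ge0.
exists (E * (C * 2 ^+ p)) => r r1 xr; have r0 : 0 < r by lra.
have i1 : ig volm (fun y => f y * kb N r (x - y)).
  by case: (N) dN d0 => [|M] dN d0; [move: d0 dN; case: (d)|exact: ig_avgk].
have i2 : ig volm (fun y => f y * kbT N d r x y).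
  by apply: (loc_ig_mulc fi); [exact: continuous_kbT|exact: csupp_kbT].
rewrite /avgk -RintB//.
have [_ fa] := loc_ig_abs fi; have rn0 : r != 0 by exact: lt0r_neq0.
apply: (@le_trans _ _ (\int[volm]_y (r^-1 ^+ (n + d) * E * (inb (2 * r) y * `|f y|)))).
  apply: Rint_norm_le; [exact: ig_measurable (igB i1 i2)|exact: igZl|move=> y].
  rewrite -mulrBr normrM mulrC; have H := kbT_le y r0 xr (introT andP (conj d0 dN)).
  apply: le_trans (ler_wpM2r (normr_ge0 _) H) _.
  rewrite le_eqVlt; apply/orP; left; apply/eqP; rewrite expr_div_n exprD !exprVn /E; ring.
rewrite RintZl//; apply: (@le_trans _ _ (r^-1 ^+ (n + d) * E * (C * (2 * r) ^+ p))).
  have P0 : 0 <= r^-1 ^+ (n + d) * E by rewrite mulr_ge0// exprn_ge0// invr_ge0 ltW.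
  by apply: (ler_wpM2l P0); apply: fC; lra.
rewrite exprMn; clearbody E.
have : r^-1 ^+ (n + d) * r ^+ p <= r^-1.
  have -> : (n + d = p + (n + d - p.+1).+1)%N by lia.
  rewrite exprD mulrAC -exprMn mulVf// expr1n mul1r exprS ler_piMr ?invr_ge0 ?(ltW r0)//.
  by rewrite exprn_ile1 ?invr_ge0 ?invf_le1 ?(ltW r0).
move=> H; rewrite [leLHS](_ : _ = E * (C * 2 ^+ p) * (r^-1 ^+ (n + d) * r ^+ p)); last by ring.
by apply: ler_wpM2l => //; rewrite !mulr_ge0 ?exprn_ge0.
Qed.

(** Averages at the radii [(j + 1) (k + 1)] reproduce [h 0]. Replacing their kernels by Taylor
    polynomials of degree [2 (m - 1)] gives polynomials [J k], and the error tends to 0 because the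
    growth exponent [n + 2 (m - 1)] is one short of [n + d]. *)
Lemma liouville m N h (C : R) : (4 < N)%N -> (0 < m)%N -> (2 * m.-1 < N)%N ->
  continuous (h 0%N) ->
  (forall j, (j < m)%N -> loc_ig (h j)) ->
  (forall j, (j < m)%N -> wlap (h j) (h j.+1)) ->
  (forall y, h m y = 0) ->
  (forall r : R, 1 <= r -> \int[volm]_y (inb r y * `|h 0%N y|) <= C * r ^+ (n + 2 * m.-1)) ->
  Pol (2 * m.-1) (h 0%N).
Proof.
move=> N4 m0 mN hc hi hw h0 hC.
have [lam Hlam] := reproducing N4 m0 hc hi hw h0.
have k0 : kmass (n := n) N != 0 :> R by rewrite -(prednK (leq_trans _ N4))//; apply: lt0r_neq0; exact: kmass_gt0.
pose d := (2 * m.-1).+1.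
pose J k x := (kmass (R := R) (n := n) N)^-1 *
  \sum_(j < m) lam j * \int[volm]_y (h 0%N y * kbT N d (j.+1%:R * k.+1%:R) x y).
have PJ k : Pol (2 * m.-1) (J k).
  apply: PolZ; apply: Pol_sum => j _; apply: PolZ; apply: Pol_Rint => [y|x].
    by apply: PolZ; exact: Pol_kbT.
  apply: (loc_ig_mulc (hi 0%N m0)); first exact: continuous_kbT.
  by apply: csupp_kbT => //; rewrite mulr_gt0.
apply: (Pol_lim PJ) => x.
have dN : (0 < d <= N)%N by [].
have [|K HK] := avgk_kbT x dN (hi 0%N m0) _ hC; first by rewrite /d addnS.
pose D (r : R) := avgk N (h 0%N) x r - \int[volm]_y (h 0%N y * kbT N d r x y).
have C0 (j : 'I_m) : (fun k : nat => lam j * D (j.+1%:R * k.+1%:R)) @ \oo --> (lam j * 0 : R).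
  apply: cvgM; first exact: cvg_cst.
  apply/cvgrPdist_le => e e0.
  have : (fun k => `|K| * @harmonic R k) @ \oo --> (`|K| * 0 : R).
    by apply: cvgM; [exact: cvg_cst|exact: cvg_harmonic].
  rewrite mulr0 => /cvgrPdist_le/(_ e e0) He.
  near=> k; rewrite sub0r normrN.
  have k1 : k.+1%:R <= j.+1%:R * k.+1%:R :> R by rewrite ler_peMl// ler1n.
  have k2 : 1 <= k.+1%:R :> R by rewrite ler1n.
  have k3 : 8 * enorm x <= k.+1%:R.
    near: k; exists (Num.truncn (8 * enorm x)).+1 => // k /= kk.
    apply: ltW; apply: lt_le_trans (truncnS_gt _) _.
    by rewrite ler_nat leqW.
  apply: le_trans (HK _ (le_trans k2 k1) (le_trans k3 k1)) _.
  have : `|0 - `|K| * harmonic k| <= e by near: k.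
  rewrite sub0r normrN ger0_norm ?mulr_ge0 ?harmonic_ge0//; apply: le_trans.
  apply: (@le_trans _ _ (`|K| / (j.+1%:R * k.+1%:R))).
    by rewrite ler_wpM2r ?ler_norm// invr_ge0 mulr_ge0.
  rewrite ler_wpM2l// lef_pV2 ?posrE// (lt_le_trans _ k1)//.
have CS := cvg_seq_sum (s := index_enum 'I_m) C0.
have -> : h 0%N x = (kmass (R := R) (n := n) N)^-1 * (h 0%N x * kmass (n := n) N - \sum_(j < m) lam j * 0).
  by rewrite big1 => [|j _]; [rewrite subr0 mulrCA mulVf ?mulr1|exact: mulr0].
apply: cvgM; first exact: cvg_cst.
have -> : (fun k : nat => \sum_(j < m) lam j * \int[volm]_y (h 0%N y * kbT N d (j.+1%:R * k.+1%:R) x y)) =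
    (fun k : nat => h 0%N x * kmass (n := n) N - \sum_(j < m) lam j * D (j.+1%:R * k.+1%:R)).
  apply/funext => k; rewrite (Hlam x k.+1%:R)// -sumrB; apply: eq_bigr => j _.
  by rewrite -mulrBr /D subKr.
by apply: cvgB; [exact: cvg_cst|exact: CS].
Unshelve. all: by end_near. Qed.

(** The averages of [h 0] are a polynomial in [r] of degree at most [2 (m - 1)], so a bound on the
    mass of [|h| - h] also bounds the averages of [|h|]. *)
Lemma growth_of_negative_part m N h (C : R) : (4 < N)%N -> (0 < m)%N ->
  (forall j, (j < m)%N -> loc_ig (h j)) ->
  (forall j, (j < m)%N -> wlap (h j) (h j.+1)) ->
  (forall y, h m y = 0) ->
  (forall r : R, 1 <= r -> \int[volm]_y (inb r y * (`|h 0%N y| - h 0%N y)) <= C * r ^+ (n + 2 * m.-1)) ->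
  exists C' : R, forall r : R, 1 <= r ->
    \int[volm]_y (inb r y * `|h 0%N y|) <= C' * r ^+ (n + 2 * m.-1).
Proof.
move=> N4 m0 hi hw h0 hC.
have [a Ha] := avgk_poly (0 : V) N4 hi hw h0.
have [mh h0i] := hi 0%N m0; have [mha hai] := loc_ig_abs (hi 0%N m0).
pose A := \sum_(i < m) `|a i| * 2 ^+ (2 * i).
pose E : R := C * 2 ^+ (n + 2 * m.-1).
(* On the ball of radius [r] the kernel of radius [2 r] is at least [(2 r)^-n (3 / 4)^N], whence the
   factors [(4 / 3)^N] and [2^n]. *)
exists ((4 / 3) ^+ N * 2 ^+ n * (A + 2^-1 ^+ n * E)) => r r1.
have r0 : 0 < r by lra.
have rn0 : r != 0 by exact: lt0r_neq0.
have kb0 y : 0 <= kb N (2 * r) (0 - y) by apply: kb_ge0; rewrite mulr_gt0.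
have [M NM] : exists M, N = M.+1 by exists N.-1; rewrite prednK// (leq_trans _ N4).
have r20 : 0 < 2 * r by rewrite mulr_gt0.
have i1 : ig volm (fun y => h 0%N y * kb N (2 * r) (0 - y)) by rewrite NM; apply: ig_avgk => //; exact: hi.
have i2 : ig volm (fun y => `|h 0%N y| * kb N (2 * r) (0 - y)).
  by rewrite NM; apply: ig_avgk => //; exact: loc_ig_abs (hi _ m0).
have i3 : ig volm (fun y => inb (2 * r) y * (`|h 0%N y| - h 0%N y)).
  by apply: ig_ext (igB (hai _) (h0i _)) => y; rewrite mulrBr.
pose B := (4 / 3) ^+ N * (2 * r) ^+ n.
have B0 : 0 <= B by rewrite mulr_ge0 ?exprn_ge0 ?divr_ge0 ?ltW.
apply: (@le_trans _ _ (\int[volm]_y (B * (`|h 0%N y| * kb N (2 * r) (0 - y))))).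
  apply: Rint_le; [exact: hai|exact: igZl|move=> y].
  have [yr|yr] := leP (enorm y) r; last by rewrite inb0// mul0r; apply: mulr_ge0 => //; apply: mulr_ge0.
  rewrite inb1// mul1r mulrCA ler_peMr// /B /kb sub0r nsqN.
  rewrite [leRHS](_ : _ = ((2 * r) * (2 * r)^-1) ^+ n * ((4 / 3) ^+ N * tp N (1 - nsq y / (2 * r) ^+ 2))); last first.
    set X := (2 * r)^-1; set T := tp _ _; set F := 4 / 3.
    rewrite [in RHS]exprMn; ring.
  rewrite divff ?expr1n ?mul1r ?gt_eqF//.
  apply: (@le_trans _ _ ((4 / 3) ^+ N * (3 / 4) ^+ N)).
    by rewrite -exprMn (_ : 4 / 3 * (3 / 4) = 1 :> R) ?expr1n//; field.
  apply: ler_wpM2l; first by rewrite exprn_ge0// divr_ge0.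
  rewrite /tp lerXn2r ?nnegrE ?divr_ge0 ?le_max ?lexx ?orbT//.
  apply/orP; left; rewrite lerBrDr addrC -lerBrDr ler_pdivrMr ?exprn_gt0//.
  rewrite -sqr_enorm; have : enorm y ^+ 2 <= r ^+ 2 by rewrite lerXn2r ?nnegrE ?enorm_ge0 ?(ltW r0).
  rewrite exprMn; lra.
rewrite RintZl//.
have : \int[volm]_y (`|h 0%N y| * kb N (2 * r) (0 - y)) <=
   avgk N (h 0%N) 0 (2 * r) + (2 * r)^-1 ^+ n * \int[volm]_y (inb (2 * r) y * (`|h 0%N y| - h 0%N y)).
  rewrite -RintZl// /avgk -RintD//; last exact: igZl.
  apply: Rint_le => //; first by apply: igD => //; exact: igZl.
  move=> y; rewrite -lerBlDl -mulrBl.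
  have n0 : 0 <= `|h 0%N y| - h 0%N y by rewrite subr_ge0 ler_norm.
  have [yr|yr] := leP (enorm y) (2 * r).
    by rewrite inb1// mul1r mulrC ler_wpM2r// kb_le.
  by rewrite inb0// mul0r mulr0 NM (kb_csupp M r20) ?mulr0// sub0r enormN.
move=> H; apply: le_trans (ler_wpM2l B0 (le_trans H (lerD (_ : _ <= A * r ^+ (2 * m.-1)) (_ : _ <= 2^-1 ^+ n * E * r ^+ (2 * m.-1))))) _.
- rewrite Ha// /A mulr_suml; apply: ler_sum => i _.
  rewrite exprMn mulrA; apply: (@le_trans _ _ (`|a i| * 2 ^+ (2 * i) * r ^+ (2 * i))).
    by rewrite !ler_wpM2r ?exprn_ge0 ?(ltW r0)// ler_norm.
  rewrite ler_wpM2l ?mulr_ge0 ?exprn_ge0// ler_weXn2l//; have := ltn_ord i; lia.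
- apply: (@le_trans _ _ ((2 * r)^-1 ^+ n * (C * (2 * r) ^+ (n + 2 * m.-1)))).
    rewrite ler_wpM2l ?exprn_ge0 ?invr_ge0 ?(ltW r20)//; apply: hC; lra.
  rewrite /E invfM !exprMn [r ^+ (n + _)]exprD.
  rewrite [leLHS](_ : _ = (r^-1 * r) ^+ n * (2^-1 ^+ n * (C * 2 ^+ (n + 2 * m.-1)) * r ^+ (2 * m.-1))); last by rewrite exprMn; ring.
  by rewrite mulVf// expr1n mul1r.
- rewrite -mulrDl /B [(2 * r) ^+ n]exprMn [r ^+ (n + _)]exprD; clearbody A E; set F := (4 / 3) ^+ N; set G := 2^-1 ^+ n.
  by rewrite le_eqVlt; apply/orP; left; apply/eqP; ring.
Qed.

End liouville.

(** * Regularised powers and logarithm of [|z|^2] *)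

Section shifted_powers.
Context {R : realType} {n : nat}.
Notation V := 'rV[R]_n.
Implicit Types (f g : V -> R) (x y z : V) (e p t : R).

Definition rp e p t : R := (t + e) `^ p.

Lemma rp_gt0 e p t : 0 < e -> 0 <= t -> 0 < rp e p t.
Proof. by move=> e0 t0; rewrite powR_gt0// ltr_wpDl. Qed.

Lemma rpM e p q t : 0 < e -> 0 <= t -> rp e p t * rp e q t = rp e (p + q) t.
Proof. by move=> e0 t0; rewrite /rp powRD//; apply/implyP => _; rewrite gt_eqF// ltr_wpDl. Qed.

Lemma rp_nat e k t : 0 <= t + e -> rp e (- k%:R) t = (t + e)^-1 ^+ k.
Proof. by move=> t0; rewrite /rp powRN powR_mulrn// exprVn. Qed.

Lemma rp1 e t : 0 <= t + e -> rp e 1 t = t + e.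
Proof. exact: powRr1. Qed.

Lemma is_derive_rp e p t : 0 < t + e -> is_derive t 1 (rp e p) (p * rp e (p - 1) t).
Proof.
move=> t0; have D1 : is_derive t 1 (fun t : R => t + e) 1.
  have := is_deriveD (is_derive_id t (1 : R)) (is_derive_cst (e : R) t (1 : R)).
  by apply: is_derive_ext => //; rewrite addr0.
have := is_derive1_chain D1 (is_derive1_powR p t0).
by apply: is_derive_ext => //; rewrite mulr1.
Qed.

Lemma continuous_rp e p t : 0 < t + e -> {for t, continuous (rp e p)}.
Proof. by move=> t0; apply: differentiable_continuous; apply/derivable1_diffP; case: (is_derive_rp p t0). Qed.

(* The [j]-th derivative of [rp e p]. *)
Definition rpd e p (j : nat) t : R := (\prod_(i < j) (p - i%:R)) * rp e (p - j%:R) t.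

Lemma is_derive_rpd e p j t : 0 < t + e -> is_derive t 1 (rpd e p j) (rpd e p j.+1 t).
Proof.
move=> t0; have D := is_deriveM (is_derive_cst (\prod_(i < j) (p - i%:R) : R) t (1 : R)) (is_derive_rp (p - j%:R) t0).
apply: is_derive_ext D => //; rewrite /rpd big_ord_recr/= scaler0 addr0 /GRing.scale/= -mulrA.
by rewrite -[j.+1]addn1 natrD opprD addrA.
Qed.

(** [(|z|^2 + e)^p]: smooth for [e > 0], while [e = 0] gives [|z|^(2 p)], with the default value 0
    at the origin when [p] is nonzero. *)
Definition sg e p : V -> R := fun z => rp e p (nsq z).

Lemma sg_rpd e p : sg e p = (fun z => rpd e p 0 (nsq z)).
Proof. by apply/funext => z; rewrite /rpd big_ord0 mul1r subr0. Qed.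

Lemma sg_gt0 e p z : 0 < e -> 0 < sg e p z.
Proof. by move=> e0; exact: rp_gt0 e0 (nsq_ge0 z). Qed.

Lemma Ck_sg k e p : 0 < e -> Ck k (sg e p).
Proof.
move=> e0; rewrite sg_rpd; apply: Ck_radial => j t _ t0.
  have te : 0 < t + e by rewrite ltr_wpDl.
  by apply: differentiable_continuous; apply/derivable1_diffP; case: (is_derive_rpd p j te).
by apply: is_derive_rpd; rewrite ltr_wpDl.
Qed.

(** Writing [nsq z = (nsq z + e) - e] separates the Riesz power from a correction that carries the
    factor [e]. *)
Lemma lap_sg e p z : 0 < e -> lap (sg e p) z =
  p * ((4 * (p - 1) + 2 * n%:R) * sg e (p - 1) z - 4 * (p - 1) * e * sg e (p - 2) z).
Proof.
move=> e0; have D j (t : R) : (j < 2)%N -> 0 <= t -> is_derive t 1 (rpd e p j) (rpd e p j.+1 t).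
  by move=> _ t0; apply: is_derive_rpd; rewrite ltr_wpDl.
rewrite sg_rpd (lap_radial _ D).
rewrite /rpd !big_ord_recr !big_ord0/= !subr0 !mul1r /sg -/(nsq z).
have : rp e (p - 1) (nsq z) = rp e (p - 2) (nsq z) * (nsq z + e).
  rewrite -[X in _ = _ * X]rp1; last by rewrite addr_ge0 ?nsq_ge0// ltW.
  by rewrite rpM ?nsq_ge0//; congr rp; ring.
move=> ->; ring.
Qed.

Lemma lap_ln_nsq e z : 0 < e -> lap (fun z => ln (nsq z + e)) z =
  (2 * n%:R - 4) * sg e (- 1) z + 4 * e * sg e (- 2) z.
Proof.
move=> e0; pose g (j : nat) : R -> R :=
  match j with 0 => fun t => ln (t + e) | 1 => rp e (-1) | _ => fun t => - rp e (- 2) t end.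
have D j (t : R) : (j < 2)%N -> 0 <= t -> is_derive t 1 (g j) (g j.+1 t).
  move=> j2 t0; have te : 0 < t + e by rewrite ltr_wpDl.
  case: j j2 => [|[|//]] _ /=.
    have D1 : is_derive t 1 (fun t : R => t + e) 1.
      have := is_deriveD (is_derive_id t (1 : R)) (is_derive_cst (e : R) t (1 : R)).
      by apply: is_derive_ext => //; rewrite addr0.
    have := is_derive1_chain D1 (is_derive1_ln te).
    by apply: is_derive_ext => //; rewrite mulr1 (rp_nat 1) ?expr1// ltW.
  apply: is_derive_ext (is_derive_rp (-1) te) => //.
  by rewrite mulN1r; congr (- rp _ _ _); ring.
rewrite (lap_radial _ D)/= /sg.
have : rp e (-1) (nsq z) = rp e (-2) (nsq z) * (nsq z + e).
  rewrite -[X in _ = _ * X]rp1; last by rewrite addr_ge0 ?nsq_ge0// ltW.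
  by rewrite rpM ?nsq_ge0//; congr rp; ring.
move=> ->; ring.
Qed.

Lemma Ck_ln_nsq k e : 0 < e -> Ck k (fun z : V => ln (nsq z + e)).
Proof.
move=> e0; pose g (j : nat) : R -> R := if j is j'.+1 then rpd e (-1) j' else fun t => ln (t + e).
have D j (t : R) : 0 <= t -> is_derive t 1 (g j) (g j.+1 t).
  move=> t0; have te : 0 < t + e by rewrite ltr_wpDl.
  case: j => [|j] /=; last exact: is_derive_rpd.
  have D1 : is_derive t 1 (fun t : R => t + e) 1.
    have := is_deriveD (is_derive_id t (1 : R)) (is_derive_cst (e : R) t (1 : R)).
    by apply: is_derive_ext => //; rewrite addr0.
  have := is_derive1_chain D1 (is_derive1_ln te).
  by apply: is_derive_ext => //; rewrite mulr1 /rpd big_ord0 mul1r subr0 (rp_nat 1) ?expr1// ltW.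
apply: (@Ck_radial _ _ k g) => j t _ t0.
by apply: differentiable_continuous; apply/derivable1_diffP; case: (D j t t0).
Qed.

End shifted_powers.

(** * Logarithmic lower bound for [u] by a maximum principle *)

Section lower_bound.
Context {R : realType} {n : nat}.
Notation V := 'rV[R]_n.
Implicit Types (f g u : V -> R) (x y z : V).

Lemma min_partial2 g x i (d : R) : Ck 2 g -> 0 < d ->
  (forall t, `|t| < d -> g x <= g (x + t *: 'e_i)) -> 0 <= partial i (partial i g) x.
Proof.
move=> gC d0 gmin; rewrite leNgt; apply/negP => neg.
have gC1 := Ck_le (leqnSn 1) gC.
have pc := Ck_cont (Ck_partial i (Ck_partial i gC)).
have e0 : 0 < - partial i (partial i g) x / 2 by rewrite divr_gt0// oppr_gt0.
have /nbhs_ballP[r r0 Hr] := (continuous_at_near _ x).2 (pc x) _ e0.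
pose t := Num.min (d / 2) (r / 4).
have t0 : 0 < t by rewrite lt_min !divr_gt0.
have neg' s : `|s| <= 3 * t -> partial i (partial i g) (x + s *: 'e_i) < 0.
  move=> st; have /= := Hr (x + s *: 'e_i); rewrite -ball_normE /=.
  rewrite opprD addrA subrr sub0r normrN.
  have H1 : `|s *: 'e_i : V| < r.
    apply: le_lt_trans (norm_le_enorm _) _; rewrite enormZ enorm_delta mulr1.
    apply: le_lt_trans st _; have : t <= r / 4 by rewrite ge_min lexx orbT.
    by lra.
  move=> /(_ H1); move: neg; move: (partial i _ x) (partial i _ (x + s *: 'e_i)) => P Q P0.
  by rewrite ler_norml => /andP[H _]; lra.
(* Symmetrised along the line: the derivative of [f] at [s] is a difference of two values of
   [partial i g], so a second mean value step brings in the second derivative. *)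
pose f (s : R) := g (x + s *: 'e_i) + g (x + s *: - 'e_i).
have fd (s : R) : is_derive s 1 f (partial i g (x + s *: 'e_i) - partial i g (x + s *: - 'e_i)).
  apply: is_deriveD; first exact: (is_derive_line g x 'e_i s _).1 (Ck_derivable i _ gC1).
  have D := (is_derive_line g x 'e_i (- s) _).1 (Ck_derivable i _ gC1).
  have D1 : is_derive s 1 (fun s : R => - s) (-1) by exact: is_deriveN.
  have := is_derive1_chain D1 D.
  by apply: is_derive_ext => [s'|]; rewrite ?mulrN1 scalerN scaleNr.
have fc : {within `[0, t], continuous f}.
  by apply: derivable_within_continuous => s _; case: (fd s).
have [s] := MVT t0 (fun s _ => fd s) fc.
rewrite in_itv/= => /andP[s0 st]; rewrite subr0 => E.
have : 0 <= f t - f 0.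
  rewrite /f subr_ge0 !scale0r addr0 scalerN -scaleNr; apply: lerD; apply: gmin.
  - rewrite gtr0_norm//; apply: le_lt_trans (_ : t <= d / 2) _; first by rewrite ge_min lexx.
    by lra.
  - rewrite normrN gtr0_norm//; apply: le_lt_trans (_ : t <= d / 2) _; first by rewrite ge_min lexx.
    by lra.
rewrite E pmulr_lge0// leNgt => /negP; apply.
have pd y : derivable (partial i g) y 'e_i by case: (Ck_derivable i y (Ck_partial i gC)).
have [s' s's] := line_MVT (x + s *: - 'e_i) (2 * s) pd.
have -> : x + s *: - 'e_i + (2 * s) *: 'e_i = x + s *: 'e_i :> V.
  by rewrite scalerN -scaleNr -addrA -scalerDl; congr (_ + _ *: _); ring.
have s2 : 0 < 2 * s by rewrite mulr_gt0.
move=> ->; rewrite (pmulr_rlt0 _ s2).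
have -> : x + s *: - 'e_i + s' *: 'e_i = x + (s' - s) *: 'e_i :> V.
  by rewrite scalerN -scaleNr -addrA -scalerDl; congr (_ + _ *: _); ring.
apply: neg'; apply: le_trans (ler_normB _ _) _.
by move: s's; rewrite (gtr0_norm s0) (gtr0_norm s2); lra.
Qed.

Lemma lapB f g x : Ck 2 f -> Ck 2 g -> lap (fun x => f x - g x) x = lap f x - lap g x.
Proof.
move=> fC gC; rewrite /lap -sumrB; apply: eq_bigr => i _.
have fC1 := Ck_le (leqnSn 1) fC; have gC1 := Ck_le (leqnSn 1) gC.
have -> : partial i (fun x => f x - g x) = (fun x => partial i f x - partial i g x).
  apply: (@partialE _ _ _ (fun i x => partial i f x - partial i g x)) => y.
  exact: is_deriveB (Ck_derivable i y fC1) (Ck_derivable i y gC1).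
apply: is_derive_near_val.
exact: is_deriveB (Ck_derivable i x (Ck_partial i fC)) (Ck_derivable i x (Ck_partial i gC)).
Qed.

Lemma Ck_expR k f : Ck k f -> Ck k (fun x => expR (f x)).
Proof.
elim: k => [|k IH] fC.
  by split => //; apply: (@cont_comp _ _ expR f (Ck_cont fC)); exact: continuous_expR.
have fC' := IH (Ck_le (leqnSn k) fC).
apply: (@Ck_intro _ _ k _ (fun i x => expR (f x) * partial i f x)).
- by apply: (@cont_comp _ _ expR f (Ck_cont fC)); exact: continuous_expR.
- by move=> i x; apply: is_derive_chain (Ck_derivable i x fC) _; exact: is_derive_expR.
- by move=> i; apply: CkM => //; exact: Ck_partial.
Qed.

Lemma lap_expR f x : Ck 2 f ->
  lap (fun x => expR (f x)) x = expR (f x) * (lap f x + \sum_i (partial i f x) ^+ 2).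
Proof.
move=> fC; have fC1 := Ck_le (leqnSn 1) fC.
rewrite /lap -big_split mulr_sumr; apply: eq_bigr => i _ /=.
have D y : is_derive y 'e_i (fun x => expR (f x)) (expR (f y) * partial i f y).
  by apply: is_derive_chain (Ck_derivable i y fC1) _; exact: is_derive_expR.
rewrite (@partialE _ _ _ (fun i x => expR (f x) * partial i f x) i D).
apply: is_derive_near_val.
have := is_deriveM (D x) (Ck_derivable i x (Ck_partial i fC)).
by apply: is_derive_ext => //; rewrite /GRing.scale/=; ring.
Qed.

Lemma lap_cst (c : R) x : lap (fun _ : V => c) x = 0.
Proof.
rewrite /lap big1// => i _; apply: is_derive_near_val.
have D0 y : is_derive y 'e_i (fun _ : V => c) 0 by exact: is_derive_cst.
by rewrite (@partialE _ _ _ (fun _ _ => 0) i D0); exact: is_derive_cst.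
Qed.

Lemma lapZ (c : R) f x : Ck 2 f -> lap (fun x => c * f x) x = c * lap f x.
Proof.
move=> fC; have fC1 := Ck_le (leqnSn 1) fC; rewrite /lap mulr_sumr; apply: eq_bigr => i _.
have D g y : is_derive y 'e_i g (partial i g y) -> is_derive y 'e_i (fun x => c * g x) (c * partial i g y).
  move=> gd; have := is_deriveZ c gd; exact.
have D' y := D f y (Ck_derivable i y fC1).
rewrite (@partialE _ _ _ (fun i x => c * partial i f x) i D').
by apply: is_derive_near_val; apply: D; exact: Ck_derivable (Ck_partial i fC).
Qed.

Lemma partialZ (c : R) f i x : Ck 1 f -> partial i (fun x => c * f x) x = c * partial i f x.
Proof.
by move=> fC; apply: is_derive_near_val; have := is_deriveZ c (Ck_derivable i x fC); exact.
Qed.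

(** The curvature bound says [lap u + a |grad u|^2 <= C1 exp (2 u)] with [a = (n - 2) / 2], hence
    [lap w <= a C1 w exp (2 u)] for [w = exp (a u)]. A small multiple of [(1 + |x|^2)^-n] is
    compared with [w] outside the unit ball: where [w] falls below it, [exp (2 u)] is so small that
    the Laplacian of [w] is less than that of the barrier, which an interior minimum of the
    difference forbids. *)
Lemma u_lower_bound u (C : R) : (3 <= n)%N -> Ck 2 u -> 0 < C -> (forall x, - C <= scal u x) ->
  exists K : R, 0 < K /\ forall x, - K * ln (enorm x + 2) <= u x.
Proof.
move=> n3 uC C0 uS; have uC1 := Ck_le (leqnSn 1) uC.
have n3R : 3 <= n%:R :> R by rewrite (ler_nat _ 3).
set nn : R := n%:R in n3R *.
pose a : R := (nn - 2) / 2; have a0 : 0 < a by rewrite /a; lra.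
pose C1 : R := C / (2 * (nn - 1)).
have C10 : 0 < C1 by rewrite divr_gt0//; lra.
have hu x : lap u x + a * \sum_i (partial i u x) ^+ 2 <= C1 * expR (2 * u x).
  have := uS x; rewrite /scal -/nn -/a expRN.
  set E := expR (2 * u x); set L := lap u x; set S := \sum_i _.
  have E0 : 0 < E := expR_gt0 _.
  have n1 : 0 < 2 * (nn - 1) by lra.
  have -> : 2 * (nn - 1) * E^-1 * (- L - a * S) = - (2 * (nn - 1) * (L + a * S) / E) by ring.
  by rewrite lerN2 ler_pdivrMr// => H; rewrite /C1 [leRHS]mulrAC ler_pdivlMr// [leLHS]mulrC.
pose w x := expR (a * u x).
have wC : Ck 2 w by apply: Ck_expR; exact: CkZ.
have lw x : lap w x <= w x * a * (C1 * expR (2 * u x)).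
  rewrite lap_expR; last exact: CkZ.
  rewrite -/(w x) -[leRHS]mulrA ler_wpM2l ?expR_ge0// lapZ//.
  rewrite (eq_bigr (fun i => a * (a * (partial i u x) ^+ 2))); last first.
    by move=> i _; rewrite partialZ// exprMn mulrA -expr2.
  by rewrite -mulr_sumr -mulrDr -mulr_sumr ler_pM2l.
have [M [M0 HM]] := bounded_on_ball 1 (Ck_cont uC).
(* Large enough for two purposes: [exp (- a L)] lies below [w] on the unit sphere because [L >= M],
   and [C1 a exp (- 2 L) < 2 n]. *)
pose L := M + ln (1 + C1 * a).
have C1a : 0 < C1 * a by rewrite mulr_gt0.
have l0 : 0 < ln (1 + C1 * a) by rewrite ln_gt0//; lra.
have L0 : 0 < L by rewrite /L; lra.
pose dl := expR (- (a * L)); have dl0 : 0 < dl := expR_gt0 _.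
have HL : C1 * a * expR (- (2 * L)) < 2 * nn.
  apply: (@lt_trans _ _ 1); last by lra.
  apply: (@le_lt_trans _ _ (C1 * a * (1 + C1 * a)^-1)); last by rewrite ltr_pdivrMr; lra.
  rewrite ler_wpM2l ?(ltW C1a)// -[X in X^-1]lnK ?posrE; last by lra.
  by rewrite -expRN ler_expR /L; lra.
(* The barrier vanishes on the sphere of radius [r] and is at most [dl] on the unit sphere, so on
   both boundaries it lies below [w]. *)
pose phi (r : R) x := dl * sg 1 (- nn) x - dl * (1 + r ^+ 2)^-1 ^+ n.
have pC r : Ck 2 (phi r) by apply: CkB; [apply: CkZ; exact: Ck_sg|exact: Ck_cst].
have main (r : R) x : 1 < r -> 1 <= nsq x -> nsq x <= r ^+ 2 -> phi r x <= w x.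
  move=> r1 x1 xr; rewrite leNgt; apply/negP => Hneg.
  pose A := [set y : V | 1 <= nsq y /\ nsq y <= r ^+ 2].
  have cA : compact A.
    apply: bounded_closed_compact.
      exists r; split; first exact: num_real.
      move=> s rs y [_ yr]; apply: le_trans (norm_le_enorm _) _; apply: le_trans (ltW rs).
      have r0 : 0 <= r by lra.
      by rewrite enormE -[leRHS](ger0_norm r0) -sqrtr_sqr ler_sqrt ?sqr_ge0.
    have c1 : closed [set y : V | 1 <= nsq y].
      by apply: (@closed_comp _ _ (@nsq R n) [set t | 1 <= t]) => [y _|]; [exact: continuous_nsq|exact: closed_ge].
    apply: (@closedI _ _ [set y : V | nsq y <= r ^+ 2] c1).
    by apply: (@closed_comp _ _ (@nsq R n) [set t | t <= r ^+ 2]) => [y _|]; [exact: continuous_nsq|exact: closed_le].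
  pose g y := w y - phi r y.
  have gC : Ck 2 g := CkB wC (pC r).
  have [|c /set_mem[cA1 cA2] Hc'] := EVT_min_rV (A := A) (f := g) _ cA (continuous_subspaceT (Ck_cont gC)).
    by exists x.
  have Hc y : A y -> g c <= g y by move=> Ay; apply: Hc'; exact: mem_set.
  have gc : g c < 0 by apply: le_lt_trans (Hc x (conj x1 xr)) _; rewrite subr_lt0.
  have s0 : 0 <= (1 + r ^+ 2)^-1 ^+ n by rewrite exprn_ge0// invr_ge0 addr_ge0// sqr_ge0.
  have ns0 := nsq_ge0 c.
  have sgE (y : V) : sg 1 (- nn) y = (nsq y + 1)^-1 ^+ n by rewrite /sg rp_nat// addr_ge0 ?nsq_ge0.
  have c1 : 1 < nsq c.
    rewrite lt_neqAle cA1 andbT; apply/eqP => c1; move: gc; rewrite subr_lt0 ltNge => /negP; apply.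
    apply: (@le_trans _ _ dl).
      rewrite /phi; apply: (@le_trans _ _ (dl * sg 1 (- nn) c)).
        by rewrite gerBl mulr_ge0 ?(ltW dl0).
      rewrite ler_piMr ?(ltW dl0)// sgE exprn_ile1// ?invr_ge0 ?invf_le1; lra.
    rewrite /w ler_expR -mulrN ler_pM2l//.
    have := HM c; rewrite enormE -c1 sqrtr1 => /(_ (lexx 1)); rewrite ler_norml => /andP[+ _].
    by rewrite /L; lra.
  have c2 : nsq c < r ^+ 2.
    rewrite lt_neqAle cA2 andbT; apply/eqP => c2; move: gc; rewrite subr_lt0 ltNge => /negP; apply.
    by rewrite /phi sgE c2 [r ^+ 2 + 1]addrC subrr expR_ge0.
  have [d d0 Hd] : exists2 d : R, 0 < d & forall i t, `|t| < d -> A (c + t *: 'e_i).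
    pose e := Num.min (nsq c - 1) (r ^+ 2 - nsq c).
    have e0 : 0 < e by rewrite lt_min !subr_gt0 c1.
    have /nbhs_ballP[d d0 Hd] := (continuous_at_near _ c).2 (@continuous_nsq R n c) _ e0.
    exists d => // i t td; have /= := Hd (c + t *: 'e_i); rewrite -ball_normE/=.
    rewrite opprD addrA subrr sub0r normrN.
    have H1 : `|t *: 'e_i : V| < d.
      by apply: le_lt_trans (norm_le_enorm _) _; rewrite enormZ enorm_delta mulr1.
    move=> /(_ H1); rewrite ler_norml => /andP[].
    have : e <= nsq c - 1 by rewrite ge_min lexx.
    have : e <= r ^+ 2 - nsq c by rewrite ge_min lexx orbT.
    by rewrite /A/=; lra.
  have : 0 <= lap g c.
    apply: sumr_ge0 => i _; apply: (min_partial2 gC d0) => t td; apply: Hc; exact: Hd.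
  have -> : lap g c = lap w c - lap (phi r) c := lapB c wC (pC r).
  rewrite subr_ge0 leNgt => /negP; apply.
  apply: le_lt_trans (lw c) _.
  have -> : lap (phi r) c = dl * lap (sg 1 (- nn)) c.
    have SC : Ck 2 (sg (n := n) 1 (- nn)) := Ck_sg 2 (- nn) ltr01.
    have E : lap (fun _ : V => dl * (1 + r ^+ 2)^-1 ^+ n) c = 0.
      exact: lap_cst.
    have := lapB c (CkZ dl SC) (@Ck_cst R n 2 (dl * (1 + r ^+ 2)^-1 ^+ n)).
    by rewrite E subr0 (lapZ dl c SC).
  rewrite lap_sg// mulr1 -/nn.
  set S := sg 1 (- nn - 1) c; have S0 : 0 < S by exact: sg_gt0.
  (* Outside the unit ball [nsq c + 1 >= 2]; this makes the Laplacian of the barrier at least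
     [2 n dl S]. *)
  have S2 : sg 1 (- nn - 2) c <= S / 2.
    rewrite (_ : S = sg 1 (- nn - 2) c * (nsq c + 1)).
      by rewrite -mulrA ler_peMr ?(ltW (sg_gt0 _ _ _))//; lra.
    rewrite -[X in _ = _ * X](@rp1 _ 1); last by rewrite addr_ge0.
    by rewrite rpM ?nsq_ge0//; congr rp; ring.
  have wphi : w c < dl * sg 1 (- nn) c.
    move: gc; rewrite /g /phi; have : 0 <= dl * (1 + r ^+ 2)^-1 ^+ n by rewrite mulr_ge0// ltW.
    by lra.
  have sgl : sg 1 (- nn) c = expR (- nn * ln (nsq c + 1)).
    by rewrite /sg /rp /powR gt_eqF//; lra.
  have l1 : 0 < ln (nsq c + 1) by rewrite ln_gt0//; lra.
  (* [w c < dl (1 + |c|^2)^-n] is an upper bound for [u c]. Since [a <= 2 n], it yields the decay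
     [exp (2 u) <= exp (- 2 L) / (1 + |c|^2)]. *)
  have ub : 2 * u c <= - (2 * L) - ln (nsq c + 1).
    move: (wphi); rewrite sgl /w /dl -expRD ltr_expR => H.
    have : a * (2 * u c) <= a * (- (2 * L) - ln (nsq c + 1)).
      have : a * ln (nsq c + 1) <= 2 * nn * ln (nsq c + 1) by rewrite ler_pM2r// /a; lra.
      by move: H; rewrite !mulrDr; lra.
    by rewrite ler_pM2l.
  have E2 : expR (2 * u c) <= expR (- (2 * L)) * sg 1 (-1) c.
    have -> : sg 1 (-1) c = expR (- ln (nsq c + 1)).
      by rewrite /sg /rp /powR gt_eqF ?mulN1r//; lra.
    by rewrite -expRD ler_expR.
  apply: (@le_lt_trans _ _ (dl * S * (C1 * a * expR (- (2 * L))))).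
    have -> : S = sg 1 (- nn) c * sg 1 (-1) c by rewrite /S /sg rpM// nsq_ge0.
    rewrite (_ : w c * a * _ = C1 * a * (w c * expR (2 * u c))); last by ring.
    rewrite [leRHS](_ : _ = C1 * a * (dl * sg 1 (- nn) c * (expR (- (2 * L)) * sg 1 (-1) c))); last by ring.
    by rewrite ler_pM2l// ler_pM ?expR_ge0// ltW.
  apply: (@lt_le_trans _ _ (dl * S * (2 * nn))); first by rewrite ltr_pM2l// mulr_gt0.
  rewrite -mulrA ler_pM2l//.
  have : 4 * nn * (nn + 1) * sg 1 (- nn - 2) c <= 4 * nn * (nn + 1) * (S / 2).
    by rewrite ler_wpM2l// !mulr_ge0//; lra.
  by move: S0 => _; nra.
(* Letting [r] grow removes the constant subtracted in the barrier. *)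
have main2 x : 1 <= nsq x -> dl * sg 1 (- nn) x <= w x.
  move=> x1; apply/ler_addgt0Pl => e e0.
  pose r := 1 + nsq x + dl / e.
  have de : 0 < dl / e by rewrite divr_gt0.
  have r1 : 1 < r by rewrite /r; lra.
  have := main r x r1 x1; rewrite /phi => /(_ _)/= H.
  have {H}: dl * sg 1 (- nn) x - dl * (1 + r ^+ 2)^-1 ^+ n <= w x.
    apply: H; apply: (@le_trans _ _ r); first by rewrite /r; lra.
    by rewrite expr2 ler_peMr; lra.
  have : dl * (1 + r ^+ 2)^-1 ^+ n <= e.
    have r2 : 0 <= r ^+ 2 by exact: sqr_ge0.
    apply: (@le_trans _ _ (dl * r^-1)).
      rewrite ler_pM2l// (le_trans (_ : _ <= (1 + r ^+ 2)^-1))//.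
        rewrite -(prednK (leq_trans (isT : (0 < 3)%N) n3)) exprS ler_piMr ?invr_ge0 ?exprn_ile1 ?invr_ge0 ?invf_le1; lra.
      by rewrite lef_pV2 ?posrE; [rewrite expr2; nra|lra|lra].
    rewrite ler_pdivrMr; last by lra.
    rewrite -ler_pdivrMl// mulrC /r; lra.
  lra.
have l2 : 0 < ln 2 :> R by rewrite ln_gt0// ltr1n.
(* [L / ln 2] absorbs the constant [L], as [ln (|x| + 2) >= ln 2]. The other summand exceeds the
   [2 (n / a)] that comes from [ln (|x|^2 + 1) <= 2 ln (|x| + 2)]. *)
exists (L / ln 2 + 4 * (nn / a)); split.
  by rewrite addr_gt0// ?divr_gt0// mulr_gt0// divr_gt0//; lra.
move=> x; have x0 := enorm_ge0 x.
have lx : ln 2 <= ln (enorm x + 2) by rewrite ler_ln ?posrE; lra.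
have B1 : L <= L / ln 2 * ln (enorm x + 2).
  by rewrite -mulrA ler_peMr ?(ltW L0)// mulrC ler_pdivlMr ?mul1r.
have na : 0 < nn / a by rewrite divr_gt0//; lra.
have [x1|x1] := leP 1 (nsq x); last first.
  have : `|u x| <= M by apply: HM; rewrite enormE -[leRHS]sqrtr1 ler_sqrt// ltW.
  rewrite ler_norml => /andP[Mu _].
  have ML : M <= L by rewrite /L; lra.
  have : 0 <= 4 * (nn / a) * ln (enorm x + 2) by apply: mulr_ge0; [apply: mulr_ge0|]; lra.
  by rewrite mulNr mulrDl; lra.
have := main2 x x1; rewrite /sg /rp /powR gt_eqF ?nsq_ge0//; last by lra.
rewrite /dl -expRD ler_expR => H.
have lq : ln (nsq x + 1) <= 2 * ln (enorm x + 2).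
  rewrite mulr_natl -lnXn; last by lra.
  rewrite ler_ln ?posrE; [|lra|by rewrite exprn_gt0//; lra].
  by rewrite -sqr_enorm; nra.
have : - L - nn / a * ln (nsq x + 1) <= u x.
  rewrite -(ler_pM2l a0); apply: le_trans H; rewrite mulrBr !mulrA [a * nn]mulrC mulfK ?gt_eqF//.
  by lra.
have : nn / a * ln (nsq x + 1) <= nn / a * (2 * ln (enorm x + 2)) by rewrite ler_pM2l.
have : 0 <= nn / a * ln (enorm x + 2) by apply: mulr_ge0; lra.
rewrite mulNr mulrDl; lra.
Qed.

End lower_bound.

(** * Integrals insensitive to the origin *)

Section null_point.
Context {R : realType} {n : nat}.
Hypothesis n0 : (0 < n)%N.
Notation V := 'rV[R]_n.
Implicit Types (f g : V -> R) (x y z : V).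

Lemma ig_kb N (r : R) : 0 < r -> ig (@volm R n) (kb N.+1 r).
Proof.
by move=> r0; apply: (ig_csupp _ (kb_csupp N r0)); exact: (Ck_cont (@Ck_kb _ _ 0 N.+1 r isT)).
Qed.

Lemma Rint_kb0 N (r : R) : (4 < N)%N -> 0 < r -> \int[@volm R n]_y kb N r y = kmass (n := n) N.
Proof.
move=> N4 r0; rewrite -(Rint_kb 0 N4 r0); apply: eq_Rint => y.
by rewrite /kb sub0r nsqN.
Qed.

Lemma inb_le_kb N (r : R) y : 0 < r -> inb r y <= (4 / 3) ^+ N * (2 * r) ^+ n * kb N (2 * r) y.
Proof.
move=> r0; have r20 : 0 < 2 * r by rewrite mulr_gt0.
have [yr|yr] := leP (enorm y) r; last first.
  rewrite inb0//; apply: mulr_ge0; last exact: kb_ge0.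
  by rewrite mulr_ge0 ?exprn_ge0 ?divr_ge0 ?ltW.
rewrite inb1// /kb.
rewrite [leRHS](_ : _ = ((2 * r) * (2 * r)^-1) ^+ n * ((4 / 3) ^+ N * tp N (1 - nsq y / (2 * r) ^+ 2))); last first.
  set X := (2 * r)^-1; set T := tp _ _; set F := 4 / 3.
  rewrite [in RHS]exprMn; ring.
rewrite divff ?expr1n ?mul1r ?gt_eqF//.
apply: (@le_trans _ _ ((4 / 3) ^+ N * (3 / 4) ^+ N)).
  by rewrite -exprMn (_ : 4 / 3 * (3 / 4) = 1 :> R) ?expr1n//; field.
apply: ler_wpM2l; first by rewrite exprn_ge0// divr_ge0.
rewrite /tp lerXn2r ?nnegrE ?divr_ge0 ?le_max ?lexx ?orbT//.
apply/orP; left; rewrite lerBrDr addrC -lerBrDr ler_pdivrMr ?exprn_gt0//.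
rewrite -sqr_enorm; have : enorm y ^+ 2 <= r ^+ 2 by rewrite lerXn2r ?nnegrE ?enorm_ge0 ?(ltW r0).
rewrite exprMn; lra.
Qed.

(** Comparison with a bump of twice the radius, whose mass is independent of the radius. *)
Lemma Rint_inb_le : exists Cv : R, 0 < Cv /\
  forall r : R, 0 < r -> \int[@volm R n]_y inb r y <= Cv * r ^+ n.
Proof.
exists ((4 / 3) ^+ 5 * 2 ^+ n * kmass (R := R) (n := n) 5); split.
  by rewrite !mulr_gt0 ?exprn_gt0 ?divr_gt0 ?kmass_gt0.
move=> r r0; have r20 : 0 < 2 * r by rewrite mulr_gt0.
have -> : (4 / 3) ^+ 5 * 2 ^+ n * kmass (R := R) (n := n) 5 * r ^+ n =
    \int[volm]_y ((4 / 3) ^+ 5 * (2 * r) ^+ n * kb (n := n) 5 (2 * r) y).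
  by rewrite RintZl; [rewrite Rint_kb0// [(2 * r) ^+ n]exprMn; ring|exact: ig_kb].
apply: Rint_le; [exact: ig_ball|by apply: igZl; exact: ig_kb|move=> y; exact: inb_le_kb].
Qed.

Lemma Rint_inb0 : \int[@volm R n]_y inb 0 y = 0.
Proof.
apply/eqP; rewrite eq_le Rint_ge0 ?andbT; last by move=> y; exact: inb_ge0.
have [Cv [Cv0 H]] := Rint_inb_le.
apply/ler_addgt0Pl => e e0; rewrite addr0.
pose r := Num.min 1 (e / Cv).
have r0 : 0 < r by rewrite lt_min ltr01 divr_gt0.
apply: (@le_trans _ _ (Cv * r ^+ n)).
  apply: le_trans (H r r0); apply: Rint_le; [exact: ig_ball|exact: ig_ball|move=> y].
  rewrite /inb; case: (leP _ 0) => y0; last by case: ifP.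
  by rewrite (le_trans y0 (ltW r0)).
apply: (@le_trans _ _ (Cv * r)); last first.
  by rewrite -ler_pdivlMl// mulrC /r ge_min lexx orbT.
rewrite ler_pM2l// -(prednK n0) exprS ler_piMr ?(ltW r0)// exprn_ile1 ?(ltW r0)//.
by rewrite /r ge_min lexx.
Qed.

Lemma inb0E y : inb 0 y = (y == 0)%:R :> R.
Proof.
have [->|y0] := eqVneq y 0; first by rewrite inb1// enorm0.
by rewrite inb0// enorm_gt0.
Qed.

(** Singular kernels take a default value at the origin. Resetting it to 0 turns hypotheses stated
    off the origin into hypotheses everywhere, at no cost for integrals since a point is null for
    [n > 0]. *)
Definition cut0 f : V -> R := fun y => f y - f 0 * inb 0 y.

Lemma cut0E f y : cut0 f y = if y == 0 then 0 else f y.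
Proof. by rewrite /cut0 inb0E; case: eqP => [->|_]; rewrite ?mulr1 ?subrr// mulr0 subr0. Qed.

Lemma ig_cut0 f : ig volm (cut0 f) -> ig volm f.
Proof.
move=> fi; apply: ig_ext (igD fi (igZl (f 0) (ig_ball 0))) => y.
by rewrite /cut0 subrK.
Qed.

Lemma Rint_cut0 f : ig volm f -> \int[volm]_y cut0 f y = \int[volm]_y f y.
Proof.
move=> fi; rewrite RintB//; last by apply: igZl; exact: ig_ball.
by rewrite RintZl ?Rint_inb0 ?mulr0 ?subr0//; exact: ig_ball.
Qed.

Lemma measurable_cut0 f : measurable_fun setT f -> measurable_fun setT (cut0 f).
Proof.
move=> mf; apply: measurable_funB => //.
exact: (measurable_funM (measurable_cst (f 0)) (measurable_inb 0)).
Qed.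

Lemma ig_le0 f g : ig volm g -> measurable_fun setT f ->
  (forall x, x != 0 -> `|f x| <= g x) -> ig volm f.
Proof.
move=> gi mf fg; apply: ig_cut0; apply: (ig_le (ig_abs gi)); first exact: measurable_cut0.
move=> x; rewrite cut0E; case: eqP => [_|/eqP x0]; first by rewrite normr0.
by apply: le_trans (fg x x0) _; exact: ler_norm.
Qed.

Lemma Rint_le0 f g : ig volm f -> ig volm g -> (forall x, x != 0 -> f x <= g x) ->
  \int[volm]_y f y <= \int[volm]_y g y.
Proof.
move=> fi gi fg; rewrite -(Rint_cut0 fi) -(Rint_cut0 gi).
have Z h : ig volm h -> ig volm (cut0 h) by move=> hi; apply: igB => //; apply: igZl; exact: ig_ball.
apply: Rint_le; [exact: Z|exact: Z|move=> x].
by rewrite !cut0E; case: eqP => // /eqP; exact: fg.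
Qed.

Lemma Rint_dct0 (f_ : nat -> V -> R) f g :
  (forall k, measurable_fun setT (f_ k)) -> ig volm g ->
  (forall k x, x != 0 -> `|f_ k x| <= g x) -> (forall x, x != 0 -> f_ ^~ x @ \oo --> f x) ->
  ig volm f /\ (fun k => \int[volm]_x f_ k x) @ \oo --> \int[volm]_x f x.
Proof.
move=> mf gi fg ff.
have [fi C] : ig volm (cut0 f) /\ (fun k => \int[volm]_x cut0 (f_ k) x) @ \oo --> \int[volm]_x cut0 f x.
  apply: (Rint_dct (g := fun x => `|g x|)) => [k||k x|x]; first exact: measurable_cut0.
  - exact: ig_abs.
  - rewrite cut0E; case: eqP => [_|/eqP x0]; first by rewrite normr0.
    by apply: le_trans (fg k x x0) _; exact: ler_norm.
  - rewrite cut0E; under eq_fun do rewrite cut0E; case: eqP => [_|/eqP x0]; first exact: cvg_cst.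
    exact: ff.
have fi' := ig_cut0 fi; split => //; rewrite -(Rint_cut0 fi').
have -> // : (fun k => \int[volm]_x f_ k x) = (fun k => \int[volm]_x cut0 (f_ k) x).
apply/funext => k; rewrite Rint_cut0//; exact: ig_le0 gi (mf k) (fg k).
Qed.

(** Fatou's lemma: a uniform bound for the integrals of regularisations yields integrability of
    their singular limit. *)
Lemma ig_fatou0 (f_ : nat -> V -> R) f (B : R) :
  (forall k, ig volm (f_ k)) -> (forall k x, 0 <= f_ k x) ->
  (forall k, \int[volm]_x f_ k x <= B) -> (forall x, x != 0 -> f_ ^~ x @ \oo --> f x) ->
  ig volm f /\ \int[volm]_x f x <= B.
Proof.
move=> fi f0 fB ff.
have ci k : ig volm (cut0 (f_ k)) by apply: igB => //; apply: igZl; exact: ig_ball.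
have c0 k x : 0 <= cut0 (f_ k) x by rewrite cut0E; case: eqP.
have cc x : (fun k => cut0 (f_ k) x) @ \oo --> cut0 f x.
  rewrite cut0E; under eq_fun do rewrite cut0E; case: eqP => [_|/eqP x0]; first exact: cvg_cst.
  exact: ff.
have mc : measurable_fun setT (cut0 f).
  by apply: (measurable_fun_cvg (h := fun k => cut0 (f_ k))) => [k|x _]; [exact: ig_measurable (ci k)|exact: cc].
have cf0 x : 0 <= cut0 f x.
  by apply: (cvgr_to_ge (cc x)); apply: nearW => k; exact: c0.
have H : (\int[volm]_x (cut0 f x)%:E <= B%:E)%E.
  have mF k : measurable_fun setT (fun x => (cut0 (f_ k) x)%:E).
    by apply/measurable_EFinP; exact: ig_measurable (ci k).
  have pF k x : setT x -> (0 <= (cut0 (f_ k) x)%:E)%E by move=> _; rewrite lee_fin.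
  have := fatou (@volm R n) measurableT mF pF.
  have -> : (fun x => limn_einf (fun k => (cut0 (f_ k) x)%:E)) = (fun x => (cut0 f x)%:E).
    apply/funext => x; apply: (cvg_limn_einf_sup _).1; apply: cvg_EFin; [exact: nearW|exact: cc].
  move/le_trans; apply.
  rewrite limn_einf_lim; apply: lime_le; first exact: is_cvg_einfs.
  apply: nearW => k; apply: (@le_trans _ _ (\int[volm]_x (cut0 (f_ k) x)%:E)%E).
    by apply: ereal_inf_lbound; exists k => //=.
  by rewrite Rint_EFin// lee_fin Rint_cut0.
have ci' : ig volm (cut0 f) := ig_ge0 mc cf0 H.
have fi' := ig_cut0 ci'; split => //.
by rewrite -(Rint_cut0 fi') -lee_fin -Rint_EFin.
Qed.

End null_point.

(** * Local integrability of singular powers *)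

Section riesz.
Context {R : realType} {n : nat}.
Hypothesis n3 : (2 < n)%N.
Notation V := 'rV[R]_n.
Implicit Types (f g : V -> R) (x y z : V) (e p : R).

Let n0 : (0 < n)%N. Proof. exact: leq_trans n3. Qed.

Lemma nsq_gt0 z : z != 0 -> 0 < nsq z.
Proof. by move=> z0; rewrite -sqr_enorm exprn_gt0// enorm_gt0. Qed.

Lemma cvg_sg p z (e0 : R) : z != 0 -> (fun k => sg (e0 * k.+1%:R^-1) p z) @ \oo --> sg 0 p z.
Proof.
move=> z0; have E e : sg e p z = rp (nsq z) p e by rewrite /sg /rp addrC.
rewrite E; under eq_fun do rewrite E.
apply: (@continuous_cvg _ _ _ _ _ _ (rp (nsq z) p)).
  by apply: continuous_rp; rewrite add0r nsq_gt0.
have : (fun k => e0 * @harmonic R k) @ \oo --> e0 * 0.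
  by apply: cvgM; [exact: cvg_cst|exact: cvg_harmonic].
by rewrite mulr0.
Qed.

Lemma sg_anti e p z : 0 <= e -> p <= 0 -> z != 0 -> sg e p z <= sg 0 p z.
Proof.
move=> e0 p0 z0; have s0 := nsq_gt0 z0; rewrite /sg /rp addr0 /powR !gt_eqF//; last lra.
by rewrite ler_expR ler_wnM2l// ler_ln ?posrE; lra.
Qed.

Lemma sg_incr e e' p z : 0 < e -> e <= e' -> 0 <= p -> sg e p z <= sg e' p z.
Proof.
move=> e0 ee p0; have s0 := nsq_ge0 z; rewrite /sg /rp /powR !gt_eqF//; try lra.
by rewrite ler_expR ler_wpM2l// ler_ln ?posrE; lra.
Qed.

Lemma sg_ge0 e p z : 0 <= sg e p z. Proof. exact: powR_ge0. Qed.

Lemma measurable_sg e p : measurable_fun setT (@sg R n e p).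
Proof.
apply: (measurableT_comp (f := fun t : R => (t + e) `^ p)).
  by apply: (measurableT_comp (f := fun t : R => t `^ p)); [exact: measurable_powR|exact: measurable_funD].
by apply: measurable_continuous; exact: continuous_nsq.
Qed.

Lemma sg_half e z : 0 <= e -> sg e 2^-1 z = Num.sqrt (nsq z + e).
Proof. by move=> e0; rewrite /sg /rp powR12_sqrt// addr_ge0// nsq_ge0. Qed.

Lemma sg_invenorm z : sg 0 (- 2^-1) z = (enorm z)^-1.
Proof. by rewrite /sg /rp addr0 powRN powR12_sqrt// nsq_ge0. Qed.

Lemma sg_inv k z : sg 0 (- k%:R) z = (nsq z)^-1 ^+ k.
Proof. by rewrite /sg rp_nat addr0// nsq_ge0. Qed.

Lemma loc_ig_kb f : measurable_fun setT f -> (forall x, 0 <= f x) ->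
  (forall r : R, 0 < r -> ig volm (fun x => f x * kb (n := n) 6 r x)) -> loc_ig f.
Proof.
move=> mf f0 fi; split => // r.
pose r' := `|r| + 1; have r0 : 0 < r' by rewrite ltr_wpDl.
have r20 : 0 < 2 * r' by rewrite mulr_gt0.
apply: (ig_le (igZl ((4 / 3) ^+ 6 * (2 * r') ^+ n) (fi _ r20))).
  by apply: measurable_funM => //; exact: measurable_inb.
move=> x; rewrite normrM (ger0_norm (inb_ge0 _ _)) (ger0_norm (f0 x)) mulrCA mulrC ler_wpM2l//.
apply: (@le_trans _ _ (inb r' x)); last exact: inb_le_kb.
rewrite /inb; case: (leP _ r) => xr; last by case: ifP.
by rewrite (le_trans xr)// /r' (le_trans (ler_norm r))// lerDl.
Qed.

(** If [A (|z|^2 + e)^p] is at most the Laplacian of a function [g e] dominated by a locally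
    integrable [G], then pairing with a bump and moving the Laplacian onto it bounds the integrals
    uniformly in [e], and Fatou's lemma lets [e] tend to 0. *)
Lemma subharmonic_step (A p e0 r : R) (g : R -> V -> R) (G : V -> R) :
  0 < A -> 0 < r -> 0 < e0 -> loc_ig G ->
  (forall e, 0 < e -> Ck 2 (g e)) -> (forall e z, 0 < e -> A * sg e p z <= lap (g e) z) ->
  (forall e z, 0 < e -> e <= e0 -> enorm z <= r -> z != 0 -> `|g e z| <= G z) ->
  ig volm (fun z => sg 0 p z * kb (n := n) 6 r z) /\
  \int[@volm R n]_z (sg 0 p z * kb (n := n) 6 r z) <= A^-1 * \int[@volm R n]_z (G z * `|lap (kb (n := n) 6 r) z|).
Proof.
move=> A0 r0 e00 Gi gC gl gG.
have kr := @kb_csupp R n 5 r r0; have kC : Ck 2 (kb (n := n) 6 r) by exact: Ck_kb.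
have kc := Ck_cont kC; have lr := csupp_lap kr; have lc := lap_cont kC.
have Gl : ig volm (fun z => G z * `|lap (kb (n := n) 6 r) z|).
  apply: (loc_ig_mulc (r := r) Gi); last by move=> z zr; rewrite lr ?normr0.
  by apply: (@cont_comp _ _ Num.norm) => // t; exact: norm_continuous.
pose e_ (k : nat) := e0 * k.+1%:R^-1.
have e_0 k : 0 < e_ k by rewrite mulr_gt0.
have e_1 k : e_ k <= e0 by rewrite ler_piMr ?(ltW e00)// invf_le1// ler1n.
have sc k : continuous (@sg R n (e_ k) p) by exact: Ck_cont (Ck_sg 0 p (e_0 k)).
apply: (ig_fatou0 n0 (f_ := fun k z => sg (e_ k) p z * kb (n := n) 6 r z)).
- by move=> k; apply: (loc_ig_mulc (loc_ig_cont _)) => //; exact: kr.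
- by move=> k z; rewrite mulr_ge0 ?sg_ge0 ?kb_ge0.
- move=> k; rewrite -(ler_pM2l A0) mulrA divff ?gt_eqF// mul1r -RintZl; last first.
    by apply: (loc_ig_mulc (loc_ig_cont _)) => //; exact: kr.
  apply: (@le_trans _ _ (\int[@volm R n]_z (kb (n := n) 6 r z * lap (g (e_ k)) z))).
    apply: Rint_le.
    + by apply: igZl; apply: (loc_ig_mulc (loc_ig_cont _)) => //; exact: kr.
    + apply: (@ig_csupp _ _ r); first exact: (contM kc (lap_cont (gC _ (e_0 k)))).
      by move=> z zr; rewrite kr ?mul0r.
    + by move=> z; rewrite mulrA mulrC ler_wpM2l ?kb_ge0 ?gl.
  rewrite -(Rint_lap_sym (gC _ (e_0 k)) kC kr).
  apply: (Rint_le0 n0) => //.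
    apply: (loc_ig_mulc (loc_ig_cont _)) => //; last exact: lr.
    exact: Ck_cont (gC _ (e_0 k)).
  move=> z z0; have [zr|zr] := leP (enorm z) r; last by rewrite lr// normr0 !mulr0.
  by apply: le_trans (ler_norm _) _; rewrite normrM ler_wpM2r// gG.
- by move=> z z0; apply: cvgM; [exact: cvg_sg|exact: cvg_cst].
Qed.

(** The Laplacian of [|z|] is [(n - 1) / |z|], so [subharmonic_step] applies to the regularised
    norm. With [e] up to [r^2] this norm stays below [2 r] on the ball, which gives the scaling
    [C / r]. *)
Lemma invenorm_kb : exists C : R, 0 < C /\ forall r : R, 0 < r ->
  ig volm (fun z : V => sg 0 (- 2^-1) z * kb (n := n) 6 r z) /\
  \int[@volm R n]_(z in [set: V]) (sg 0 (- 2^-1) z * kb (n := n) 6 r z) <= C / r.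
Proof.
have [Cv [Cv0 HCv]] := @Rint_inb_le R n.
have n1 : 0 < n%:R - 1 :> R by rewrite subr_gt0 ltr1n; exact: leq_trans n3.
pose D : R := 2 * 6 * (2 * 5 + n%:R).
have D0 : 0 < D by rewrite !mulr_gt0// ltr_wpDr.
exists ((n%:R - 1)^-1 * (2 * D * Cv)); split; first by rewrite !mulr_gt0 ?invr_gt0.
move=> r r0; have rn0 : r != 0 by rewrite gt_eqF.
have r2 : 0 < r ^+ 2 by rewrite exprn_gt0.
have Gi : loc_ig (@sg R n (r ^+ 2) 2^-1) by apply: loc_ig_cont; exact: Ck_cont (Ck_sg 0 _ r2).
have [|e z e0|e z e0 er zr z0|i1 i2] := subharmonic_step (p := - 2^-1) (g := fun e => sg e 2^-1) n1 r0 r2 Gi.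
- by move=> e e0; exact: Ck_sg.
- rewrite lap_sg//; have -> : 2^-1 - 1 = - 2^-1 :> R by field.
  have : 0 <= e * sg e (2^-1 - 2) z by rewrite mulr_ge0 ?sg_ge0 ?ltW.
  by move: (sg e _ z) (sg e _ z) => a b; lra.
- by rewrite ger0_norm ?sg_ge0// sg_incr.
split => //; apply: le_trans i2 _; rewrite -[leRHS]mulrA ler_wpM2l ?invr_ge0 ?(ltW n1)//.
apply: (@le_trans _ _ (\int[@volm R n]_(z in [set: V]) (2 * r * (D * r^-1 ^+ n.+2) * inb r z))).
  have kr := @kb_csupp R n 5 r r0; have kC : Ck 2 (kb (n := n) 6 r) by exact: Ck_kb.
  have lr := csupp_lap kr; have lc := lap_cont kC.
  apply: Rint_le; first apply: (loc_ig_mulc (r := r) Gi).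
  - by apply: (@cont_comp _ _ Num.norm) => // t; exact: norm_continuous.
  - by move=> z zr; rewrite lr ?normr0.
  - by apply: igZl; exact: ig_ball.
  move=> z; have [zr|zr] := leP (enorm z) r; last by rewrite lr// inb0// normr0 !mulr0.
  rewrite inb1// mulr1; apply: ler_pM => //; first exact: sg_ge0.
    rewrite sg_half ?(ltW r2)// -[leRHS]gtr0_norm ?mulr_gt0// -sqrtr_sqr ler_sqrt ?sqr_ge0//.
    have : nsq z <= r ^+ 2 by rewrite -sqr_enorm lerXn2r ?nnegrE ?enorm_ge0 ?(ltW r0).
    by rewrite exprMn; lra.
  have := norm_lap_kb z (isT : (1 < 5)%N) r0; rewrite normrM.
  rewrite ger0_norm ?divr_ge0 ?mulr_ge0 ?(ltW r0)// => H.
  rewrite -(ler_pM2l (_ : 0 < r / (2 * 6))) ?divr_gt0//.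
  apply: le_trans H _; rewrite /D [r^-1 ^+ n.+2]exprS le_eqVlt; apply/orP; left; apply/eqP.
  by set X := r^-1 ^+ n.+1; field.
rewrite RintZl; last exact: ig_ball.
apply: (@le_trans _ _ (2 * r * (D * r^-1 ^+ n.+2) * (Cv * r ^+ n))).
  have P : 0 <= 2 * r * (D * r^-1 ^+ n.+2) by apply: mulr_ge0; apply: mulr_ge0; rewrite ?exprn_ge0 ?invr_ge0 ?ltW.
  by apply: (ler_wpM2l P); exact: HCv.
rewrite [leLHS](_ : _ = 2 * D * Cv * (r * r^-1 * r^-1) * (r^-1 ^+ n * r ^+ n)); last first.
  by rewrite [r^-1 ^+ n.+2]exprS [r^-1 ^+ n.+1]exprS; set X := r^-1; ring.
by rewrite -exprMn mulVf// expr1n mulr1 divff// mul1r.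
Qed.

Lemma loc_ig_invenorm : loc_ig (fun z : V => (enorm z)^-1).
Proof.
have [C [C0 H]] := invenorm_kb.
have -> : (fun z : V => (enorm z)^-1) = sg 0 (- 2^-1) by apply/funext => z; rewrite sg_invenorm.
apply: loc_ig_kb => [||r r0]; [exact: measurable_sg|exact: sg_ge0|exact: (H r r0).1].
Qed.

Lemma Rint_invenorm_ball : exists C : R, 0 < C /\ forall r : R, 0 < r ->
  \int[@volm R n]_(z in [set: V]) (inb r z * (enorm z)^-1) <= C * r ^+ n.-1.
Proof.
have [C [C0 H]] := invenorm_kb.
exists ((4 / 3) ^+ 6 * 2 ^+ n * (C / 2)); split; first by rewrite !mulr_gt0 ?exprn_gt0 ?divr_gt0.
move=> r r0; have r20 : 0 < 2 * r by rewrite mulr_gt0.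
have [i1 i2] := H _ r20.
pose B := (4 / 3) ^+ 6 * (2 * r) ^+ n.
have B0 : 0 <= B by rewrite mulr_ge0 ?exprn_ge0 ?divr_ge0 ?(ltW r20).
apply: (@le_trans _ _ (\int[@volm R n]_z (B * (sg 0 (- 2^-1) z * kb (n := n) 6 (2 * r) z)))).
  apply: Rint_le; [exact: loc_ig_invenorm.2|exact: igZl|move=> z].
  rewrite sg_invenorm mulrCA mulrC ler_wpM2l ?invr_ge0 ?enorm_ge0//; exact: inb_le_kb.
rewrite RintZl//; apply: (le_trans (ler_wpM2l B0 i2)).
rewrite /B [(2 * r) ^+ n]exprMn [r ^+ n](_ : _ = r * r ^+ n.-1); last by rewrite -exprS prednK.
rewrite invfM le_eqVlt; apply/orP; left; apply/eqP.
by set X := r ^+ _; set Y := 2 ^+ n; field; rewrite gt_eqF.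
Qed.

Lemma ln_nsq_bound e z : 0 <= e -> e <= 1 -> z != 0 ->
  `|ln (nsq z + e)| <= nsq z + 1 + 2 * (enorm z)^-1.
Proof.
move=> e0 e1 z0; have s0 := nsq_gt0 z0; have en0 : 0 < enorm z by rewrite enorm_gt0.
have i0 : 0 < (enorm z)^-1 by rewrite invr_gt0.
rewrite ler_norml; apply/andP; split; last first.
  by apply: le_trans (ltW (ln_sublinear (_ : 0 < nsq z + e))) _; lra.
have : ln (nsq z) <= ln (nsq z + e) by rewrite ler_ln ?posrE; lra.
have : - ln (nsq z) <= 2 * (enorm z)^-1.
  rewrite -sqr_enorm lnXn// -mulNrn -[leLHS]mulr_natl ler_pM2l//.
  by rewrite -lnV ?posrE//; apply: ltW; exact: ln_sublinear.
by lra.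
Qed.

Lemma loc_ig_ln_bound : loc_ig (fun z : V => nsq z + 1 + 2 * (enorm z)^-1).
Proof.
have H1 : loc_ig (fun z : V => nsq z + 1).
  by apply: loc_ig_cont; apply: contD; [exact: continuous_nsq|exact: cont_cst].
have := loc_igB H1 (loc_igZ (-2) loc_ig_invenorm).
by congr loc_ig; apply/funext => z; rewrite mulNr opprK.
Qed.

(** Induction by [subharmonic_step]: up to positive factors and corrections of the right sign,
    [|z|^-2] is the Laplacian of [ln |z|^2], and each further power is the Laplacian of minus the
    preceding one. The factors stay positive as long as [2 j < n]. *)
Lemma loc_ig_sg_inv j : (2 * j < n)%N -> loc_ig (@sg R n 0 (- j%:R)).
Proof.
elim: j => [|j IH] jn.
  have := loc_ig_cst 1 : loc_ig (fun _ : V => 1 : R); congr loc_ig; apply/funext => z.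
  by rewrite oppr0 /sg /rp powRr0.
have Hl (g : R -> V -> R) (A : R) (G : V -> R) : 0 < A -> loc_ig G ->
  (forall e, 0 < e -> Ck 2 (g e)) -> (forall e z, 0 < e -> A * sg e (- j.+1%:R) z <= lap (g e) z) ->
  (forall e z, 0 < e -> e <= 1 -> z != 0 -> `|g e z| <= G z) -> loc_ig (@sg R n 0 (- j.+1%:R)).
  move=> A0 Gi gC gl gG; apply: loc_ig_kb => [||r r0]; [exact: measurable_sg|exact: sg_ge0|].
  by apply: (subharmonic_step A0 r0 ltr01 Gi gC gl _).1 => e z e0 e1 _; exact: gG.
case: j IH jn Hl => [_ jn|j IH jn] Hl.
  apply: (Hl (fun e z => ln (nsq z + e)) (2 * n%:R - 4) _ _ loc_ig_ln_bound).
  - have : 3 <= n%:R :> R by rewrite (ler_nat _ 3).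
    by lra.
  - by move=> e e0; exact: Ck_ln_nsq.
  - move=> e z e0; rewrite lap_ln_nsq// lerDl; apply: mulr_ge0 (sg_ge0 _ _ _).
    by apply: mulr_ge0 => //; exact: ltW.
  - by move=> e z e0 e1 z0; apply: ln_nsq_bound => //; exact: ltW.
have jn' : (2 * j.+1 < n)%N by lia.
have jnR : 0 < n%:R - 2 * j.+1%:R - 2 :> R.
  have : (2 * j.+1 + 2 < n)%N by lia.
  by rewrite -(ltr_nat R) natrD natrM; lra.
apply: (Hl (fun e z => - sg e (- j.+1%:R) z) (2 * j.+1%:R * (n%:R - 2 * j.+1%:R - 2)) _ _ (IH jn')).
- by apply: mulr_gt0 => //; apply: mulr_gt0; rewrite ?ltr0n.
- by move=> e e0; apply: CkN; exact: Ck_sg.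
- move=> e z e0.
  have -> : (fun z : V => - sg e (- j.+1%:R) z) = (fun z : V => -1 * sg e (- j.+1%:R) z).
    by apply/funext => y; rewrite mulN1r.
  rewrite (lapZ (-1) z (Ck_sg 2 _ e0)) lap_sg//; set J : R := j.+1%:R; have J0 : 0 <= J by exact: ler0n.
  have -> : - J - 1 = - j.+2%:R by rewrite -[j.+2]addn1 natrD opprD.
  have : 0 <= J * (J + 1) * (e * sg e (- J - 2) z).
    by rewrite !mulr_ge0 ?sg_ge0 ?(ltW e0)//; lra.
  rewrite -/J -natr1 -/J.
  by move: (sg e _ z) (sg e _ z) => a b; lra.
- by move=> e z e0 e1 z0; rewrite normrN ger0_norm ?sg_ge0// sg_anti// ?ltW// oppr_le0.
Qed.

End riesz.

(** * Gamma, Gaussian and Cauchy integrals *)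

Section gamma_integrals.
Context {R : realType}.
Notation leb := (@lebesgue_measure R).
Implicit Types (a e t x : R).

Lemma is_derive_expRN a t : is_derive t 1 (fun t : R => expR (- (a * t))) (- a * expR (- (a * t))).
Proof.
have D : is_derive t 1 (fun t : R => - (a * t)) (- a).
  have := is_deriveN (is_deriveZ a (is_derive_id t (1 : R))).
  by apply: is_derive_ext => //; rewrite [a *: _]mulr1.
have := is_derive1_chain D (is_derive_expR (- (a * t))).
by apply: is_derive_ext => //; rewrite mulrC.
Qed.

Lemma cvg_powexp a k : 0 < a -> (fun t : R => t ^+ k * expR (- (a * t))) x @[x --> +oo] --> (0 : R).
Proof.
move=> a0; pose B : R := k.+1`!%:R / a ^+ k.+1.
have B0 : 0 < B by rewrite divr_gt0 ?exprn_gt0// ltr0n fact_gt0.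
apply/cvgrPdist_le => e e0; near=> t.
have t0 : 0 < t by near: t; exact: nbhs_pinfty_gt.
have Bt : B / e <= t by near: t; apply: nbhs_pinfty_ge; exact: num_real.
rewrite sub0r normrN ger0_norm ?mulr_ge0 ?exprn_ge0 ?expR_ge0 ?(ltW t0)//.
have H : (a * t) ^+ k.+1 / k.+1`!%:R <= expR (a * t).
  apply: le_trans (expR_ge1Dxn k (mulr_ge0 (ltW a0) (ltW t0))).
  by rewrite lerDr.
have f0 : 0 < k.+1`!%:R :> R by rewrite ltr0n fact_gt0.
rewrite expRN ler_pdivrMr ?expR_gt0//.
apply: (@le_trans _ _ (e * ((a * t) ^+ k.+1 / k.+1`!%:R))); last by rewrite ler_pM2l.
have -> : e * ((a * t) ^+ k.+1 / k.+1`!%:R) = t ^+ k * (e * t / B).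
  rewrite /B exprMn [t ^+ k.+1]exprS; set X := t ^+ k; set Y := a ^+ k.+1.
  have Y0 : Y != 0 by rewrite expf_neq0// gt_eqF.
  by field; rewrite Y0/= gt_eqF.
rewrite ler_peMr ?exprn_ge0 ?(ltW t0)// ler_pdivlMr// mul1r mulrC -ler_pdivrMr//.
Unshelve. all: by end_near. Qed.

(** The primitive of [t^k exp (- a t)] that vanishes at infinity, by repeated integration by
    parts. *)
Fixpoint gamF a k t : R :=
  if k is k'.+1 then - (t ^+ k * expR (- (a * t)) / a) + k%:R / a * gamF a k' t
  else - (expR (- (a * t)) / a).

Lemma is_derive_gamF a k t : a != 0 -> is_derive t 1 (gamF a k) (t ^+ k * expR (- (a * t))).
Proof.
move=> a0; elim: k => [|k IH].
  have := is_deriveN (is_deriveM (is_derive_expRN a t) (is_derive_cst (a^-1) t (1 : R))).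
  apply: is_derive_ext => //; rewrite scaler0 add0r /GRing.scale/= expr0 mul1r.
  by field.
have D1 : is_derive t 1 (fun t : R => t ^+ k.+1) (k.+1%:R * t ^+ k).
  by apply: is_derive_ext (is_derive_powc 1 k t) => [s|]; rewrite mul1r.
have := is_deriveD (is_deriveN (is_deriveM (is_deriveM D1 (is_derive_expRN a t)) (is_derive_cst (a^-1) t (1 : R)))) (is_deriveZ (k.+1%:R / a) IH).
apply: is_derive_ext => //.
by rewrite scaler0 add0r /GRing.scale/= exprS; set X := t ^+ k; set E := expR _; field.
Qed.

Lemma gamF0 a k : a != 0 -> gamF a k 0 = - (k`!%:R / a ^+ k.+1).
Proof.
move=> a0; elim: k => [|k IH] /=; first by rewrite mulr0 oppr0 expR0 fact0 expr1.
by rewrite IH exprS !mul0r oppr0 add0r factS natrM [a ^+ k.+2]exprS -mulNr; set X := a ^+ k.+1;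
  have X0 : X != 0 by [rewrite expf_neq0]; field; rewrite X0.
Qed.

Lemma cvg_gamF a k : 0 < a -> gamF a k x @[x --> +oo] --> (0 : R).
Proof.
move=> a0; elim: k => [|k IH] /=.
  have C : (fun t : R => expR (- (a * t))) x @[x --> +oo] --> (0 : R).
    by have := cvg_powexp 0 a0; under eq_fun do rewrite expr0 mul1r.
  have : - (expR (- (a * x)) / a) @[x --> +oo] --> - (0 / a : R).
    by apply: cvgN; apply: cvgM; [exact: C|exact: cvg_cst].
  by rewrite mul0r oppr0.
have : - (x ^+ k.+1 * expR (- (a * x)) / a) + k.+1%:R / a * gamF a k x @[x --> +oo] --> - (0 / a) + k.+1%:R / a * 0.
  apply: cvgD; last by apply: cvgM; [exact: cvg_cst|exact: IH].
  by apply: cvgN; apply: cvgM; [exact: cvg_powexp|exact: cvg_cst].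
by rewrite mul0r mulr0 oppr0 addr0.
Qed.

(** The integrand is extended by 0 to the whole line, so that Tonelli applies with plain Lebesgue
    measure. *)
Definition gam k a t : R := if 0 < t then t ^+ k * expR (- (a * t)) else 0.

Lemma gam_ge0 k a t : 0 <= gam k a t.
Proof. by rewrite /gam; case: ltP => // t0; rewrite mulr_ge0 ?exprn_ge0 ?expR_ge0// ltW. Qed.

Lemma integral_gam k a : 0 < a -> (\int[leb]_t (gam k a t)%:E = (k`!%:R / a ^+ k.+1)%:E)%E.
Proof.
move=> a0; have an0 : a != 0 by rewrite gt_eqF.
have fc : continuous (fun t : R => t ^+ k * expR (- (a * t))).
  move=> t; apply: cvgM; first exact: exprn_continuous.
  apply: (@continuous_comp _ _ _ (fun t : R => - (a * t)) expR); last exact: continuous_expR.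
  by apply: cvgN; apply: cvgM; [exact: cvg_cst|exact: cvg_id].
have H : (\int[leb]_(x in `[0%R, +oo[) (x ^+ k * expR (- (a * x)))%:E = 0%:E - (gamF a k 0)%:E)%E.
  apply: ge0_continuous_FTC2y.
  - by move=> x x0; rewrite mulr_ge0 ?exprn_ge0 ?expR_ge0.
  - exact: continuous_subspaceT.
  - exact: cvg_gamF.
  - by move=> x _; case: (is_derive_gamF k x an0).
  - apply: cvg_at_right_filter; apply: differentiable_continuous; apply/derivable1_diffP.
    by case: (is_derive_gamF k 0 an0).
  - by move=> x _; rewrite derive1E; case: (is_derive_gamF k x an0).
have -> : (k`!%:R / a ^+ k.+1)%:E = (0%:E - (gamF a k 0)%:E)%E by rewrite gamF0// -EFinB sub0r opprK.
rewrite -H -integral_itv_obnd_cbnd; last first.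
  by apply/measurable_EFinP; apply: measurable_funTS; exact: continuous_measurable_fun.
rewrite [RHS]integral_mkcond; apply: eq_integral => t _.
rewrite patchE /gam mem_setE in_itv/= andbT; by case: ifP.
Qed.

(** Normalisation of the normal law of variance [1 / (2 t)]. *)
Lemma gaussian1 t : 0 < t -> (\int[leb]_x (expR (- (t * x ^+ 2)))%:E = (Num.sqrt (pi / t))%:E)%E.
Proof.
move=> t0; pose s := Num.sqrt (2 * t)^-1.
have s2 : s ^+ 2 = (2 * t)^-1 by rewrite sqr_sqrtr// invr_ge0 mulr_ge0// ltW.
have s0 : s != 0 by rewrite gt_eqF// sqrtr_gt0 invr_gt0 mulr_gt0.
have tn0 : t != 0 by rewrite gt_eqF.
have S0 : 0 < Num.sqrt (pi / t) by rewrite sqrtr_gt0 divr_gt0 ?pi_gt0.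
have E x : normal_pdf 0 s x = (Num.sqrt (pi / t))^-1 * expR (- (t * x ^+ 2)).
  rewrite normal_pdfE// /normal_peak /normal_fun subr0 s2; congr (_^-1 * expR _).
    by congr Num.sqrt; rewrite -mulr_natr; field.
  by rewrite -[X in _ / X]mulr_natr; field.
have H : (\int[leb]_x ((Num.sqrt (pi / t))^-1 * expR (- (t * x ^+ 2)))%:E = 1)%E.
  by rewrite -(integral_normal_pdf 0 s); apply: eq_integral => x _; rewrite E.
have m : measurable_fun setT (fun x : R => (expR (- (t * x ^+ 2)))%:E).
  apply/measurable_EFinP; apply: continuous_measurable_fun => x.
  apply: (@continuous_comp _ _ _ (fun x : R => - (t * x ^+ 2)) expR); last exact: continuous_expR.
  by apply: cvgN; apply: cvgM; [exact: cvg_cst|exact: exprn_continuous].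
have Z : ((Num.sqrt (pi / t))^-1%:E * \int[leb]_x (expR (- (t * x ^+ 2)))%:E = 1)%E.
  by rewrite -ge0_integralZl// lee_fin invr_ge0 ltW.
rewrite -[LHS]mul1e -[X in (X * _)%E](_ : (Num.sqrt (pi / t))%:E * ((Num.sqrt (pi / t))^-1)%:E = 1)%E.
  by rewrite -muleA Z mule1.
by rewrite -EFinM divff// gt_eqF.
Qed.

Lemma integral_cauchy e : 0 < e -> (\int[leb]_x ((x ^+ 2 + e)^-1)%:E = (pi / Num.sqrt e)%:E)%E.
Proof.
move=> e0; set s := Num.sqrt e; have s0 : 0 < s by rewrite sqrtr_gt0.
have se : s ^+ 2 = e by rewrite sqr_sqrtr// ltW.
have p0 (x : R) : 0 < x ^+ 2 + e by rewrite ltr_wpDl// sqr_ge0.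
have sn0 : s != 0 by rewrite gt_eqF.
have fc : continuous (fun x : R => (x ^+ 2 + e)^-1).
  move=> x; apply: cvgV; first by rewrite gt_eqF.
  by apply: cvgD; [exact: exprn_continuous|exact: cvg_cst].
have D (x : R) : is_derive x 1 (fun x : R => s^-1 * atan (s^-1 * x)) ((x ^+ 2 + e)^-1).
  have D1 : is_derive x 1 (fun x : R => s^-1 * x) s^-1.
    have := is_deriveZ (s^-1) (is_derive_id x (1 : R)); apply: is_derive_ext => //.
    exact: mulr1.
  have := is_deriveZ (s^-1) (is_derive1_chain D1 (is_derive1_atan (s^-1 * x))).
  apply: is_derive_ext => //; rewrite /GRing.scale/= -se.
  by rewrite -!invfM; congr (_^-1); field.
have f0 (x : R) : 0 <= (x ^+ 2 + e)^-1 by rewrite invr_ge0 ltW.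
have fs : (fun x : R => (x ^+ 2 + e)^-1) =1 (fun x : R => (x ^+ 2 + e)^-1) \o -%R.
  by move=> x /=; rewrite sqrrN.
rewrite (ge0_symfun_integralT f0 fc fs) -set_itvcy.
rewrite (@ge0_continuous_FTC2y _ _ (fun x : R => s^-1 * atan (s^-1 * x)) 0 (s^-1 * (pi / 2))).
  + by rewrite mulr0 atan0 mulr0 sube0 -EFinM; congr EFin; field.
  + by move=> x _; rewrite invr_ge0 ltW.
  + exact: continuous_subspaceT.
  + apply: cvgM; first exact: cvg_cst.
    apply: (@cvg_comp _ _ _ (fun x : R => s^-1 * x) atan _ (pinfty_nbhs R)); last exact: cvgy_atan.
    apply/cvgryPge => A; apply: (filterS _ (nbhs_pinfty_ge (num_real (A * s)))) => x Ax.
    by rewrite mulrC ler_pdivlMr.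
  + by move=> x _; case: (D x).
  + have c0 : {for 0, continuous (fun x : R => s^-1 * atan (s^-1 * x))}.
      by apply: differentiable_continuous; apply/derivable1_diffP; case: (D 0).
    exact: (cvg_at_right_filter c0).
  + by move=> x _; rewrite derive1E; case: (D x).
Qed.

End gamma_integrals.

(** * Masses of [(|z|^2 + e)^-(k+1)] *)

Section masses.
Context {R : realType} {n : nat}.

Let volm_sfinite : sfinite_measure (@volm R n).
Proof. by apply: sfinite_measure_sigma_finite; exact: volm_sigma_finite. Qed.

HB.instance Definition _ := @isSFinite.Build _ _ _ (@volm R n) volm_sfinite.

Notation leb := (@lebesgue_measure R).
Notation V := 'rV[R]_n.

Lemma gaussian_n (t : R) : 0 < t ->
  (\int[@volm R n]_z (expR (- (t * nsq z)))%:E = (Num.sqrt (pi / t) ^+ n)%:E)%E.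
Proof.
move=> t0; under eq_integral => z _.
  rewrite (_ : expR _ = \prod_(i < n) expR (- (t * (z ord0 i) ^+ 2))); last first.
    by rewrite -expR_sum; congr expR; rewrite sumrN /nsq mulr_sumr.
  over.
rewrite (intRn_prod (g := fun _ x => expR (- (t * x ^+ 2))) (I := fun=> Num.sqrt (pi / t))).
- by rewrite prodr_const card_ord.
- move=> _; apply: continuous_measurable_fun => x.
  apply: (@continuous_comp _ _ _ (fun x : R => - (t * x ^+ 2)) expR); last exact: continuous_expR.
  by apply: cvgN; apply: cvgM; [exact: cvg_cst|exact: exprn_continuous].
- by move=> *; exact: expR_ge0.
- by move=> _; exact: gaussian1.
Qed.

Lemma measurable_gam k (g : V -> R) : measurable_fun setT g ->
  measurable_fun setT (fun zt : V * R => gam k (g zt.1) zt.2).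
Proof.
move=> mg; have -> : (fun zt : V * R => gam k (g zt.1) zt.2) =
    (fun zt => \1_`]0, +oo[%classic zt.2 * (zt.2 ^+ k * expR (- (g zt.1 * zt.2)))).
  apply/funext => zt; rewrite /gam indicE mem_setE in_itv/= andbT.
  by case: ifP => _; rewrite ?mul1r ?mul0r.
have m1 : measurable_fun setT (fun zt : V * R => zt.1) by exact: measurable_fst.
have m2 : measurable_fun setT (fun zt : V * R => zt.2) by exact: measurable_snd.
apply: measurable_funM; first by apply: (measurableT_comp _ m2); exact: measurable_indic.
apply: measurable_funM; first exact: measurable_funX.
have mN : measurable_fun setT (fun t : R => expR (- t)).
  apply: continuous_measurable_fun => t.
  by apply: (@continuous_comp _ _ _ (fun t : R => - t) expR); [exact: opp_continuous|exact: continuous_expR].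
apply: (measurableT_comp mN); apply: measurable_funM => //; exact: (measurableT_comp mg m1).
Qed.

(** By the Gamma integral the power is a superposition of Gaussians, which Tonelli integrates in
    [z]. *)
Lemma integral_inv_power k (e : R) : 0 < e ->
  (\int[@volm R n]_z ((nsq z + e)^-1 ^+ k.+1)%:E * (k`!%:R)%:E =
   \int[leb]_t (if (0 < t)%R then t ^+ k * expR (- (e * t)) * Num.sqrt (pi / t) ^+ n else 0)%R%:E)%E.
Proof.
move=> e0; have p0 (z : V) : 0 < nsq z + e by rewrite ltr_wpDl ?nsq_ge0.
have mq : measurable_fun setT (fun z : V => nsq z + e).
  by apply: measurable_continuous; apply: contD; [exact: continuous_nsq|exact: cont_cst].
have M := measurable_gam k mq.
have mp : measurable_fun setT (fun z : V => (nsq z + e)^-1 ^+ k.+1).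
  apply: measurable_continuous => z; apply: (@continuous_comp _ _ _ (fun z : V => (nsq z + e)^-1) (fun t : R => t ^+ k.+1)); last exact: exprn_continuous.
  apply: (@continuous_comp _ _ _ (fun z : V => nsq z + e) (fun t : R => t^-1)).
    by apply: contD; [exact: continuous_nsq|exact: cont_cst].
  by apply: cvgV; [rewrite gt_eqF|exact: cvg_id].
rewrite -ge0_integralZr//; last 2 first.
- exact/measurable_EFinP.
- by move=> z _; rewrite lee_fin exprn_ge0// invr_ge0 ltW.
under eq_integral => z _ do rewrite -EFinM mulrC exprVn -(integral_gam k (p0 z)).
have mg : measurable_fun setT (fun zt : V * R => (gam k (nsq zt.1 + e) zt.2)%:E) by exact/measurable_EFinP.
have g0 (zt : V * R) : (0 <= (gam k (nsq zt.1 + e) zt.2)%:E)%E by rewrite lee_fin gam_ge0.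
transitivity (\int[leb]_t \int[@volm R n]_z (gam k (nsq z + e) t)%:E)%E; first exact: (@fubini_tonelli _ _ _ _ R (@volm R n) leb _ mg g0).
apply: eq_integral => t _ /=; rewrite /gam; case: ifPn => t0; last by rewrite integral0.
rewrite EFinM -gaussian_n// -ge0_integralZl//.
- apply: eq_integral => z _; rewrite -EFinM -mulrA -expRD; congr (_ * expR _)%:E; ring.
- apply/measurable_EFinP; apply: measurable_continuous => z.
  apply: (@continuous_comp _ _ _ (fun z : V => - (t * nsq z)) expR); last exact: continuous_expR.
  by apply: contN; apply: contM; [exact: cont_cst|exact: continuous_nsq].
- by rewrite lee_fin mulr_ge0 ?exprn_ge0 ?expR_ge0// ltW.
Qed.

(** For [n = 2 k] the Gaussian mass [(pi / t)^k] cancels [t^k], and an exponential integral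
    remains. *)
Lemma mass_even k (e : R) : n = (2 * k)%N -> 0 < e ->
  (\int[@volm R n]_z ((nsq z + e)^-1 ^+ k.+1)%:E = (pi ^+ k / k`!%:R / e)%:E)%E.
Proof.
move=> nk e0; have := integral_inv_power k e0.
under [X in _ = X -> _]eq_integral => t _.
  rewrite (_ : (if _ then _ else _) = pi ^+ k * gam 0 e t); last first.
    rewrite /gam; case: ifPn => t0; last by rewrite mulr0.
    rewrite nk exprM sqr_sqrtr; last by rewrite divr_ge0 ?pi_ge0// ltW.
    rewrite expr_div_n expr0 mul1r; set X := t ^+ k; set Y := pi ^+ k; set E := expR _.
    have X0 : X != 0 by rewrite expf_neq0// gt_eqF.
    by field.
  rewrite EFinM; over.
have mg : measurable_fun setT (fun t : R => (gam 0 e t)%:E).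
  apply/measurable_EFinP.
  by have := measurableT_comp (measurable_gam 0 (measurable_cst (e : R) : measurable_fun setT (fun _ : V => e))) (measurable_fun_pair (measurable_cst (0 : V)) (@measurable_id _ R setT)).
rewrite ge0_integralZl//; last 2 first.
- by move=> t _; rewrite lee_fin gam_ge0.
- by rewrite lee_fin exprn_ge0 ?pi_ge0.
rewrite integral_gam// fact0 expr1 => H.
have f0 : k`!%:R != 0 :> R by rewrite pnatr_eq0 -lt0n fact_gt0.
rewrite -[LHS]mule1 -[X in (_ * X)%E](_ : ((k`!%:R)%:E * ((k`!%:R)^-1)%:E = 1)%E); last by rewrite -EFinM divff.
rewrite muleA H -!EFinM; congr EFin; field.
by rewrite f0/= gt_eqF.
Qed.

(** For [n = 2 k + 1] a factor [sqrt (pi / t)] is left over. It is rewritten as a Gaussian integral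
    in one extra variable, and exchanging the integrals leads to the Cauchy integral. *)
Lemma mass_odd k (e : R) : n = (2 * k).+1 -> 0 < e ->
  (\int[@volm R n]_z ((nsq z + e)^-1 ^+ k.+1)%:E = (pi ^+ k.+1 / k`!%:R / Num.sqrt e)%:E)%E.
Proof.
move=> nk e0; have := integral_inv_power k e0.
pose F (xt : R * R) : R := \1_`]0, +oo[%classic xt.2 * expR (- ((xt.1 ^+ 2 + e) * xt.2)).
have mF : measurable_fun setT F.
  have m1 : measurable_fun setT (fun zt : R * R => zt.1) by exact: measurable_fst.
  have m2 : measurable_fun setT (fun zt : R * R => zt.2) by exact: measurable_snd.
  apply: measurable_funM; first by apply: (measurableT_comp _ m2); exact: measurable_indic.
  have mN : measurable_fun setT (fun t : R => expR (- t)).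
    apply: continuous_measurable_fun => t.
    by apply: (@continuous_comp _ _ _ (fun t : R => - t) expR); [exact: opp_continuous|exact: continuous_expR].
  apply: (measurableT_comp mN).
  by apply: measurable_funM => //; apply: measurable_funD => //; exact: measurable_funX.
have F0 xt : (0 <= (F xt)%:E)%E by rewrite lee_fin mulr_ge0 ?expR_ge0.
have gE (x t : R) : F (x, t) = gam 0 (x ^+ 2 + e) t.
  rewrite /F /gam indicE mem_setE in_itv/= andbT expr0 mul1r.
  by case: ifP; rewrite ?mul1r ?mul0r.
have IF : (\int[leb]_t \int[leb]_x (F (x, t))%:E = (pi / Num.sqrt e)%:E)%E.
  have mFE : measurable_fun setT (fun xt : R * R => (F xt)%:E) by exact/measurable_EFinP.
  transitivity (\int[leb]_x \int[leb]_t (F (x, t))%:E)%E; first by apply/esym; exact: (@fubini_tonelli _ _ _ _ R leb leb _ mFE F0).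
  rewrite -integral_cauchy//; apply: eq_integral => x _.
  under eq_integral do rewrite gE.
  by rewrite integral_gam ?fact0 ?expr1 ?mul1r// ltr_wpDl// sqr_ge0.
have iF : measurable_fun setT (fun t : R => \int[leb]_x (F (x, t))%:E)%E.
  have mFE : measurable_fun setT (fun xt : R * R => (F xt)%:E) by exact/measurable_EFinP.
  exact: (@measurable_fun_fubini_tonelli_G _ _ _ _ R leb _ mFE F0).
under [X in _ = X -> _]eq_integral => t _.
  rewrite (_ : (if _ then _ else _)%:E = (pi ^+ k)%:E * \int[leb]_x (F (x, t))%:E)%E; last first.
    case: ifPn => t0; last first.
      rewrite [X in (_ * X)%E]integral0_eq ?mule0// => x _.
      by rewrite gE /gam (negbTE t0).
    under [in RHS]eq_integral => x _.
      rewrite gE /gam t0 expr0 mul1r (_ : - _ = - (t * x ^+ 2) + - (e * t)); last by ring.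
      rewrite expRD mulrC EFinM; over.
    have mE : measurable_fun setT (fun x : R => (expR (- (t * x ^+ 2)))%:E).
      apply/measurable_EFinP; apply: continuous_measurable_fun => x.
      apply: (@continuous_comp _ _ _ (fun x : R => - (t * x ^+ 2)) expR); last exact: continuous_expR.
      by apply: cvgN; apply: cvgM; [exact: cvg_cst|exact: exprn_continuous].
    rewrite ge0_integralZl//.
    rewrite gaussian1// -!EFinM; congr EFin.
    rewrite nk exprS exprM sqr_sqrtr; last by rewrite divr_ge0 ?pi_ge0// ltW.
    rewrite expr_div_n; set X := t ^+ k; set Y := pi ^+ k; set E := expR _; set S := Num.sqrt _.
    have X0 : X != 0 by rewrite expf_neq0// gt_eqF.
    by field.
  over.
rewrite ge0_integralZl//; last 2 first.
- by move=> t _; apply: integral_ge0 => x _.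
- by rewrite lee_fin exprn_ge0 ?pi_ge0.
rewrite IF => H.
have f0 : k`!%:R != 0 :> R by rewrite pnatr_eq0 -lt0n fact_gt0.
rewrite -[LHS]mule1 -[X in (_ * X)%E](_ : ((k`!%:R)%:E * ((k`!%:R)^-1)%:E = 1)%E); last by rewrite -EFinM divff.
rewrite muleA H -!EFinM exprS; congr EFin; field.
by rewrite f0/= gt_eqF ?sqrtr_gt0.
Qed.

End masses.

(** * Distributional Laplacians of [ln |z|] and of powers of [|z|] *)

Section riesz_identities.
Context {R : realType} {n : nat}.
Hypothesis n3 : (2 < n)%N.
Notation V := 'rV[R]_n.
Implicit Types (f g phi : V -> R) (x y z : V) (e p : R).

Let n0 : (0 < n)%N. Proof. exact: leq_trans n3. Qed.

(** Green's identity holds for the smooth regularisations; dominated convergence off the origin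
    transports it to the limit. *)
Lemma riesz_limit (g_ : nat -> V -> R) g (G H l : V -> R) phi : testfun phi ->
  (forall k, Ck 2 (g_ k)) -> loc_ig G -> loc_ig H ->
  (forall k z, z != 0 -> `|g_ k z| <= G z) -> (forall k z, z != 0 -> `|lap (g_ k) z| <= H z) ->
  (forall z, z != 0 -> g_ ^~ z @ \oo --> g z) ->
  (forall z, z != 0 -> (fun k => lap (g_ k) z) @ \oo --> l z) ->
  \int[@volm R n]_z (g z * lap phi z) = \int[@volm R n]_z (l z * phi z).
Proof.
move=> [pC [r pr]] gC Gi Hi gG lH gg ll.
have pC2 : Ck 2 phi := Ck_le (isT : (2 <= 4)%N) pC.
have lr := csupp_lap pr; have lc := lap_cont pC2; have pc := Ck_cont pC.
have cabs (h : V -> R) : continuous h -> continuous (fun z : V => `|h z|).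
  by move=> hc; apply: (@cont_comp _ _ Num.norm) => // t; exact: norm_continuous.
have sabs (h : V -> R) : csupp r h -> csupp r (fun z : V => `|h z|) by move=> hr z zr; rewrite hr ?normr0.
have [_ C1] : ig volm (fun z => g z * lap phi z) /\ (fun k => \int[@volm R n]_z (g_ k z * lap phi z)) @ \oo --> \int[@volm R n]_z (g z * lap phi z).
  apply: (Rint_dct0 n0 (g := fun z => G z * `|lap phi z|)).
  - by move=> k; apply: measurable_continuous; exact: (contM (Ck_cont (gC k)) lc).
  - by apply: (loc_ig_mulc Gi); [exact: cabs|exact: sabs].
  - by move=> k z z0; rewrite normrM ler_wpM2r// gG.
  - by move=> z z0; apply: cvgM; [exact: gg|exact: cvg_cst].
have [_ C2] : ig volm (fun z => l z * phi z) /\ (fun k => \int[@volm R n]_z (lap (g_ k) z * phi z)) @ \oo --> \int[@volm R n]_z (l z * phi z).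
  apply: (Rint_dct0 n0 (g := fun z => H z * `|phi z|)).
  - by move=> k; apply: measurable_continuous; exact: (contM (lap_cont (gC k)) pc).
  - by apply: (loc_ig_mulc Hi); [exact: cabs|exact: sabs].
  - by move=> k z z0; rewrite normrM ler_wpM2r// lH.
  - by move=> z z0; apply: cvgM; [exact: ll|exact: cvg_cst].
have E : (fun k => \int[@volm R n]_z (g_ k z * lap phi z)) = (fun k => \int[@volm R n]_z (lap (g_ k) z * phi z)).
  apply/funext => k; rewrite (Rint_lap_sym (gC k) pC2 pr).
  by apply: eq_Rint => z; rewrite mulrC.
by rewrite E in C1; rewrite -(cvg_lim (@Rhausdorff R) C1) -(cvg_lim (@Rhausdorff R) C2).
Qed.

(** The factor 1 matches the shape of the sequence in [cvg_sg]. *)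
Let ek (k : nat) : R := 1 * k.+1%:R^-1.

Let ek_gt0 k : 0 < ek k. Proof. by rewrite /ek mul1r invr_gt0. Qed.

Let ek_le1 k : ek k <= 1. Proof. by rewrite /ek mul1r invf_le1 ?ler1n. Qed.

Lemma cvg_ek : ek @ \oo --> (0 : R).
Proof.
have -> : ek = @harmonic R by apply/funext => k; rewrite /ek mul1r.
exact: cvg_harmonic.
Qed.

(** [e <= nsq z + e] trades the factor [e] for one power, which bounds the correction term of
    [lap_sg] uniformly in [e]. *)
Lemma e_sg_le e p z : 0 < e -> p <= 0 -> z != 0 -> e * sg e (p - 1) z <= sg 0 p z.
Proof.
move=> e0 p0 z0; apply: le_trans (sg_anti (ltW e0) p0 z0).
have -> : sg e p z = sg e (p - 1) z * (nsq z + e).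
  rewrite -[X in _ = _ * X](@rp1 R e); last by rewrite addr_ge0 ?nsq_ge0// ltW.
  by rewrite /sg rpM ?nsq_ge0// subrK.
by rewrite mulrC ler_wpM2l ?sg_ge0// lerDr nsq_ge0.
Qed.

Lemma riesz_ln phi : testfun phi ->
  \int[@volm R n]_z (ln (nsq z) * lap phi z) = (2 * n%:R - 4) * \int[@volm R n]_z (sg 0 (- 1%:R) z * phi z).
Proof.
move=> pt; have [pC [r pr]] := pt.
have L1 : loc_ig (@sg R n 0 (- 1%:R)) by apply: (loc_ig_sg_inv n3); exact: n3.
have i1 : ig volm (fun z => sg 0 (- 1%:R) z * phi z) by apply: (loc_ig_mulc L1 _ pr); exact: Ck_cont pC.
rewrite -RintZl//.
have -> : \int[@volm R n]_z ((2 * n%:R - 4) * (sg 0 (- 1%:R) z * phi z)) =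
    \int[@volm R n]_z ((2 * n%:R - 4) * sg 0 (- 1%:R) z * phi z).
  by apply: eq_Rint => z; rewrite mulrA.
have nn : 3 <= n%:R :> R by rewrite (ler_nat _ 3).
have m2 : -2 = - 1%:R - 1 :> R by rewrite -opprD.
apply: (riesz_limit (g_ := fun k z => ln (nsq z + ek k)) (G := fun z => nsq z + 1 + 2 * (enorm z)^-1)
  (H := fun z => 2 * n%:R * sg 0 (- 1%:R) z)) => //.
- by move=> k; exact: Ck_ln_nsq.
- exact: loc_ig_ln_bound.
- exact: loc_igZ.
- by move=> k z z0; apply: ln_nsq_bound => //; exact: ltW.
- move=> k z z0; rewrite lap_ln_nsq// m2 ger0_norm; last first.
    apply: addr_ge0; apply: mulr_ge0; rewrite ?sg_ge0//; first lra.
    by rewrite mulr_ge0// ltW.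
  have m1 : - 1%:R <= 0 :> R by lra.
  have := e_sg_le (ek_gt0 k) m1 z0; have := sg_anti (ltW (ek_gt0 k)) m1 z0.
  move: (sg_ge0 (ek k) (- 1%:R) z); rewrite -mulrA.
  move: (sg _ _ z) (ek k * _) (sg 0 _ z) => a b c a0 ac bc.
  have : (2 * n%:R - 4) * a <= (2 * n%:R - 4) * c by rewrite ler_wpM2l//; lra.
  by lra.
- move=> z z0; have C : (fun k => nsq z + ek k) @ \oo --> nsq z.
    by rewrite -[X in _ --> X]addr0; apply: cvgD; [exact: cvg_cst|exact: cvg_ek].
  by apply: (@continuous_cvg _ _ _ \oo _ (fun k => nsq z + ek k) (@ln R) (nsq z) _ C); apply: continuous_ln; exact: nsq_gt0.
- move=> z z0; under eq_fun do rewrite lap_ln_nsq//.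
  have C : (fun k => (2 * n%:R - 4) * sg (ek k) (-1) z + 4 * ek k * sg (ek k) (-2) z) @ \oo -->
      (2 * n%:R - 4) * sg 0 (-1) z + 4 * 0 * sg 0 (-2) z.
    apply: cvgD; first by apply: cvgM; [exact: cvg_cst|exact: cvg_sg].
    apply: cvgM; last exact: cvg_sg.
    by apply: cvgM; [exact: cvg_cst|exact: cvg_ek].
  by move: C; rewrite mulr0 mul0r addr0.
Qed.

(** The correction in [lap_sg] tends to 0 off the origin and is dominated by a multiple of
    [|z|^(-2 (j + 1))], which is still locally integrable because [2 j + 2 < n]; no Dirac mass
    appears. *)
Lemma riesz_power j phi : (2 * j + 2 < n)%N -> testfun phi ->
  \int[@volm R n]_z (sg 0 (- j%:R) z * lap phi z) =
  - (2 * j%:R * (n%:R - 2 * j%:R - 2)) * \int[@volm R n]_z (sg 0 (- j.+1%:R) z * phi z).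
Proof.
move=> jn pt; have [pC [r pr]] := pt.
have L0 : loc_ig (@sg R n 0 (- j%:R)) by apply: (loc_ig_sg_inv n3); lia.
have L1 : loc_ig (@sg R n 0 (- j.+1%:R)) by apply: (loc_ig_sg_inv n3); lia.
have i1 : ig volm (fun z => sg 0 (- j.+1%:R) z * phi z) by apply: (loc_ig_mulc L1 _ pr); exact: Ck_cont pC.
have [nn J0] : 0 < n%:R - 2 * j%:R - 2 :> R /\ 0 <= j%:R :> R.
  by split=> //; move: jn; rewrite -(ltr_nat R) natrD natrM; lra.
set J : R := j%:R in nn J0 *.
have E1 : - j.+1%:R = - J - 1 :> R by rewrite -natr1 opprD.
have jneg : - J <= 0 by lra.
have jneg1 : - J - 1 <= 0 by lra.
rewrite -RintZl// E1.
have -> : \int[@volm R n]_z (- (2 * J * (n%:R - 2 * J - 2)) * (sg 0 (- J - 1) z * phi z)) =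
    \int[@volm R n]_z (- (2 * J * (n%:R - 2 * J - 2)) * sg 0 (- J - 1) z * phi z).
  by apply: eq_Rint => z; rewrite mulrA.
have lE e z : 0 < e -> lap (sg e (- J)) z =
    - (2 * J * (n%:R - 2 * J - 2)) * sg e (- J - 1) z - 4 * J * (J + 1) * (e * sg e (- J - 2) z).
  by move=> e0; rewrite lap_sg//; move: (sg e (- J - 1) z) (sg e (- J - 2) z) => a b; ring.
have m2 : - J - 2 = - J - 1 - 1 by ring.
apply: (riesz_limit (g_ := fun k z => sg (ek k) (- J) z) (G := sg 0 (- J))
  (H := fun z => (2 * J * (n%:R - 2 * J - 2) + 4 * J * (J + 1)) * sg 0 (- J - 1) z)) => //.
- by move=> k; exact: Ck_sg.
- by apply: loc_igZ; rewrite -E1.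
- by move=> k z z0; rewrite ger0_norm ?sg_ge0// sg_anti// ltW.
- move=> k z z0; rewrite lE// m2.
  have := e_sg_le (ek_gt0 k) jneg1 z0; have := sg_anti (ltW (ek_gt0 k)) jneg1 z0.
  have b0 : 0 <= ek k * sg (ek k) (- J - 1 - 1) z by rewrite mulr_ge0 ?sg_ge0// ltW.
  move: b0 (sg_ge0 (ek k) (- J - 1) z).
  move: (sg _ _ z) (ek k * _) (sg 0 _ z) => a b c b0 a0 ac bc.
  have A0 : 0 <= 2 * J * (n%:R - 2 * J - 2) by rewrite !mulr_ge0// ltW.
  have B0 : 0 <= 4 * J * (J + 1) by rewrite !mulr_ge0//; lra.
  move: A0 B0; move: (2 * J * _) (4 * J * _) => A B A0 B0.
  rewrite mulNr -opprD normrN ger0_norm; last by rewrite addr_ge0// mulr_ge0.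
  by rewrite mulrDl lerD// ler_wpM2l.
- by move=> z z0; exact: cvg_sg.
- move=> z z0; under eq_fun do rewrite lE//.
  have C : (fun k => - (2 * J * (n%:R - 2 * J - 2)) * sg (ek k) (- J - 1) z - 4 * J * (J + 1) * (ek k * sg (ek k) (- J - 2) z)) @ \oo -->
     - (2 * J * (n%:R - 2 * J - 2)) * sg 0 (- J - 1) z - 4 * J * (J + 1) * (0 * sg 0 (- J - 2) z).
    apply: cvgB; first by apply: cvgM; [exact: cvg_cst|exact: cvg_sg].
    apply: cvgM; first exact: cvg_cst.
    by apply: cvgM; [exact: cvg_ek|exact: cvg_sg].
  by move: C; rewrite mul0r mulr0 subr0.
Qed.

(** For [n = 2 k] the Riesz coefficient in [lap_sg] vanishes and only
    [- 4 (k - 1) k e (|z|^2 + e)^-(k+1)] is left. Its mass does not depend on [e] ([mass_even]), so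
    it is a multiple of an approximate identity. *)
Lemma riesz_critical k phi : n = (2 * k)%N -> testfun phi ->
  \int[@volm R n]_z (sg 0 (- k.-1%:R) z * lap phi z) =
  - (4 * k.-1%:R * k%:R * (pi ^+ k / k`!%:R)) * phi 0.
Proof.
move=> nk pt; have [pC [r pr]] := pt.
have k2 : (1 < k)%N by lia.
set J : R := k.-1%:R; have kJ : k%:R = J + 1 :> R by rewrite /J natr1 prednK// (ltn_trans _ k2).
have J0 : 0 <= J := ler0n _ _.
have nJ : n%:R = 2 * (J + 1) :> R by rewrite nk natrM kJ.
pose w e (z : V) : R := (nsq z + e)^-1 ^+ k.+1.
have wE e z : 0 < e -> sg e (- J - 2) z = w e z.
  move=> e0; rewrite /w -rp_nat; last by rewrite addr_ge0 ?nsq_ge0// ltW.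
  have kS : k.+1%:R = J + 1 + 1 by rewrite -kJ natr1.
  by congr rp; rewrite kS; ring.
have wc e : 0 < e -> continuous (w e).
  move=> e0; have -> : w e = sg e (- J - 2) by apply/funext => z; rewrite wE.
  exact: Ck_cont (Ck_sg 0 _ e0).
have w0 e z : 0 < e -> 0 <= w e z.
  by move=> e0; rewrite exprn_ge0// invr_ge0 addr_ge0 ?nsq_ge0// ltW.
have wi e : 0 < e -> ig volm (w e).
  move=> e0; apply: (ig_ge0 (c := pi ^+ k / k`!%:R / e)).
  - by apply: measurable_continuous; exact: wc.
  - by move=> z; exact: w0.
  - by rewrite mass_even.
have wI e : 0 < e -> \int[@volm R n]_z w e z = pi ^+ k / k`!%:R / e.
  by move=> e0; rewrite /Rintegral mass_even.
set mu : R := pi ^+ k / k`!%:R in wI *.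
have mu0 : 0 <= mu by rewrite divr_ge0 ?exprn_ge0 ?pi_ge0.
have lE e z : 0 < e -> lap (sg e (- J)) z = - (4 * J * (J + 1)) * (e * w e z).
  by move=> e0; rewrite lap_sg// nJ -wE//; move: (sg e (- J - 1) z) (sg e (- J - 2) z) => a b; ring.
have pC2 : Ck 2 phi := Ck_le (isT : (2 <= 4)%N) pC.
have lr := csupp_lap pr; have lc := lap_cont pC2; have pc := Ck_cont pC.
have [M [M0 HM]] := csupp_bounded pc pr.
have wp e : 0 < e -> ig volm (fun z => w e z * phi z).
  move=> e0; apply: (@ig_csupp _ _ r); first exact: (contM (wc e e0) pc).
  by move=> z zr; rewrite pr ?mulr0.
have L0 : loc_ig (@sg R n 0 (- J)) by apply: (loc_ig_sg_inv n3); lia.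
have jneg : - J <= 0 by lra.
have [_ C1] : ig volm (fun z => sg 0 (- J) z * lap phi z) /\ (fun i => \int[@volm R n]_z (sg (ek i) (- J) z * lap phi z)) @ \oo --> \int[@volm R n]_z (sg 0 (- J) z * lap phi z).
  apply: (Rint_dct0 n0 (g := fun z => sg 0 (- J) z * `|lap phi z|)).
  - by move=> i; apply: measurable_continuous; exact: (contM (Ck_cont (Ck_sg 0 (- J) (ek_gt0 i))) lc).
  - apply: (loc_ig_mulc (r := r) L0); last by move=> z zr; rewrite lr ?normr0.
    by apply: (@cont_comp _ _ Num.norm) => // t; exact: norm_continuous.
  - move=> i z z0; rewrite normrM ler_wpM2r// ger0_norm ?sg_ge0// sg_anti// ltW//.
  - by move=> z z0; apply: cvgM; [exact: cvg_sg|exact: cvg_cst].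
have E i : \int[@volm R n]_z (sg (ek i) (- J) z * lap phi z) =
    - (4 * J * (J + 1)) * (ek i * \int[@volm R n]_z (w (ek i) z * phi z)).
  rewrite (Rint_lap_sym (Ck_sg 2 (- J) (ek_gt0 i)) pC2 pr) -RintZl; last exact: wp.
  rewrite -RintZl; last by apply: igZl; exact: wp.
  by apply: eq_Rint => z; rewrite lE//; ring.
have C2 : (fun i => ek i * \int[@volm R n]_z (w (ek i) z * phi z)) @ \oo --> phi 0 * mu.
  apply/cvgrPdist_le => eta eta0.
  have e0 : 0 < eta / (2 * (mu + 1)) by rewrite divr_gt0// mulr_gt0//; lra.
  have /nbhs_ballP[d d0 Hd] := (continuous_at_near phi 0).2 (pc 0) _ e0.
  pose q : R := (d / n.+1%:R) ^+ 2; have dn0 : 0 < d / n.+1%:R by rewrite divr_gt0.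
  have q0 : 0 < q by rewrite exprn_gt0.
  (* Where [nsq z >= q], [w e] is at most [((q + 1) / q)^(k+1)] times [w 1], uniformly in [e]; the
     factor [ek i] then makes this part vanish. *)
  pose K : R := 2 * M * ((q + 1) / q) ^+ k.+1.
  have K0 : 0 <= K by rewrite !mulr_ge0// exprn_ge0// divr_ge0//; lra.
  have key e z : 0 < e -> e <= 1 -> `|phi z - phi 0| * w e z <= eta / (2 * (mu + 1)) * w e z + K * w 1 z.
    move=> e_0 e1; have [zq|zq] := ltP (nsq z) q.
      have : `|phi 0 - phi z| <= eta / (2 * (mu + 1)).
        apply: Hd; rewrite -ball_normE/= sub0r normrN.
        apply: le_lt_trans (norm_le_enorm _) _; apply: (@lt_le_trans _ _ (d / n.+1%:R)).
          by rewrite -(ltr_pXn2r (n := 2)) ?nnegrE ?enorm_ge0 ?(ltW dn0)// sqr_enorm.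
        by rewrite ler_pdivrMr// ler_peMr ?(ltW d0)// ler1n.
      rewrite distrC => H; apply: (@le_trans _ _ (eta / (2 * (mu + 1)) * w e z)).
        by rewrite ler_wpM2r// w0.
      by rewrite lerDl mulr_ge0// w0.
    apply: (@le_trans _ _ (K * w 1 z)); last by rewrite lerDr mulr_ge0 ?w0// ltW.
    have zq0 : 0 < nsq z by lra.
    rewrite (_ : K * w 1 z = 2 * M * (((q + 1) / q) ^+ k.+1 * w 1 z)); last by rewrite /K !mulrA.
    apply: ler_pM => //; first exact: w0.
      by apply: le_trans (ler_normB _ _) _; rewrite mulr_natl mulr2n; apply: lerD; exact: HM.
    rewrite /w -exprMn lerXn2r ?nnegrE ?invr_ge0 ?mulr_ge0 ?divr_ge0 ?invr_ge0//; try lra.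
    have b1 : 0 < nsq z + 1 by lra.
    rewrite -[leLHS]mul1r ler_pdivrMr; last by lra.
    rewrite mulrAC ler_pdivlMr// mul1r mulrAC ler_pdivlMr//.
    nra.
  have : (fun i => K * (mu * ek i)) @ \oo --> K * (mu * 0).
    by apply: cvgM; [exact: cvg_cst|apply: cvgM; [exact: cvg_cst|exact: cvg_ek]].
  rewrite !mulr0 => /cvgrPdist_le/(_ _ (divr_gt0 eta0 (ltr0n R 2))) Hk.
  near=> i.
  have : `|0 - K * (mu * ek i)| <= eta / 2 by near: i.
  rewrite sub0r normrN ger0_norm; last first.
    by apply: mulr_ge0 => //; apply: mulr_ge0 => //; exact: ltW.
  move=> Hi; have ei := ek_gt0 i; have ein : ek i != 0 by rewrite gt_eqF.
  have -> : phi 0 * mu = ek i * \int[@volm R n]_z (phi 0 * w (ek i) z).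
    by rewrite RintZl ?wI//; [field|exact: wi].
  rewrite -mulrBr -RintB//; [|by apply: igZl; exact: wi|exact: wp].
  rewrite normrM (gtr0_norm ei).
  apply: (@le_trans _ _ (ek i * \int[@volm R n]_z (eta / (2 * (mu + 1)) * w (ek i) z + K * w 1 z))).
    rewrite ler_pM2l//; apply: Rint_norm_le.
    - by apply: ig_measurable; apply: igB; [apply: igZl; exact: wi|exact: wp].
    - by apply: igD; apply: igZl; exact: wi.
    - move=> z; apply: le_trans (key _ _ ei (ek_le1 i)).
      rewrite [w _ z * _]mulrC -mulrBl normrM distrC ler_wpM2l// ger0_norm// w0//.
  rewrite RintD; [|by apply: igZl; exact: wi|by apply: igZl; exact: wi].
  rewrite !RintZl; [|exact: wi|exact: wi].
  rewrite !wI// mulrDr divr1.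
  have -> : ek i * (eta / (2 * (mu + 1)) * (mu / ek i)) = eta / 2 * (mu / (mu + 1)).
    by field; rewrite ein/= gt_eqF//; lra.
  have : mu / (mu + 1) <= 1 by rewrite ler_pdivrMr; lra.
  have -> : ek i * (K * mu) = K * (mu * ek i) by ring.
  move: Hi; move: (K * _) (mu / _) => a b H1 H2.
  have : eta / 2 * b <= eta / 2 by rewrite ler_piMr// divr_ge0// ltW.
  by lra.
have C3 : (fun i => \int[@volm R n]_z (sg (ek i) (- J) z * lap phi z)) @ \oo --> - (4 * J * (J + 1)) * (phi 0 * mu).
  by under eq_fun do rewrite E; apply: cvgM; [exact: cvg_cst|exact: C2].
rewrite -(cvg_lim (@Rhausdorff R) C1) (cvg_lim (@Rhausdorff R) C3) kJ; ring.
Unshelve. all: by end_near. Qed.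

End riesz_identities.

(** * Convolutions and the logarithmic potential *)

Section integral_operators.
Context {R : realType} {n : nat}.
Notation V := 'rV[R]_n.
Notation mu := (@volm R n).

Lemma loc_ig_inb (h : V -> R) : (forall r : R, ig mu (fun x => inb r x * h x)) -> loc_ig h.
Proof.
move=> H; split => //.
apply: (measurable_fun_cvg (h := fun k x => inb k%:R x * h x)) => [k|x _]; first exact: ig_measurable (H _).
apply/cvgrPdist_le => e e0; near=> k.
rewrite inb1 ?mul1r ?subrr ?normr0 ?(ltW e0)//.
near: k; exists (Num.truncn (enorm x)).+1 => // k /= kk.
by apply: ltW; apply: lt_le_trans (truncnS_gt _) _; rewrite ler_nat.
Unshelve. all: by end_near. Qed.

Lemma integral_operator (G : V * V -> R) : measurable_fun setT G ->
  (forall x, ig mu (fun y => G (x, y))) ->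
  (forall r : R, exists g : V -> R, ig mu g /\ forall y,
     ig mu (fun x => inb r x * G (x, y)) /\ \int[mu]_x (inb r x * `|G (x, y)|) <= g y) ->
  let T x := \int[mu]_y G (x, y) in
  loc_ig T /\ forall (r M : R) (k : V -> R), measurable_fun setT k -> csupp r k -> (forall x, `|k x| <= M) ->
    \int[mu]_x (T x * k x) = \int[mu]_y \int[mu]_x (G (x, y) * k x) /\
    ig mu (fun y => \int[mu]_x (G (x, y) * k x)).
Proof.
move=> mG Gy Gx T.
have main (r M : R) (k : V -> R) : measurable_fun setT k -> csupp r k -> (forall x, `|k x| <= M) ->
    ig (mu \x mu)%E (fun xy => G xy * k xy.1).
  move=> mk kr kM; have [g [gi Hg]] := Gx r.
  have M0 : 0 <= M by apply: le_trans (kM 0).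
  have E x y : G (x, y) * k x = k x * (inb r x * G (x, y)).
    have [xr|xr] := leP (enorm x) r; first by rewrite inb1// mul1r mulrC.
    by rewrite kr// !mul0r mulr0.
  apply: (ig_prod2 (g := fun y => M * g y)).
  - by apply: measurable_funM => //; exact: (measurableT_comp mk (@measurable_fst _ _ _ _)).
  - move=> y /=; apply: ig_ext (ig_mulb (Hg y).1 mk kM) => x; by rewrite E.
  - exact: igZl.
  - move=> y /=; apply: (@le_trans _ _ (\int[mu]_x (M * (inb r x * `|G (x, y)|)))); last first.
      rewrite RintZl; first by rewrite ler_wpM2l// (Hg y).2.
      by apply: ig_ext (ig_abs (Hg y).1) => x; rewrite normrM ger0_norm ?inb_ge0.
    have i1 := ig_abs (Hg y).1.
    apply: Rint_le.
    + by apply: ig_ext (ig_abs (ig_mulb (Hg y).1 mk kM)) => x; rewrite E.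
    + by apply: igZl; apply: ig_ext i1 => x; rewrite normrM ger0_norm ?inb_ge0.
    + move=> x; rewrite E normrM ler_pM// normrM ler_wpM2r// ger0_norm ?inb_ge0//.
have TE x (k : V -> R) : \int[mu]_y (G (x, y) * k x) = T x * k x by rewrite RintZr.
split.
  apply: loc_ig_inb => r.
  have mi : measurable_fun setT (fun x : V => inb r x) by exact: measurable_inb.
  have ir : csupp r (fun x : V => inb r x) by move=> x xr; rewrite inb0.
  have := ig_fubini1 (main r 1 _ mi ir (norm_inb r)).
  by apply: ig_ext => x /=; rewrite TE mulrC.
move=> r M k mk kr kM; have H := main r M k mk kr kM; split; last exact: ig_fubini2 H.
by rewrite -(Rint_fubini H); apply: eq_Rint => x; rewrite TE.
Qed.

End integral_operators.

Section kernels.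
Context {R : realType} {n : nat}.
Hypothesis n3 : (2 < n)%N.
Notation V := 'rV[R]_n.
Notation mu := (@volm R n).
Implicit Types (K f : V -> R) (x y z : V).

Let n0 : (0 < n)%N. Proof. exact: leq_trans n3. Qed.

Lemma eq_Rint_to (g f : V -> R) : (forall x, f x = g x) -> \int[mu]_x f x = \int[mu]_x g x.
Proof. by move=> fg; exact: eq_Rint. Qed.

(** Chosen so that convolution makes sense with a density that is integrable and locally bounded:
    the kernel may be singular near the origin and is bounded elsewhere. *)
Definition kernel K := [/\ loc_ig K, forall z, 0 <= K z & forall z, 1 < enorm z -> K z <= 1].

Lemma kernel_sg j : (2 * j < n)%N -> kernel (sg 0 (- j%:R)).
Proof.
move=> jn; split; [exact: loc_ig_sg_inv|exact: sg_ge0|move=> z z1].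
rewrite sg_inv exprn_ile1 ?invr_ge0 ?nsq_ge0//.
have q1 : 1 < nsq z by rewrite -sqr_enorm exprn_egt1.
by rewrite invf_le1 ?ltW// (lt_trans _ q1).
Qed.

Lemma kernel_invenorm : kernel (fun z => (enorm z)^-1).
Proof.
split; [exact: loc_ig_invenorm|by move=> z; rewrite invr_ge0 enorm_ge0|move=> z z1].
by rewrite invf_le1 ?ltW// (lt_trans _ z1).
Qed.

Lemma kernel_le K z : kernel K -> K z <= inb 1 z * K z + 1.
Proof.
move=> [_ K0 K1]; have [z1|z1] := leP (enorm z) 1; first by rewrite inb1// mul1r lerDl.
by rewrite inb0// mul0r add0r K1.
Qed.

Definition kball K : R := \int[mu]_z (inb 1 z * K z).

Lemma kball_ge0 K : kernel K -> 0 <= kball K.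
Proof. by move=> [_ K0 _]; apply: Rint_ge0 => z; rewrite mulr_ge0 ?inb_ge0. Qed.

Lemma kernel_shift K (k : V -> R) (M : R) y : kernel K -> ig mu k ->
  (forall x, 0 <= k x) -> (forall x, k x <= M) ->
  ig mu (fun x => k x * K (x - y)) /\
  \int[mu]_x (k x * K (x - y)) <= M * kball K + \int[mu]_x k x.
Proof.
move=> kK ki k0 kM; have [[mK Ki] K0 K1] := kK.
have mKy : measurable_fun setT (fun x : V => K (x - y)) by exact: (measurableT_comp mK (measurable_vecD (- y))).
have i1 : ig mu (fun x => inb 1 (x - y) * K (x - y)) by exact: ig_shift (Ki 1).
have H x : k x * K (x - y) <= M * (inb 1 (x - y) * K (x - y)) + k x.
  apply: le_trans (ler_wpM2l (k0 x) (kernel_le (x - y) kK)) _.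
  rewrite mulrDr mulr1 lerD2r ler_wpM2r// mulr_ge0 ?inb_ge0//.
have i2 : ig mu (fun x => M * (inb 1 (x - y) * K (x - y)) + k x) by apply: igD => //; exact: igZl.
have i3 : ig mu (fun x => k x * K (x - y)).
  apply: (ig_le i2); first exact: measurable_funM (ig_measurable ki) mKy.
  by move=> x; rewrite ger0_norm// mulr_ge0.
split => //; apply: le_trans (Rint_le i3 i2 H) _.
rewrite RintD//; last exact: igZl.
by rewrite RintZl// (Rint_shift (- y) (Ki 1)).
Qed.

(** Near [x] the density is bounded and the kernel integrable; far from [x] the kernel is at most 1
    and the density integrable. *)
Lemma kernel_section K f (M r : R) x : kernel K -> ig mu f -> 0 <= M ->
  (forall y, enorm y <= r + 1 -> `|f y| <= M) -> enorm x <= r ->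
  ig mu (fun y => K (x - y) * f y) /\
  \int[mu]_y (K (x - y) * `|f y|) <= M * kball K + \int[mu]_y `|f y|.
Proof.
move=> kK fi M0 fM xr; have [[mK Ki] K0 K1] := kK.
have mKy : measurable_fun setT (fun y : V => K (x - y)).
  by apply: (measurableT_comp mK); apply: measurable_vecB2; [exact: measurable_cst|exact: measurable_id].
have i1 : ig mu (fun y => inb 1 (x - y) * K (x - y)) by exact: ig_reflect (Ki 1).
have H y : K (x - y) * `|f y| <= M * (inb 1 (x - y) * K (x - y)) + `|f y|.
  have [z1|z1] := leP (enorm (x - y)) 1.
    rewrite inb1// mul1r [M * _]mulrC; apply: (@le_trans _ _ (K (x - y) * M)); last by rewrite lerDl.
    rewrite ler_wpM2l// fM//; have := enormB_ge y x; rewrite enormBC; lra.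
  by rewrite inb0// mul0r mulr0 add0r ler_piMl// K1.
have i2 : ig mu (fun y => M * (inb 1 (x - y) * K (x - y)) + `|f y|).
  by apply: igD; [exact: igZl|exact: ig_abs].
have i3 : ig mu (fun y => K (x - y) * f y).
  apply: (ig_le i2); first exact: measurable_funM mKy (ig_measurable fi).
  by move=> y; rewrite normrM (ger0_norm (K0 _)).
have i4 : ig mu (fun y => K (x - y) * `|f y|).
  by apply: ig_ext (ig_abs i3) => y; rewrite normrM (ger0_norm (K0 _)).
split => //; apply: le_trans (Rint_le i4 i2 H) _.
rewrite RintD//; [|exact: igZl|exact: ig_abs].
by rewrite RintZl// (Rint_reflect x (Ki 1)).
Qed.

Lemma shift_testfun phi y : testfun phi ->
  testfun (fun z : V => phi (z + y)) /\ forall z, lap (fun z : V => phi (z + y)) z = lap phi (z + y).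
Proof.
move=> [pC [r pr]].
have E : (fun z : V => phi (z + y)) = (fun z => (fun w => phi (0 - w)) (- y - z)).
  by apply/funext => z /=; rewrite sub0r opprB opprK.
have pC1 := Ck_reflect 0 pC; have pC2 := Ck_reflect (- y) pC1.
have C2 (g : V -> R) : Ck 4 g -> Ck 2 g by exact: Ck_le.
split; last first.
  move=> z; rewrite E (lap_reflect _ _ (C2 _ pC1)) (lap_reflect _ _ (C2 _ pC)).
  by rewrite sub0r opprB opprK.
split; first by rewrite E.
exists (r + enorm y) => z zr; apply: pr; have := enormB_ge z (- y).
by rewrite opprK enormN; lra.
Qed.

Lemma eq_Rint0 (f g : V -> R) : ig mu f -> measurable_fun setT g -> (forall x, x != 0 -> f x = g x) ->
  ig mu g /\ \int[mu]_x f x = \int[mu]_x g x.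
Proof.
move=> fi mg fg; have gi : ig mu g.
  by apply: (ig_le0 (ig_abs fi) mg) => x x0; rewrite fg.
split => //; rewrite -(Rint_cut0 n0 fi) -(Rint_cut0 n0 gi); apply: eq_Rint => x.
by rewrite !cut0E; case: eqP => // /eqP; exact: fg.
Qed.

(** From [ln (1 + t) <= t]. It dominates the logarithmic kernel by the two locally integrable
    kernels [1 / |y|] and [1 / |x - y|]. *)
Lemma ln_ratio_le (a b d : R) : 0 <= a -> 0 <= b -> 0 <= d -> a <= b + d -> b <= a + d ->
  `|ln (a / b)| <= d * (a^-1 + b^-1).
Proof.
move=> a0 b0 d0 ab ba; have D0 : 0 <= d * (a^-1 + b^-1) by rewrite mulr_ge0// addr_ge0// invr_ge0.
(* Degenerate arguments are harmless: [0^-1] and [ln 0] are both 0. *)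
have [->|an] := eqVneq a 0; first by rewrite mul0r ln0// normr0 invr0 add0r mulr_ge0// invr_ge0.
have [->|bn] := eqVneq b 0; first by rewrite invr0 mulr0 ln0// normr0 addr0 mulr_ge0// invr_ge0.
have ap : 0 < a by rewrite lt_def an.
have bp : 0 < b by rewrite lt_def bn.
have L (s t : R) : 0 < s -> 0 < t -> s <= t + d -> ln (s / t) <= d * t^-1.
  move=> s0 t0 st; rewrite (_ : s / t = 1 + (s - t) / t); last by field; rewrite gt_eqF.
  apply: (@le_trans _ _ ((s - t) / t)); last by rewrite ler_wpM2r ?invr_ge0 ?(ltW t0)//; lra.
  apply: le_ln1Dx; rewrite ltr_pdivlMr//; lra.
have i1 : 0 <= d * a^-1 by rewrite mulr_ge0// invr_ge0.
have i2 : 0 <= d * b^-1 by rewrite mulr_ge0// invr_ge0.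
rewrite mulrDr ler_norml; apply/andP; split; last by apply: le_trans (L a b ap bp ab) _; lra.
have := L b a bp ap ba; rewrite -[b / a]invrK invf_div lnV ?posrE ?divr_gt0//; lra.
Qed.

Definition lk x y := ln (enorm y / enorm (x - y)).

Lemma lk_le x y : `|lk x y| <= enorm x * ((enorm y)^-1 + (enorm (x - y))^-1).
Proof.
apply: ln_ratio_le; rewrite ?enorm_ge0//.
  by have := enormB_ge y x; rewrite enormBC; lra.
by have := enormD x (- y); rewrite enormN; lra.
Qed.

Lemma measurable_invenorm : measurable_fun setT (fun z : V => (enorm z)^-1).
Proof.
have -> : (fun z : V => (enorm z)^-1) = sg 0 (- 2^-1) by apply/funext => z; rewrite sg_invenorm.
exact: measurable_sg.
Qed.

Lemma measurable_lk : measurable_fun setT (fun xy : V * V => lk xy.1 xy.2).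
Proof.
apply: (measurableT_comp (f := @ln R)); first exact: measurable_ln.
apply: measurable_funM.
  by apply: (measurableT_comp (@measurable_enorm R n)); exact: measurable_snd.
apply: (measurableT_comp measurable_invenorm).
by apply: measurable_vecB2; [exact: measurable_fst|exact: measurable_snd].
Qed.

Section density.
Variable f : V -> R.
Hypothesis fi : ig mu f.
Hypothesis fb : forall r : R, exists M : R, 0 <= M /\ forall y, enorm y <= r -> `|f y| <= M.

Definition conv K x := \int[mu]_y (K (x - y) * f y).

Lemma conv_spec K : kernel K -> loc_ig (conv K) /\
  forall (r M : R) (k : V -> R), measurable_fun setT k -> csupp r k -> (forall x, `|k x| <= M) ->
    \int[mu]_x (conv K x * k x) = \int[mu]_y ((\int[mu]_x (K (x - y) * k x)) * f y) /\
    ig mu (fun y => (\int[mu]_x (K (x - y) * k x)) * f y).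
Proof.
move=> kK; have [[mK Ki] K0 K1] := kK.
have [|x|r|li H] := @integral_operator R n (fun xy => K (xy.1 - xy.2) * f xy.2).
- apply: measurable_funM.
    by apply: (measurableT_comp mK); apply: measurable_vecB2; [exact: measurable_fst|exact: measurable_snd].
  by apply: (measurableT_comp (ig_measurable fi)); exact: measurable_snd.
- have [M [M0 HM]] := fb (enorm x + 1).
  by have [] := kernel_section kK fi M0 HM (lexx _).
- exists (fun y => (1 * kball K + \int[mu]_x inb r x) * `|f y|); split; first by apply: igZl; exact: ig_abs.
  move=> y /=; have i1 (x : V) : inb r x <= 1 by apply: le_trans (ler_norm _) (norm_inb _ _).
  have [j1 j2] := kernel_shift y kK (ig_ball r) (inb_ge0 r) i1.
  split; first by apply: ig_ext (igZr (f y) j1) => x; rewrite mulrA.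
  rewrite (eq_Rint_to (g := fun x => inb r x * K (x - y) * `|f y|)); last first.
    by move=> x; rewrite normrM (ger0_norm (K0 _)) mulrA.
  by rewrite RintZr// ler_wpM2r.
split => // r M k mk kr kM; have [E i] := H r M k mk kr kM.
have Z y : \int[mu]_x (K (x - y) * f y * k x) = (\int[mu]_x (K (x - y) * k x)) * f y.
  rewrite -RintZr; first by apply: eq_Rint => x; rewrite mulrAC.
  have := loc_ig_mul (r := r + enorm y) (k := fun z => k (z + y)) (M := M) (conj mK Ki).
  have m' : measurable_fun setT (fun z : V => k (z + y)) by exact: (measurableT_comp mk (measurable_vecD y)).
  have c' : csupp (r + enorm y) (fun z : V => k (z + y)).
    by move=> z zr; apply: kr; have := enormB_ge z (- y); rewrite opprK enormN; lra.
  move=> /(_ m' c' (fun z => kM _))/(ig_shift (- y)); apply: ig_ext => x /=.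
  by rewrite subrK.
split; first by rewrite E; apply: eq_Rint => y; exact: Z.
by apply: ig_ext i => y; exact: Z.
Qed.

Lemma testfun_bounds phi : testfun phi -> exists r M : R,
  [/\ [/\ measurable_fun setT phi, csupp r phi & forall x, `|phi x| <= M],
      [/\ measurable_fun setT (lap phi), csupp r (lap phi) & forall x, `|lap phi x| <= M] &
      continuous phi /\ continuous (lap phi)].
Proof.
move=> [pC [r pr]]; have pC2 : Ck 2 phi := Ck_le (isT : (2 <= 4)%N) pC.
have lr := csupp_lap pr; have lc := lap_cont pC2; have pc := Ck_cont pC.
have [M [M0 HM]] := csupp_bounded pc pr; have [M' [M'0 HM']] := csupp_bounded lc lr.
exists r, (M + M'); split => //; split => //; try exact: measurable_continuous.
- by move=> x; apply: le_trans (HM x) _; rewrite lerDl.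
- by move=> x; apply: le_trans (HM' x) _; rewrite lerDr.
Qed.

Lemma Rint_kernel_shift K (psi : V -> R) y : loc_ig K -> continuous psi -> (exists r : R, csupp r psi) ->
  \int[mu]_x (K (x - y) * psi x) = \int[mu]_z (K z * psi (z + y)).
Proof.
move=> Ki pc [r pr].
have c' : csupp (r + enorm y) (fun z : V => psi (z + y)).
  by move=> z zr; apply: pr; have := enormB_ge z (- y); rewrite opprK enormN; lra.
have cc : continuous (fun z : V => psi (z + y)).
  move=> z; apply: (@continuous_comp _ _ _ (fun z : V => z + y) psi); last exact: pc.
  by apply: (@cvgD _ _ _ _ (nbhs_filter z)); [exact: cvg_id|exact: cvg_cst].
rewrite -(Rint_shift (- y) (loc_ig_mulc Ki cc c')).
by apply: eq_Rint => x; rewrite subrK.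
Qed.

(** Fubini moves the Laplacian under the integral in [y], where the identity for [K] is applied to
    the test function translated by [y]. *)
Lemma wlap_conv K K' (a : R) : kernel K -> kernel K' ->
  (forall psi, testfun psi -> \int[mu]_z (K z * lap psi z) = - a * \int[mu]_z (K' z * psi z)) ->
  wlap (conv K) (fun x => a * conv K' x).
Proof.
move=> kK kK' KK phi pt; have [r [M [[m1 c1 b1] [m2 c2 b2] [pc lc]]]] := testfun_bounds pt.
have [_ H] := conv_spec kK; have [li' H'] := conv_spec kK'.
have [-> _] := H r M _ m2 c2 b2.
have [E' i'] := H' r M _ m1 c1 b1.
rewrite [in RHS](eq_Rint_to (g := fun x => a * (conv K' x * phi x))); last by move=> x; rewrite mulrA.
rewrite RintZl; last exact: (loc_ig_mul li' m1 c1 b1).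
rewrite E' -mulNr -RintZl//; apply: eq_Rint => y.
rewrite mulrA; congr (_ * _).
have [lK _ _] := kK; have [lK' _ _] := kK'.
have [pt' lt'] := shift_testfun y pt.
rewrite (Rint_kernel_shift _ lK lc); last by exists r.
rewrite (Rint_kernel_shift _ lK' pc); last by exists r.
rewrite -(KK _ pt'); apply: eq_Rint => z; by rewrite lt'.
Qed.

Lemma wlap_conv_dirac K (b : R) : kernel K ->
  (forall psi, testfun psi -> \int[mu]_z (K z * lap psi z) = - b * psi 0) ->
  wlap (conv K) (fun x => b * f x).
Proof.
move=> kK KK phi pt; have [r [M [[m1 c1 b1] [m2 c2 b2] [pc lc]]]] := testfun_bounds pt.
have [_ H] := conv_spec kK; have [lK _ _] := kK.
have [-> _] := H r M _ m2 c2 b2.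
rewrite -RintN; last first.
  apply: ig_ext (igZl b (ig_mulb fi m1 b1)) => x; ring.
apply: eq_Rint => y; have [pt' lt'] := shift_testfun y pt.
rewrite (Rint_kernel_shift _ lK lc); last by exists r.
rewrite (eq_Rint_to (g := fun z => K z * lap (fun z => phi (z + y)) z)); last by move=> z; rewrite lt'.
rewrite KK// add0r; ring.
Qed.

Lemma invenorm_section (M r : R) x : 0 <= M -> (forall y, enorm y <= r + 1 -> `|f y| <= M) -> enorm x <= r ->
  ig mu (fun y => (enorm (x - y))^-1 * f y) /\
  \int[mu]_y ((enorm (x - y))^-1 * `|f y|) <= M * kball (fun z => (enorm z)^-1) + \int[mu]_y `|f y|.
Proof. exact: kernel_section kernel_invenorm fi. Qed.

Lemma ig_invenorm x : ig mu (fun y => (enorm (x - y))^-1 * `|f y|).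
Proof.
have [M [M0 HM]] := fb (enorm x + 1); have [i _] := invenorm_section M0 HM (lexx _).
by apply: ig_ext (ig_abs i) => y; rewrite normrM ger0_norm// invr_ge0 enorm_ge0.
Qed.

Lemma ig_invenorm0 : ig mu (fun y => (enorm y)^-1 * `|f y|).
Proof. by apply: ig_ext (ig_invenorm 0) => y; rewrite sub0r enormN. Qed.

Lemma ig_lk x : ig mu (fun y => lk x y * f y).
Proof.
apply: (ig_le (igZl (enorm x) (igD ig_invenorm0 (ig_invenorm x)))).
  apply: measurable_funM; last exact: ig_measurable fi.
  apply: (measurableT_comp (f := @ln R)); first exact: measurable_ln.
  apply: measurable_funM; first exact: measurable_enorm.
  by apply: (measurableT_comp measurable_invenorm); apply: measurable_vecB2; [exact: measurable_cst|exact: measurable_id].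
move=> y; rewrite normrM; apply: le_trans (ler_wpM2r (normr_ge0 _) (lk_le x y)) _.
by rewrite -mulrA mulrDl.
Qed.

Definition vlog x := \int[mu]_y (lk x y * f y).
(** Nonnegative majorant of [vlog]; all growth estimates go through it. *)
Definition vabs x := \int[mu]_y `|lk x y * f y|.

Lemma vlog_le x : `|vlog x| <= vabs x.
Proof. by apply: Rint_norm_le; [exact: ig_measurable (ig_lk x)|exact: ig_abs (ig_lk x)|]. Qed.

Let A := kball (fun z : V => (enorm z)^-1).

Let A0 : 0 <= A. Proof. exact: kball_ge0 kernel_invenorm. Qed.

Lemma lk_ball (r : R) y : 0 <= r -> ig mu (fun x => inb r x * lk x y) /\
  \int[mu]_x (inb r x * `|lk x y|) <= r * ((enorm y)^-1 * \int[mu]_x inb r x + (A + \int[mu]_x inb r x)).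
Proof.
move=> r0; have i1 (x : V) : inb r x <= 1 by apply: le_trans (ler_norm _) (norm_inb _ _).
have [j1 j2] := kernel_shift y kernel_invenorm (ig_ball r) (inb_ge0 r) i1.
have i3 : ig mu (fun x : V => r * ((enorm y)^-1 * inb r x + inb r x * (enorm (x - y))^-1)).
  by apply: igZl; apply: igD => //; apply: igZl; exact: ig_ball.
have H x : inb r x * `|lk x y| <= r * ((enorm y)^-1 * inb r x + inb r x * (enorm (x - y))^-1).
  have [xr|xr] := leP (enorm x) r; last by rewrite inb0// !(mul0r, mulr0) addr0 mulr0.
  rewrite inb1// !mul1r mulr1; apply: le_trans (lk_le x y) _.
  by rewrite ler_wpM2r// addr_ge0 ?invr_ge0 ?enorm_ge0.
have m1 : measurable_fun setT (fun x : V => inb r x * lk x y).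
  apply: measurable_funM; first exact: measurable_inb.
  apply: (measurableT_comp (f := @ln R)); first exact: measurable_ln.
  apply: measurable_funM; first exact: measurable_cst.
  by apply: (measurableT_comp measurable_invenorm); exact: measurable_vecD.
have i4 : ig mu (fun x : V => inb r x * lk x y).
  by apply: (ig_le i3 m1) => x; rewrite normrM (ger0_norm (inb_ge0 _ _)).
split => //.
have i5 : ig mu (fun x : V => inb r x * `|lk x y|).
  by apply: ig_ext (ig_abs i4) => x; rewrite normrM (ger0_norm (inb_ge0 _ _)).
apply: le_trans (Rint_le i5 i3 H) _.
rewrite RintZl; last by apply: igD => //; apply: igZl; exact: ig_ball.
rewrite RintD//; last by apply: igZl; exact: ig_ball.
rewrite RintZl; last exact: ig_ball.
by rewrite ler_wpM2l// lerD2l; move: j2; rewrite mul1r.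
Qed.

Lemma lk_operator_bound (r : R) : 0 <= r ->
  let g y := r * ((enorm y)^-1 * \int[mu]_x inb r x + (A + \int[mu]_x inb r x)) * `|f y| in
  ig mu g /\ forall y, ig mu (fun x => inb r x * (lk x y * f y)) /\
     \int[mu]_x (inb r x * `|lk x y * f y|) <= g y.
Proof.
move=> r0 g; split.
  apply: ig_ext (igZl r (igD (igZl (\int[mu]_x inb r x) ig_invenorm0) (igZl (A + \int[mu]_x inb r x) (ig_abs fi)))) => y.
  rewrite /g; ring.
move=> y; have [i1 i2] := lk_ball y r0; split.
  by apply: ig_ext (igZr (f y) i1) => x; rewrite mulrA.
rewrite (eq_Rint_to (g := fun x => inb r x * `|lk x y| * `|f y|)); last by move=> x; rewrite normrM mulrA.
rewrite RintZr; first by rewrite ler_wpM2r.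
by apply: ig_ext (ig_abs i1) => x; rewrite normrM (ger0_norm (inb_ge0 _ _)).
Qed.

Lemma inb_neg (r : R) (x : V) : r < 0 -> inb r x = 0.
Proof. by move=> r0; rewrite inb0// (lt_le_trans r0)// enorm_ge0. Qed.

(** Stated for any integrand with the modulus of [lk x y * f y], so as to serve both [vlog] and
    [vabs]. *)
Lemma lk_spec (G : V * V -> R) : measurable_fun setT G ->
  (forall x y, `|G (x, y)| = `|lk x y * f y|) ->
  let T x := \int[mu]_y G (x, y) in
  loc_ig T /\ forall (r M : R) (k : V -> R), measurable_fun setT k -> csupp r k -> (forall x, `|k x| <= M) ->
    \int[mu]_x (T x * k x) = \int[mu]_y \int[mu]_x (G (x, y) * k x) /\
    ig mu (fun y => \int[mu]_x (G (x, y) * k x)).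
Proof.
move=> mG GE; apply: integral_operator => // [x|r].
  apply: (ig_le (ig_abs (ig_lk x))) => [|y]; last by rewrite GE.
  exact: (measurableT_comp mG (pair1_measurable x)).
have [r0|r0] := leP 0 r; last first.
  exists (fun=> 0); split; first exact: ig_cst0.
  move=> y; split.
    by apply: ig_ext (ig_cst0 _) => x; rewrite inb_neg// mul0r.
  rewrite (eq_Rint_to (g := fun=> 0)) ?Rint_zero// => x; by rewrite inb_neg// mul0r.
have [gi H] := lk_operator_bound r0.
exists (fun y => r * ((enorm y)^-1 * \int[mu]_x inb r x + (A + \int[mu]_x inb r x)) * `|f y|); split => // y.
have [i1 i2] := H y; split.
  apply: (ig_le (ig_abs i1)) => [|x]; last by rewrite !normrM GE -normrM.
  apply: measurable_funM; first exact: measurable_inb.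
  exact: (measurableT_comp mG (pair2_measurable y)).
rewrite (eq_Rint_to (g := fun x => inb r x * `|lk x y * f y|))// => x; by rewrite GE.
Qed.

Lemma vlog_spec : loc_ig vlog /\ forall (r M : R) (k : V -> R), measurable_fun setT k -> csupp r k ->
  (forall x, `|k x| <= M) ->
    \int[mu]_x (vlog x * k x) = \int[mu]_y \int[mu]_x (lk x y * f y * k x) /\
    ig mu (fun y => \int[mu]_x (lk x y * f y * k x)).
Proof.
apply: (lk_spec (G := fun xy => lk xy.1 xy.2 * f xy.2)) => //.
apply: measurable_funM; first exact: measurable_lk.
by apply: (measurableT_comp (ig_measurable fi)); exact: measurable_snd.
Qed.

Lemma vabs_spec : loc_ig vabs /\ forall (r M : R) (k : V -> R), measurable_fun setT k -> csupp r k ->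
  (forall x, `|k x| <= M) ->
    \int[mu]_x (vabs x * k x) = \int[mu]_y \int[mu]_x (`|lk x y * f y| * k x) /\
    ig mu (fun y => \int[mu]_x (`|lk x y * f y| * k x)).
Proof.
apply: (lk_spec (G := fun xy => `|lk xy.1 xy.2 * f xy.2|)) => // [|x y]; last by rewrite normr_id.
apply: measurableT_comp => //; apply: measurable_funM; first exact: measurable_lk.
by apply: (measurableT_comp (ig_measurable fi)); exact: measurable_snd.
Qed.

(** Integrating [lk_le] loses one power of [r] against the volume. This is affordable: the Liouville
    argument tolerates [r^(n + 2 (m - 1))] with [m > 1]. *)
Lemma vabs_growth : exists C : R, forall r : R, 1 <= r -> \int[mu]_x (inb r x * vabs x) <= C * r ^+ n.+1.
Proof.
have [Cv [Cv0 HCv]] := @Rint_inb_le R n.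
pose B := \int[mu]_y ((enorm y)^-1 * `|f y|); pose F := \int[mu]_y `|f y|.
have B0 : 0 <= B by apply: Rint_ge0 => y; rewrite mulr_ge0// invr_ge0 enorm_ge0.
have F0 : 0 <= F by apply: Rint_ge0.
exists (Cv * B + (A + Cv) * F) => r r1; have r0 : 0 < r by lra.
have mi : measurable_fun setT (fun x : V => inb r x) by exact: measurable_inb.
have ir : csupp r (fun x : V => inb r x) by move=> x xr; rewrite inb0.
have [_ H] := vabs_spec; have [E i] := H r 1 _ mi ir (norm_inb r).
rewrite (eq_Rint_to (g := fun x => vabs x * inb r x)); last by move=> x; rewrite mulrC.
have [gi Hg] := lk_operator_bound (ltW r0).
rewrite E; apply: le_trans (Rint_le i gi _) _.
  move=> y; rewrite (eq_Rint_to (g := fun x => inb r x * `|lk x y * f y|)); last by move=> x; rewrite mulrC.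
  exact: (Hg y).2.
set I := \int[mu]_x inb r x; have I0 : 0 <= I by apply: Rint_ge0 => x; exact: inb_ge0.
rewrite (eq_Rint_to (g := fun y => r * I * ((enorm y)^-1 * `|f y|) + r * (A + I) * `|f y|)); last by move=> y; ring.
rewrite RintD; [|by apply: igZl; exact: ig_invenorm0|by apply: igZl; exact: ig_abs].
rewrite RintZl; last exact: ig_invenorm0.
rewrite RintZl; last exact: ig_abs.
rewrite -/B -/F; have := HCv r r0; rewrite -/I => HI.
have rn1 : 1 <= r ^+ n by rewrite exprn_ege1.
rewrite (_ : (Cv * B + (A + Cv) * F) * r ^+ n.+1 = r * (Cv * r ^+ n) * B + r * (A * r ^+ n + Cv * r ^+ n) * F); last by rewrite exprS; ring.
have AA : A <= A * r ^+ n by rewrite ler_peMr.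
apply: lerD; rewrite ler_wpM2r// ler_wpM2l ?(ltW r0)//.
exact: lerD.
Qed.

Lemma Rint_le_except2 (g h : V -> R) a b : ig mu g -> ig mu h ->
  (forall y, y != a -> y != b -> g y <= h y) -> \int[mu]_y g y <= \int[mu]_y h y.
Proof.
move=> gi hi H; pose pt c (y : V) : R := inb 0 (y - c).
have pi c : ig mu (pt c) by exact: ig_shift (- c) (ig_ball 0).
have pI c : \int[mu]_y pt c y = 0 by rewrite (Rint_shift (- c) (ig_ball 0)) Rint_inb0.
have pE c y : pt c y = (y == c)%:R by rewrite /pt inb0E subr_eq0.
(* [g] is lowered at [a] and [b] until it lies below [h] there; indicators of points have integral
   0. *)
pose g' y := g y + (`|g a| + `|h a|) * - pt a y + (`|g b| + `|h b|) * - pt b y.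
have ipt c (s : R) : ig mu (fun y => s * - pt c y) by apply: igZl; exact: igN.
have Ipt c (s : R) : \int[mu]_y (s * - pt c y) = 0 by rewrite RintZl ?RintN ?pI ?oppr0 ?mulr0//; exact: igN.
have E : \int[mu]_y g y = \int[mu]_y g' y.
  by rewrite /g' RintD ?RintD ?Ipt ?addr0//; apply: igD.
rewrite E; apply: Rint_le => //; first by apply: igD => //; exact: igD.
move=> y; rewrite /g' !pE.
have := ler_norm (g y); have := ler_norm (- h y); rewrite normrN.
have := normr_ge0 (g a); have := normr_ge0 (h a); have := normr_ge0 (g b); have := normr_ge0 (h b).
have [ya|ya] := eqVneq y a; have [yb|yb] := eqVneq y b; rewrite ?mulr0 ?mulr1 ?mulrN1 ?mulrN ?mulr0 ?oppr0 ?addr0.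
- by rewrite -ya -yb; lra.
- by rewrite -ya; lra.
- by rewrite -yb; lra.
- by move=> *; exact: H.
Qed.

(** Kernel differences are bounded by [|x - x'|^(1/2)] times [1 + 1 / |x - y| + 1 / |x' - y|], whose
    integrals against [|f|] are bounded uniformly for [x'] near [x]. *)
Lemma vlog_continuous : continuous vlog.
Proof.
move=> x; apply/continuous_at_near => e e0.
pose r := enorm x + 1; have [M [M0 HM]] := fb (r + 1).
pose F := \int[mu]_y `|f y|; have F0 : 0 <= F by apply: Rint_ge0.
pose B := F + (M * A + F) + (M * A + F).
have B0 : 0 <= B by rewrite !addr_ge0// mulr_ge0.
pose t := e / (B + 1); have t0 : 0 < t by rewrite divr_gt0//; lra.
pose d := Num.min 1 (t ^+ 2); have d0 : 0 < d by rewrite lt_min ltr01 exprn_gt0.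
have dn : 0 < d / n.+1%:R by rewrite divr_gt0// ltr0n.
apply: filterS (near_norm x dn) => x' xx'.
have [->|nx] := eqVneq x' x; first by rewrite subrr normr0 ltW.
pose q := enorm (x - x'); have q0 : 0 < q by apply: enorm_gt0; rewrite subr_eq0 eq_sym.
have qd : q <= d.
  apply: le_trans (enorm_le_norm _) _; rewrite mulrC -ler_pdivlMr ?ltr0n//.
  apply: le_trans (ltW xx') _.
  by rewrite ler_pM2l// lef_pV2 ?posrE ?ltr0n// ler_nat.
have q1 : q <= 1 by apply: le_trans qd _; rewrite ge_min lexx.
pose s := Num.sqrt q; have s0 : 0 < s by rewrite sqrtr_gt0.
have ss : s * s = q by rewrite -expr2 sqr_sqrtr// ltW.
have st : s <= t.
  rewrite -(ler_pXn2r (n := 2)) ?nnegrE ?(ltW s0) ?(ltW t0)// expr2 ss.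
  by apply: le_trans qd _; rewrite ge_min lexx orbT.
have xr : enorm x <= r by rewrite lerDl.
have xr' : enorm x' <= r by have := enormB_ge x' x; rewrite enormBC -/q /r; lra.
have [_ I1] := invenorm_section M0 HM xr; have [_ I2] := invenorm_section M0 HM xr'.
have key y : y != x -> y != x' -> `|lk x y - lk x' y| <= s * (1 + (enorm (x - y))^-1 + (enorm (x' - y))^-1).
  move=> yx yx'; set b := enorm (x - y); set b' := enorm (x' - y).
  have b0 : 0 < b by apply: enorm_gt0; rewrite subr_eq0 eq_sym.
  have b'0 : 0 < b' by apply: enorm_gt0; rewrite subr_eq0 eq_sym.
  have i0 : 0 < b^-1 by rewrite invr_gt0.
  have i'0 : 0 < b'^-1 by rewrite invr_gt0.
  have [->|y0] := eqVneq y 0.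
    by rewrite /lk enorm0 !mul0r subrr normr0 mulr_ge0 ?(ltW s0)//; lra.
  have yp : 0 < enorm y by rewrite enorm_gt0.
  rewrite /lk -/b -/b' !ln_div ?posrE//.
  have -> : ln (enorm y) - ln b - (ln (enorm y) - ln b') = ln b' - ln b by ring.
  have T (u w : R) : 0 < u -> 0 < w -> u <= w + q -> ln u - ln w <= s * (1 + w^-1).
    move=> u0 w0 uw; rewrite -ln_div ?posrE//.
    apply: (@le_trans _ _ (ln ((1 + s) * (1 + s / w)))).
      rewrite ler_ln ?posrE ?divr_gt0 ?mulr_gt0 ?addr_gt0 ?divr_gt0//.
      rewrite ler_pdivrMr// (_ : _ * w = (w + s * s) + s * w + s); last by field; rewrite gt_eqF.
      rewrite ss; apply: le_trans uw _; rewrite -addrA lerDl addr_ge0 ?mulr_ge0 ?ltW//.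
    rewrite lnM ?posrE ?addr_gt0 ?divr_gt0// mulrDr mulr1; apply: lerD; apply: le_ln1Dx.
      by rewrite (lt_trans _ s0)// ltrN10.
    by rewrite (lt_trans _ (divr_gt0 s0 w0))// ltrN10.
  have h1 : b' <= b + q.
    by have := enormD (x - y) (x' - x); rewrite addrC addrA subrK [enorm (x' - x)]enormBC.
  have h2 : b <= b' + q.
    by have := enormD (x' - y) (x - x'); rewrite addrC addrA subrK.
  have P1 : 0 <= s * b^-1 by rewrite mulr_ge0 ?ltW.
  have P2 : 0 <= s * b'^-1 by rewrite mulr_ge0 ?ltW.
  have := T _ _ b'0 b0 h1; have := T _ _ b0 b'0 h2; rewrite !mulrDr !mulr1 ler_norml => k1 k2.
  by apply/andP; split; lra.
have ir : ig mu (fun y => s * (`|f y| + (enorm (x - y))^-1 * `|f y| + (enorm (x' - y))^-1 * `|f y|)).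
  by apply: igZl; apply: igD; [apply: igD; [exact: ig_abs|exact: ig_invenorm]|exact: ig_invenorm].
have il : ig mu (fun y => lk x y * f y - lk x' y * f y) by apply: igB; exact: ig_lk.
have H y : y != x -> y != x' -> `|lk x y * f y - lk x' y * f y| <= s * (`|f y| + (enorm (x - y))^-1 * `|f y| + (enorm (x' - y))^-1 * `|f y|).
  move=> yx yx'; rewrite -mulrBl normrM; apply: le_trans (ler_wpM2r (normr_ge0 _) (key y yx yx')) _.
  by rewrite -mulrA !mulrDl mul1r.
rewrite /vlog -RintB; [|exact: ig_lk|exact: ig_lk].
apply: (@le_trans _ _ (\int[mu]_y (s * (`|f y| + (enorm (x - y))^-1 * `|f y| + (enorm (x' - y))^-1 * `|f y|)))).
  rewrite ler_norml; apply/andP; split.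
    rewrite lerNl -RintN//; apply: (Rint_le_except2 (a := x) (b := x')) => // [|y yx yx']; first exact: igN.
    by apply: le_trans (H y yx yx'); rewrite -normrN ler_norm.
  by apply: (Rint_le_except2 (a := x) (b := x')) => // y yx yx'; apply: le_trans (H y yx yx'); exact: ler_norm.
rewrite RintZl; last by apply: igD; [apply: igD; [exact: ig_abs|exact: ig_invenorm]|exact: ig_invenorm].
rewrite RintD; [|by apply: igD; [exact: ig_abs|exact: ig_invenorm]|exact: ig_invenorm].
rewrite RintD; [|exact: ig_abs|exact: ig_invenorm].
apply: (@le_trans _ _ (t * B)).
  apply: ler_pM => //; [exact: ltW| |by rewrite !lerD].
  by rewrite !addr_ge0//; apply: Rint_ge0 => y; rewrite ?mulr_ge0 ?invr_ge0 ?enorm_ge0.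
by rewrite /t mulrAC ler_pdivrMr; [rewrite ler_pM2l//; lra|lra].
Qed.

Lemma Rint_lap0 (psi : V -> R) : testfun psi -> \int[mu]_z lap psi z = 0.
Proof.
move=> pt; have [r [M [[m1 c1 b1] [m2 c2 b2] [pc lc]]]] := testfun_bounds pt.
have pC2 : Ck 2 psi := Ck_le (isT : (2 <= 4)%N) pt.1.
transitivity (\int[mu]_z (1 * lap psi z)); first by apply: eq_Rint => z; rewrite mul1r.
rewrite (Rint_lap_sym (@Ck_cst R n 2 1) pC2 c1).
transitivity (\int[mu]_(z in [set: V]) (0 : R)); last exact: Rint_zero.
by apply: eq_Rint => z; rewrite lap_cst mulr0.
Qed.

(** Off the origin [lk (z + y) y = ln |y| - ln |z|^2 / 2]. The constant disappears because the
    Laplacian of a test function has integral 0, and [riesz_ln] treats the logarithm. *)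
Lemma log_pairing (psi : V -> R) y : y != 0 -> testfun psi ->
  ig mu (fun z => lk (z + y) y * lap psi z) /\
  \int[mu]_z (lk (z + y) y * lap psi z) = - (n%:R - 2) * \int[mu]_z (sg 0 (- 1%:R) z * psi z).
Proof.
move=> y0 pt; have yp : 0 < enorm y := enorm_gt0 y0.
have [r [M [[m1 c1 b1] [m2 c2 b2] [pc lc]]]] := testfun_bounds pt.
have lK : loc_ig (fun z => lk (z + y) y).
  apply: loc_ig_inb => s; have [i1 _] := lk_ball y (normr_ge0 (s + enorm y)).
  have mlk : measurable_fun setT (fun z : V => lk (z + y) y).
    apply: (measurableT_comp (f := @ln R)); first exact: measurable_ln.
    apply: measurable_funM; first exact: measurable_cst.
    apply: (measurableT_comp measurable_invenorm); apply: measurable_vecB2; last exact: measurable_cst.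
    exact: measurable_vecD.
  apply: (ig_le (ig_abs (ig_shift y i1))); first by apply: measurable_funM => //; exact: measurable_inb.
  move=> z /=; rewrite !normrM (ger0_norm (inb_ge0 s z)) (ger0_norm (inb_ge0 _ (z + y))); apply: ler_wpM2r => //; rewrite /inb.
  case: (leP _ s) => zs; last by case: ifP.
  by rewrite (le_trans (enormD z y))// (le_trans (lerD zs (lexx _)))// ler_norm.
have i0 : ig mu (fun z => lk (z + y) y * lap psi z) := loc_ig_mul lK m2 c2 b2.
split => //.
have lnl : loc_ig (fun z : V => ln (nsq z)).
  apply: loc_ig_inb => s; apply: (ig_le0 ((loc_ig_ln_bound n3).2 s)).
  - apply: measurable_funM; first exact: measurable_inb.
    by apply: (measurableT_comp (f := @ln R)); [exact: measurable_ln|apply: measurable_continuous; exact: continuous_nsq].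
  - move=> z z0; rewrite normrM (ger0_norm (inb_ge0 _ _)) ler_wpM2l ?inb_ge0//.
    by have := ln_nsq_bound (lexx 0) ler01 z0; rewrite addr0.
have j1 : ig mu (fun z => ln (nsq z) * lap psi z) := loc_ig_mul lnl m2 c2 b2.
have j2 : ig mu (lap psi) := ig_csupp lc c2.
have m3 : measurable_fun setT (fun z => ln (enorm y) * lap psi z - 2^-1 * (ln (nsq z) * lap psi z)).
  exact: ig_measurable (igB (igZl _ j2) (igZl _ j1)).
have E z : z != 0 -> lk (z + y) y * lap psi z = ln (enorm y) * lap psi z - 2^-1 * (ln (nsq z) * lap psi z).
  move=> z0; have zp : 0 < enorm z := enorm_gt0 z0.
  rewrite /lk addrK ln_div ?posrE// -sqr_enorm lnXn// -mulr_natl.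
  by move: (ln _) (ln _) (lap _ _) => a b c; field.
rewrite (eq_Rint0 i0 m3 E).2 (RintB (igZl _ j2) (igZl _ j1)) (RintZl _ j2) (RintZl _ j1).
rewrite (riesz_ln n3 pt) (Rint_lap0 pt).
by move: (Rintegral _ _ _) => a; field.
Qed.

Lemma wlap_vlog : wlap vlog (fun x => (n%:R - 2) * conv (sg 0 (- 1%:R)) x).
Proof.
move=> phi pt; have [r [M [[m1 c1 b1] [m2 c2 b2] [pc lc]]]] := testfun_bounds pt.
have k1 : kernel (sg 0 (- 1%:R)) by apply: kernel_sg; exact: n3.
have [_ H] := vlog_spec; have [li' H'] := conv_spec k1.
have [-> iL] := H r M _ m2 c2 b2; have [E' i'] := H' r M _ m1 c1 b1.
rewrite [in RHS](eq_Rint_to (g := fun x => (n%:R - 2) * (conv (sg 0 (- 1%:R)) x * phi x))); last by move=> x; rewrite mulrA.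
rewrite RintZl; last exact: (loc_ig_mul li' m1 c1 b1).
rewrite E' -mulNr -RintZl//.
have mm := ig_measurable (igZl (- (n%:R - 2)) i').
(* At [y = 0] the identity may fail, as [lk x 0] is [ln 0 = 0]; a single point is negligible. *)
apply: (eq_Rint0 iL mm _).2 => y y0; have yp : 0 < enorm y by rewrite enorm_gt0.
rewrite mulrA (eq_Rint_to (g := fun x => lk x y * lap phi x * f y)); last by move=> x; rewrite mulrAC.
have [pt' lt'] := shift_testfun y pt.
have [r' [M' [[m1' c1' b1'] [m2' c2' b2'] [pc' lc']]]] := testfun_bounds pt'.
have [i0 I0] := log_pairing y0 pt'.
have i0' : ig mu (fun x => lk x y * lap phi x).
  by apply: ig_ext (ig_shift (- y) i0) => x /=; rewrite subrK lt' subrK.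
rewrite RintZr//; congr (_ * _).
have -> : \int[mu]_x (lk x y * lap phi x) = \int[mu]_z (lk (z + y) y * lap (fun z => phi (z + y)) z).
  rewrite -[RHS](Rint_shift (- y) i0); apply: eq_Rint => x /=; by rewrite subrK lt' subrK.
have [lk1 _ _] := k1.
by rewrite I0 (Rint_kernel_shift _ lk1 pc)//; exists r.
Qed.

End density.
End kernels.

(** * Local Lipschitz bounds of polynomial growth *)

Section polynomial_growth.
Context {R : realType} {n : nat}.
Notation V := 'rV[R]_n.
Implicit Types (f g : V -> R) (x y : V).

(** Designed for averaging over tiny balls: within distance [(|x| + 2)^-(k+1)] of [x] such a
    function varies by at most [C]. *)
Definition plip f := exists (C : R) (k : nat), 0 <= C /\ forall x y, enorm (x - y) <= 1 ->
  `|f x| <= C * (enorm x + 2) ^+ k /\ `|f x - f y| <= C * (enorm x + 2) ^+ k * enorm (x - y).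

Lemma X2_ge1 x : 1 <= enorm x + 2 :> R.
Proof. by have := enorm_ge0 x; lra. Qed.

Lemma plip_cst (c : R) : plip (fun=> c).
Proof.
exists `|c|, 0%N; split => // x y _; rewrite expr0 mulr1 subrr normr0; split => //.
by rewrite mulr_ge0// enorm_ge0.
Qed.

Lemma plip_coord i : plip (fun x => x ord0 i).
Proof.
exists 1, 1%N; split => // x y _; rewrite !mul1r expr1; split.
  by apply: le_trans (coord_le_enorm x i) _; rewrite lerDl.
have := coord_le_enorm (x - y) i; rewrite !mxE => H; apply: le_trans H _.
by rewrite ler_peMl ?enorm_ge0// X2_ge1.
Qed.

Lemma plipD f g : plip f -> plip g -> plip (fun x => f x + g x).
Proof.
move=> [C [k [C0 HC]]] [D [l [D0 HD]]]; exists (C + D), (k + l)%N.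
split; first exact: addr_ge0.
move=> x y xy; have [a1 a2] := HC x y xy; have [b1 b2] := HD x y xy.
have X := X2_ge1 x; have e0 := enorm_ge0 (x - y).
have k1 : C * (enorm x + 2) ^+ k <= C * (enorm x + 2) ^+ (k + l).
  by rewrite ler_wpM2l// ler_weXn2l// leq_addr.
have l1 : D * (enorm x + 2) ^+ l <= D * (enorm x + 2) ^+ (k + l).
  by rewrite ler_wpM2l// ler_weXn2l// leq_addl.
rewrite !mulrDl; split; first by apply: le_trans (ler_normD _ _) (lerD (le_trans a1 k1) (le_trans b1 l1)).
rewrite opprD addrACA; apply: le_trans (ler_normD _ _) (lerD (le_trans a2 _) (le_trans b2 _)).
- by rewrite ler_wpM2r.
- by rewrite ler_wpM2r.
Qed.

Lemma plipM f g : plip f -> plip g -> plip (fun x => f x * g x).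
Proof.
move=> [C [k [C0 HC]]] [D [l [D0 HD]]]; exists (C * (D * 2 ^+ 1) + C * D * 2 + C * D * 2 ^+ l * 2 ^+ k + C * D * 3 ^+ l + C * D * 3 ^+ k), (k + l)%N.
split; first by rewrite !addr_ge0 ?mulr_ge0 ?exprn_ge0.
move=> x y xy; have [a1 a2] := HC x y xy; have [b1 b2] := HD x y xy.
have xy0 : enorm (y - y) <= 1 by rewrite subrr enorm0.
have [b3 _] := HD y y xy0.
have X := X2_ge1 x; have Y := X2_ge1 y; have e0 := enorm_ge0 (x - y).
have x0 := enorm_ge0 x; have y0 := enorm_ge0 y.
set E := enorm (x - y) in xy a2 b2 e0 *; set p := (enorm x + 2) in X a1 a2 b1 b2 *.
have p0 : 0 <= p by lra.
have YX : enorm y + 2 <= 3 * p.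
  by have := enormB_ge y x; rewrite enormBC -/E /p; lra.
have b4 : `|g y| <= D * (3 ^+ l * p ^+ l).
  apply: le_trans b3 _; rewrite -exprMn ler_wpM2l// lerXn2r ?nnegrE ?mulr_ge0//; lra.
set S := _ + C * D * 3 ^+ k.
have S1 : C * D + C * D * 3 ^+ l <= S.
  have : 0 <= C * D * 2 ^+ l * 2 ^+ k by rewrite !mulr_ge0 ?exprn_ge0.
  have : 0 <= C * D * 3 ^+ k by rewrite !mulr_ge0 ?exprn_ge0.
  have : 0 <= C * D by rewrite mulr_ge0.
  by rewrite /S expr1; lra.
have q0 : 0 <= p ^+ (k + l) by rewrite exprn_ge0.
have CD3 : 0 <= C * D * 3 ^+ l by rewrite !mulr_ge0 ?exprn_ge0.
split.
  apply: (@le_trans _ _ (C * D * p ^+ (k + l))); last by rewrite ler_wpM2r//; lra.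
  by rewrite normrM exprD mulrACA ler_pM.
rewrite (_ : f x * g x - f y * g y = f x * (g x - g y) + (f x - f y) * g y); last by ring.
apply: le_trans (ler_normD _ _) _; rewrite !normrM.
apply: (@le_trans _ _ ((C * D + C * D * 3 ^+ l) * p ^+ (k + l) * E)); last by rewrite !ler_wpM2r.
rewrite !mulrDl exprD; apply: lerD.
  by rewrite (_ : _ * E = (C * p ^+ k) * (D * p ^+ l * E)); [rewrite ler_pM|ring].
by rewrite (_ : _ * E = (C * p ^+ k * E) * (D * (3 ^+ l * p ^+ l))); [rewrite ler_pM|ring].
Qed.

Lemma Pol_plip D f : Pol D f -> plip f.
Proof.
move=> [P [_ fP]].
have X (g : V -> R) k : plip g -> plip (fun x => g x ^+ k).
  move=> gl; elim: k => [|k IH]; first exact: plip_cst.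
  by have := plipM gl IH; congr plip; apply/funext => x; rewrite exprS.
have -> : f = (fun x => \sum_(m <- mpoly.msupp P) mpoly.mcoeff m P * \prod_i x ord0 i ^+ m i).
  by apply/funext => x; rewrite fP /peval mpoly.mevalE.
elim: (mpoly.msupp P) => [|m s IH].
  by have := plip_cst 0; congr plip; apply/funext => x; rewrite big_nil.
have H : plip (fun x => mpoly.mcoeff m P * \prod_i x ord0 i ^+ m i).
  apply: plipM; first exact: plip_cst.
  elim: (index_enum _) => [|i t IHt].
    by have := plip_cst 1; congr plip; apply/funext => x; rewrite big_nil.
  by have := plipM (X _ (m i) (plip_coord i)) IHt; congr plip; apply/funext => x; rewrite big_cons.
by have := plipD H IH; congr plip; apply/funext => x; rewrite big_cons.
Qed.

End polynomial_growth.

(** * Parity of the degree of a polynomial with a logarithmic lower bound *)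

Section even_degree.
Context {R : realType} {n : nat}.
Notation V := 'rV[R]_n.

Lemma digits_inj (B : nat) k (a b : nat -> nat) : (forall i, a i < B)%N -> (forall i, b i < B)%N ->
  (\sum_(i < k) a i * B ^ i = \sum_(i < k) b i * B ^ i)%N -> forall i, (i < k)%N -> a i = b i.
Proof.
elim: k a b => [//|k IH] a b aB bB.
have B0 : (0 < B)%N by exact: leq_ltn_trans (aB 0%N).
have E (c : nat -> nat) : (\sum_(i < k.+1) c i * B ^ i = c 0%N + (\sum_(i < k) c i.+1 * B ^ i) * B)%N.
  rewrite big_ord_recl/= expn0 muln1 big_distrl/=; congr addn.
  by apply: eq_bigr => i _; rewrite /bump/= add1n expnSr mulnA.
rewrite !E => H.
have H0 : a 0%N = b 0%N.
  by have := congr1 (modn^~ B) H; rewrite ![(_ + _ * B)%N]addnC !modnMDl !modn_small.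
move: H; rewrite H0 => /addnI/eqP; rewrite eqn_pmul2r// => /eqP H.
by case=> [//|i] ik; exact: (IH (fun i => a i.+1) (fun i => b i.+1)).
Qed.

(** Along the curve with coordinates [t^(w i)] a monomial becomes a power of [t]. With
    [w i = W + B^i] its exponent is [W] times the total degree plus a number whose base-[B] digits
    are the exponents; so exponents of different monomials differ, and the largest belongs to a
    monomial of top degree. *)
Lemma separating_weights (P : mpoly.mpoly n R) : (0 < pdeg P)%N ->
  exists (w : 'I_n -> nat) (m0 : mpoly.multinom n), [/\ m0 \in mpoly.msupp P, mpoly.mdeg m0 = pdeg P,
    forall i, (1 < w i)%N &
    forall m, m \in mpoly.msupp P -> m != m0 -> (\sum_i m i * w i < \sum_i m0 i * w i)%N].
Proof.
move D_ : (pdeg P) => D D0.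
have mD m : m \in mpoly.msupp P -> (mpoly.mdeg m <= D)%N.
  by rewrite -D_; exact: (pdeg_leP P (pdeg P)).1 (leqnn _) m.
(* Exceeds every exponent occurring in [P], so that exponents are base-[B] digits. *)
have [B B_] : {B | B = D.+1} by exists D.+1.
pose phi (m : mpoly.multinom n) := (\sum_(i < n) m i * B ^ i)%N.
(* Exceeds every value of [phi] on the support, so that comparing keys compares total degrees before
   anything else. *)
have [W W_] : {W | W = (n * (D.+1 * B ^ n)).+2} by eexists.
pose key (m : mpoly.multinom n) := (W * mpoly.mdeg m + phi m)%N.
have miD m i : m \in mpoly.msupp P -> (m i < B)%N.
  move=> mP; rewrite B_ ltnS; apply: leq_trans (mD m mP).
  by rewrite mpoly.mdegE (bigD1 i)//= leq_addr.
have B0 : (0 < B)%N by rewrite B_.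
have phiW m : m \in mpoly.msupp P -> (phi m < W)%N.
  move=> mP; rewrite W_ ltnS ltnW// ltnS; apply: (@leq_trans (\sum_(i < n) D.+1 * B ^ n)).
    apply: leq_sum => i _; apply: leq_mul; first by rewrite -B_ ltnW// miD.
    by rewrite leq_pexp2l// ltnW.
  by rewrite sum_nat_const card_ord.
have phi_inj m m' : m \in mpoly.msupp P -> m' \in mpoly.msupp P -> phi m = phi m' -> m = m'.
  move=> mP mP' E; apply/mpoly.mnmP => i.
  pose a (q : mpoly.multinom n) (j : nat) := if insub j is Some i then q (i : 'I_n) else 0%N.
  have aE q (j : 'I_n) : a q j = q j by rewrite /a valK.
  rewrite -!aE; apply: (@digits_inj B n) => // [j|j|].
  - by rewrite /a; case: insubP => // j' _ _; exact: miD.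
  - by rewrite /a; case: insubP => // j' _ _; exact: miD.
  - rewrite (eq_bigr (fun i : 'I_n => m i * B ^ i)%N) => [|j _]; last by rewrite aE.
    by rewrite -/(phi m) E; apply: eq_bigr => j _; rewrite aE.
have [m1 m1P m1D] : exists2 m1, m1 \in mpoly.msupp P & mpoly.mdeg m1 = D.
  move: D0; rewrite -D_ lt0n /pdeg; elim: (mpoly.msupp P) => [|m s IH]; first by rewrite big_nil.
  rewrite big_cons; have [ms|ms] := leqP (mpoly.mdeg m) (\max_(j <- s) mpoly.mdeg j).
    by move=> /IH[m1 m1s E]; exists m1 => //; rewrite inE m1s orbT.
  by move=> _; exists m; rewrite ?inE ?eqxx.
have [m0 m0P Hm0] : exists2 m0, m0 \in mpoly.msupp P & forall m, m \in mpoly.msupp P -> (key m <= key m0)%N.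
  move: m1P; elim: (mpoly.msupp P) m1 {m1D} => [//|m s IH] m1 _.
  case: s IH => [_|m' s IH].
    by exists m; rewrite ?inE// => m'; rewrite inE => /eqP ->.
  have [m0 m0s H] := IH m' (mem_head _ _).
  have [mm|mm] := leqP (key m) (key m0).
    exists m0; first by rewrite inE m0s orbT.
    by move=> q; rewrite inE => /predU1P[->//|]; exact: H.
  exists m; first exact: mem_head.
  move=> q; rewrite inE => /predU1P[->//|/H qm]; exact: leq_trans qm (ltnW mm).
have m0D : mpoly.mdeg m0 = D.
  apply/eqP; rewrite eqn_leq mD//= leqNgt; apply/negP => lt.
  have := Hm0 m1 m1P; rewrite /key m1D leqNgt => /negP; apply.
  have p0 := phiW m0 m0P.
  have H : (W * mpoly.mdeg m0 + W <= W * D)%N by rewrite addnC -mulnS leq_mul2l lt orbT.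
  by rewrite (leq_trans _ (leq_addr _ _))// (leq_trans _ H)// ltn_add2l.
have keyE (m : mpoly.multinom n) : (\sum_i m i * (W + B ^ i))%N = key m.
  rewrite /key mpoly.mdegE big_distrr -big_split; apply: eq_bigr => i _ /=.
  by rewrite mulnDr [(W * _)%N]mulnC.
exists (fun i => W + B ^ i)%N, m0; split => //.
  by move=> i; rewrite W_ (leq_trans _ (leq_addr _ _)).
move=> m mP mm0; rewrite !keyE ltn_neqAle Hm0// andbT; apply: contra mm0 => /eqP E.
have W0 : (0 < W)%N by rewrite W_.
have E' : mpoly.mdeg m = mpoly.mdeg m0.
  have p0 := phiW m0 m0P; have p1 := phiW m mP.
  by have := congr1 (divn^~ W) E; rewrite /key ![(W * _)%N]mulnC !divnMDl// !divn_small// !addn0.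
by apply/eqP; apply: phi_inj => //; move: E; rewrite /key E' => /addnI.
Qed.

(** A linear lower bound, which a logarithm of a power satisfies, is already incompatible with a
    negative leading term of exponent [K > 1]. *)
Lemma poly_log_contra (p : R -> R) (a S L : R) K : 0 < a -> 0 <= S -> 0 <= L -> (1 < K)%N ->
  (forall t, 1 <= t -> p t <= - a * t ^+ K + S * t ^+ K.-1) ->
  (forall t, 1 <= t -> - (L * t) <= p t) -> False.
Proof.
move=> a0 S0 L0 K2 up lo; pose t : R := 1 + (S + L) / a.
have t1 : 1 <= t by rewrite lerDl divr_ge0// ?addr_ge0// ltW.
have t0 : 0 < t by lra.
have K1 : (0 < K.-1)%N by case: (K) K2 => [//|[]].
have tK : t <= t ^+ K.-1 by rewrite -[leLHS]expr1 ler_weXn2l.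
have tK0 : 0 < t ^+ K.-1 by rewrite exprn_gt0.
have : a * t ^+ K <= (S + L) * t ^+ K.-1.
  have : L * t <= L * t ^+ K.-1 by rewrite ler_wpM2l.
  by move: (up t t1) (lo t t1); rewrite mulNr mulrDl; lra.
have -> : t ^+ K = t * t ^+ K.-1 by rewrite -exprS prednK// ltnW.
rewrite mulrA ler_pM2r// /t mulrDr mulr1 mulrCA divff ?gt_eqF// mulr1; lra.
Qed.

Lemma even_pdeg (P : mpoly.mpoly n R) (C : R) : 0 < C ->
  (forall x : V, - C * ln (enorm x + 2) <= peval P x) -> ~~ odd (pdeg P).
Proof.
move=> C0 HP; apply/negP => oddP.
have D0 : (0 < pdeg P)%N by case: (pdeg P) oddP.
have [w [m0 [m0P m0D w1 m0max]]] := separating_weights D0.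
pose key (m : mpoly.multinom n) := (\sum_i m i * w i)%N.
pose E := (\sum_i w i)%N.
pose xt (sgn t : R) : V := \row_i (sgn * t ^+ w i).
have ev (sgn t : R) : peval P (xt sgn t) =
    \sum_(m <- mpoly.msupp P) mpoly.mcoeff m P * (sgn ^+ mpoly.mdeg m * t ^+ key m).
  rewrite /peval mpoly.mevalE; apply: eq_bigr => m _; congr (_ * _).
  rewrite mpoly.mdegE /key -!prodrXr -big_split; apply: eq_bigr => i _ /=.
  by rewrite mxE exprMn -exprM [(m i * _)%N]mulnC.
have c0 : mpoly.mcoeff m0 P != 0 by rewrite -mpoly.mcoeff_msupp.
set c := mpoly.mcoeff m0 P in c0.
(* For odd degree the sign can be chosen so that the leading coefficient along the curve is
   [- |c|]. *)
pose sgn : R := if c < 0 then 1 else -1.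
have nsgn : `|sgn| = 1 by rewrite /sgn; case: ifP => _; rewrite ?normrN normr1.
have csgn : c * sgn ^+ pdeg P = - `|c|.
  rewrite /sgn; case: ltP => cc; first by rewrite expr1n mulr1 ltr0_norm// opprK.
  by rewrite -signr_odd oddP expr1 mulrN1 ger0_norm.
pose K := key m0; have K2 : (1 < K)%N.
  have /eqP : mpoly.mdeg m0 != 0%N by rewrite m0D -lt0n.
  rewrite mpoly.mdegE => /eqP; rewrite sum_nat_eq0 negb_forall => /existsP[i /= mi].
  rewrite /K /key (bigD1 i)//= (leq_trans _ (leq_addr _ _))// (leq_trans (w1 i))//.
  by rewrite leq_pmull// lt0n.
pose S := \sum_(m <- mpoly.msupp P) `|mpoly.mcoeff m P|.
have S0 : 0 <= S by apply: sumr_ge0.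
have np : 1 <= n%:R + 2 :> R by rewrite -natrD ler1n addnS.
pose L : R := C * (ln (n%:R + 2) + E%:R).
have L0 : 0 <= L by rewrite mulr_ge0 ?(ltW C0)// addr_ge0// ln_ge0.
have ac0 : 0 < `|c| by rewrite normr_gt0.
apply: (@poly_log_contra (fun t => peval P (xt sgn t)) _ S L K ac0 S0 L0 K2) => t t1; have t0 : 0 < t := lt_le_trans ltr01 t1.
- rewrite ev (bigD1_seq m0 m0P (mpoly.msupp_uniq P))/=.
  rewrite m0D mulrA csgn lerD2l /S.
  rewrite [in leRHS](bigD1_seq m0 m0P (mpoly.msupp_uniq P))/=.
  rewrite mulrDl; apply: (@le_trans _ _ ((\sum_(i <- mpoly.msupp P | i != m0) `|mpoly.mcoeff i P|) * t ^+ K.-1)); last first.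
    by rewrite lerDr mulr_ge0 ?exprn_ge0// ltW.
  rewrite mulr_suml big_seq_cond [leRHS]big_seq_cond; apply: ler_sum => m /andP[mP mm0].
  apply: le_trans (ler_norm _) _; rewrite normrM ler_wpM2l// normrM normrX nsgn expr1n mul1r.
  rewrite ger0_norm ?exprn_ge0 ?(ltW t0)// ler_weXn2l//.
  by have := m0max m mP mm0; rewrite -/(key m) -/(key m0) -/K; case: (K) => [//|q]; rewrite ltnS.
- apply: le_trans (HP _); rewrite mulNr lerN2 /L -mulrA ler_pM2l//.
  have xb : enorm (xt sgn t) + 2 <= (n%:R + 2) * t ^+ E.
    have tB : 1 <= t ^+ E by rewrite exprn_ege1.
    rewrite mulrDl; apply: lerD; last by rewrite ler_peMr.
    apply: le_trans (enorm_le_sum _) _.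
    apply: (@le_trans _ _ (\sum_(i < n) t ^+ E)); last by rewrite sumr_const card_ord mulr_natl.
    apply: ler_sum => i _; rewrite mxE normrM nsgn mul1r ger0_norm ?exprn_ge0 ?(ltW t0)// ler_weXn2l//.
    by rewrite /E (bigD1 i)//= leq_addr.
  have np0 : 0 < n%:R + 2 :> R := lt_le_trans ltr01 np.
  apply: le_trans (_ : ln ((n%:R + 2) * t ^+ E) <= _).
    rewrite ler_ln ?posrE//; first by rewrite ltr_wpDl// enorm_ge0.
    by rewrite mulr_gt0// exprn_gt0.
  rewrite lnM ?posrE ?exprn_gt0// mulrDl lnXn//; apply: lerD.
    by rewrite ler_peMr// ln_ge0.
  by rewrite -[leLHS]mulr_natl ler_wpM2l// ltW// ln_sublinear.
Qed.

End even_degree.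

(** * The polynomial part and its lower bound *)

Section assembly.
Context {R : realType} {n : nat}.
Hypothesis n3 : (2 < n)%N.
Notation V := 'rV[R]_n.
Notation mu := (@volm R n).
Variable f : V -> R.
Hypothesis fi : ig mu f.
Hypothesis fb : forall r : R, exists M : R, 0 <= M /\ forall y, enorm y <= r -> `|f y| <= M.

Let n0 : (0 < n)%N. Proof. exact: leq_trans n3. Qed.

Lemma loc_ig_vabs : loc_ig (vabs f).
Proof. by have [] := vabs_spec n3 fi fb. Qed.

Lemma polynomial_part (u : V -> R) (h : nat -> V -> R) (m : nat) (c K : R) :
  (1 < m)%N -> (2 * m.-1 < n)%N -> continuous u ->
  0 < K -> (forall x, - K * ln (enorm x + 2) <= u x) ->
  (forall x, h 0%N x = u x - c * vlog f x) ->
  (forall j, (j < m)%N -> loc_ig (h j)) -> (forall j, (j < m)%N -> wlap (h j) (h j.+1)) ->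
  (forall y, h m y = 0) -> Pol (2 * m.-1) (h 0%N).
Proof.
move=> m1 mn uc K0 uK hE hi hw h0.
have m0 : (0 < m)%N by exact: ltnW.
have [C HC] := vabs_growth n3 fi fb.
have [Cv [Cv0 HCv]] := @Rint_inb_le R n.
(* Large enough for [4 < N] and, given [2 * m.-1 < n], for [2 * m.-1 < N]. *)
pose N := (n + 4)%N; have N4 : (4 < N)%N by rewrite /N; lia.
have hc : continuous (h 0%N).
  have -> : h 0%N = (fun x => u x - c * vlog f x) by apply/funext.
  by apply: contB => //; apply: contM; [exact: cont_cst|exact: vlog_continuous].
have [_ vi] := loc_ig_vabs.
pose E : R := 2 * `|c| * C + 2 * K * 3 * Cv.
have C0 : 0 <= C.
  have := HC 1 (lexx 1); rewrite expr1n mulr1; apply: le_trans; apply: Rint_ge0 => x.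
  by rewrite mulr_ge0 ?inb_ge0// /vabs; apply: Rint_ge0.
have [C' HC'] : exists C' : R, forall r : R, 1 <= r ->
    \int[mu]_y (inb r y * `|h 0%N y|) <= C' * r ^+ (n + 2 * m.-1).
  apply: (growth_of_negative_part (C := E) N4 m0 hi hw h0) => r r1.
  have r0 : 0 < r by lra.
  have [mh hi0] := hi 0%N m0; have [_ hai] := loc_ig_abs (hi 0%N m0).
  apply: (@le_trans _ _ (\int[mu]_y (2 * `|c| * (inb r y * vabs f y) + 2 * K * (3 * r) * inb r y))).
    apply: Rint_le.
    - by apply: ig_ext (igB (hai r) (hi0 r)) => y; rewrite mulrBr.
    - by apply: igD; apply: igZl; [exact: vi|exact: ig_ball].
    - move=> y; have [yr|yr] := leP (enorm y) r; last by rewrite inb0// !(mul0r, mulr0) addr0.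
      rewrite inb1// !mul1r mulr1 hE.
      have v1 : `|c * vlog f y| <= `|c| * vabs f y by rewrite normrM ler_wpM2l// vlog_le.
      have u1 := uK y; have y0 := enorm_ge0 y.
      have l1 : ln (enorm y + 2) <= 3 * r.
        by apply: le_trans (ltW (ln_sublinear (_ : 0 < enorm y + 2))) _; lra.
      have l2 : K * ln (enorm y + 2) <= K * (3 * r) by rewrite ler_pM2l.
      have l3 : 0 <= K * (3 * r) by rewrite !mulr_ge0 ?ltW.
      move: v1; rewrite ler_norml => /andP[v1 v2].
      rewrite -!mulrA; have [H|H] := leP 0 (u y - c * vlog f y); first by rewrite ger0_norm//; lra.
      by rewrite ltr0_norm//; move: u1; rewrite mulNr; lra.
  rewrite RintD; [|by apply: igZl; exact: vi|by apply: igZl; exact: ig_ball].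
  have R1 : \int[mu]_y (2 * `|c| * (inb r y * vabs f y)) = 2 * `|c| * \int[mu]_y (inb r y * vabs f y) := RintZl _ (vi r).
  have R2 : \int[mu]_y (2 * K * (3 * r) * inb r y) = 2 * K * (3 * r) * \int[mu]_y inb r y := RintZl _ (ig_ball r).
  rewrite R1 R2; have p1 : r ^+ n.+1 <= r ^+ (n + 2 * m.-1) by rewrite ler_weXn2l//; lia.
  have E0 : 0 <= E by apply: addr_ge0; rewrite !mulr_ge0 ?(ltW K0) ?(ltW Cv0).
  apply: le_trans (ler_wpM2l E0 p1).
  have c0 : 0 <= 2 * `|c| by rewrite mulr_ge0.
  have k0 : 0 <= 2 * K * (3 * r) by rewrite !mulr_ge0 ?(ltW K0) ?(ltW r0).
  apply: le_trans (lerD (ler_wpM2l c0 (HC r r1)) (ler_wpM2l k0 (HCv r r0))) _.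
  rewrite /E exprS le_eqVlt; apply/orP; left; apply/eqP.
  by set X := r ^+ n; ring.
by apply: (liouville (N := N) (C := C')) => //; rewrite /N; lia.
Qed.

(** Beyond distance [s] from [y] the singular factor is at most [1 / s]; within it the bump is at
    most [s^-n] and [Rint_invenorm_ball] applies. The bound is uniform in [y]. *)
Lemma kb_invenorm : exists C : R, 0 < C /\ forall (s : R) x y, 0 < s ->
  ig mu (fun x' => kb 6 s (x - x') * (enorm (x' - y))^-1) /\
  \int[mu]_x' (kb 6 s (x - x') * (enorm (x' - y))^-1) <= C / s.
Proof.
have [C [C0 HC]] := @Rint_invenorm_ball R n n3.
exists (kmass (R := R) (n := n) 6 + C); split; first by rewrite addr_gt0// kmass_gt0.
move=> s x y s0; have sn : 0 <= s^-1 ^+ n by rewrite exprn_ge0// invr_ge0 ltW.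
have ik : ig mu (fun x' => kb 6 s (x - x')) by exact: ig_reflect (ig_kb 5 s0).
have [mI iI] : loc_ig (fun z : V => (enorm z)^-1) by exact: loc_ig_invenorm.
have ib : ig mu (fun x' => inb s (x' - y) * (enorm (x' - y))^-1) by exact: ig_shift (iI s).
have k0 z : 0 <= kb (n := n) 6 s z by exact: kb_ge0.
have H x' : kb 6 s (x - x') * (enorm (x' - y))^-1 <= s^-1 * kb 6 s (x - x') + s^-1 ^+ n * (inb s (x' - y) * (enorm (x' - y))^-1).
  have [d|d] := leP (enorm (x' - y)) s.
    rewrite inb1// mul1r; apply: (@le_trans _ _ (s^-1 ^+ n * (enorm (x' - y))^-1)).
      by rewrite ler_wpM2r ?invr_ge0 ?enorm_ge0// kb_le.
    by rewrite lerDr mulr_ge0 ?invr_ge0 ?(ltW s0).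
  rewrite inb0// mul0r mulr0 addr0 mulrC ler_wpM2r// lef_pV2 ?posrE ?ltW//.
  exact: lt_trans s0 d.
have i2 : ig mu (fun x' => s^-1 * kb 6 s (x - x') + s^-1 ^+ n * (inb s (x' - y) * (enorm (x' - y))^-1)).
  by apply: igD; exact: igZl.
have i1 : ig mu (fun x' => kb 6 s (x - x') * (enorm (x' - y))^-1).
  apply: (ig_le i2) => [|x']; last by rewrite ger0_norm// mulr_ge0 ?invr_ge0 ?enorm_ge0.
  apply: measurable_funM; first exact: ig_measurable ik.
  exact: (measurableT_comp mI (measurable_vecD (- y))).
split => //; apply: le_trans (Rint_le i1 i2 H) _.
rewrite RintD; [|exact: igZl|exact: igZl].
have I1 : \int[mu]_x' kb 6 s (x - x') = kmass 6 := Rint_kb x (isT : (4 < 6)%N) s0.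
rewrite (RintZl _ ik) (RintZl _ ib) I1 (Rint_shift (- y) (iI s)) mulrDl mulrC lerD2l.
apply: (@le_trans _ _ (s^-1 ^+ n * (C * s ^+ n.-1))); first by rewrite ler_wpM2l// HC.
rewrite (_ : s^-1 ^+ n * (C * s ^+ n.-1) = C * s^-1 * (s^-1 * s) ^+ n.-1); last first.
  by rewrite -[X in s^-1 ^+ X](prednK n0) exprS exprMn; ring.
by rewrite mulVf ?gt_eqF// expr1n mulr1.
Qed.

(** For [|x - x'| <= s] the modulus of [lk x' y] is at most [ln (1 + (|x| + 1) / s) + 1 / |y| + s /
    |x' - y|]. Averaging in [x'] makes the last term [O(1)] by [kb_invenorm], and the result is
    integrable against [|f|]. *)
Lemma vabs_average : exists C : R, 0 < C /\ forall (s : R) x, 0 < s -> s <= 1 ->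
  \int[mu]_x' (vabs f x' * kb 6 s (x - x')) <= C * (1 + ln (1 + (enorm x + 1) / s)).
Proof.
have [C1 [C10 HC1]] := kb_invenorm.
set ka := kmass (R := R) (n := n) 6; have ka0 : 0 < ka by exact: kmass_gt0.
pose F := \int[mu]_y `|f y|; pose B := \int[mu]_y ((enorm y)^-1 * `|f y|).
have F0 : 0 <= F by apply: Rint_ge0.
have B0 : 0 <= B by apply: Rint_ge0 => y; rewrite mulr_ge0// invr_ge0 enorm_ge0.
exists (ka * F + C1 * F + ka * B + 1); split.
  apply: ltr_wpDl => //; apply: addr_ge0; [apply: addr_ge0|]; apply: mulr_ge0 => //; exact: ltW.
move=> s x s0 s1; set l := ln _.
have x0 := enorm_ge0 x.
have l1 : 0 <= l by rewrite ln_ge0// lerDl divr_ge0 ?(ltW s0)//; lra.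
have kc : csupp (s + enorm x) (fun x' => kb 6 s (x - x')) by exact: kb_reflect_csupp.
have ik : ig mu (fun x' => kb 6 s (x - x')) by exact: ig_reflect (ig_kb 5 s0).
have kM x' : `|kb 6 s (x - x')| <= s^-1 ^+ n by rewrite ger0_norm ?kb_ge0// kb_le.
have [_ H] := vabs_spec n3 fi fb; have [-> i] := H _ _ _ (ig_measurable ik) kc kM.
have ifF : ig mu (fun y => `|f y|) by exact: ig_abs.
have ifB := ig_invenorm0 n3 fi fb.
have key x' y : `|lk x' y * f y| * kb 6 s (x - x') <=
    `|f y| * ((l + (enorm y)^-1) * kb 6 s (x - x') + s * (kb 6 s (x - x') * (enorm (x' - y))^-1)).
  have k0 : 0 <= kb 6 s (x - x') by exact: kb_ge0.
  have [d|d] := leP (enorm (x - x')) s; last by rewrite (kb_csupp 5 s0 d) !(mulr0, mul0r) addr0 mulr0.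
  rewrite normrM -mulrA mulrCA ler_wpM2l//.
  rewrite (_ : (l + _) * _ + _ = (l + (enorm y)^-1 + s * (enorm (x' - y))^-1) * kb 6 s (x - x')); last by ring.
  rewrite ler_wpM2r//.
  have x'1 : enorm x' <= enorm x + 1 by have := enormB_ge x' x; rewrite enormBC; lra.
  have x'0 := enorm_ge0 x'.
  rewrite /lk; set a := enorm y; set b := enorm (x' - y).
  have a0 : 0 <= a by exact: enorm_ge0.
  have b0 : 0 <= b by exact: enorm_ge0.
  have ia : 0 <= a^-1 by rewrite invr_ge0.
  have ib : 0 <= s * b^-1 by rewrite mulr_ge0 ?invr_ge0 ?(ltW s0).
  have ab : a <= b + enorm x' by have := enormB_ge y x'; rewrite enormBC -/a -/b; lra.
  have ba : b <= a + enorm x' by have := enormD x' (- y); rewrite enormN -/a -/b; lra.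
  have [->|an] := eqVneq a 0; first by rewrite mul0r ln0// normr0 invr0 addr0 addr_ge0.
  have [->|bn] := eqVneq b 0; first by rewrite invr0 mulr0 ln0// normr0 mulr0 addr0 addr_ge0.
  have ap : 0 < a by rewrite lt_def an.
  have bp : 0 < b by rewrite lt_def bn.
  have xs : 0 < 1 + (enorm x + 1) / s by rewrite ltr_wpDr// divr_ge0 ?(ltW s0)// addr_ge0// enorm_ge0.
  have X1 : enorm x' <= (enorm x + 1) / s.
    by apply: le_trans x'1 _; rewrite ler_pdivlMr// ler_piMr//; lra.
  have T (p q e : R) : 0 < p -> 0 < q -> 0 <= e -> p <= q * ((1 + (enorm x + 1) / s) * (1 + e)) -> ln (p / q) <= l + e.
    move=> p0 q0 e0 pq; apply: (@le_trans _ _ (ln ((1 + (enorm x + 1) / s) * (1 + e)))).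
      by rewrite ler_ln ?posrE ?divr_gt0 ?mulr_gt0//; [rewrite ler_pdivrMr// mulrC|lra].
    by rewrite lnM ?posrE//; [rewrite lerD2l; apply: le_ln1Dx; lra|lra].
  have h1 : ln (a / b) <= l + s * b^-1.
    apply: T => //; rewrite (_ : b * _ = (1 + (enorm x + 1) / s) * (b + s)); last by field; rewrite bn/= gt_eqF.
    have X2 : (1 + enorm x' / s) * (b + s) <= (1 + (enorm x + 1) / s) * (b + s).
      by rewrite ler_wpM2r ?lerD2l ?ler_wpM2r ?invr_ge0//; lra.
    apply: le_trans X2; rewrite (_ : _ * _ = b + enorm x' + (s + enorm x' / s * b)); last by field; rewrite gt_eqF.
    by apply: le_trans ab _; rewrite lerDl addr_ge0 ?mulr_ge0 ?invr_ge0 ?(ltW s0).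
  have h2 : ln (b / a) <= l + a^-1.
    apply: T => //; rewrite (_ : a * _ = (1 + (enorm x + 1) / s) * (a + 1)); last by field; rewrite an/= gt_eqF.
    have X2 : (1 + enorm x') * (a + 1) <= (1 + (enorm x + 1) / s) * (a + 1) by rewrite ler_wpM2r ?lerD2l//; lra.
    apply: le_trans X2; rewrite (_ : _ * _ = a + enorm x' + (1 + enorm x' * a)); last by ring.
    by apply: le_trans ba _; rewrite lerDl addr_ge0 ?mulr_ge0.
  rewrite ler_norml; apply/andP; split; last by lra.
  by move: h2; rewrite -[b / a]invrK invf_div lnV ?posrE ?divr_gt0//; lra.
have iG : ig mu (fun y => (ka * l + C1) * `|f y| + ka * ((enorm y)^-1 * `|f y|)) by apply: igD; exact: igZl.
apply: (@le_trans _ _ (\int[mu]_y ((ka * l + C1) * `|f y| + ka * ((enorm y)^-1 * `|f y|)))).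
  apply: Rint_le => // y; have [j1 j2] := HC1 s x y s0.
  have jj : ig mu (fun x' => (l + (enorm y)^-1) * kb 6 s (x - x') + s * (kb 6 s (x - x') * (enorm (x' - y))^-1)).
    by apply: igD; exact: igZl.
  have ja : ig mu (fun x' => `|lk x' y * f y| * kb 6 s (x - x')).
    apply: (ig_le (igZl `|f y| jj)) => [|x']; last by rewrite ger0_norm ?key// mulr_ge0// kb_ge0.
    apply: measurable_funM; last exact: ig_measurable ik.
    apply: measurableT_comp => //; apply: measurable_funM => //.
    exact: (measurableT_comp (@measurable_lk R n) (pair2_measurable y)).
  apply: le_trans (Rint_le ja (igZl `|f y| jj) (fun x' => key x' y)) _.
  rewrite RintZl// RintD; [|exact: igZl|exact: igZl].
  rewrite RintZl// RintZl// Rint_kb// -/ka.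
  rewrite (_ : _ + ka * _ = `|f y| * ((l + (enorm y)^-1) * ka + C1)); last by ring.
  rewrite ler_wpM2l// lerD2l -[leRHS](_ : s * (C1 / s) = _); first by rewrite ler_pM2l.
  by field; rewrite gt_eqF.
rewrite RintD; [|exact: igZl|exact: igZl].
rewrite RintZl// RintZl// -/F -/B.
have : 0 <= ka * B * l by rewrite !mulr_ge0 ?(ltW ka0).
have : 0 <= C1 * F * l by rewrite !mulr_ge0 ?(ltW C10).
have : 0 <= ka * F by rewrite mulr_ge0 ?(ltW ka0).
by move=> a1 a2 a3; rewrite !mulrDl !mulrDr !mulr1; lra.
Qed.

Lemma ln_shift_le (a b c : R) : 0 <= a -> 0 <= b -> b - a <= c -> c <= 1 -> ln (b + 2) <= 2 * ln (a + 2).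
Proof.
move=> a0 b0 ba c1; have a2 : 0 < a + 2 by rewrite ltr_wpDl.
have b2 : 0 < b + 2 by rewrite ltr_wpDl.
by rewrite mulr_natl -lnXn// ler_ln ?posrE ?exprn_gt0// expr2; nra.
Qed.

Lemma polynomial_lower_bound (u P : V -> R) (c K : R) D : Pol D P -> continuous u ->
  0 < K -> (forall x, - K * ln (enorm x + 2) <= u x) ->
  (forall x, P x = u x - c * vlog f x) ->
  exists C : R, 0 < C /\ forall x, - C * ln (enorm x + 2) <= P x.
Proof.
move=> PD uc K0 uK PE; have [Cp [k [Cp0 HCp]]] := Pol_plip PD.
have [Ca [Ca0 HCa]] := vabs_average.
set ka := kmass (R := R) (n := n) 6; have ka0 : 0 < ka by exact: kmass_gt0.
have l2 : 0 < ln 2 :> R by rewrite ln_gt0// ltr1n.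
exists (2 * K + Cp / ln 2 + `|c| * (Ca / ka) * ((ln 2)^-1 + k.+2%:R)); split.
  rewrite ltr_wpDr ?ltr_wpDr ?mulr_gt0// ?divr_ge0 ?(ltW l2)// !mulr_ge0 ?invr_ge0 ?(ltW l2) ?(ltW ka0) ?(ltW Ca0)//.
  by rewrite addr_ge0// invr_ge0 ltW.
move=> x; set X := enorm x + 2; have x0 := enorm_ge0 x.
have X1 : 1 <= X by rewrite /X; apply: (@le_trans _ _ 2); rewrite ?ler1n ?lerDr ?enorm_ge0.
have X0 : 0 < X by lra.
(* On a ball of this radius the polynomial varies by at most [Cp], while [ln (1 / s)] is still a
   multiple of [ln X]. *)
pose s := X^-1 ^+ k.+1; have s0 : 0 < s by rewrite exprn_gt0// invr_gt0.
have s1 : s <= 1 by rewrite exprn_ile1 ?invr_ge0 ?invf_le1 ?(ltW X0).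
have lX : ln 2 <= ln X by rewrite ler_ln ?posrE// /X; lra.
have ik : ig mu (fun x' => kb 6 s (x - x')) by exact: ig_reflect (ig_kb 5 s0).
have PA : continuous P.
  have -> : P = (fun x => u x - c * vlog f x) by apply/funext.
  by apply: contB => //; apply: contM; [exact: cont_cst|exact: vlog_continuous].
have kc : csupp (s + enorm x) (fun x' => kb 6 s (x - x')) by exact: kb_reflect_csupp.
have ck : continuous (fun x' : V => kb 6 s (x - x')) by exact: continuous_kb.
have [_ vi] := loc_ig_vabs.
have iv : ig mu (fun x' => vabs f x' * kb 6 s (x - x')) by exact: loc_ig_mulc loc_ig_vabs ck kc.
have iP : ig mu (fun x' => P x * kb 6 s (x - x')) by exact: igZl.
have low x' : (- (2 * K * ln X) - Cp) * kb 6 s (x - x') - `|c| * (vabs f x' * kb 6 s (x - x')) <= P x * kb 6 s (x - x').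
  have k0 : 0 <= kb 6 s (x - x') by exact: kb_ge0.
  rewrite (_ : _ - _ = (- (2 * K * ln X) - Cp - `|c| * vabs f x') * kb 6 s (x - x')); last by rewrite [RHS]mulrBl -[X in _ = _ - X]mulrA.
  have [d|d] := leP (enorm (x - x')) s; last by rewrite (kb_csupp 5 s0 d) !mulr0.
  rewrite ler_wpM2r//.
  have [_] := HCp x x' (le_trans d s1); rewrite -/X ler_norml => /andP[H1 _].
  have H2 : Cp * X ^+ k * enorm (x - x') <= Cp.
    apply: (@le_trans _ _ (Cp * X ^+ k * s)); first by rewrite ler_wpM2l// mulr_ge0 ?exprn_ge0 ?(ltW X0).
    rewrite -mulrA ler_piMr// /s exprS mulrCA -exprMn divff ?gt_eqF// expr1n mulr1.
    by rewrite invf_le1.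
  have H3 : `|c * vlog f x'| <= `|c| * vabs f x' by rewrite normrM ler_wpM2l// vlog_le.
  have H4 : ln (enorm x' + 2) <= 2 * ln X.
    have x'0 := enorm_ge0 x'; have := enormB_ge x' x; rewrite enormBC => xx.
    exact: (ln_shift_le (enorm_ge0 x) x'0 xx (le_trans d s1)).
  have H5 : K * ln (enorm x' + 2) <= K * (2 * ln X) by rewrite ler_pM2l.
  have := uK x'; move: H3; rewrite mulNr ler_norml => /andP[H3 H3'] H6.
  by have := PE x'; lra.
have ek : \int[mu]_x' kb 6 s (x - x') = ka by exact: Rint_kb.
have H : (- (2 * K * ln X) - Cp) * ka - `|c| * \int[mu]_x' (vabs f x' * kb 6 s (x - x')) <= P x * ka.
  rewrite -ek -(RintZl (- (2 * K * ln X) - Cp) ik) -(RintZl `|c| iv) -(RintZl (P x) ik).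
  rewrite -(RintB (igZl (- (2 * K * ln X) - Cp) ik) (igZl `|c| iv)).
  exact: Rint_le (igB (igZl (- (2 * K * ln X) - Cp) ik) (igZl `|c| iv)) iP low.
have Ha := HCa s x s0 s1.
have lb : ln (1 + (enorm x + 1) / s) <= k.+2%:R * ln X.
  rewrite mulr_natl -lnXn// ler_ln ?posrE ?exprn_gt0//; last first.
    by rewrite ltr_wpDr// divr_ge0 ?(ltW s0)// addr_ge0// enorm_ge0.
  rewrite /s exprVn invrK [X ^+ k.+2]exprS.
  have Xk : 1 <= X ^+ k.+1 by rewrite exprn_ege1.
  have -> : enorm x + 1 = X - 1 by rewrite /X; ring.
  by rewrite mulrBl mul1r addrCA gerDl subr_le0.
have H1 : `|c| * \int[mu]_x' (vabs f x' * kb 6 s (x - x')) <= `|c| * (Ca * (1 + k.+2%:R * ln X)).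
  by rewrite ler_wpM2l//; apply: le_trans Ha _; rewrite ler_pM2l// lerD2l.
rewrite -(ler_pM2r ka0); apply: le_trans H; apply: le_trans (_ : _ <= (- (2 * K * ln X) - Cp) * ka - `|c| * (Ca * (1 + k.+2%:R * ln X))) _; last by rewrite lerD2l lerN2.
have E1 : Cp <= Cp / ln 2 * ln X by rewrite -mulrA ler_peMr// mulrC ler_pdivlMr// mul1r.
have E2 : 1 <= (ln 2)^-1 * ln X by rewrite mulrC ler_pdivlMr// mul1r.
have E3 : `|c| * Ca * (1 + k.+2%:R * ln X) <= `|c| * Ca * (((ln 2)^-1 + k.+2%:R) * ln X).
  apply: ler_wpM2l; first by rewrite mulr_ge0// ltW.
  by rewrite [leRHS]mulrDl lerD2r.
have E4 : Cp * ka <= Cp / ln 2 * ln X * ka by rewrite ler_pM2r.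
rewrite [leLHS](_ : _ = - (2 * K * ln X + Cp / ln 2 * ln X) * ka - `|c| * Ca * (((ln 2)^-1 + k.+2%:R) * ln X)); last by field; rewrite !gt_eqF.
apply: lerB; first by rewrite ler_pM2r// opprD lerD2l lerN2.
by rewrite [leLHS]mulrA.
Qed.

End assembly.

(** * Symmetrised half-Laplacian and its Poisson regularisation *)

Section half_laplacian.
Context {R : realType} {n : nat}.
Hypothesis n3 : (2 < n)%N.
Variable k : nat.
Hypothesis nk : n = (2 * k).+1.
Notation V := 'rV[R]_n.
Notation mu := (@volm R n).
Notation K := k.+1.
Implicit Types (x y z : V) (phi : V -> R).

Let n0 : (0 < n)%N. Proof. exact: leq_trans n3. Qed.

(** [|z|^-(n + 1)], the kernel of the half-Laplacian, as [n + 1 = 2 (k + 1)]. *)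
Definition pw z : R := (nsq z)^-1 ^+ K.
(** Up to a constant the Poisson kernel at height 1, comparable with the weight of [Lhalf]. *)
Definition om z : R := (nsq z + 1)^-1 ^+ K.
Definition sdiff phi x z : R := 2 * phi x - phi (x + z) - phi (x - z).

Lemma pw_sg z : pw z = sg 0 (- K%:R) z. Proof. by rewrite sg_inv. Qed.

Lemma sgK e z : 0 <= e -> sg e (- K%:R) z = (nsq z + e)^-1 ^+ K.
Proof. by move=> e0; rewrite /sg rp_nat// addr_ge0// nsq_ge0. Qed.

Lemma om_sg : om = sg 1 (- K%:R).
Proof. by apply/funext => z; rewrite sgK. Qed.

Lemma om_gt0 z : 0 < om z. Proof. by rewrite om_sg sg_gt0. Qed.

Lemma om_le1 z : om z <= 1.
Proof. by rewrite exprn_ile1 ?invr_ge0 ?invf_le1 ?addr_ge0 ?nsq_ge0// ?lerDr ?nsq_ge0// ltr_wpDl ?nsq_ge0. Qed.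

Lemma pw_ge0 z : 0 <= pw z. Proof. by rewrite pw_sg sg_ge0. Qed.

Lemma measurable_pw : measurable_fun setT pw.
Proof. have -> : pw = sg 0 (- K%:R) by apply/funext => z; rewrite pw_sg. exact: measurable_sg. Qed.

Lemma continuous_om : continuous om. Proof. by rewrite om_sg; exact: Ck_cont (Ck_sg 0 _ ltr01). Qed.

Lemma mass_sg e : 0 < e -> ig mu (sg e (- K%:R)) /\ \int[mu]_z sg e (- K%:R) z = pi ^+ K / k`!%:R / Num.sqrt e.
Proof.
move=> e0; have E : sg e (- K%:R) = (fun z : V => (nsq z + e)^-1 ^+ K) by apply/funext => z; rewrite sgK// ltW.
have M := mass_odd nk e0.
split; last by rewrite E /Rintegral M.
apply: (ig_ge0 (c := pi ^+ K / k`!%:R / Num.sqrt e)); [exact: measurable_sg|exact: sg_ge0|].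
by rewrite E M.
Qed.

Lemma ig_om : ig mu om. Proof. by rewrite om_sg; exact: (mass_sg ltr01).1. Qed.

Lemma omN z : om (- z) = om z. Proof. by rewrite /om nsqN. Qed.

Lemma om_shift x z : om z <= (2 * (nsq x + 1)) ^+ K * om (x + z).
Proof.
have x0 := nsq_ge0 x; have z0 := nsq_ge0 z; have xz0 := nsq_ge0 (x + z).
rewrite /om -exprMn lerXn2r ?nnegrE ?invr_ge0 ?mulr_ge0 ?invr_ge0//; try lra.
rewrite ler_pdivlMr; last lra.
rewrite mulrC ler_pdivrMr; last lra.
have d := dotv_le x z; have := enormD x z.
have : nsq (x + z) <= 2 * nsq x + 2 * nsq z.
  have := nsq_ge0 (x - z); rewrite nsqB nsqD; lra.
by nra.
Qed.

(** With [A] and [B] as in the proof, [|x|^2 + 1 <= 2 (A + B)] and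
    [1 / (A B) = (1 / A + 1 / B) / (A + B)]. Integrated in [z], the bound says that convolution
    preserves the decay of [om]. *)
Lemma om_conv x z : om (x + z) * om z <= 4 ^+ K * (om x * (om z + om (x + z))).
Proof.
set A := nsq (x + z) + 1; set B := nsq z + 1; set C := nsq x + 1.
have A1 : 1 <= A by rewrite lerDr nsq_ge0.
have B1 : 1 <= B by rewrite lerDr nsq_ge0.
have C1 : 1 <= C by rewrite lerDr nsq_ge0.
have CAB : C <= 2 * (A + B).
  have := nsq_ge0 (x + z + z); rewrite nsqD => H.
  have : nsq x = nsq (x + z) - 2 * dotv (x + z) z + nsq z by rewrite -nsqB addrK.
  by rewrite /A /B /C; lra.
have A0 : 0 < A by lra.
have B0 : 0 < B by lra.
have C0 : 0 < C by lra.
have ia : 0 < A^-1 by rewrite invr_gt0.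
have ib : 0 < B^-1 by rewrite invr_gt0.
have ic : 0 < C^-1 by rewrite invr_gt0.
have E : A^-1 * B^-1 <= 2 * C^-1 * (A^-1 + B^-1).
  rewrite (_ : A^-1 * B^-1 = (A + B)^-1 * (A^-1 + B^-1)); last by field; rewrite !gt_eqF// addr_gt0.
  rewrite ler_wpM2r ?addr_ge0 ?(ltW ia) ?(ltW ib)//.
  have AB0 : 0 < A + B by rewrite addr_gt0.
  rewrite -(ler_pM2r AB0) mulVf ?gt_eqF// -(ler_pM2r C0) mul1r.
  by rewrite (_ : 2 * C^-1 * (A + B) * C = 2 * (A + B)); [exact: CAB|field; rewrite gt_eqF].
have P : (A^-1 + B^-1) ^+ K <= 2 ^+ K * (B^-1 ^+ K + A^-1 ^+ K).
  have [ab|ab] := leP (A^-1) (B^-1).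
    apply: (@le_trans _ _ ((2 * B^-1) ^+ K)).
      by rewrite lerXn2r ?nnegrE ?addr_ge0 ?mulr_ge0 ?(ltW ia) ?(ltW ib)// mulr_natl mulr2n lerD2r.
    by rewrite exprMn ler_wpM2l ?exprn_ge0// lerDl exprn_ge0// ltW.
  apply: (@le_trans _ _ ((2 * A^-1) ^+ K)).
    by rewrite lerXn2r ?nnegrE ?addr_ge0 ?mulr_ge0 ?(ltW ia) ?(ltW ib)// mulr_natl mulr2n lerD2l ltW.
  by rewrite exprMn ler_wpM2l ?exprn_ge0// lerDr exprn_ge0// ltW.
rewrite /om -/A -/B -/C -exprMn.
apply: (@le_trans _ _ ((2 * C^-1 * (A^-1 + B^-1)) ^+ K)).
  by rewrite lerXn2r ?nnegrE ?mulr_ge0 ?addr_ge0 ?(ltW ia) ?(ltW ib) ?(ltW ic).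
rewrite !exprMn (_ : 4 = 2 * 2 :> R); last by ring.
rewrite exprMn -!mulrA ler_wpM2l ?exprn_ge0// [X in _ <= X]mulrCA ler_wpM2l ?exprn_ge0 ?(ltW ic)//.
Qed.

Lemma pw_le_om z : 1 <= nsq z -> pw z <= 2 ^+ K * om z.
Proof.
move=> z1; rewrite /pw /om -exprMn lerXn2r ?nnegrE ?invr_ge0 ?mulr_ge0 ?invr_ge0//; try lra.
by rewrite ler_pdivlMr; [rewrite mulrC ler_pdivrMr; lra|lra].
Qed.

(** A second difference of size [|z|^2] turns the kernel near the origin into
    [|z|^2 * pw z = |z|^(-2 k)], integrable since [2 k < n]. *)
Definition S0 : R := \int[mu]_z (inb 1 z * sg 0 (- k%:R) z).

Lemma loc_ig_sgk : loc_ig (@sg R n 0 (- k%:R)).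
Proof. by apply: (loc_ig_sg_inv n3); rewrite nk. Qed.

Lemma measurable_sdiff phi x : measurable_fun setT phi -> measurable_fun setT (sdiff phi x).
Proof.
move=> mp; apply: measurable_funB; first apply: measurable_funB => //.
  by apply: (measurableT_comp mp); apply: measurable_vecD2; [exact: measurable_cst|exact: measurable_id].
by apply: (measurableT_comp mp); apply: measurable_vecB2; [exact: measurable_cst|exact: measurable_id].
Qed.

Definition Ch : R := k`!%:R / pi ^+ K.

Lemma Ch_gt0 : 0 < Ch. Proof. by rewrite divr_gt0 ?exprn_gt0 ?pi_gt0// ltr0n fact_gt0. Qed.

Definition Lam phi x : R := Ch / 2 * \int[mu]_z (sdiff phi x z * pw z).

(** Functions that decay like the Poisson kernel together with their increments. Second increments
    control [sdiff] at the singularity; first increments enter the product rule with cut-offs. *)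
Definition nice (M : R) phi := [/\ measurable_fun setT phi, 0 <= M, forall x, `|phi x| <= M * om x,
  forall x z, enorm z <= 1 -> `|phi (x + z) - phi x| <= M * enorm z * om x &
  forall x z, enorm z <= 1 -> `|sdiff phi x z| <= M * nsq z * om x].

(** Majorant of [sdiff phi x z * pw z], near part plus far part. Its integral in [z] is a multiple
    of [om x], so the half-Laplacian keeps the decay. *)
Definition nice_dom (M : R) x z : R :=
  M * om x * (inb 1 z * sg 0 (- k%:R) z) +
  2 ^+ K * (M * om x * (2 * om z + 4 ^+ K * (om z + om (x + z)) + 4 ^+ K * (om z + om (x - z)))).

Definition C0 : R := S0 + 2 ^+ K * (2 * \int[mu]_z om z + 2 * (4 ^+ K * (2 * \int[mu]_z om z))).

Lemma om_trans (M : R) phi x w : 0 <= M -> (forall x, `|phi x| <= M * om x) ->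
  `|phi (x + w)| * om w <= M * om x * (4 ^+ K * (om w + om (x + w))).
Proof.
move=> M0 pM; apply: le_trans (ler_wpM2r (ltW (om_gt0 w)) (pM _)) _.
rewrite -[leLHS]mulrA; apply: le_trans (ler_wpM2l M0 (om_conv x w)) _.
by rewrite [leRHS](_ : _ = M * (4 ^+ K * (om x * (om w + om (x + w)))))//; move: (4 ^+ K) => c; ring.
Qed.

Lemma nice_dom_ig M x : ig mu (nice_dom M x).
Proof.
have ish : ig mu (fun z => om (x + z)) by apply: ig_ext (ig_shift x ig_om) => z; rewrite addrC.
have ish' : ig mu (fun z => om (x - z)) by exact: ig_reflect ig_om.
have [_ Hk] := loc_ig_sgk.
apply: igD; apply: igZl; first exact: Hk.
by apply: igZl; apply: igD; [apply: igD|]; apply: igZl; try (apply: igD); try exact: ig_om.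
Qed.

Lemma nice_dom_int M x : \int[mu]_z nice_dom M x z = C0 * (M * om x).
Proof.
have ish : ig mu (fun z => om (x + z)) by apply: ig_ext (ig_shift x ig_om) => z; rewrite addrC.
have ish' : ig mu (fun z => om (x - z)) by exact: ig_reflect ig_om.
have [_ Hk] := loc_ig_sgk; have io := ig_om.
have I1 : \int[mu]_z (om z + om (x + z)) = 2 * \int[mu]_z om z.
  rewrite (RintD io ish) (eq_Rint_to (f := fun z => om (x + z)) (g := fun z => om (z + x))); last by move=> z; rewrite addrC.
  by rewrite (Rint_shift x io) mulr2n mulrDl mul1r.
have I2 : \int[mu]_z (om z + om (x - z)) = 2 * \int[mu]_z om z.
  by rewrite (RintD io ish') (Rint_reflect x io) mulr2n mulrDl mul1r.
have i1 := igZl 2 io; have i2 := igZl (4 ^+ K) (igD io ish); have i3 := igZl (4 ^+ K) (igD io ish').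
have i4 := igD (igD i1 i2) i3; have i5 := igZl (M * om x) i4; have i6 := igZl (2 ^+ K) i5.
have i7 := igZl (M * om x) (Hk 1).
rewrite /nice_dom (RintD i7 i6) (RintZl _ (Hk 1)) (RintZl _ i5) (RintZl _ i4) (RintD (igD i1 i2) i3) (RintD i1 i2).
rewrite (RintZl _ io) (RintZl _ (igD io ish)) (RintZl _ (igD io ish')) I1 I2 /C0 -/S0.
by move: (4 ^+ K) (2 ^+ K) => a b; ring.
Qed.

Lemma nice_le M phi x z : nice M phi -> z != 0 -> `|sdiff phi x z * pw z| <= nice_dom M x z.
Proof.
move=> [mp M0 pM _ sM] z0; have ox := om_gt0 x; have Mo : 0 <= M * om x by rewrite mulr_ge0// ltW.
have q0 := nsq_gt0 z0; have oz := om_gt0 z; have p0 := pw_ge0 z.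
have a2 := ltW (om_gt0 (x + z)); have a3 := ltW (om_gt0 (x - z)).
have g0 : 0 <= M * om x * (2 * om z + 4 ^+ K * (om z + om (x + z)) + 4 ^+ K * (om z + om (x - z))).
  have oz' := ltW oz; have X1 : 0 <= 4 ^+ K :> R by rewrite exprn_ge0.
  by apply: mulr_ge0 => //; apply: addr_ge0; first apply: addr_ge0; apply: mulr_ge0 => //; exact: addr_ge0.
rewrite normrM (ger0_norm p0) /nice_dom; have [z1|z1] := leP (enorm z) 1.
  rewrite inb1// mul1r; apply: (@le_trans _ _ (M * om x * sg 0 (- k%:R) z)); last by rewrite lerDl mulr_ge0 ?exprn_ge0.
  apply: le_trans (ler_wpM2r p0 (sM x z z1)) _.
  rewrite [leLHS](_ : _ = M * om x * (nsq z * pw z)); last by ring.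
  rewrite ler_wpM2l// sg_inv /pw exprS mulrA divff ?gt_eqF// mul1r//.
rewrite inb0// mul0r mulr0 add0r.
have n1 : 1 <= nsq z by rewrite -sqr_enorm exprn_ege1// ltW.
apply: le_trans (ler_wpM2l (normr_ge0 _) (pw_le_om n1)) _.
rewrite mulrCA ler_wpM2l ?exprn_ge0//.
apply: (@le_trans _ _ ((2 * `|phi x| + `|phi (x + z)| + `|phi (x - z)|) * om z)).
  rewrite ler_wpM2r ?(ltW oz)//; apply: le_trans (ler_normB _ _) _; rewrite lerD2r.
  by apply: le_trans (ler_normB _ _) _; rewrite lerD2r normrM ger0_norm.
have P1 := om_trans x z M0 pM; have := om_trans x (- z) M0 pM; rewrite omN => P2.
have P0 : `|phi x| * om z <= M * om x * om z by rewrite ler_wpM2r ?(ltW oz).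
rewrite 2!mulrDl [leRHS]mulrDr [M * om x * (2 * _ + _)]mulrDr; apply: lerD => //; apply: lerD => //.
by rewrite -mulrA [leRHS]mulrCA ler_wpM2l.
Qed.

(* [LI phi] is [2 / Ch] times the half-Laplacian, in symmetrised form; [LS s]
   replaces the singular kernel by a Poisson kernel. *)
Definition LI phi x : R := \int[mu]_z (sdiff phi x z * pw z).
Definition ss (s : R) z : R := sg (s ^+ 2) (- K%:R) z.
Definition LS s phi x : R := \int[mu]_z (sdiff phi x z * ss s z).
Definition sj (j : nat) : R := j.+1%:R^-1.

Lemma sj_gt0 j : 0 < sj j. Proof. by rewrite invr_gt0. Qed.

Lemma measurable_ss s : measurable_fun setT (ss s). Proof. exact: measurable_sg. Qed.

Lemma ss_ge0 s z : 0 <= ss s z. Proof. exact: sg_ge0. Qed.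

Lemma ss_le_pw s z : z != 0 -> ss s z <= pw z.
Proof. by move=> z0; rewrite pw_sg; apply: sg_anti => //; rewrite ?sqr_ge0// oppr_le0 ler0n. Qed.

Lemma ssN s z : ss s (- z) = ss s z. Proof. by rewrite /ss /sg nsqN. Qed.

Lemma ss_le_om s z : 0 < s -> ss s z <= (1 + s ^- 2) ^+ K * om z.
Proof.
move=> s0; have z0 := nsq_ge0 z; have s2 : 0 < s ^+ 2 by rewrite exprn_gt0.
have i2 : 0 < s ^- 2 by rewrite invr_gt0.
rewrite /ss sgK ?(ltW s2)// /om -exprMn lerXn2r ?nnegrE ?invr_ge0 ?mulr_ge0 ?invr_ge0 ?addr_ge0 ?(ltW i2) ?(ltW s2)//.
rewrite ler_pdivlMr; last by rewrite ltr_wpDl.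
rewrite mulrC ler_pdivrMr; last by rewrite ltr_wpDl.
rewrite mulrDl mul1r mulrDr mulVf ?gt_eqF//.
have : 0 <= s ^- 2 * nsq z by rewrite mulr_ge0// ltW.
by move: (s ^- 2 * nsq z) => w w0; lra.
Qed.

Lemma ss_mass s : 0 < s -> ig mu (ss s) /\ \int[mu]_z ss s z = pi ^+ K / k`!%:R / s.
Proof.
move=> s0; have s2 : 0 < s ^+ 2 by rewrite exprn_gt0.
by have [i e] := mass_sg s2; split => //; rewrite e sqrtr_sqr gtr0_norm.
Qed.

Lemma cvg_ss z : z != 0 -> (fun j => ss (sj j) z) @ \oo --> pw z.
Proof.
move=> z0; rewrite /ss pw_sg.
have nz : nsq z != 0 by rewrite gt_eqF// nsq_gt0.
under eq_fun do rewrite sgK ?sqr_ge0//.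
rewrite sgK// addr0.
have c : (fun j => nsq z + sj j ^+ 2) @ \oo --> nsq z + 0 ^+ 2.
  by apply: cvgD; [exact: cvg_cst|rewrite expr2; apply: cvgM; exact: cvg_harmonic].
rewrite expr0n/= addr0 in c; exact: (cvg_comp _ _ (cvgV nz c) (@exprn_continuous R K _)).
Qed.

(** The kernels [ss s] stay below [pw] off the origin, so one majorant serves every [s]. *)
Lemma LS_cvg phi x (G : V -> R) : measurable_fun setT phi -> ig mu G ->
  (forall z, z != 0 -> `|sdiff phi x z * pw z| <= G z) -> (fun j => LS (sj j) phi x) @ \oo --> LI phi x.
Proof.
move=> mp iG HG.
have [||j z z0|z z0|_ H] := @Rint_dct0 R n n0 (fun j z => sdiff phi x z * ss (sj j) z) (fun z => sdiff phi x z * pw z) G; last exact: H.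
- by move=> j; apply: measurable_funM; [exact: measurable_sdiff|exact: measurable_ss].
- exact: iG.
- apply: le_trans (HG z z0); rewrite !normrM ler_wpM2l//.
  by rewrite (ger0_norm (ss_ge0 _ _)) (ger0_norm (pw_ge0 _)) ss_le_pw.
- by apply: cvgMr; exact: cvg_ss.
Qed.

Lemma LS_le s phi x (G : V -> R) : measurable_fun setT phi -> ig mu G ->
  (forall z, z != 0 -> `|sdiff phi x z * pw z| <= G z) ->
  ig mu (fun z => sdiff phi x z * ss s z) /\ `|LS s phi x| <= \int[mu]_z G z.
Proof.
move=> mp iG HG.
have B z : z != 0 -> `|sdiff phi x z * ss s z| <= G z.
  move=> z0; apply: le_trans (HG z z0); rewrite !normrM ler_wpM2l//.
  by rewrite (ger0_norm (ss_ge0 _ _)) (ger0_norm (pw_ge0 _)) ss_le_pw.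
have i : ig mu (fun z => sdiff phi x z * ss s z).
  by apply: (ig_le0 iG) B; apply: measurable_funM; [exact: measurable_sdiff|exact: measurable_ss].
split => //; apply: le_trans (Rint_le0 n0 (ig_abs i) iG B).
exact: Rint_norm_le (ig_measurable i) (ig_abs i) (fun z => lexx _).
Qed.

Lemma LI_le phi x (G : V -> R) : measurable_fun setT phi -> ig mu G ->
  (forall z, z != 0 -> `|sdiff phi x z * pw z| <= G z) -> `|LI phi x| <= \int[mu]_z G z.
Proof.
move=> mp iG HG.
have i : ig mu (fun z => sdiff phi x z * pw z).
  by apply: (ig_le0 iG) HG; apply: measurable_funM; [exact: measurable_sdiff|exact: measurable_pw].
apply: le_trans (Rint_le0 n0 (ig_abs i) iG HG).
exact: Rint_norm_le (ig_measurable i) (ig_abs i) (fun z => lexx _).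
Qed.

Section weighted.
Variable F : V -> R.
Hypothesis FC : Ck 2 F.
Hypothesis Fo : ig mu (fun y => F y * om y).

Let mF : measurable_fun setT F. Proof. exact: measurable_continuous (Ck_cont FC). Qed.

Definition wF y : R := `|F y| * om y.

Lemma ig_wF : ig mu wF.
Proof. by apply: ig_ext (ig_abs Fo) => y; rewrite normrM (gtr0_norm (om_gt0 y)). Qed.

Lemma wF_ge0 y : 0 <= wF y. Proof. by rewrite mulr_ge0// ltW// om_gt0. Qed.

Lemma om_wF (r : R) x w : 0 <= r -> enorm x <= r -> `|F (x + w)| * om w <= (2 * (r ^+ 2 + 1)) ^+ K * wF (x + w).
Proof.
move=> r0 xr; rewrite /wF mulrCA ler_wpM2l//; apply: le_trans (om_shift x w) _.
rewrite ler_wpM2r ?(ltW (om_gt0 _))// lerXn2r ?nnegrE ?mulr_ge0 ?addr_ge0 ?nsq_ge0 ?sqr_ge0//.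
by rewrite ler_wpM2l// lerD2r -sqr_enorm lerXn2r ?nnegrE ?enorm_ge0.
Qed.

(** Second derivatives of [F] on a larger ball handle [|z| <= 1], weighted integrability handles the
    rest. Uniformity for [x] in a ball yields local boundedness of [LI k F] and limits under
    compactly supported pairings. *)
Lemma wF_dom (r : R) : 0 <= r -> exists (B : R) (G : V -> V -> R), forall x, enorm x <= r ->
  [/\ ig mu (G x), \int[mu]_z G x z <= B & forall z, z != 0 -> `|sdiff F x z * pw z| <= G x z].
Proof.
move=> r0; pose A := (2 * (r ^+ 2 + 1)) ^+ K.
have A0 : 0 <= A by rewrite exprn_ge0// mulr_ge0// addr_ge0// sqr_ge0.
have [Mf [Mf0 HMf]] := bounded_on_ball r (Ck_cont FC).
have /choice[M2 HM2] : forall ij : 'I_n * 'I_n, exists M, 0 <= M /\ forall y, enorm y <= r + 1 -> `|partial ij.2 (partial ij.1 F) y| <= M.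
  move=> [i j] /=; apply: bounded_on_ball; apply: (@Ck_cont _ _ 0); apply: Ck_partial; exact: Ck_partial.
pose M := \sum_ij M2 ij.
have M0 : 0 <= M by apply: sumr_ge0 => ij _; have [] := HM2 ij.
have HM i j y : enorm y <= r + 1 -> `|partial j (partial i F) y| <= M.
  move=> yr; apply: le_trans ((HM2 (i, j)).2 y yr) _; rewrite /M (bigD1 (i, j))//= lerDl.
  by apply: sumr_ge0 => ij _; have [] := HM2 ij.
pose a := 2 * n%:R ^+ 2 * M.
have a0 : 0 <= a by rewrite !mulr_ge0// exprn_ge0.
pose G x z := a * (inb 1 z * sg 0 (- k%:R) z) + 2 ^+ K * (2 * Mf * om z + A * wF (x + z) + A * wF (x - z)).
exists (a * S0 + 2 ^+ K * (2 * Mf * \int[mu]_z om z + A * \int[mu]_z wF z + A * \int[mu]_z wF z)), G => x xr.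
have iw := ig_wF; have io := ig_om; have [_ Hk] := loc_ig_sgk.
have ish : ig mu (fun z => wF (x + z)) by apply: ig_ext (ig_shift x iw) => z; rewrite addrC.
have ish' : ig mu (fun z => wF (x - z)) by exact: ig_reflect iw.
have i1 := igZl (2 * Mf) io; have i2 := igZl A ish; have i3 := igZl A ish'.
have i4 := igD (igD i1 i2) i3; have i5 := igZl (2 ^+ K) i4; have i6 := igZl a (Hk 1).
split; first exact: igD i6 i5.
  rewrite /G (RintD i6 i5) (RintZl _ (Hk 1)) (RintZl _ i4) (RintD (igD i1 i2) i3) (RintD i1 i2).
  rewrite (RintZl _ io) (RintZl _ ish) (RintZl _ ish') (Rint_reflect x iw).
  by rewrite (eq_Rint_to (f := fun z => wF (x + z)) (g := fun z => wF (z + x))) ?(Rint_shift x iw)// => z; rewrite addrC.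
move=> z z0; have q0 := nsq_gt0 z0; have oz := om_gt0 z; have p0 := pw_ge0 z.
have w1 := wF_ge0 (x + z); have w2 := wF_ge0 (x - z).
have g0 : 0 <= 2 * Mf * om z + A * wF (x + z) + A * wF (x - z).
  by rewrite !addr_ge0 ?(mulr_ge0 A0)// !mulr_ge0// ltW.
rewrite normrM (ger0_norm p0) /G; have [z1|z1] := leP (enorm z) 1.
  rewrite inb1// mul1r; apply: (@le_trans _ _ (a * sg 0 (- k%:R) z)); last by rewrite lerDl mulr_ge0 ?exprn_ge0.
  have L : `|sdiff F x z| <= a * nsq z.
    rewrite -sqr_enorm; apply: incr2_le => // i j y yx; apply: HM.
    have := enormD (y - x) x; rewrite subrK => H; apply: le_trans H _.
    by rewrite addrC lerD// (le_trans yx).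
  apply: le_trans (ler_wpM2r p0 L) _.
  by rewrite -mulrA ler_wpM2l// sg_inv /pw exprS mulrA divff ?gt_eqF// mul1r.
rewrite inb0// mul0r mulr0 add0r.
have n1 : 1 <= nsq z by rewrite -sqr_enorm exprn_ege1// ltW.
apply: le_trans (ler_wpM2l (normr_ge0 _) (pw_le_om n1)) _.
rewrite mulrCA ler_wpM2l ?exprn_ge0//.
apply: (@le_trans _ _ ((2 * `|F x| + `|F (x + z)| + `|F (x - z)|) * om z)).
  rewrite ler_wpM2r ?(ltW oz)//; apply: le_trans (ler_normB _ _) _; rewrite lerD2r.
  by apply: le_trans (ler_normB _ _) _; rewrite lerD2r normrM ger0_norm.
have P1 := om_wF z r0 xr; have := om_wF (- z) r0 xr; rewrite omN => P2.
rewrite 2!mulrDl; apply: lerD => //; apply: lerD => //.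
by rewrite ler_wpM2r ?(ltW oz)// ler_wpM2l// HMf.
Qed.

Lemma ig_F_ss s x : 0 < s -> ig mu (fun z => F (x - z) * ss s z).
Proof.
move=> s0; have c0 : 0 <= (1 + s ^- 2) ^+ K by rewrite exprn_ge0// addr_ge0// invr_ge0 sqr_ge0.
apply: (ig_le (g := fun z => (1 + s ^- 2) ^+ K * ((2 * (enorm x ^+ 2 + 1)) ^+ K * wF (x - z)))).
- by apply: igZl; apply: igZl; apply: ig_reflect ig_wF.
- apply: measurable_funM (measurable_ss s); apply: (measurableT_comp mF).
  by apply: measurable_vecB2; [exact: measurable_cst|exact: measurable_id].
move=> z; rewrite normrM (ger0_norm (ss_ge0 _ _)).
apply: le_trans (ler_wpM2l (normr_ge0 _) (ss_le_om z s0)) _.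
rewrite mulrCA ler_wpM2l//; rewrite -omN; exact: om_wF (enorm_ge0 x) (lexx _).
Qed.

(** Poisson kernels are integrable, so the second difference can be integrated term by term. *)
Lemma LS_split s x : 0 < s ->
  LS s F x = 2 * (pi ^+ K / k`!%:R / s) * F x - 2 * \int[mu]_z (F (x - z) * ss s z).
Proof.
move=> s0; have [is_ es] := ss_mass s0; have i1 := ig_F_ss x s0.
have i2 : ig mu (fun z => F (x + z) * ss s z).
  by apply: ig_ext (ig_opp i1) => z; rewrite opprK ssN.
have e2 : \int[mu]_z (F (x + z) * ss s z) = \int[mu]_z (F (x - z) * ss s z).
  rewrite -(Rint_opp i1); apply: eq_Rint => z; by rewrite opprK ssN.
rewrite /LS (eq_Rint_to (g := fun z => 2 * F x * ss s z - F (x + z) * ss s z - F (x - z) * ss s z)); last first.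
  by move=> z; rewrite /sdiff !mulrBl.
have i3 := igZl (2 * F x) is_.
rewrite (RintB (igB i3 i2) i1) (RintB i3 i2) (RintZl _ is_) es e2.
by move: (\int[mu]_z _) (pi ^+ K / _ / _) => a b; ring.
Qed.

End weighted.

End half_laplacian.

(** * Integrals over the line: error function and Cauchy-Schlomilch *)

Section line_integrals.
Context {R : realType}.
Notation leb := (@lebesgue_measure R).

Lemma FTC_line (f N : R -> R) (l l' : R) : continuous f -> (forall x, 0 <= f x) ->
  (forall x : R, is_derive x 1 N (f x)) -> N x @[x --> +oo] --> l -> N (- x) @[x --> +oo] --> l' ->
  (\int[leb]_x (f x)%:E = (l - l')%:E)%E.
Proof.
move=> cf f0 dN Nl Nl'.
have H (g G : R -> R) (a : R) : continuous g -> (forall x, 0 <= g x) -> (forall x : R, is_derive x 1 G (g x)) ->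
    G x @[x --> +oo] --> a -> (\int[leb]_(x in `[0%R, +oo[) (g x)%:E = (a - G 0)%:E)%E.
  move=> cg g0 dG Ga; rewrite EFinB; apply: ge0_continuous_FTC2y => //.
  - exact: continuous_subspaceT.
  - apply: cvg_at_right_filter; apply: differentiable_continuous; apply/derivable1_diffP.
    by case: (dG 0).
  - by move=> x _; rewrite derive1E; case: (dG x).
have mf : measurable_fun setT (fun x => (f x)%:E) by apply/measurable_EFinP; exact: continuous_measurable_fun.
have cg : continuous (fun x => f (- x)).
  by move=> x; apply: (@continuous_comp _ _ _ (fun x : R => - x) f); [exact: cvgN cvg_id|exact: cf].
have mg : measurable_fun setT (fun x : R => (f (- x))%:E) by apply/measurable_EFinP; exact: continuous_measurable_fun.
have P1 := H f N l cf f0 dN Nl.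
have P2 : (\int[leb]_(x in `[0%R, +oo[) (f (- x))%:E = (- l' - (- N (- 0)))%:E)%E.
  apply: (H (fun x => f (- x)) (fun x => - N (- x)) (- l') cg) => //; last exact: cvgN.
  move=> x; have := is_deriveN (is_derive1_chain (is_deriveN (is_derive_id x (1 : R))) (dN (- x))).
  by apply: is_derive_ext => //; rewrite mulrN1 opprK.
have E1 : (\int[leb]_x (f x)%:E = \int[leb]_(x in `[0%R, +oo[) (f x)%:E + \int[leb]_(x in `]-oo, 0%R[) (f x)%:E)%E.
  rewrite -ge0_integral_setU//=.
  - congr integral; apply/seteqP; split => // x _ /=; rewrite !in_itv/= andbT.
    by have [x0|x0] := leP 0 x; [left|right].
  - exact: measurable_funTS.
  - by move=> x _; rewrite lee_fin.
  - rewrite disj_set2E; apply/eqP/seteqP; split => // x [] /=; rewrite !in_itv/= andbT => x0.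
    by rewrite ltNge x0.
have E2 : (\int[leb]_(x in `]-oo, 0%R[) (f x)%:E = \int[leb]_(x in `[0%R, +oo[) (f (- x))%:E)%E.
  transitivity (\int[leb]_x ((f x)%:E * (\1_(`]-oo, 0%R[) x)%:E))%E.
    by rewrite [LHS]integral_mkcond; apply: eq_integral => x _; rewrite patchE indicE; case: ifP; rewrite ?mule1 ?mule0.
  rewrite -ge0_lebesgue_integralN; last 2 first.
  - by apply: emeasurable_funM => //; apply/measurable_EFinP; exact: measurable_indic.
  - by move=> x; rewrite mule_ge0// lee_fin.
  transitivity (\int[leb]_(x in `]0%R, +oo[) (f (- x))%:E)%E; last first.
    by apply: integral_itv_obnd_cbnd; exact: measurable_funTS mg.
  rewrite [RHS]integral_mkcond; apply: eq_integral => x _; rewrite patchE indicE !mem_setE !in_itv/= andbT oppr_lt0.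
  by case: ifP; rewrite ?mule1 ?mule0.
by rewrite E1 E2 P1 P2 -EFinD oppr0; congr EFin; ring.
Qed.

(** The primitive of the Gaussian that vanishes at 0, hence odd; it supplies the boundary values at
    both infinities in [cauchy_schlomilch]. *)
Lemma error_function : exists E : R -> R, [/\ forall y : R, is_derive y 1 E (expR (- y ^+ 2)),
  forall y, E (- y) = - E y & E x @[x --> +oo] --> Num.sqrt pi / 2].
Proof.
pose g := @gauss_fun R; pose F x := (\int[leb]_(t in [set` Interval -oo%O (BRight x)]) g t)%R.
have cg : continuous g by exact: continuous_gauss_fun.
have dF (x : R) : is_derive x 1 F (g x).
  have H1 : x < x + 1 by rewrite ltrDl.
  have H2 : leb.-integrable [set` Interval -oo%O (BRight (x + 1))] (EFin \o g).
    by have := @integrableT_gauss R; apply: integrableS => //; exact: measurable_itv.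
  have [|d e] := @continuous_FTC1 R g -oo%O x (x + 1) H1 H2 _ (@cg x); first (first [exact: isT|exact: ltNye|by rewrite ltNyr|by rewrite /Order.lt /=|by rewrite /Order.lt/= /lt_bound|by apply: ltBSide|by rewrite ltNge]).
  exact: (DeriveDef d (etrans (esym (derive1E F x)) e)).
pose E x := F x - F 0.
have dE (x : R) : is_derive x 1 E (g x).
  by have := is_deriveB (dF x) (is_derive_cst (F 0) x (1 : R)); apply: is_derive_ext => //; rewrite subr0.
have Eo y : E (- y) = - E y.
  have dS (x : R) : is_derive x 1 (fun y => E (- y) + E y) 0.
    have := is_deriveD (is_derive1_chain (is_deriveN (is_derive_id x (1 : R))) (dE (- x))) (dE x).
    by apply: is_derive_ext => //; rewrite mulrN1 /g /gauss_fun sqrrN addNr.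
  have := is_derive_0_is_cst (f := fun y => E (- y) + E y) y 0 dS.
  by rewrite oppr0 /E subrr addr0 => /eqP; rewrite addr_eq0 => /eqP.
have I0 (x : R) : 0 < x -> E x = gauss_integral_proof.integral0_gauss x.
  move=> x0; rewrite /gauss_integral_proof.integral0_gauss /Rintegral (@continuous_FTC2 R g E 0 x)//.
  - have E00 : E 0 = 0 by rewrite /E subrr.
    by rewrite E00 -EFinB subr0.
  - exact: continuous_subspaceT.
  - split => [y _||]; first by case: (dE y).
    + apply: cvg_at_right_filter; apply: differentiable_continuous; apply/derivable1_diffP; by case: (dE 0).
    + apply: cvg_at_left_filter; apply: differentiable_continuous; apply/derivable1_diffP; by case: (dE x).
  - by move=> y _; rewrite derive1E; case: (dE y).
exists E; split => //.
have S : Num.sqrt (gauss_integral_proof.integral0_gauss x ^+ 2) @[x --> +oo] --> Num.sqrt (pi / 4 : R).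
  apply: (cvg_comp _ _ (@gauss_integral_proof.cvg_integral0_gauss_sqr R)); exact: sqrt_continuous.
have -> : Num.sqrt pi / 2 = Num.sqrt (pi / 4 : R).
  rewrite sqrtrM ?pi_ge0// sqrtrV// (_ : 4 = 2 ^+ 2 :> R); last by rewrite expr2; ring.
  by rewrite sqrtr_sqr ger0_norm.
apply: cvg_trans S; apply: near_eq_cvg; near=> x.
by rewrite sqrtr_sqr ger0_norm ?gauss_integral_proof.integral0_gauss_ge0// I0.
Unshelve. all: by end_near. Qed.

(** The Gamma integral in a logarithmic variable, where dilations become translations. *)
Lemma log_gamma k (c : R) : 0 < c ->
  (\int[leb]_x (expR (k.+1%:R * x - c * expR x))%:E = (k`!%:R / c ^+ k.+1)%:E)%E.
Proof.
move=> c0; have cn : c != 0 by rewrite gt_eqF.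
have E (x : R) : expR (k.+1%:R * x - c * expR x) = expR x ^+ k * expR (- (c * expR x)) * expR x.
  by rewrite mulrAC -exprSr -expRM_natl -expRD.
have dN (x : R) : is_derive x 1 (fun x => gamF c k (expR x)) (expR (k.+1%:R * x - c * expR x)).
  by rewrite E; exact: (is_derive1_chain (is_derive_expR x) (is_derive_gamF k (expR x) cn)).
rewrite (FTC_line (N := fun x => gamF c k (expR x)) (l := 0) (l' := gamF c k 0)).
- by rewrite gamF0// sub0r opprK.
- move=> x; apply: (@continuous_comp _ _ _ (fun x : R => k.+1%:R * x - c * expR x) expR); last exact: continuous_expR.
  by apply: cvgB; apply: cvgM; [exact: cvg_cst|exact: cvg_id|exact: cvg_cst|exact: continuous_expR].
- by move=> x; exact: expR_ge0.
- apply: (@cvg_comp _ _ _ (@expR R) (gamF c k) _ (pinfty_nbhs R)); last exact: cvg_gamF.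
  apply/cvgryPge => A; near=> x.
  apply: le_trans (expR_ge1Dx x); apply: (@le_trans _ _ x); last by rewrite lerDr.
  by near: x; apply: nbhs_pinfty_ge; rewrite num_real.
- apply: (@cvg_comp _ _ _ (fun x : R => expR (- x)) (gamF c k) _ (nbhs 0)); first exact: (@cvgr_expR R).
  by apply: differentiable_continuous; apply/derivable1_diffP; case: (is_derive_gamF k 0 cn).
Unshelve. all: by end_near. Qed.

(* With [y = t e^(x/2) - s e^(-x/2)] and [y' = t e^(x/2) + s e^(-x/2)] the
   integrand is [(s + t) exp (-r y^2) dy + (s - t) e^(4 r s t) exp (-r y'^2) dy']. *)
Lemma cauchy_schlomilch (v s t : R) : 0 < v -> 0 < s -> 0 < t ->
  (\int[leb]_x (s * t * (expR (x / 2) + expR (- (x / 2))) *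
     expR (- (v * (t * expR (x / 2) - s * expR (- (x / 2)))) ^+ 2))%:E = ((s + t) * Num.sqrt pi / v)%:E)%E.
Proof.
move=> v0 s0 t0; have vn : v != 0 by rewrite gt_eqF.
have [E [dE Eo El]] := error_function.
pose p (x : R) := expR (x / 2); pose m (x : R) := expR (- (x / 2)).
have dp (x : R) : is_derive x 1 p (p x / 2).
  have := is_derive1_chain (is_deriveM (is_derive_id x (1 : R)) (is_derive_cst (2^-1 : R) x (1 : R))) (is_derive_expR (x / 2)).
  by apply: is_derive_ext => //; rewrite scaler0 add0r /GRing.scale/= mulr1.
have dm (x : R) : is_derive x 1 m (- (m x / 2)).
  have := is_derive1_chain (is_deriveN (is_deriveM (is_derive_id x (1 : R)) (is_derive_cst (2^-1 : R) x (1 : R)))) (is_derive_expR (- (x / 2))).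
  by apply: is_derive_ext => //; rewrite scaler0 add0r /GRing.scale/= mulr1 mulrN.
pose e := expR (4 * (v ^+ 2 * (s * t))).
pose y (x : R) := v * t * p x + - (v * s) * m x; pose y' (x : R) := v * t * p x + v * s * m x.
have dy (x : R) : is_derive x 1 y (v * t * (p x / 2) + v * s * (m x / 2)).
  have := is_deriveD (is_deriveZ (v * t) (dp x)) (is_deriveZ (- (v * s)) (dm x)).
  by apply: is_derive_ext => //; rewrite /GRing.scale/= mulrNN.
have dy' (x : R) : is_derive x 1 y' (v * t * (p x / 2) - v * s * (m x / 2)).
  have := is_deriveD (is_deriveZ (v * t) (dp x)) (is_deriveZ (v * s) (dm x)).
  by apply: is_derive_ext => //; rewrite /GRing.scale/= mulrN.
pose N x := (s + t) / v * E (y x) + (s - t) / v * e * E (y' x).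
have pm x : p x * m x = 1 by rewrite -expRD subrr expR0.
pose f x := s * t * (p x + m x) * expR (- (v * (t * p x - s * m x)) ^+ 2).
have dN (x : R) : is_derive x 1 N (f x).
  have := is_deriveD (is_deriveZ ((s + t) / v) (is_derive1_chain (dy x) (dE (y x))))
    (is_deriveZ ((s - t) / v * e) (is_derive1_chain (dy' x) (dE (y' x)))).
  apply: is_derive_ext => //; rewrite /GRing.scale/= /f.
  have -> : (v * (t * p x - s * m x)) ^+ 2 = y x ^+ 2 by rewrite /y; congr (_ ^+ 2); ring.
  have E' : e * expR (- y' x ^+ 2) = expR (- y x ^+ 2).
    rewrite -expRD; congr expR.
    have : v ^+ 2 * (s * t) = v ^+ 2 * (s * t) * (p x * m x) by rewrite pm mulr1.
    by rewrite /y /y' => ->; ring.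
  rewrite -[(s - t) / v * e * _]mulrA [e * _]mulrA E'.
  by move: (expR (- y x ^+ 2)) (p x) (m x) => X P M; field.
have lim a b : 0 < a -> 0 < b -> a * p x - b * m x @[x --> +oo] --> +oo.
  move=> a0 b0; apply/cvgryPge => A; near=> x.
  have x0 : 0 <= x by near: x; apply: nbhs_pinfty_ge; rewrite num_real.
  have x1 : 2 * ((A + b) / a) <= x by near: x; apply: nbhs_pinfty_ge; rewrite num_real.
  have P : A + b <= a * p x.
    rewrite mulrC -ler_pdivrMr//; apply: le_trans (expR_ge1Dx _).
    by rewrite -(ler_pM2l (ltr0n R 2)); apply: le_trans x1 _; rewrite mulrDr mulrCA divff// !mulr1 lerDr.
  have M : b * m x <= b by rewrite ger_pMr// expR_le1 oppr_le0 divr_ge0.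
  by rewrite lerBrDr; apply: le_trans P; rewrite lerD2l.
have lim' a b : 0 < a -> 0 < b -> a * p x + b * m x @[x --> +oo] --> +oo.
  move=> a0 b0; apply/cvgryPge => A; near=> x.
  have : A <= a * p x - b * m x by near: x; have /cvgryPge := lim a b a0 b0; exact.
  by move=> H; apply: le_trans H _; rewrite lerD2l; apply: (@le_trans _ _ 0); rewrite ?oppr_le0 mulr_ge0 ?expR_ge0// ltW.
rewrite (FTC_line (f := f) (N := N) (l := (s + t) / v * (Num.sqrt pi / 2) + (s - t) / v * e * (Num.sqrt pi / 2))
  (l' := (s + t) / v * (- (Num.sqrt pi / 2)) + (s - t) / v * e * (Num.sqrt pi / 2))).
- by congr EFin; rewrite [RHS](_ : _ = (s + t) / v * (Num.sqrt pi / 2 + Num.sqrt pi / 2)); [ring|field].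
- move=> x.
  have cp : {for x, continuous p} by apply: differentiable_continuous; apply/derivable1_diffP; case: (dp x).
  have cm : {for x, continuous m} by apply: differentiable_continuous; apply/derivable1_diffP; case: (dm x).
  apply: cvgM; first by apply: cvgM; [exact: cvg_cst|exact: cvgD cp cm].
  apply: (@continuous_comp _ _ _ (fun x => - (v * (t * p x - s * m x)) ^+ 2) expR); last exact: continuous_expR.
  apply: cvgN; apply: (@continuous_comp _ _ _ (fun x => v * (t * p x - s * m x)) (fun z : R => z ^+ 2)); last exact: exprn_continuous.
  by apply: cvgM; [exact: cvg_cst|]; apply: cvgB; apply: cvgM; try exact: cvg_cst; [exact: cp|exact: cm].
- by move=> x; rewrite !mulr_ge0 ?addr_ge0 ?expR_ge0// ltW.
- apply: cvgD; apply: cvgM; try exact: cvg_cst.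
    have -> : y = (fun x => v * t * p x - v * s * m x) by apply/funext => x; rewrite /y mulNr.
    by apply: cvg_comp El; apply: lim; rewrite mulr_gt0.
  by apply: cvg_comp El; apply: lim'; rewrite mulr_gt0.
- apply: cvgD; apply: cvgM; try exact: cvg_cst.
    have -> : (fun x => E (y (- x))) = (fun x => - E (v * s * p x - v * t * m x)).
      apply/funext => x; have e2 : - x / 2 = - (x / 2) by rewrite mulNr.
      by rewrite -Eo /y /p /m e2 opprK; congr E; ring.
    by apply: cvgN; apply: cvg_comp El; apply: lim; rewrite mulr_gt0.
  have -> : (fun x => E (y' (- x))) = (fun x => E (v * s * p x + v * t * m x)).
    by apply/funext => x; rewrite /y' /p /m mulNr opprK addrC.
  by apply: cvg_comp El; apply: lim'; rewrite mulr_gt0.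
Unshelve. all: by end_near. Qed.

End line_integrals.

(** * Convolution of Gaussians *)

Section gaussian_convolution.
Context {R : realType} {n : nat}.
Notation V := 'rV[R]_n.
Notation mu := (@volm R n).
Notation leb := (@lebesgue_measure R).
Implicit Types (x y z : V) (a b w : R).

HB.instance Definition _ := isSFinite.Build _ _ _ mu (sfinite_measure_sigma_finite (@volm_sigma_finite R n)).

Lemma measurable_expRn d (T : measurableType d) (f : T -> R) : measurable_fun setT f -> measurable_fun setT (fun t => expR (f t)).
Proof. by move=> mf; apply: (measurableT_comp (@measurable_expR R)). Qed.

Lemma gaussian_conv x (a b : R) : 0 < a -> 0 < b ->
  (\int[mu]_y (expR (- (a * nsq (x - y))) * expR (- (b * nsq y)))%:E =
   (Num.sqrt (pi / (a + b)) ^+ n * expR (- (a * b / (a + b) * nsq x)))%:E)%E.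
Proof.
move=> a0 b0; have ab : 0 < a + b by rewrite addr_gt0.
have abn : a + b != 0 by rewrite gt_eqF.
(* The shift that completes the square. *)
pose c : V := (- (a / (a + b))) *: x.
have m0 : measurable_fun setT (fun z : V => expR (- ((a + b) * nsq z))).
  apply: measurable_expRn; apply: measurable_continuous; apply: contN; apply: contM; [exact: cont_cst|exact: continuous_nsq].
have mf : measurable_fun setT (fun z : V => (expR (- ((a + b) * nsq z)))%:E) by exact/measurable_EFinP.
have ms : measurable_fun setT (fun z : V => (expR (- ((a + b) * nsq (z + c))))%:E).
  by apply: (measurableT_comp mf); exact: measurable_vecD.
rewrite EFinM -gaussian_n//.
rewrite -(_ : \int[mu]_z (expR (- ((a + b) * nsq (z + c))))%:E = \int[mu]_z (expR (- ((a + b) * nsq z)))%:E)%E; last first.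
  rewrite (integral_volm ms); last by move=> z; rewrite lee_fin expR_ge0.
  rewrite (integral_volm mf); last by move=> z; rewrite lee_fin expR_ge0.
  rewrite /intRn (iint_shift (F := fun z => (expR (- ((a + b) * nsq z)))%:E) c 0 mf)//.
    by rewrite -intRn_eq.
rewrite muleC -ge0_integralZl//; try (by move=> z _; rewrite lee_fin expR_ge0); try (by rewrite lee_fin expR_ge0).
apply: eq_integral => y _; rewrite -EFinM -!expRD; congr (expR _)%:E.
rewrite nsqB nsqD nsqZ dotvZr (_ : dotv y x = dotv x y); last by apply: eq_bigr => i _; rewrite mulrC.
by move: (nsq x) (nsq y) (dotv x y) => X Y D; field.
Qed.

End gaussian_convolution.

(** * Symmetry of the half-Laplacian *)

Section pairing.
Context {R : realType} {n : nat}.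
Hypothesis n3 : (2 < n)%N.
Variable k : nat.
Hypothesis nk : n = (2 * k).+1.
Notation V := 'rV[R]_n.
Notation mu := (@volm R n).
Notation K := k.+1.
Notation omk := (@om R n k).
Implicit Types (x y z : V) (phi psi : V -> R).

Let n0 : (0 < n)%N. Proof. exact: leq_trans n3. Qed.
Let mass (s : R) : R := pi ^+ K / k`!%:R / s.

Lemma LS_split_gen s psi x : 0 < s -> ig mu (fun z => psi (x - z) * ss k s z) ->
  LS k s psi x = 2 * (pi ^+ K / k`!%:R / s) * psi x - 2 * \int[mu]_z (psi (x - z) * ss k s z).
Proof.
move=> s0 i1; have [is_ es] := ss_mass nk s0.
have i2 : ig mu (fun z => psi (x + z) * ss k s z).
  by apply: ig_ext (ig_opp i1) => z; rewrite opprK ssN.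
have e2 : \int[mu]_z (psi (x + z) * ss k s z) = \int[mu]_z (psi (x - z) * ss k s z).
  rewrite -(Rint_opp i1); apply: eq_Rint => z; by rewrite opprK ssN.
rewrite /LS (eq_Rint_to (g := fun z => 2 * psi x * ss k s z - psi (x + z) * ss k s z - psi (x - z) * ss k s z)); last first.
  by move=> z; rewrite /sdiff !mulrBl.
have i3 := igZl (2 * psi x) is_.
rewrite (RintB (igB i3 i2) i1) (RintB i3 i2) (RintZl _ is_) es e2.
by move: (\int[mu]_z _) (pi ^+ K / _ / _) => a b; ring.
Qed.

Lemma ig_nice_ss (s M : R) psi x : 0 < s -> nice k M psi -> ig mu (fun z => psi (x - z) * ss k s z).
Proof.
move=> s0 [mp M0 pM _ _]; have [is_ _] := ss_mass nk s0.
apply: (ig_mulb (c := M) is_).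
  by apply: (measurableT_comp mp); apply: measurable_vecB2; [exact: measurable_cst|exact: measurable_id].
by move=> z; apply: le_trans (pM _) _; rewrite ler_piMr ?om_le1.
Qed.

Variable F : V -> R.
Hypothesis FC : Ck 2 F.
Hypothesis Fo : ig mu (fun y => F y * omk y).

Let mF : measurable_fun setT F. Proof. exact: measurable_continuous (Ck_cont FC). Qed.

Lemma ig_F_nice (M : R) psi : nice k M psi -> ig mu (fun x => F x * psi x).
Proof.
move=> [mp M0 pM _ _]; apply: (ig_le (g := fun x => M * wF k F x)).
- by apply: igZl; exact: ig_wF Fo.
- exact: measurable_funM.
- by move=> x; rewrite normrM /wF mulrCA ler_wpM2l.
Qed.

(** For [s > 0] the kernel is even and integrable, so Fubini exchanges the roles of [F] and [psi];
    [om_conv] gives integrability on the product. *)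
Lemma LS_pairing (s M : R) psi : 0 < s -> nice k M psi ->
  [/\ ig mu (fun x => LS k s F x * psi x), ig mu (fun x => F x * LS k s psi x) &
   \int[mu]_x (LS k s F x * psi x) = \int[mu]_x (F x * LS k s psi x)].
Proof.
move=> s0 np; have [mp M0 pM _ _] := np; have io := ig_om (R := R) nk.
pose A := (1 + s ^- 2) ^+ K; have A0 : 0 <= A by rewrite exprn_ge0// addr_ge0// invr_ge0 sqr_ge0.
pose I := \int[mu]_z omk z.
pose G (xy : V * V) := F xy.2 * ss k s (xy.1 - xy.2) * psi xy.1.
have mG : measurable_fun setT G.
  apply: measurable_funM; last by apply: (measurableT_comp mp); exact: measurable_fst.
  apply: measurable_funM; first by apply: (measurableT_comp mF); exact: measurable_snd.
  by apply: (measurableT_comp (measurable_ss k s)); apply: measurable_vecB2; [exact: measurable_fst|exact: measurable_snd].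
have ish y : ig mu (fun x => omk (x - y)) by exact: ig_shift io.
have Gb y x : `|G (x, y)| <= (A * M * 4 ^+ K * wF k F y) * (omk x + omk (x - y)).
  rewrite /G/= !normrM (ger0_norm (ss_ge0 _ _ _)).
  apply: (@le_trans _ _ (`|F y| * (A * omk (x - y)) * (M * omk x))).
    by apply: ler_pM => //; [rewrite mulr_ge0// ss_ge0|rewrite ler_wpM2l// ss_le_om].
  have := om_conv k (- y) x; rewrite omN [- y + x]addrC => H.
  rewrite (_ : _ * _ * _ = (`|F y| * (A * M)) * (omk (x - y) * omk x)); last by ring.
  apply: le_trans (ler_wpM2l _ H) _; first by rewrite !mulr_ge0.
  by rewrite /wF; move: (4 ^+ K) => c; rewrite [leRHS](_ : _ = `|F y| * (A * M) * (c * (omk y * (omk x + omk (x - y)))))//; ring.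
have id y : ig mu (fun x => (A * M * 4 ^+ K * wF k F y) * (omk x + omk (x - y))).
  by apply: igZl; exact: igD.
have Gy y : ig mu (fun x => G (x, y)).
  apply: (ig_le (id y)) (Gb y); exact: (measurableT_comp mG (measurable_pair2 y)).
have iG : ig (mu \x mu)%E G.
  apply: (ig_prod2 (g := fun y => A * M * 4 ^+ K * (2 * I) * wF k F y)) => //; first by apply: igZl; exact: ig_wF Fo.
  move=> y; apply: le_trans (Rint_le (ig_abs (Gy y)) (id y) (Gb y)) _.
  rewrite (RintZl _ (igD io (ish y))) (RintD io (ish y)) (Rint_shift (- y) io) -/I.
  by rewrite le_eqVlt; apply/orP; left; apply/eqP; move: (4 ^+ K) => c; ring.
pose T1 x := \int[mu]_z (F (x - z) * ss k s z); pose T2 y := \int[mu]_z (psi (y - z) * ss k s z).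
have E1 x : \int[mu]_y G (x, y) = T1 x * psi x.
  have i1 := ig_F_ss FC Fo x s0.
  rewrite /T1 -(Rint_reflect x i1) -RintZr; last by exact: ig_reflect i1.
  by apply: eq_Rint => y; rewrite /G/= subKr.
have E2 y : \int[mu]_x G (x, y) = F y * T2 y.
  have i1 := ig_nice_ss y s0 np.
  rewrite /T2 -(Rint_reflect y i1) -RintZl; last by exact: ig_reflect i1.
  by apply: eq_Rint => x; rewrite /G/= subKr -mulrA [ss _ _ _ * _]mulrC -(ssN k s (x - y)) opprB.
have FE := Rint_fubini iG.
have j1 : ig mu (fun x => T1 x * psi x) by apply: ig_ext (ig_fubini1 iG) => x; rewrite E1.
have j2 : ig mu (fun y => F y * T2 y) by apply: ig_ext (ig_fubini2 iG) => y; rewrite E2.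
have jF := ig_F_nice np.
have S1 x : LS k s F x * psi x = 2 * mass s * (F x * psi x) - 2 * (T1 x * psi x).
  by rewrite (LS_split_gen s0 (ig_F_ss FC Fo x s0)) mulrBl !mulrA.
have S2 x : F x * LS k s psi x = 2 * mass s * (F x * psi x) - 2 * (F x * T2 x).
  by rewrite (LS_split_gen s0 (ig_nice_ss x s0 np)) -/(mass s) -/(T2 x); ring.
have k1 := igZl (2 * mass s) jF; have k2 := igZl 2 j1; have k3 := igZl 2 j2.
split; [by apply: ig_ext (igB k1 k2) => x; rewrite S1|by apply: ig_ext (igB k1 k3) => x; rewrite S2|].
rewrite (eq_Rint_to S1) (eq_Rint_to S2) (RintB k1 k2) (RintB k1 k3) (RintZl _ j1) (RintZl _ j2).
congr (_ - 2 * _); transitivity (\int[mu]_x \int[mu]_y G (x, y)); first by apply: eq_Rint => x; rewrite E1.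
by rewrite FE; apply: eq_Rint => y; rewrite E2.
Qed.

(** Limit of [LS_pairing] as [s] tends to 0. On the left [LS s F] is dominated only locally, hence
    the compact support of [psi]; on the right the domination is global, through [nice_dom]. *)
Lemma LI_pairing_csupp (r M : R) psi : 0 <= r -> csupp r psi -> nice k M psi ->
  [/\ ig mu (fun x => LI k F x * psi x), ig mu (fun x => F x * LI k psi x) &
   \int[mu]_x (LI k F x * psi x) = \int[mu]_x (F x * LI k psi x)].
Proof.
move=> r0 sp np; have [mp M0 pM _ _] := np.
have [B [G HG]] := wF_dom n3 nk FC Fo r0.
have P j := LS_pairing (sj_gt0 j) np.
have [||j x|x|i1 c1] := @Rint_dct _ _ R mu (fun j x => LS k (sj j) F x * psi x) (fun x => LI k F x * psi x) (fun x => B * M * inb r x).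
- by move=> j; have [/ig_measurable] := P j.
- by apply: igZl; exact: ig_ball.
- have [xr|xr] := leP (enorm x) r; last by rewrite sp// mulr0 normr0 inb0// mulr0.
  have [g1 g2 g3] := HG x xr; have [_ L] := LS_le n3 (sj j) mF g1 g3.
  rewrite normrM inb1// mulr1; apply: ler_pM => //; first exact: le_trans L g2.
  by apply: le_trans (pM _) _; rewrite ler_piMr ?om_le1.
- have [xr|xr] := leP (enorm x) r; last by rewrite sp// mulr0; under eq_fun do rewrite mulr0; exact: cvg_cst.
  have [g1 g2 g3] := HG x xr; apply: cvgMl; exact: (LS_cvg n3 mF g1 g3).
have [||j x|x|i2 c2] := @Rint_dct _ _ R mu (fun j x => F x * LS k (sj j) psi x) (fun x => F x * LI k psi x) (fun x => @C0 R n k * M * wF k F x).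
- by move=> j; have [_ /ig_measurable] := P j.
- by apply: igZl; exact: ig_wF Fo.
- have D (z : V) (z0 : z != 0) := nice_le x np z0.
  have [_ L] := LS_le n3 (sj j) mp (nice_dom_ig n3 nk M x) D.
  rewrite normrM /wF mulrCA ler_wpM2l//; apply: le_trans L _.
  by rewrite (nice_dom_int n3 nk) mulrA.
- have D (z : V) (z0 : z != 0) := nice_le x np z0.
  apply: cvgMr; exact: (LS_cvg n3 mp (nice_dom_ig n3 nk M x) D).
split => //; have c3 : (fun j => \int[mu]_x (LS k (sj j) F x * psi x)) @ \oo --> \int[mu]_x (F x * LI k psi x).
  have E : (fun j => \int[mu]_x (LS k (sj j) F x * psi x)) = (fun j => \int[mu]_x (F x * LS k (sj j) psi x)).
    by apply/funext => j; have [_ _] := P j.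
  by rewrite E; exact: c2.
exact: (cvg_unique _ c1 c3).
Qed.

End pairing.

(** * Removal of the compact support *)

Section cutoff.
Context {R : realType} {n : nat}.
Notation V := 'rV[R]_n.
Implicit Types (x y z : V).

Definition chi (j : nat) x : R := kb 6 1 (j.+1%:R^-1 *: x).

Lemma chi_ge0 j x : 0 <= chi j x. Proof. exact: kb_ge0. Qed.

Lemma chi_le1 j x : chi j x <= 1.
Proof. by have := @kb_le R n 6 1 (j.+1%:R^-1 *: x) ltr01; rewrite invr1 expr1n. Qed.

Lemma chi_csupp j : csupp j.+1%:R (chi j).
Proof.
move=> x xj; apply: (kb_csupp 5 ltr01); rewrite enormZ ger0_norm//.
by rewrite mulrC ltr_pdivlMr// mul1r.
Qed.

Lemma continuous_chi j : continuous (chi j).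
Proof.
move=> x; apply: (@continuous_comp _ _ _ (fun x : V => j.+1%:R^-1 *: x) (kb 6 1)).
  exact: scaler_continuous.
exact: (Ck_cont (Ck_kb 1 (isT : (0 < 6)%N))).
Qed.

Lemma cvg_chi x : chi ^~ x @ \oo --> (1 : R).
Proof.
have k0 : kb 6 1 (0 : V) = 1 by rewrite /kb (_ : nsq (0 : V) = 0) ?mul0r ?subr0 ?invr1 ?expr1n ?mul1r ?tp_pos ?expr1n// -sqr_enorm enorm0 expr0n.
have H : (fun j : nat => j.+1%:R^-1 *: x) @ \oo --> (0 : V).
  by rewrite -(scale0r x); apply: cvgZ; [exact: cvg_harmonic|exact: cvg_cst].
have C0 : {for 0, continuous (kb 6 1 : V -> R)} by exact: (Ck_cont (Ck_kb 1 (isT : (0 < 6)%N))).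
rewrite -k0; exact: (cvg_comp _ _ H C0).
Qed.

Lemma chi_incr : exists L : R, 0 <= L /\ forall j x z,
  `|chi j (x + z) - chi j x| <= L * enorm z /\ `|sdiff (chi j) x z| <= L * nsq z.
Proof.
have C2 : Ck 2 (kb 6 1 : V -> R) by exact: Ck_kb.
have cs : csupp 1 (kb 6 1 : V -> R) by exact: kb_csupp.
have /choice[M1 H1] : forall i : 'I_n, exists M, 0 <= M /\ forall y, `|partial i (kb 6 1) y| <= M :> R.
  by move=> i; apply: csupp_bounded; [apply: (@Ck_cont _ _ 1); exact: Ck_partial|exact: csupp_partial cs].
have /choice[M2 H2] : forall ij : 'I_n * 'I_n, exists M, 0 <= M /\ forall y, `|partial ij.2 (partial ij.1 (kb 6 1)) y| <= M :> R.
  move=> [i j] /=; apply: csupp_bounded; last by do 2 apply: csupp_partial; exact: cs.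
  by apply: (@Ck_cont _ _ 0); apply: Ck_partial; exact: Ck_partial.
pose A1 := \sum_i M1 i; pose A2 := \sum_ij M2 ij.
have B1 i y : `|partial i (kb 6 1) y| <= A1.
  apply: le_trans ((H1 i).2 y) _; rewrite /A1 (bigD1 i)//= lerDl; apply: sumr_ge0 => j _; exact: (H1 j).1.
have B2 i j y : `|partial j (partial i (kb 6 1)) y| <= A2.
  apply: le_trans ((H2 (i, j)).2 y) _; rewrite /A2 (bigD1 (i, j))//= lerDl; apply: sumr_ge0 => ij _; exact: (H2 ij).1.
have A10 : 0 <= A1 by apply: sumr_ge0 => j _; exact: (H1 j).1.
have A20 : 0 <= A2 by apply: sumr_ge0 => j _; exact: (H2 j).1.
have L1 : 0 <= n%:R * A1 by rewrite mulr_ge0.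
have L2 : 0 <= 2 * n%:R ^+ 2 * A2 by rewrite !mulr_ge0// exprn_ge0.
exists (n%:R * A1 + 2 * n%:R ^+ 2 * A2); split; first exact: addr_ge0.
move=> j x z; have j1 : j.+1%:R^-1 <= 1 :> R by rewrite invf_le1// ler1n.
have jz : enorm (j.+1%:R^-1 *: z) <= enorm z.
  by rewrite enormZ ger0_norm// ler_piMl ?enorm_ge0.
split.
  rewrite /chi scalerDr; apply: le_trans (incr_le (M := A1) _ _) _ => //.
    by move=> i y; case: (Ck_derivable i y (Ck_le (isT : (1 <= 2)%N) C2)).
  apply: (@le_trans _ _ (n%:R * A1 * enorm z)); first by rewrite ler_wpM2l.
  by rewrite ler_wpM2r ?enorm_ge0// lerDl.
rewrite /sdiff /chi scalerDr scalerBr; apply: le_trans (incr2_le A20 C2 _) _ => //.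
rewrite -sqr_enorm; apply: (@le_trans _ _ (2 * n%:R ^+ 2 * A2 * enorm z ^+ 2)).
  by rewrite ler_wpM2l// lerXn2r ?nnegrE ?enorm_ge0.
by rewrite ler_wpM2r ?sqr_ge0// lerDr.
Qed.

Variable k : nat.

(** The second difference of a product obeys a discrete Leibniz rule whose cross terms are products
    of first increments. [M'] does not depend on [j], so the cut-off can be removed by dominated
    convergence. *)
Lemma nice_chi (M : R) psi : nice k M psi -> exists M', forall j, nice k M' (fun x => chi j x * psi x).
Proof.
move=> [mp M0 pM dM sM]; have [L [L0 HL]] := chi_incr.
have om0 x := ltW (@om_gt0 R n k x).
exists (M * (1 + 3 * L)) => j; have M1 : M <= M * (1 + 3 * L) by rewrite ler_peMr// lerDl mulr_ge0.
split.
- by apply: measurable_funM => //; apply: measurable_continuous; exact: continuous_chi.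
- by rewrite mulr_ge0// addr_ge0// mulr_ge0.
- move=> x; rewrite normrM ger0_norm ?chi_ge0//; apply: (@le_trans _ _ (M * om k x)); last by rewrite ler_wpM2r.
  by apply: le_trans (pM x); rewrite ler_piMl// chi_le1.
- move=> x z z1; have [H1 _] := HL j x z; have z0 := enorm_ge0 z.
  rewrite (_ : _ - _ = chi j (x + z) * (psi (x + z) - psi x) + (chi j (x + z) - chi j x) * psi x); last by ring.
  have A : chi j (x + z) * `|psi (x + z) - psi x| <= M * enorm z * om k x.
    by apply: le_trans (dM x z z1); rewrite ler_piMl// chi_le1.
  have B : `|chi j (x + z) - chi j x| * `|psi x| <= L * enorm z * (M * om k x) by apply: ler_pM.
  apply: (@le_trans _ _ (M * enorm z * om k x + L * enorm z * (M * om k x))).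
    apply: le_trans (ler_normD _ _) _; apply: lerD; rewrite normrM; last exact: B.
    by rewrite [X in X * _]ger0_norm ?chi_ge0.
  rewrite [leRHS](_ : _ = M * enorm z * om k x + L * enorm z * (M * om k x) + 2 * (L * enorm z * (M * om k x))); last by ring.
  by rewrite lerDl !mulr_ge0.
- move=> x z z1; have [H1 H2] := HL j x z; have [H3 _] := HL j x (- z); rewrite enormN in H3.
  have D1 := dM x z z1; have D2 : `|psi (x - z) - psi x| <= M * enorm z * om k x by rewrite -(enormN z); apply: dM; rewrite enormN.
  have z0 := enorm_ge0 z; have q0 := nsq_ge0 z.
  rewrite (_ : sdiff _ x z = chi j x * sdiff psi x z + psi x * sdiff (chi j) x z
    - (chi j (x + z) - chi j x) * (psi (x + z) - psi x) - (chi j (x - z) - chi j x) * (psi (x - z) - psi x)); last by rewrite /sdiff; ring.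
  have A : `|chi j x * sdiff psi x z| <= M * nsq z * om k x.
    by rewrite normrM (ger0_norm (chi_ge0 _ _)); apply: le_trans (sM x z z1); rewrite ler_piMl// chi_le1.
  have B : `|psi x * sdiff (chi j) x z| <= M * om k x * (L * nsq z) by rewrite normrM; apply: ler_pM.
  have C (a b : R) : `|a| <= L * enorm z -> `|b| <= M * enorm z * om k x -> `|a * b| <= L * enorm z * (M * enorm z * om k x).
    by move=> ha hb; rewrite normrM; apply: ler_pM.
  apply: le_trans (ler_normB _ _) _; apply: le_trans (lerD (ler_normB _ _) (C _ _ H3 D2)) _.
  apply: le_trans (lerD (lerD (ler_normD _ _) (C _ _ H1 D1)) (lexx _)) _.
  apply: le_trans (lerD (lerD (lerD A B) (lexx _)) (lexx _)) _.
  rewrite le_eqVlt; apply/orP; left; apply/eqP; rewrite -sqr_enorm; ring.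
Qed.

End cutoff.

Section noncompact_pairing.
Context {R : realType} {n : nat}.
Hypothesis n3 : (2 < n)%N.
Variable k : nat.
Hypothesis nk : n = (2 * k).+1.
Notation V := 'rV[R]_n.
Notation mu := (@volm R n).
Variable F : V -> R.
Hypothesis FC : Ck 2 F.
Hypothesis Fo : ig mu (fun y => F y * om k y).
Hypothesis fi : ig mu (LI k F).

Let n0 : (0 < n)%N. Proof. exact: leq_trans n3. Qed.

(** Both sides pass to the limit along the cut-offs: on the left [LI k F] is integrable and [psi]
    bounded, on the right the decay [om] holds uniformly in [j]. *)
Lemma LI_pairing (M : R) psi : nice k M psi ->
  ig mu (fun x => F x * LI k psi x) /\ \int[mu]_x (LI k F x * psi x) = \int[mu]_x (F x * LI k psi x).
Proof.
move=> np; have [mp M0 pM _ _] := np; have [M' HM'] := nice_chi np.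
have cs j : csupp j.+1%:R (fun x => psi x * chi j x) by apply: csuppM; exact: chi_csupp.
have P j N (h : nice k N (fun x => psi x * chi j x)) := LI_pairing_csupp n3 nk FC Fo (ler0n R j.+1) (cs j) h.
have np' j : nice k M' (fun x => psi x * chi j x).
  by rewrite (_ : (fun x => _) = (fun x => chi j x * psi x))//; apply/funext => x; rewrite mulrC.
have cchi x : chi ^~ x @ \oo --> (1 : R) by exact: cvg_chi.
have [||j x|x|_ c1] := @Rint_dct _ _ R mu (fun j x => LI k F x * (psi x * chi j x)) (fun x => LI k F x * psi x) (fun x => `|LI k F x| * M).
- by move=> j; have [/ig_measurable] := P j _ (np' j).
- by apply: igZr; exact: ig_abs.
- rewrite normrM ler_wpM2l// normrM (ger0_norm (chi_ge0 _ _)); apply: (@le_trans _ _ `|psi x|).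
    by rewrite ler_piMr// chi_le1.
  by apply: le_trans (pM _) _; rewrite ler_piMr ?om_le1.
- by apply: cvgMr; rewrite -[X in _ --> X]mulr1; apply: cvgMr; exact: cchi.
have [||j x|x|i2 c2] := @Rint_dct _ _ R mu (fun j x => F x * LI k (fun x => psi x * chi j x) x) (fun x => F x * LI k psi x) (fun x => @C0 R n k * M' * wF k F x).
- by move=> j; have [_ /ig_measurable] := P j _ (np' j).
- by apply: igZl; exact: ig_wF Fo.
- have D (z : V) (z0 : z != 0) := nice_le x (np' j) z0; have [mj _ _ _ _] := np' j.
  have L := LI_le n3 mj (nice_dom_ig n3 nk M' x) D.
  rewrite normrM /wF mulrCA ler_wpM2l//; apply: le_trans L _.
  by rewrite (nice_dom_int n3 nk) mulrA.
- apply: cvgMr; have [||j z z0|z z0|_ H] := @Rint_dct0 R n n0 (fun j z => sdiff (fun x => psi x * chi j x) x z * pw k z) (fun z => sdiff psi x z * pw k z) (nice_dom k M' x); last exact: H.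
  + move=> j; have [mj _ _ _ _] := np' j.
    by apply: measurable_funM; [exact: measurable_sdiff|exact: measurable_pw].
  + exact: nice_dom_ig.
  + exact: nice_le (np' j) z0.
  + apply: cvgMl; rewrite /sdiff; apply: cvgB; first apply: cvgB.
    * by apply: cvgMr; rewrite -[X in _ --> X]mulr1; apply: cvgMr; exact: cchi.
    * by rewrite -[X in _ --> X]mulr1; apply: cvgMr; exact: cchi.
    * by rewrite -[X in _ --> X]mulr1; apply: cvgMr; exact: cchi.
split => //; have c3 : (fun j => \int[mu]_x (LI k F x * (psi x * chi j x))) @ \oo --> \int[mu]_x (F x * LI k psi x).
  have E : (fun j => \int[mu]_x (LI k F x * (psi x * chi j x))) = (fun j => \int[mu]_x (F x * LI k (fun x => psi x * chi j x) x)).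
    by apply/funext => j; have [_ _] := P j _ (np' j).
  by rewrite E; exact: c2.
exact: (cvg_unique _ c1 c3).
Qed.

End noncompact_pairing.

(** * Semigroup law of the Poisson kernels *)

Lemma measurable_neg {R : realType} d (T : measurableType d) (f : T -> R) :
  measurable_fun setT f -> measurable_fun setT (fun t => - f t).
Proof.
move=> mf; rewrite (_ : (fun t => - f t) = (fun t => 0 - f t)); last by apply/funext => t; rewrite sub0r.
by apply: measurable_funB => //; exact: measurable_cst.
Qed.

Lemma measurable_lnn {R : realType} d (T : measurableType d) (f : T -> R) :
  measurable_fun setT f -> measurable_fun setT (fun t => ln (f t)).
Proof. by move=> mf; apply: (measurableT_comp (@measurable_ln R)). Qed.

Ltac measurability := repeat first
  [ exact: measurable_cst | exact: measurable_fst | exact: measurable_snd | exact: measurable_id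
  | apply: measurable_expRn | apply: measurable_lnn | apply: measurable_neg | apply: measurable_funX
  | apply: measurable_funB | apply: measurable_funD | apply: measurable_funM | eassumption ].

Section semigroup.
Context {R : realType} {n : nat}.
Variable k : nat.
Hypothesis nk : n = (2 * k).+1.
Notation V := 'rV[R]_n.
Notation mu := (@volm R n).
Notation leb := (@lebesgue_measure R).
Notation K := k.+1.
Implicit Types (x y z : V).

Lemma integralZr_fin d (T : measurableType d) (m : {measure set T -> \bar R}) (f : T -> R) (a w : R) :
  measurable_fun setT f -> (forall u, 0 <= f u) -> 0 <= w -> (\int[m]_u (f u)%:E = a%:E)%E ->
  (\int[m]_u (f u * w)%:E = (a * w)%:E)%E.
Proof.
move=> mf f0 w0 E; under eq_integral => x _ do rewrite EFinM.
by rewrite ge0_integralZr ?E//; [exact/measurable_EFinP|move=> x _; rewrite lee_fin].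
Qed.

Lemma tonelli_fin d1 d2 (T1 : measurableType d1) (T2 : measurableType d2)
  (m1 : {sigma_finite_measure set T1 -> \bar R}) (m2 : {sigma_finite_measure set T2 -> \bar R}) (f : T1 -> T2 -> R) :
  measurable_fun setT (fun z : T1 * T2 => f z.1 z.2) -> (forall u v, 0 <= f u v) ->
  (\int[m1]_u \int[m2]_v (f u v)%:E = \int[m2]_v \int[m1]_u (f u v)%:E)%E.
Proof.
move=> mf f0; have mf' : measurable_fun setT (fun z : T1 * T2 => (f z.1 z.2)%:E) by exact/measurable_EFinP.
have f0' (z : T1 * T2) : (0 <= (f z.1 z.2)%:E)%E by rewrite lee_fin.
refine (@fubini_tonelli _ _ _ _ R m1 m2 _ mf' f0').
Qed.

(* Both factors are superpositions of Gaussians with parameters [e^a] and [e^b].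
   The shifts [b = th + a] and [a = w + ln (1 + e^-th)] reduce the double
   integral of Gaussian convolutions to Cauchy-Schlomilch integrals. *)
Lemma poisson_semigroup_ereal (s t : R) x : 0 < s -> 0 < t ->
  (\int[mu]_y (s * t * (k`!%:R / (nsq (x - y) + s ^+ 2) ^+ K) * (k`!%:R / (nsq y + t ^+ 2) ^+ K))%:E =
   (pi ^+ K * (s + t) * (k`!%:R / (nsq x + (s + t) ^+ 2) ^+ K))%:E)%E.
Proof.
move=> s0 t0; have st0 : 0 <= s * t by rewrite mulr_ge0// ltW.
have s2 : 0 < s ^+ 2 by rewrite exprn_gt0.
have t2 : 0 < t ^+ 2 by rewrite exprn_gt0.
pose c1 y := nsq (x - y) + s ^+ 2; pose c2 y := nsq y + t ^+ 2.
have c10 y : 0 < c1 y by rewrite ltr_wpDl ?nsq_ge0.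
have c20 y : 0 < c2 y by rewrite ltr_wpDl ?nsq_ge0.
have mn : measurable_fun setT (fun y : V => nsq y) by apply: measurable_continuous; exact: continuous_nsq.
have mc1 : measurable_fun setT c1.
  apply: measurable_funD; last exact: measurable_cst.
  by apply: (measurableT_comp mn); apply: measurable_vecB2; [exact: measurable_cst|exact: measurable_id].
have mc2 : measurable_fun setT c2 by apply: measurable_funD; [exact: mn|exact: measurable_cst].
have cE (c : V -> R) : (forall y, 0 < c y) -> measurable_fun setT c -> measurable_fun setT (fun y => k`!%:R / c y ^+ K).
  move=> c0 mc; have -> : (fun y => k`!%:R / c y ^+ K) = (fun y => k`!%:R * expR (- (K%:R * ln (c y)))).
    by apply/funext => y; rewrite expRN expRM_natl lnK ?posrE.
  by measurability.
pose g (c : V -> R) (y : V) (a : R) := expR (K%:R * a - c y * expR a).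
have g0 c y a : 0 <= g c y a by exact: expR_ge0.
have mg (c : V -> R) : measurable_fun setT c -> measurable_fun setT (fun z : V * R => g c z.1 z.2).
  move=> mc; have mc' : measurable_fun setT (fun z : V * R => c z.1) by apply: (measurableT_comp mc); exact: measurable_fst.
  by rewrite /g; measurability.
have mgy (c : V -> R) y : measurable_fun [set: measurableTypeR R] (g c y) by rewrite /g; measurability.
have mga (c : V -> R) a : measurable_fun setT c -> measurable_fun setT (fun y => g c y a).
  by move=> mc; rewrite /g; measurability.
pose tau (a b : R) := expR a + expR b.
have lg1 y : (\int[leb]_a (g c1 y a)%:E = (k`!%:R / c1 y ^+ K)%:E)%E := log_gamma k (c10 y).
have lg2 y : (\int[leb]_a (g c2 y a)%:E = (k`!%:R / c2 y ^+ K)%:E)%E := log_gamma k (c20 y).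
have tau0 a b : 0 < tau a b by rewrite addr_gt0 ?expR_gt0.
(* What remains after integrating in [y] the Gaussians of parameters [exp a] and [exp b] with their
   weights. Reciprocals are written as exponentials of logarithms, a form covered by
   [measurability]. *)
pose H (a b : R) := s * t * Num.sqrt pi ^+ n * expR (K%:R * a + K%:R * b - s ^+ 2 * expR a - t ^+ 2 * expR b
  - n%:R / 2 * ln (tau a b) - expR a * expR b * expR (0 - ln (tau a b)) * nsq x).
have H0 a b : 0 <= H a b by rewrite !mulr_ge0 ?exprn_ge0 ?sqrtr_ge0 ?expR_ge0 ?(ltW s0) ?(ltW t0).
have mH : measurable_fun setT (fun z : R * R => H z.1 z.2).
  by rewrite /H /tau; measurability.
have gauss a b : (\int[mu]_y (s * t * g c1 y a * g c2 y b)%:E = (H a b)%:E)%E.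
  have ea := expR_gt0 a; have eb := expR_gt0 b.
  have E y : s * t * g c1 y a * g c2 y b = expR (- (expR a * nsq (x - y))) * expR (- (expR b * nsq y)) *
      (s * t * expR (K%:R * a + K%:R * b - s ^+ 2 * expR a - t ^+ 2 * expR b)).
    rewrite /g /c1 /c2 -[s * t * _ * _]mulrA -expRD -[expR (- _) * expR _]expRD [RHS]mulrC -[RHS]mulrA -expRD.
    by congr (_ * expR _); ring.
  under eq_integral => y _ do rewrite E.
  rewrite (integralZr_fin _ _ _ (gaussian_conv x ea eb)).
  - congr EFin; rewrite -/(tau a b) /H.
    have -> : Num.sqrt (pi / tau a b) ^+ n = Num.sqrt pi ^+ n * expR (- (n%:R / 2 * ln (tau a b))).
      rewrite sqrtrM ?pi_ge0// exprMn; congr (_ * _).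
      rewrite -mulrA -mulrN expRM_natl; congr (_ ^+ _).
      rewrite sqrtrV ?(ltW (tau0 a b))// -[in LHS](lnK (tau0 a b)).
      rewrite expRN; congr (_^-1); rewrite mulrC.
      have -> : expR (ln (tau a b)) = expR (ln (tau a b) / 2) ^+ 2 by rewrite -expRM_natl; congr expR; field.
      by rewrite sqrtr_sqr ger0_norm ?expR_ge0.
    have -> : expR (0 - ln (tau a b)) = (tau a b)^-1 by rewrite sub0r expRN lnK ?posrE.
    rewrite [LHS](_ : _ = s * t * Num.sqrt pi ^+ n * (expR (- (n%:R / 2 * ln (tau a b))) *
      expR (- (expR a * expR b / tau a b * nsq x)) * expR (K%:R * a + K%:R * b - s ^+ 2 * expR a - t ^+ 2 * expR b))); last by ring.
    by rewrite -!expRD; congr (_ * expR _); ring.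
  - apply: measurable_funM; apply: measurable_expRn; apply: measurable_neg; apply: measurable_funM;
      try exact: measurable_cst; last exact: mn.
    by apply: (measurableT_comp mn); apply: measurable_vecB2; [exact: measurable_cst|exact: measurable_id].
  - by move=> y; rewrite mulr_ge0 ?expR_ge0.
  - by rewrite mulr_ge0 ?expR_ge0.
have c2K y : 0 <= k`!%:R / c2 y ^+ K by rewrite divr_ge0// exprn_ge0// ltW.
transitivity (\int[mu]_y \int[leb]_a (s * t * g c1 y a * (k`!%:R / c2 y ^+ K))%:E)%E.
  apply: eq_integral => y _; rewrite (integralZr_fin (a := s * t * (k`!%:R / c1 y ^+ K)))//.
  - by apply: measurable_funM; [exact: measurable_cst|exact: mgy].
  - by move=> a; rewrite mulr_ge0.
  - under eq_integral => a _ do rewrite mulrC.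
    by rewrite (integralZr_fin (mgy c1 y) (g0 c1 y) st0 (lg1 y)) mulrC.
rewrite (@tonelli_fin _ _ _ _ mu leb (fun y a => s * t * g c1 y a * (k`!%:R / c2 y ^+ K))); last 2 first.
- apply: measurable_funM; first by apply: measurable_funM; [exact: measurable_cst|exact: mg].
  by apply: (measurableT_comp (cE _ c20 mc2)); exact: measurable_fst.
- by move=> y a; rewrite mulr_ge0// mulr_ge0.
transitivity (\int[leb]_a \int[leb]_b (H a b)%:E)%E.
  apply: eq_integral => a _.
  transitivity (\int[mu]_y \int[leb]_b (s * t * g c1 y a * g c2 y b)%:E)%E.
    apply: eq_integral => y _; under [RHS]eq_integral => b _ do rewrite mulrC.
    by rewrite (integralZr_fin (mgy c2 y) (g0 c2 y) _ (lg2 y)) 1?mulrC// mulr_ge0.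
  rewrite (@tonelli_fin _ _ _ _ mu leb (fun y b => s * t * g c1 y a * g c2 y b)).
  - by apply: eq_integral => b _; exact: gauss.
  - apply: measurable_funM; last exact: mg.
    apply: measurable_funM; first exact: measurable_cst.
    by apply: (measurableT_comp (mga c1 a mc1)); exact: measurable_fst.
  - by move=> y b; rewrite !mulr_ge0 ?(ltW s0) ?(ltW t0).
have mHa a : measurable_fun setT (fun b => (H a b)%:E).
  by apply/measurable_EFinP; exact: (measurableT_comp mH (measurable_pair1 a)).
transitivity (\int[leb]_a \int[leb]_b (H a (b + a))%:E)%E.
  apply: eq_integral => a _; have nH b : (0 <= (H a b)%:E)%E by rewrite lee_fin.
  exact: (esym (@ge0_lebesgue_integralD R a (fun b => (H a b)%:E) (mHa a) nH)).
have mH2 (f1 f2 : R * R -> R) : measurable_fun setT f1 -> measurable_fun setT f2 ->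
    measurable_fun setT (fun z : R * R => H (f1 z) (f2 z)).
  by move=> m1 m2; rewrite /H /tau; measurability.
have M1 : measurable_fun setT (fun z : R * R => H z.1 (z.2 + z.1)) by apply: mH2; measurability.
transitivity (\int[leb]_b \int[leb]_a (H a (b + a))%:E)%E.
  exact: (@tonelli_fin _ _ _ _ leb leb (fun a b => H a (b + a)) M1 (fun a b => H0 a (b + a))).
pose lam (th : R) := ln (1 + expR (0 - th)).
have l0 th : 0 < 1 + expR (0 - th) by rewrite addr_gt0 ?expR_gt0.
have mlam : measurable_fun setT lam.
  by rewrite /lam; apply: (measurableT_comp (@measurable_ln R)); measurability.
transitivity (\int[leb]_th \int[leb]_w (H (w + lam th) (th + (w + lam th)))%:E)%E.
  apply: eq_integral => th _; have nH w : (0 <= (H w (th + w))%:E)%E by rewrite lee_fin.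
  have mth : measurable_fun [set: measurableTypeR R] (fun w => (H w (th + w))%:E).
    apply/measurable_EFinP; have m2 := mH2 (@snd R R) (fun z : R * R => z.1 + z.2).
    by apply: (measurableT_comp (m2 _ _) (measurable_pair1 th)); measurability.
  exact: (esym (@ge0_lebesgue_integralD R (lam th) (fun w => (H w (th + w))%:E) mth nH)).
(* After the shifts the integrand factors: [S] is the Cauchy-Schlomilch integrand in [th] with
   [v = exp (w / 2)], and the factor [exp (w / 2)] of [W] cancels the [1 / v] of its integral,
   leaving a logarithmic Gamma integral in [w]. *)
pose S (w th : R) := s * t * (expR (th / 2) + expR (- (th / 2))) *
     expR (- (expR (w / 2) * (t * expR (th / 2) - s * expR (- (th / 2)))) ^+ 2).
pose c3 := nsq x + (s + t) ^+ 2.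
have c30 : 0 < c3 by rewrite ltr_wpDl ?nsq_ge0// exprn_gt0// addr_gt0.
pose W (w : R) := Num.sqrt pi ^+ n * expR (K%:R * w - c3 * expR w) * expR (w / 2).
have HS w th : H (w + lam th) (th + (w + lam th)) = S w th * W w.
  pose p := expR (th / 2); pose m := expR (- (th / 2)).
  have pm : p * m = 1 by rewrite -expRD subrr expR0.
  have em : expR (0 - th) = m ^+ 2 by rewrite -expRM_natl; congr expR; field.
  have ep : expR th = p ^+ 2 by rewrite -expRM_natl; congr expR; field.
  have el : expR (lam th) = 1 + m ^+ 2 by rewrite /lam lnK ?posrE// em.
  have elt : expR (lam th + th) = 1 + p ^+ 2.
    rewrite expRD el ep mulrDl mul1r addrC; congr (_ + _).
    by rewrite -exprMn mulrC pm expr1n.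
  have lt : ln (tau (w + lam th) (th + (w + lam th))) = w + 2 * lam th + th.
    apply: expR_inj; rewrite lnK ?posrE//.
    rewrite /tau (_ : th + (w + lam th) = w + (lam th + th)); last by ring.
    rewrite (_ : w + 2 * lam th + th = w + (lam th + (lam th + th))); last by ring.
    have elt' : expR (lam th) * expR th = 1 + p ^+ 2 by rewrite -expRD.
    rewrite !expRD elt' el; have : p ^+ 2 * m ^+ 2 = 1 by rewrite -exprMn pm expr1n.
    by move: (expR w) (p ^+ 2) (m ^+ 2) => X P M E; rewrite (_ : X * ((1 + M) * (1 + P)) = X * (1 + M) + X * (P + P * M)); [rewrite E; ring|ring].
  have hp : expR (lam th + th / 2) = p + m.
    by rewrite expRD el -/p mulrDl mul1r; congr (_ + _); rewrite expr2 -mulrA [m * p]mulrC pm mulr1.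
  rewrite /H lt /S -/p -/m -hp /W.
  have eww : expR (w + lam th) * expR (th + (w + lam th)) * expR (0 - (w + 2 * lam th + th)) = expR w.
    by rewrite -!expRD; congr expR; ring.
  rewrite eww (_ : th + (w + lam th) = w + (lam th + th)); last by ring.
  rewrite [expR (w + lam th)]expRD el [expR (w + (lam th + th))]expRD elt.
  have ew : expR (w / 2) ^+ 2 = expR w by rewrite -expRM_natl; congr expR; field.
  rewrite exprMn ew.
  rewrite [RHS](_ : _ = s * t * Num.sqrt pi ^+ n * (expR (lam th + th / 2) * expR (- (expR w * (t * p - s * m) ^+ 2)) *
    expR (K%:R * w - c3 * expR w) * expR (w / 2))); last by ring.
  rewrite -!expRD; congr (_ * expR _).
  have nE : n%:R / 2 = K%:R - 2^-1 :> R by rewrite nk -[(2 * k).+1]addn1 natrD natrM -[K]addn1 natrD; field.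
  rewrite nE /c3; have -> : (t * p - s * m) ^+ 2 = t ^+ 2 * p ^+ 2 + s ^+ 2 * m ^+ 2 - 2 * s * t.
    have e : 2 * s * t = 2 * s * t * (p * m) by rewrite pm mulr1.
    by rewrite [in RHS]e; ring.
  by move: (K%:R : R) (p ^+ 2) (m ^+ 2) (expR w) (lam th) => k0 P M X L; field.
have mS : measurable_fun setT (fun z : R * R => S z.1 z.2 * W z.1) by rewrite /S /W; measurability.
have mS1 : measurable_fun setT (fun z : R * R => S z.1 z.2) by rewrite /S; measurability.
have S0 w th : 0 <= S w th.
  by rewrite !mulr_ge0 ?addr_ge0 ?expR_ge0 ?(ltW s0) ?(ltW t0).
have W0 w : 0 <= W w by rewrite !mulr_ge0 ?exprn_ge0 ?sqrtr_ge0 ?expR_ge0.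
transitivity (\int[leb]_w \int[leb]_th (S w th * W w)%:E)%E.
  transitivity (\int[leb]_th \int[leb]_w (S w th * W w)%:E)%E; last first.
    exact: (esym (@tonelli_fin _ _ _ _ leb leb (fun w th => S w th * W w) mS (fun w th => mulr_ge0 (S0 w th) (W0 w)))).
  by apply: eq_integral => th _; apply: eq_integral => w _; rewrite HS.
transitivity (\int[leb]_w (expR (K%:R * w - c3 * expR w) * (pi ^+ K * (s + t)))%:E)%E.
  apply: eq_integral => w _; rewrite (integralZr_fin _ _ _ (cauchy_schlomilch (expR_gt0 (w / 2)) s0 t0))//.
  - have sp : Num.sqrt pi ^+ n * Num.sqrt pi = pi ^+ K :> R.
      by rewrite nk -exprSr -[(2 * k).+2]/(2 * k).+2 (_ : (2 * k).+2 = 2 * K)%N ?exprM ?sqr_sqrtr ?pi_ge0//; lia.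
    congr EFin; rewrite /W -sp; have en : expR (w / 2) != 0 by rewrite gt_eqF ?expR_gt0.
    by move: (expR (w / 2)) en (Num.sqrt pi ^+ n) (expR (_ - _)) => e en q r; field.
  - exact: (measurableT_comp mS1 (measurable_pair1 w)).
  - by move=> u; exact: S0.
transitivity ((k`!%:R / c3 ^+ K * (pi ^+ K * (s + t)))%:E)%E; last by rewrite mulrC.
have mW : measurable_fun [set: measurableTypeR R] (fun w => expR (K%:R * w - c3 * expR w)) by measurability.
have W1 : 0 <= pi ^+ K * (s + t) by rewrite mulr_ge0 ?exprn_ge0 ?pi_ge0// addr_ge0 ?ltW.
exact: (@integralZr_fin _ _ leb (fun w => expR (K%:R * w - c3 * expR w)) _ _ mW (fun w => expR_ge0 _) W1 (log_gamma k c30)).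
Qed.

End semigroup.

(** * Half-Laplacian of the Poisson kernels *)

Section poisson_kernel.
Context {R : realType} {n : nat}.
Hypothesis n3 : (2 < n)%N.
Variable k : nat.
Hypothesis nk : n = (2 * k).+1.
Notation V := 'rV[R]_n.
Notation mu := (@volm R n).
Notation K := k.+1.
Notation m0 := (pi ^+ K / k`!%:R : R).
Implicit Types (x y z w : V) (t s : R).

Let n0 : (0 < n)%N. Proof. exact: leq_trans n3. Qed.

Definition rho t y : R := (nsq y + t ^+ 2)^-1.

Lemma ssE t y : ss k t y = rho t y ^+ K. Proof. by rewrite /ss sgK ?sqr_ge0. Qed.

Lemma rho_gt0 t y : 0 < t -> 0 < rho t y.
Proof. by move=> t0; rewrite invr_gt0 ltr_wpDl ?nsq_ge0// exprn_gt0. Qed.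

Lemma is_derive_rho t y (i : 'I_n) : 0 < t -> is_derive y 'e_i (rho t) (- (2 * y ord0 i * rho t y ^+ 2)).
Proof.
move=> t0; have q0 : 0 < nsq y + t ^+ 2 by rewrite ltr_wpDl ?nsq_ge0// exprn_gt0.
have E (z : V) : sg (t ^+ 2) (- 1%:R) z = rho t z.
  by rewrite /sg rp_nat ?addr_ge0 ?nsq_ge0 ?sqr_ge0// expr1.
have := is_derive_chain (is_derive_nsq i y) (is_derive_rp (- 1%:R) q0).
apply: is_derive_ext => [z|]; first by rewrite -E.
rewrite (_ : - 1%:R - 1 = - 2%:R :> R); last by rewrite [2%:R]mulr2n opprD.
by rewrite rp_nat ?(ltW q0)// /rho; ring.
Qed.

Lemma is_derive_ss t y (i : 'I_n) : 0 < t ->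
  is_derive y 'e_i (ss k t) (- (2 * K%:R) * (y ord0 i * rho t y * ss k t y)).
Proof.
move=> t0; have := is_derive_chain (is_derive_rho y i t0) (is_derive_powc 1 k (rho t y)).
apply: is_derive_ext => [z|]; first by rewrite ssE mul1r.
by rewrite ssE mul1r [rho t y ^+ K]exprS; move: (rho t y ^+ k) (rho t y) => X Y; ring.
Qed.

(** Differentiation brings out factors [y_i * rho] and [rho], all bounded by [1 + t^-2]; so
    derivatives are bounded by multiples of the kernel itself. *)
Lemma ss_partials t : 0 < t -> exists A : R, 0 <= A /\ forall i j y,
  `|partial i (ss k t) y| <= A * ss k t y /\ `|partial j (partial i (ss k t)) y| <= A * ss k t y.
Proof.
move=> t0; have t2 : 0 < t ^+ 2 by rewrite exprn_gt0.
pose B := 1 + t ^- 2; have B1 : 1 <= B by rewrite lerDl invr_ge0 ltW.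
have B0 : 0 <= B by rewrite (le_trans _ B1).
have rB y (a : R) : a <= nsq y + 1 -> a * rho t y <= B.
  move=> ay; rewrite ler_pdivrMr; last by rewrite ltr_wpDl ?nsq_ge0.
  apply: le_trans ay _; rewrite /B mulrDl mul1r mulrDr mulVf ?gt_eqF//.
  have : 0 <= t ^- 2 * nsq y by rewrite mulr_ge0 ?nsq_ge0// invr_ge0 ltW.
  by move: (t ^- 2 * nsq y) (t ^+ 2) t2 => u v v0 u0; lra.
have yB y i : `|y ord0 i * rho t y| <= B.
  rewrite normrM (gtr0_norm (rho_gt0 y t0)); apply: rB.
  have := coord_le_enorm y i; have := sqr_enorm y; have := enorm_ge0 y.
  by move: (enorm y) (nsq y) `|y ord0 i| => e q a e0 <- ae; nra.
have r1 y : `|rho t y| <= B by rewrite gtr0_norm ?rho_gt0// -[rho _ _]mul1r; apply: rB; rewrite lerDr nsq_ge0.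
have d1 (i : 'I_n) (y : V) := is_derive_ss y i t0.
have P1 i : partial i (ss k t) = fun y => - (2 * K%:R) * (y ord0 i * rho t y * ss k t y).
  exact: (@partialE _ _ (ss k t) (fun i y => - (2 * K%:R) * (y ord0 i * rho t y * ss k t y)) i (d1 i)).
pose D2 (i j : 'I_n) (y : V) : R := - (2 * K%:R) * (((j == i)%:R * rho t y - 2 * (y ord0 i * rho t y) * (y ord0 j * rho t y) -
      (2 * K%:R) * (y ord0 i * rho t y) * (y ord0 j * rho t y)) * ss k t y).
have d2 (i j : 'I_n) y : is_derive y 'e_j (partial i (ss k t)) (D2 i j y).
  rewrite P1.
  have e1 : is_derive y 'e_j (fun y : V => y ord0 i * rho t y) ((j == i)%:R * rho t y - 2 * y ord0 i * y ord0 j * rho t y ^+ 2).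
    have := is_deriveM (is_derive_coord j i y) (is_derive_rho y j t0); apply: is_derive_ext => [z //|].
    by rewrite /GRing.scale/=; move: ((j == i)%:R : R) => dl; ring.
  have e2 : is_derive y 'e_j (fun y : V => y ord0 i * rho t y * ss k t y)
      (((j == i)%:R * rho t y - 2 * y ord0 i * y ord0 j * rho t y ^+ 2) * ss k t y +
       (y ord0 i * rho t y) * (- (2 * K%:R) * (y ord0 j * rho t y * ss k t y))).
    have := is_deriveM e1 (d1 j y); apply: is_derive_ext => [z //|].
    by rewrite /GRing.scale/= addrC; congr (_ + _); rewrite mulrC.
  have := is_deriveZ (- (2 * K%:R)) e2; apply: is_derive_ext => [z //|].
  rewrite /GRing.scale/= /D2; move: (ss k t y) (rho t y) (K%:R : R) ((j == i)%:R : R) => S r0 K0 dl; ring.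
have P2 i j : partial j (partial i (ss k t)) = D2 i j := @partialE _ _ (partial i (ss k t)) (fun j => D2 i j) j (d2 i j).
pose K2 : R := 2 * K%:R; have K20 : 0 <= K2 by rewrite mulr_ge0.
exists (K2 * (B + 2 * B * B + K2 * B * B)); split; first by apply: mulr_ge0 => //; apply: addr_ge0; [apply: addr_ge0 => //|]; rewrite -mulrA; apply: mulr_ge0 => //; exact: mulr_ge0.
move=> i j y; have s0 := ss_ge0 k t y; split.
  rewrite P1 mulrA normrM (ger0_norm s0) ler_wpM2r// normrM normrN (ger0_norm K20) ler_wpM2l//.
  by apply: le_trans (yB y i) _; rewrite -addrA lerDl addr_ge0// !mulr_ge0.
rewrite P2 /D2 normrM normrN (ger0_norm K20) -[leRHS]mulrA ler_wpM2l// normrM (ger0_norm s0) ler_wpM2r//.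
have h1 : `|(j == i)%:R * rho t y| <= B.
  by case: (j == i); rewrite ?mul1r ?mul0r ?normr0// r1.
have h2 (c : R) : 0 <= c -> `|c * (y ord0 i * rho t y) * (y ord0 j * rho t y)| <= c * B * B.
  move=> c0; rewrite normrM normrM (ger0_norm c0) -!mulrA ler_wpM2l//; exact: ler_pM (yB y i) (yB y j).
apply: le_trans (ler_normB _ _) (lerD (le_trans (ler_normB _ _) (lerD h1 (h2 2 _))) (h2 _ K20)) => //.
Qed.

Lemma om_near x y : enorm (y - x) <= 1 -> om k y <= 4 ^+ K * om k x.
Proof.
move=> yx; have := om_shift k (x - y) y; rewrite subrK => H; apply: le_trans H _.
rewrite ler_wpM2r ?(ltW (om_gt0 _ _))// lerXn2r ?nnegrE ?mulr_ge0 ?addr_ge0 ?nsq_ge0//.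
rewrite -sqr_enorm enormBC (_ : 4 = 2 * 2 :> R); last by ring.
by rewrite ler_wpM2l// (_ : 2 = 1 + 1 :> R)// lerD2r exprn_ile1 ?enorm_ge0.
Qed.

Lemma nice_ss t : 0 < t -> exists M, nice k M (@ss R n k t).
Proof.
move=> t0; have t2 : 0 < t ^+ 2 by rewrite exprn_gt0.
have [A [A0 HA]] := ss_partials t0.
pose A1 := (1 + t ^- 2) ^+ K; have A10 : 0 <= A1 by rewrite exprn_ge0// addr_ge0// invr_ge0 sqr_ge0.
pose D := A * A1 * 4 ^+ K; have D0 : 0 <= D by rewrite !mulr_ge0// exprn_ge0.
have o0 x := ltW (@om_gt0 R n k x).
have C2 : Ck 2 (@ss R n k t) by exact: Ck_sg.
have sD x y : enorm (y - x) <= 1 -> A * ss k t y <= D * om k x.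
  move=> yx; rewrite /D -2!mulrA ler_wpM2l//; apply: le_trans (ss_le_om k y t0) _.
  by rewrite ler_wpM2l// om_near.
exists (A1 + n%:R * D + 2 * n%:R ^+ 2 * D); split.
- exact: measurable_ss.
- by rewrite !addr_ge0// !mulr_ge0// exprn_ge0.
- move=> x; rewrite ger0_norm ?ss_ge0//; apply: le_trans (ss_le_om k x t0) _.
  by rewrite ler_wpM2r// -addrA lerDl addr_ge0// !mulr_ge0// exprn_ge0.
- move=> x z z1; apply: (@le_trans _ _ (n%:R * (D * om k x) * enorm z)).
    apply: incr_le => [i y|i y yx]; first by case: (Ck_derivable i y (Ck_le (isT : (1 <= 2)%N) C2)).
    by apply: le_trans ((HA i i y).1) _; apply: sD; exact: le_trans yx z1.
  rewrite [leLHS](_ : _ = n%:R * D * enorm z * om k x); last by ring.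
  rewrite ler_wpM2r// ler_wpM2r ?enorm_ge0// addrAC lerDr addr_ge0// !mulr_ge0// exprn_ge0.
- move=> x z z1; apply: (@le_trans _ _ (2 * n%:R ^+ 2 * (D * om k x) * enorm z ^+ 2)).
    apply: incr2_le => // [|i j y yx]; first by rewrite mulr_ge0.
    by apply: le_trans ((HA i j y).2) _; apply: sD; exact: le_trans yx z1.
  rewrite sqr_enorm [leLHS](_ : _ = 2 * n%:R ^+ 2 * D * nsq z * om k x); last by ring.
  by rewrite ler_wpM2r// ler_wpM2r ?nsq_ge0// lerDr addr_ge0// mulr_ge0.
Qed.

Lemma om_reflect x y : om k (x - y) <= (2 * (nsq x + 1)) ^+ K * om k y.
Proof. by have := om_shift k (- x) (x - y); rewrite nsqN addKr omN. Qed.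

Lemma nice_reflect (M : R) phi x : nice k M phi -> exists M', nice k M' (fun y => phi (x - y)).
Proof.
move=> [mp M0 pM dM sM]; pose A := (2 * (nsq x + 1)) ^+ K.
have A0 : 0 <= A by rewrite exprn_ge0// mulr_ge0// addr_ge0// nsq_ge0.
have o y : M * om k (x - y) <= M * A * om k y by rewrite -mulrA ler_wpM2l// om_reflect.
exists (M * A); split.
- by apply: (measurableT_comp mp); apply: measurable_vecB2; [exact: measurable_cst|exact: measurable_id].
- exact: mulr_ge0.
- by move=> y; exact: le_trans (pM _) (o y).
- move=> y z z1; rewrite opprD addrA -(enormN z); apply: le_trans (dM _ _ _) _; first by rewrite enormN.
  by rewrite mulrAC [leRHS]mulrAC ler_wpM2r ?enorm_ge0.
- move=> y z z1; rewrite (_ : sdiff _ y z = sdiff phi (x - y) z); last first.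
    by rewrite /sdiff opprD addrA opprD opprK addrA -!addrA; congr (_ + _); rewrite [LHS]addrC.
  by apply: le_trans (sM _ _ z1) _; rewrite mulrAC [leRHS]mulrAC ler_wpM2r ?nsq_ge0.
Qed.

Lemma LI_reflect phi x y : LI k (fun y => phi (x - y)) y = LI k phi (x - y).
Proof.
apply: eq_Rint => z; congr (_ * _); rewrite /sdiff opprD addrA opprD opprK addrA -!addrA; congr (_ + _).
by rewrite [LHS]addrC.
Qed.

Lemma poisson_semigroup s t x : 0 < s -> 0 < t ->
  \int[mu]_z (ss k t (x - z) * ss k s z) = m0 * (s + t) / (s * t) * ss k (s + t) x.
Proof.
move=> s0 t0; have := poisson_semigroup_ereal nk x t0 s0.
have k0 : k`!%:R != 0 :> R by rewrite pnatr_eq0 -lt0n fact_gt0.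
have E y : t * s * (k`!%:R / (nsq (x - y) + t ^+ 2) ^+ K) * (k`!%:R / (nsq y + s ^+ 2) ^+ K) =
    (t * s * k`!%:R ^+ 2) * (ss k t (x - y) * ss k s y).
  by rewrite !ssE /rho !exprVn; move: ((nsq (x - y) + _) ^+ K)^-1 ((nsq y + _) ^+ K)^-1 => a b; ring.
under eq_integral => y _ do rewrite E.
have i1 : ig mu (fun z => ss k t (x - z) * ss k s z).
  by have [M HM] := nice_ss t0; exact: (ig_nice_ss nk x s0 HM).
rewrite (Rint_EFin (igZl (t * s * k`!%:R ^+ 2) i1)) => -[]; rewrite (RintZl _ i1) => H.
have sn : s != 0 by rewrite gt_eqF.
have tn : t != 0 by rewrite gt_eqF.
have -> : \int[mu]_z (ss k t (x - z) * ss k s z) = (t * s * k`!%:R ^+ 2)^-1 * (t * s * k`!%:R ^+ 2 * \int[mu]_z (ss k t (x - z) * ss k s z)).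
  by rewrite mulKf// !mulf_neq0// expf_neq0.
rewrite H [t + s]addrC ssE /rho exprVn; move: ((nsq x + _) ^+ K)^-1 (pi ^+ K : R) => a b.
by field; rewrite sn tn k0.
Qed.

(** The [t]-derivative of [t * ss k t x], which is [m0] times the Poisson kernel at height [t]. *)
Definition dq t x : R := ss k t x - 2 * K%:R * t ^+ 2 * rho t x * ss k t x.

Lemma is_derive_rho_t t x : 0 < t -> is_derive t 1 (fun t : R => rho t x) (- (2 * t * rho t x ^+ 2)).
Proof.
move=> t0; have q0 : 0 < t ^+ 2 + nsq x by rewrite ltr_pwDl ?nsq_ge0// exprn_gt0.
have D2 : is_derive t 1 (fun t : R => t ^+ 2) (2 * t).
  by have := is_derive_powc 1 1 t; apply: is_derive_ext => [z|]; rewrite mul1r// expr1.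
have := is_derive1_chain D2 (is_derive_rp (- 1%:R) q0).
apply: is_derive_ext => [z|]; first by rewrite rp_nat ?addr_ge0 ?nsq_ge0 ?sqr_ge0// expr1 /rho addrC.
rewrite (_ : - 1%:R - 1 = - 2%:R :> R); last by rewrite [2%:R]mulr2n opprD.
by rewrite rp_nat ?(ltW q0)// /rho addrC; ring.
Qed.

Lemma is_derive_q t x : 0 < t -> is_derive t 1 (fun t : R => t * ss k t x) (dq t x).
Proof.
move=> t0; have e1 : is_derive t 1 (fun t : R => ss k t x) (K%:R * rho t x ^+ k * (- (2 * t * rho t x ^+ 2))).
  have := is_derive1_chain (is_derive_rho_t x t0) (is_derive_powc 1 k (rho t x)).
  by apply: is_derive_ext => [z|]; rewrite ?ssE mul1r.
have := is_deriveM (is_derive_id t (1 : R)) e1.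
apply: is_derive_ext => [z //|].
by rewrite /GRing.scale/= /dq ssE [rho t x ^+ K]exprS; move: (rho t x ^+ k) (rho t x) => X Y; ring.
Qed.

Lemma is_derive_u t x : 0 < t -> is_derive t 1 (fun t : R => rho t x ^+ k) (- (2 * k%:R) * (t * ss k t x)).
Proof.
move=> t0; case: (k) => [|j].
  have := is_derive_cst (1 : R) t (1 : R); apply: is_derive_ext => [z|]; first by rewrite expr0.
  by rewrite mulr0 oppr0 mul0r.
have := is_derive1_chain (is_derive_rho_t x t0) (is_derive_powc 1 j (rho t x)).
apply: is_derive_ext => [z|]; first by rewrite mul1r.
rewrite mul1r (_ : ss j.+1 t x = rho t x ^+ j.+2); last by rewrite /ss sgK ?sqr_ge0.
by rewrite [rho t x ^+ j.+2]exprS [rho t x ^+ j.+1]exprS; move: (rho t x ^+ j) (rho t x) => X Y; ring.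
Qed.

Lemma cvg_sj : @sj R @ \oo --> (0 : R). Proof. exact: cvg_harmonic. Qed.

Lemma cvg_quotient (f : R -> R) t (d : R) : is_derive t 1 f d ->
  (fun j => (f (sj j + t) - f t) / sj j) @ \oo --> d.
Proof.
move=> [df fd]; have sd : @sj R @ \oo --> (0 : R)^'.
  move=> P [e /= e0 He]; have /cvgrPdist_lt /(_ e e0) [N _ HN] := cvg_sj.
  by exists N => // j Nj; apply: He; [exact: HN|rewrite gt_eqF ?sj_gt0].
rewrite -fd; have := cvg_comp _ _ sd df; apply: cvg_trans; apply: near_eq_cvg; near=> j => /=.
by rewrite /GRing.scale/= mulr1 mulrC.
Unshelve. all: by end_near. Qed.

(** By the semigroup law, [LS s] of the kernel at height [t] is a difference quotient of
    [t * ss k t x] in the height, with step [s]. *)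
Lemma LI_ss t x : 0 < t -> LI k (ss k t) x = - (2 * m0 / t) * dq t x.
Proof.
move=> t0; have [M HM] := nice_ss t0.
have D (z : V) (z0 : z != 0) := nice_le x HM z0; have [ms _ _ _ _] := HM.
have c1 := LS_cvg n3 ms (nice_dom_ig n3 nk M x) D.
have E j : LS k (sj j) (ss k t) x = - (2 * m0 / t) * (((sj j + t) * ss k (sj j + t) x - t * ss k t x) / sj j).
  have s0 := sj_gt0 (R := R) j; rewrite (LS_split_gen nk s0 (ig_nice_ss nk x s0 HM)) poisson_semigroup//.
  have sn : sj j != 0 :> R by rewrite gt_eqF.
  have tn : t != 0 by rewrite gt_eqF.
  have k0 : k`!%:R != 0 :> R by rewrite pnatr_eq0 -lt0n fact_gt0.
  by move: (ss k t x) (ss k (sj j + t) x) (pi ^+ K : R) => a b p; field; rewrite sn tn k0.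
have c2 : (fun j => LS k (sj j) (ss k t) x) @ \oo --> - (2 * m0 / t) * dq t x.
  have c3 := @cvg_quotient (fun t => t * ss k t x) t _ (is_derive_q x t0).
  by rewrite (funext E); apply: cvgM; [exact: cvg_cst|exact: c3].
exact: (cvg_unique _ c1 c2).
Qed.

End poisson_kernel.

(** * Inversion of the half-Laplacian up to constants *)

Section half_laplacian_inverse.
Context {R : realType} {n : nat}.
Hypothesis n3 : (2 < n)%N.
Variable k : nat.
Hypothesis nk : n = (2 * k).+1.
Notation V := 'rV[R]_n.
Notation mu := (@volm R n).
Notation K := k.+1.
Notation m0 := (pi ^+ K / k`!%:R : R).
Variable F : V -> R.
Hypothesis FC : Ck 2 F.
Hypothesis Fo : ig mu (fun y => F y * om k y).
Hypothesis fi : ig mu (LI k F).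
Implicit Types (x y z : V) (t s : R).

Let n0 : (0 < n)%N. Proof. exact: leq_trans n3. Qed.
Let k0 : (0 < k)%N. Proof. by move: n3; rewrite nk; lia. Qed.
Let mF : measurable_fun setT F. Proof. exact: measurable_continuous (Ck_cont FC). Qed.

Lemma LI_bounded (r : R) : exists M, 0 <= M /\ forall y, enorm y <= r -> `|LI k F y| <= M.
Proof.
have [B [G HG]] := wF_dom n3 nk FC Fo (normr_ge0 r).
exists `|B|; split => // y yr; have [g1 g2 g3] := HG y (le_trans yr (ler_norm r)).
by apply: le_trans (LI_le n3 mF g1 g3) _; exact: le_trans g2 (ler_norm B).
Qed.

(** Fubini in [LS_pairing] gives measurability of [LS] times a Poisson kernel; the limit in [s] is
    then divided by that positive kernel. *)
Lemma measurable_LI : measurable_fun setT (LI k F).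
Proof.
have [M HM] := nice_ss (n := n) k (@ltr01 R).
have m1 : measurable_fun setT (fun x => LI k F x * ss k 1 x).
  apply: (measurable_fun_cvg (h := fun j x => LS k (sj j) F x * ss k 1 x)) => [j|x _].
    by have [i1 _ _] := LS_pairing nk FC Fo (sj_gt0 j) HM; exact: ig_measurable i1.
  have [B [G HG]] := wF_dom n3 nk FC Fo (enorm_ge0 x); have [g1 g2 g3] := HG x (lexx _).
  by apply: cvgMl; exact: (LS_cvg n3 mF g1 g3).
have E : LI k F = fun x => LI k F x * ss k 1 x * (nsq x + 1) ^+ K.
  apply/funext => x; rewrite ssE /rho expr1n exprVn mulfVK//.
  by rewrite expf_neq0// gt_eqF// ltr_wpDl// nsq_ge0.
rewrite E; apply: measurable_funM => //; apply: measurable_funX; apply: measurable_funD; last exact: measurable_cst.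
by apply: measurable_continuous; exact: continuous_nsq.
Qed.

Let G := LI k F.
(** [a] is the order-one Riesz potential of [G] with [|z|^2] replaced by [|z|^2 + t^2], and [g] is
    [m0] times the Poisson extension of [F] to height [t]. *)
Let a x t : R := \int[mu]_y (G y * rho t (x - y) ^+ k).
Let g x t : R := \int[mu]_y (F y * (t * ss k t (x - y))).

Lemma ig_F_q x t : 0 < t -> ig mu (fun y => F y * (t * ss k t (x - y))).
Proof.
move=> t0; have i := igZl t (ig_reflect x (ig_F_ss FC Fo x t0)).
by apply: ig_ext i => y; rewrite subKr mulrCA.
Qed.

Lemma gE x t : 0 < t -> g x t = t * \int[mu]_z (F (x - z) * ss k t z).
Proof.
move=> t0; have i1 := ig_F_ss FC Fo x t0; rewrite -(Rint_reflect x i1) -RintZl; last exact: ig_reflect i1.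
by apply: eq_Rint => y; rewrite subKr mulrCA.
Qed.

Lemma wF_reflect x y : `|F y| * om k (x - y) <= (2 * (nsq x + 1)) ^+ K * wF k F y.
Proof. by rewrite /wF mulrCA ler_wpM2l// om_reflect. Qed.

Lemma t2rho_le1 t y : 0 < t -> t ^+ 2 * rho t y <= 1.
Proof.
move=> t0; have t2 : 0 < t ^+ 2 by rewrite exprn_gt0.
by rewrite ler_pdivrMr ?mul1r ?lerDr ?nsq_ge0// ltr_wpDl ?nsq_ge0.
Qed.

Lemma dq_le t y : 0 < t -> `|dq k t y| <= (1 + 2 * K%:R) * ss k t y.
Proof.
move=> t0; have s0 := ss_ge0 k t y; rewrite mulrDl mul1r; apply: le_trans (ler_normB _ _) _.
rewrite (ger0_norm s0) lerD2l normrM (ger0_norm s0) ler_wpM2r// -[_ * t ^+ 2 * _]mulrA.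
have r0 : 0 <= t ^+ 2 * rho t y by rewrite mulr_ge0 ?sqr_ge0// ltW// rho_gt0.
have K2 : 0 <= 2 * K%:R :> R by rewrite mulr_ge0.
rewrite ger0_norm; last exact: (mulr_ge0 K2 r0).
by rewrite -[leRHS]mulr1 ler_wpM2l// t2rho_le1.
Qed.

Lemma ss_le_half (t0 t : R) y : 0 < t0 -> t0 / 2 < t -> ss k t y <= (1 + 4 * t0 ^- 2) ^+ K * om k y.
Proof.
move=> p0 pt; have t1 : 0 < t by apply: lt_trans pt; rewrite divr_gt0.
apply: le_trans (ss_le_om k y t1) _; rewrite ler_wpM2r ?(ltW (om_gt0 _ _))//.
rewrite lerXn2r ?nnegrE ?addr_ge0 ?mulr_ge0 ?invr_ge0 ?sqr_ge0// lerD2l.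
have -> : 4 * t0 ^- 2 = ((t0 / 2) ^+ 2)^-1 by rewrite expr_div_n invf_div; congr (_ / _); rewrite expr2; ring.
by rewrite lef_pV2 ?posrE ?exprn_gt0 ?divr_gt0// lerXn2r ?nnegrE ?ltW ?divr_gt0.
Qed.

Lemma is_derive_g x t : 0 < t -> is_derive t 1 (g x) (\int[mu]_y (F y * dq k t (x - y))).
Proof.
move=> t0; have h0 : 0 < t / 2 by rewrite divr_gt0.
pose C := (1 + 2 * K%:R) * (1 + 4 * t ^- 2) ^+ K * (2 * (nsq x + 1)) ^+ K.
have c1 : 0 <= 1 + 2 * K%:R :> R by rewrite addr_ge0// mulr_ge0.
have c2 : 0 <= (1 + 4 * t ^- 2) ^+ K by rewrite exprn_ge0// addr_ge0// mulr_ge0// invr_ge0 sqr_ge0.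
apply: (@is_derive_Rint _ _ R mu (fun s y => F y * (s * ss k s (x - y))) (fun s y => F y * dq k s (x - y)) (fun y => C * wF k F y) t (t / 2) (2 * t)).
- by rewrite ltr_pdivrMr// mulr_natr mulr2n ltrDl.
- by rewrite mulr_natl mulr2n ltrDl.
- by move=> s s1 _; apply: ig_F_q; exact: lt_trans s1.
- move=> s y s1 _; have := is_deriveZ (F y) (is_derive_q k (x - y) (lt_trans h0 s1)).
  exact.
- move=> s y s1 _; rewrite normrM; apply: le_trans (ler_wpM2l (normr_ge0 _) (dq_le _ (lt_trans h0 s1))) _.
  apply: le_trans (ler_wpM2l (normr_ge0 _) (ler_wpM2l c1 (ss_le_half _ t0 s1))) _.
  rewrite [leLHS](_ : _ = (1 + 2 * K%:R) * (1 + 4 * t ^- 2) ^+ K * (`|F y| * om k (x - y))); last by move: ((1 + 4 * _) ^+ K) => q; ring.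
  by rewrite /C -[leRHS]mulrA ler_wpM2l ?mulr_ge0// wF_reflect.
- by apply: igZl; exact: ig_wF Fo.
Qed.

Lemma ig_G_bounded t x : 0 < t -> ig mu (fun y => G y * rho t (x - y) ^+ k) /\ ig mu (fun y => G y * ss k t (x - y)).
Proof.
move=> t0; have mr (j : nat) : measurable_fun setT (fun y => rho t (x - y) ^+ j).
  rewrite (_ : (fun y => _) = (fun y => sg (t ^+ 2) (- j%:R) (x - y))); last first.
    by apply/funext => y; rewrite /sg rp_nat ?addr_ge0 ?nsq_ge0 ?sqr_ge0.
  by apply: (measurableT_comp (measurable_sg _ _)); apply: measurable_vecB2; [exact: measurable_cst|exact: measurable_id].
have r1 (y : V) : rho t y <= t ^- 2.
  by rewrite lef_pV2 ?posrE ?exprn_gt0 ?ltr_wpDl ?nsq_ge0 ?exprn_gt0// lerDr nsq_ge0.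
have rj (j : nat) y : `|rho t (x - y) ^+ j| <= (t ^- 2) ^+ j.
  have r0 := ltW (rho_gt0 (x - y) t0).
  by rewrite ger0_norm ?exprn_ge0// lerXn2r ?nnegrE// (le_trans r0).
split; first by apply: ig_ext (ig_mulb fi (mr k) (rj k)) => y; rewrite mulrC.
by apply: ig_ext (ig_mulb fi (mr K) (rj K)) => y; rewrite mulrC ssE.
Qed.

Lemma is_derive_a x t : 0 < t -> is_derive t 1 (a x) (- (2 * k%:R * t) * \int[mu]_y (G y * ss k t (x - y))).
Proof.
move=> t0; have h0 : 0 < t / 2 by rewrite divr_gt0.
have c2 : 0 <= (1 + 4 * t ^- 2) ^+ K by rewrite exprn_ge0// addr_ge0// mulr_ge0// invr_ge0 sqr_ge0.
have [_ i1] := ig_G_bounded x t0.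
have D : is_derive t 1 (a x) (\int[mu]_y (G y * (- (2 * k%:R) * (t * ss k t (x - y))))).
  apply: (@is_derive_Rint _ _ R mu (fun s y => G y * rho s (x - y) ^+ k) (fun s y => G y * (- (2 * k%:R) * (s * ss k s (x - y))))
    (fun y => 2 * k%:R * (2 * t) * (1 + 4 * t ^- 2) ^+ K * `|G y|) t (t / 2) (2 * t)).
  - by rewrite ltr_pdivrMr// mulr_natr mulr2n ltrDl.
  - by rewrite mulr_natl mulr2n ltrDl.
  - by move=> s s1 _; have [] := ig_G_bounded x (lt_trans h0 s1).
  - move=> s y s1 _; have := is_deriveZ (G y) (is_derive_u k (x - y) (lt_trans h0 s1)); exact.
  - move=> s y s1 s2; have s0 := lt_trans h0 s1.
    have s00 := ss_ge0 k s (x - y); have k2 : 0 <= 2 * k%:R :> R by rewrite mulr_ge0.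
    have B : s * ss k s (x - y) <= 2 * t * (1 + 4 * t ^- 2) ^+ K.
      apply: ler_pM; rewrite ?ss_ge0 ?(ltW s0) ?(ltW s2)//.
      by apply: le_trans (ss_le_half _ t0 s1) _; rewrite ler_piMr// om_le1.
    rewrite normrM mulrC normrM normrN (ger0_norm k2) (ger0_norm (mulr_ge0 (ltW s0) s00)).
    by rewrite ler_wpM2r// -[leRHS]mulrA ler_wpM2l.
  - by apply: igZl; exact: ig_abs.
rewrite (_ : - (2 * k%:R * t) * _ = \int[mu]_y (G y * (- (2 * k%:R) * (t * ss k t (x - y)))))//.
by rewrite -(RintZl _ i1); apply: eq_Rint => y; ring.
Qed.

Lemma m0_gt0 : 0 < m0. Proof. by rewrite divr_gt0 ?exprn_gt0 ?pi_gt0// ltr0n fact_gt0. Qed.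

Lemma pairing_ss x t : 0 < t ->
  \int[mu]_y (G y * ss k t (x - y)) = - (2 * m0 / t) * \int[mu]_y (F y * dq k t (x - y)).
Proof.
move=> t0; have [M HM] := nice_ss (n := n) k t0; have [M' HM'] := nice_reflect x HM.
have [i1 e1] := LI_pairing n3 nk FC Fo fi HM'; rewrite /G e1.
have E y : F y * LI k (fun y => ss k t (x - y)) y = - (2 * m0 / t) * (F y * dq k t (x - y)).
  by rewrite LI_reflect LI_ss// mulrCA.
have c : - (2 * m0 / t) != 0.
  by rewrite oppr_eq0 gt_eqF// divr_gt0// mulr_gt0// m0_gt0.
have i2 : ig mu (fun y => F y * dq k t (x - y)).
  by apply: ig_ext (igZl (- (2 * m0 / t))^-1 i1) => y; rewrite E mulKf.
by rewrite (eq_Rint_to E) (RintZl _ i2).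
Qed.

(** Constant in [t]: [rho^k] has derivative [- 2 k t ss], and by symmetry of the half-Laplacian [G]
    against [ss] is [- 2 m0 / t] times the derivative of [g], so the two derivatives cancel. *)
Let h x t : R := a x t - 4 * k%:R * m0 * g x t.

Lemma h_const x s t : 0 < s -> 0 < t -> h x s = h x t.
Proof.
apply: derive0_const => t0 {s t}; move: t0 => t t0.
have := is_deriveB (is_derive_a x t0) (is_deriveZ (4 * k%:R * m0) (is_derive_g x t0)).
apply: is_derive_ext => //; rewrite (pairing_ss x t0) /GRing.scale/=.
have m00 := m0_gt0; have tn : t != 0 by rewrite gt_eqF.
by move: (m0) (\int[mu]_y _) => c I; field.
Qed.

(** By [LS_split], [g x s] differs from [m0 F x] by [s / 2] times [LS s F x], which converges. *)
Lemma cvg_g0 x : (fun j => g x (sj j)) @ \oo --> m0 * F x.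
Proof.
have [B [D HD]] := wF_dom n3 nk FC Fo (enorm_ge0 x); have [g1 g2 g3] := HD x (lexx _).
have c1 := LS_cvg n3 mF g1 g3.
have E j : g x (sj j) = m0 * F x - sj j / 2 * LS k (sj j) F x.
  have s0 := sj_gt0 (R := R) j; rewrite (gE _ s0) (LS_split nk FC Fo x s0).
  have sn : sj j != 0 :> R by rewrite gt_eqF.
  have kn : k`!%:R != 0 :> R by rewrite pnatr_eq0 -lt0n fact_gt0.
  by move: (\int[mu]_z _) (pi ^+ K : R) => I p; field; rewrite sn kn.
have c2 : (fun j => m0 * F x - sj j / 2 * LS k (sj j) F x) @ \oo --> m0 * F x - 0 / 2 * LI k F x.
  by apply: cvgB; [exact: cvg_cst|apply: cvgM => //; apply: cvgM; [exact: cvg_sj|exact: cvg_cst]].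
by rewrite (funext E) -[X in _ --> X](_ : m0 * F x - 0 / 2 * LI k F x = _)// !mul0r subr0.
Qed.

Definition potential x : R := \int[mu]_y (sg 0 (- k%:R) (x - y) * G y).

Lemma cvg_a0 x : (fun j => a x (sj j)) @ \oo --> potential x.
Proof.
have [M [M0 HM]] := LI_bounded (enorm x + 1).
have kn : (2 * k < n)%N by rewrite nk.
have kk := kernel_sg (R := R) n3 kn.
have [i1 _] := kernel_section kk fi M0 HM (lexx _).
have i2 : ig mu (fun z => sg 0 (- k%:R) z * G (x - z)).
  by apply: ig_ext (ig_reflect x i1) => z; rewrite subKr.
have E j : a x (sj j) = \int[mu]_z (rho (sj j) z ^+ k * G (x - z)).
  have [i3 _] := ig_G_bounded x (sj_gt0 (R := R) j).
  by rewrite /a -(Rint_reflect x i3); apply: eq_Rint => z; rewrite subKr mulrC.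
rewrite (funext E).
have -> : potential x = \int[mu]_z (sg 0 (- k%:R) z * G (x - z)).
  by rewrite /potential -(Rint_reflect x i1); apply: eq_Rint => z; rewrite subKr.
have rE t z : rho t z ^+ k = sg (t ^+ 2) (- k%:R) z by rewrite /sg rp_nat// addr_ge0 ?nsq_ge0 ?sqr_ge0.
have [||j z z0|z z0|_ H] := @Rint_dct0 R n n0 (fun j z => rho (sj j) z ^+ k * G (x - z)) (fun z => sg 0 (- k%:R) z * G (x - z)) (fun z => `|sg 0 (- k%:R) z * G (x - z)|); last exact: H.
- move=> j; have [i3 _] := ig_G_bounded x (sj_gt0 (R := R) j).
  by apply: ig_measurable; apply: ig_ext (ig_reflect x i3) => z; rewrite subKr mulrC.
- exact: ig_abs.
- by rewrite !normrM ler_wpM2r// rE !ger0_norm ?sg_ge0// sg_anti ?sqr_ge0// oppr_le0.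
- apply: cvgMl; rewrite sg_inv; have nz : nsq z != 0 by rewrite gt_eqF// nsq_gt0.
  have c : (fun j => nsq z + sj j ^+ 2) @ \oo --> nsq z + 0 ^+ 2.
    by apply: cvgD; [exact: cvg_cst|rewrite expr2; apply: cvgM; exact: cvg_sj].
  by rewrite expr0n/= addr0 in c; exact: (cvg_comp _ _ (cvgV nz c) (@exprn_continuous R k _)).
Qed.

Lemma rho_large j z (i : nat) : (0 < i)%N -> rho j.+1%:R z ^+ i <= @sj R j.
Proof.
move=> i0; have j1 : 1 <= j.+1%:R :> R by rewrite ler1n.
have q : rho j.+1%:R z <= @sj R j.
  rewrite lef_pV2 ?posrE ?ltr_wpDl ?nsq_ge0 ?exprn_gt0//.
  by apply: (@le_trans _ _ (j.+1%:R ^+ 2)); [rewrite expr2 ler_pMr|rewrite lerDr nsq_ge0].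
have r0 : 0 <= rho j.+1%:R z by rewrite invr_ge0 addr_ge0 ?nsq_ge0 ?sqr_ge0.
have r1 : rho j.+1%:R z <= 1 by apply: le_trans q _; rewrite invf_le1.
by case: i i0 => // i _; rewrite exprS; apply: le_trans q; rewrite ler_piMr// exprn_ile1.
Qed.

Lemma cvg_small (f : nat -> R) (c : R) : (forall j, `|f j| <= c * sj j) -> f @ \oo --> (0 : R).
Proof.
move=> H; have c1 : (fun j => c * @sj R j) @ \oo --> (0 : R) by rewrite -[X in _ --> X](mulr0 c); apply: cvgMr; exact: cvg_sj.
apply/cvgr0Pnorm_le => e e0; have /cvgr0Pnorm_le /(_ e e0) := c1; apply: filterS => j; apply: le_trans.
exact: le_trans (H j) (ler_norm _).
Qed.

Lemma cvg_a_infty x : (fun j => a x j.+1%:R) @ \oo --> (0 : R).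
Proof.
apply: (@cvg_small _ (\int[mu]_y `|G y|)) => j.
have [i1 _] := ig_G_bounded x (ltr0Sn R j).
have r0 z : 0 <= rho j.+1%:R z by rewrite invr_ge0 addr_ge0 ?nsq_ge0 ?sqr_ge0.
rewrite -(RintZr _ (ig_abs fi)); apply: Rint_norm_le (ig_measurable i1) (igZr _ (ig_abs fi)) _ => y.
by rewrite normrM ler_wpM2l// ger0_norm ?exprn_ge0// rho_large.
Qed.

Lemma ss_shift t x y : 1 <= t -> ss k t y <= (2 * (nsq (x - y) + 1)) ^+ K * ss k t x.
Proof.
move=> t1; have t2 : 1 <= t ^+ 2 by rewrite exprn_ege1.
have E1 := nsqD (x - y) y; rewrite subrK in E1.
have E2 := nsq_ge0 (x - y - y); rewrite [nsq (x - y - y)]nsqB in E2.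
have a0 := nsq_ge0 (x - y); have y0 := nsq_ge0 y; have x0 := nsq_ge0 x.
rewrite !ssE -exprMn /rho.
move: (nsq x) (nsq y) (nsq (x - y)) (dotv (x - y) y) (t ^+ 2) E1 E2 a0 y0 x0 t2 => X Y A D T E1 E2 A0 Y0 X0 T1.
have T0 : 0 <= T by lra.
have YT : 0 < Y + T by lra.
have XT : 0 < X + T by lra.
have i1 : 0 <= (Y + T)^-1 by rewrite invr_ge0 ltW.
have i2 : 0 <= 2 * (A + 1) * (X + T)^-1.
  by apply: mulr_ge0; [apply: mulr_ge0 => //; exact: addr_ge0|rewrite invr_ge0 ltW].
have hX : X <= 2 * A + 2 * Y by lra.
have q : X + T <= 2 * (A + 1) * (Y + T) by nra.
have z0 : 0 <= (Y + T)^-1 * (X + T)^-1 by rewrite mulr_ge0// invr_ge0 ltW.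
have H : (Y + T)^-1 <= 2 * (A + 1) * (X + T)^-1.
  have := ler_wpM2r z0 q.
  rewrite (_ : (X + T) * ((Y + T)^-1 * (X + T)^-1) = (Y + T)^-1); last by field; rewrite !gt_eqF.
  by rewrite (_ : 2 * (A + 1) * (Y + T) * ((Y + T)^-1 * (X + T)^-1) = 2 * (A + 1) * (X + T)^-1)//; field; rewrite !gt_eqF.
by rewrite lerXn2r ?nnegrE.
Qed.

(** At large heights the relative gradient of the kernel is [O(1 / t)]; against the factor [t] this
    leaves a bound by [ss] alone. *)
Lemma q_incr t x z : 1 <= t -> `|t * ss k t (x + z) - t * ss k t x| <=
  n%:R * (2 * K%:R * (2 * (nsq z + 1)) ^+ K * ss k t x) * enorm z.
Proof.
move=> t1; have t0 : 0 < t by rewrite (lt_le_trans _ t1).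
have tn : t != 0 by rewrite gt_eqF.
have K20 : 0 <= 2 * K%:R :> R by rewrite mulr_ge0.
have C2 : Ck 2 (@ss R n k t) by apply: Ck_sg; rewrite exprn_gt0.
pose M := 2 * K%:R / t * ((2 * (nsq z + 1)) ^+ K * ss k t x).
rewrite -mulrBr normrM (gtr0_norm t0).
have -> : n%:R * (2 * K%:R * (2 * (nsq z + 1)) ^+ K * ss k t x) * enorm z = t * (n%:R * M * enorm z).
  by rewrite /M; move: ((2 * _) ^+ K) (ss k t x) (enorm z) => p q e; field.
rewrite ler_pM2l//; apply: incr_le => [i y|i y yx]; first by case: (Ck_derivable i y (Ck_le (isT : (1 <= 2)%N) C2)).
rewrite [partial i _ y](is_derive_near_val (is_derive_ss k y i t0)).
rewrite normrM normrN (ger0_norm K20) /M -[2 * K%:R / t * _]mulrA ler_wpM2l//.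
have r0 := rho_gt0 y t0; have s0 := ss_ge0 k t y.
rewrite 2!normrM (gtr0_norm r0) (ger0_norm s0) ler_pdivlMl//.
have yt : `|y ord0 i| * rho t y * t <= 1.
  rewrite mulrAC ler_pdivrMr ?mul1r ?ltr_wpDl ?nsq_ge0 ?exprn_gt0//.
  have := coord_le_enorm y i; have := sqr_enorm y; have := enorm_ge0 y.
  move: (enorm y) (nsq y) `|y ord0 i| (normr_ge0 (y ord0 i)) => e q b b0 e0 <- be.
  have h1 : 0 <= (b - t) * (b - t) by rewrite -expr2 sqr_ge0.
  have h2 : b * b <= e * e by apply: ler_pM.
  by rewrite !expr2; have := mulr_ge0 b0 (ltW t0); nra.
apply: (@le_trans _ _ (ss k t y)); first by rewrite mulrA [t * _]mulrC ler_piMl.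
apply: le_trans (ss_shift x y t1) _; rewrite ler_wpM2r ?ss_ge0// lerXn2r ?nnegrE ?mulr_ge0 ?addr_ge0 ?nsq_ge0//.
by rewrite ler_wpM2l// lerD2r -!sqr_enorm lerXn2r ?nnegrE ?enorm_ge0// enormBC.
Qed.

(** Only differences are estimated, as [F] is merely integrable against [om]. By [q_incr] they are
    integrals of [|F|] against multiples of [ss], which tends to 0 and is dominated by [om]. *)
Lemma cvg_g_infty x x' : (fun j => g x j.+1%:R - g x' j.+1%:R) @ \oo --> (0 : R).
Proof.
have t0 j : 0 < j.+1%:R :> R by rewrite ltr0Sn.
pose C := n%:R * (2 * K%:R * (2 * (nsq (x - x') + 1)) ^+ K) * enorm (x - x').
have C0' : 0 <= C by rewrite !mulr_ge0 ?enorm_ge0// exprn_ge0// mulr_ge0// addr_ge0// nsq_ge0.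
have B j y : `|F y * (j.+1%:R * ss k j.+1%:R (x - y)) - F y * (j.+1%:R * ss k j.+1%:R (x' - y))| <= `|F y| * (C * ss k j.+1%:R (x' - y)).
  rewrite -mulrBr normrM ler_wpM2l//; have j1 : 1 <= j.+1%:R :> R by rewrite ler1n.
  have := q_incr (x' - y) (x - x') j1; rewrite (_ : x' - y + (x - x') = x - y); last by rewrite addrC addrA subrK.
  by move=> H; apply: le_trans H _; rewrite /C; move: (ss k _ _) ((2 * _) ^+ K) => u v; rewrite le_eqVlt; apply/orP; left; apply/eqP; ring.
have so j y : ss k j.+1%:R y <= om k y.
  rewrite ssE lerXn2r ?nnegrE ?invr_ge0 ?addr_ge0 ?nsq_ge0 ?sqr_ge0//.
  by rewrite lef_pV2 ?posrE ?ltr_wpDl ?nsq_ge0 ?exprn_gt0// lerD2l exprn_ege1// ler1n.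
have E j : g x j.+1%:R - g x' j.+1%:R = \int[mu]_y (F y * (j.+1%:R * ss k j.+1%:R (x - y)) - F y * (j.+1%:R * ss k j.+1%:R (x' - y))).
  by rewrite (RintB (ig_F_q x (t0 j)) (ig_F_q x' (t0 j))).
rewrite (funext E).
have Z : \int[mu]_(y in [set: V]) (0 : R) = 0 by exact: Rint_zero.
have [|| j y | y | _ H] := @Rint_dct _ _ R mu (fun j y => F y * (j.+1%:R * ss k j.+1%:R (x - y)) - F y * (j.+1%:R * ss k j.+1%:R (x' - y))) (fun _ => 0) (fun y => C * (2 * (nsq x' + 1)) ^+ K * wF k F y); last by rewrite -Z; exact: H.
- by move=> j; apply: ig_measurable; exact: igB (ig_F_q x (t0 j)) (ig_F_q x' (t0 j)).
- by apply: igZl; exact: ig_wF Fo.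
- apply: le_trans (B j y) _; rewrite mulrCA -mulrA ler_wpM2l//.
  by apply: le_trans (wF_reflect x' y); rewrite ler_wpM2l.
- apply: (@cvg_small _ (`|F y| * C)) => j; apply: le_trans (B j y) _.
  rewrite mulrA; apply: ler_wpM2l; first by rewrite mulr_ge0.
  by rewrite ssE rho_large.
Qed.

(** [h] does not depend on the height. At height 0 it is the combination in question; at large
    heights its values at [x] and [x'] have difference tending to 0. *)
Lemma half_laplacian_inverse x x' :
  potential x - 4 * k%:R * m0 ^+ 2 * F x = potential x' - 4 * k%:R * m0 ^+ 2 * F x'.
Proof.
have L y : h y 1 = potential y - 4 * k%:R * m0 ^+ 2 * F y.
  have c1 : (fun j => h y (sj j)) @ \oo --> potential y - 4 * k%:R * m0 * (m0 * F y).
    by apply: cvgB; [exact: cvg_a0|apply: cvgMr; exact: cvg_g0].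
  have c2 : (fun j => h y (sj j)) @ \oo --> h y 1.
    rewrite (_ : (fun j => _) = fun=> h y 1); first exact: cvg_cst.
    by apply/funext => j; apply: h_const => //; exact: sj_gt0.
  have e : h y 1 = potential y - 4 * k%:R * m0 * (m0 * F y) by exact: (cvg_unique _ c2 c1).
  by rewrite e; congr (_ - _); rewrite expr2 !mulrA.
suff e : h x 1 = h x' 1 by move: e; rewrite (L x) (L x').
apply: subr0_eq.
have c1 : (fun j => h x j.+1%:R - h x' j.+1%:R) @ \oo --> h x 1 - h x' 1.
  rewrite (_ : (fun j => _) = fun=> h x 1 - h x' 1); first exact: cvg_cst.
  by apply/funext => j; rewrite (h_const x (ltr0Sn R j) ltr01) (h_const x' (ltr0Sn R j) ltr01).
have c2 : (fun j => (a x j.+1%:R - a x' j.+1%:R) - 4 * k%:R * m0 * (g x j.+1%:R - g x' j.+1%:R)) @ \oo --> (0 - 0) - 4 * k%:R * m0 * 0.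
  by apply: cvgB; [apply: cvgB; exact: cvg_a_infty|apply: cvgMr; exact: cvg_g_infty].
rewrite mulr0 !subr0 in c2.
have E : (fun j => h x j.+1%:R - h x' j.+1%:R) = (fun j => (a x j.+1%:R - a x' j.+1%:R) - 4 * k%:R * m0 * (g x j.+1%:R - g x' j.+1%:R)).
  apply/funext => j; rewrite /h; move: (a x j.+1%:R) (a x' j.+1%:R) (g x j.+1%:R) (g x' j.+1%:R) (4 * k%:R * m0) => p q r t w; ring.
rewrite E in c1; exact: (cvg_unique _ c1 c2).
Qed.

End half_laplacian_inverse.

(** * The principal value as a symmetrised integral *)

Section principal_value.
Context {R : realType} {n : nat}.
Hypothesis n3 : (2 < n)%N.
Variable k : nat.
Hypothesis nk : n = (2 * k).+1.
Notation V := 'rV[R]_n.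
Notation mu := (@volm R n).
Notation K := k.+1.
Variable F : V -> R.
Hypothesis FC : Ck 2 F.
Hypothesis Fo : ig mu (fun y => F y * om k y).
Implicit Types (x y z : V).

Let n0 : (0 < n)%N. Proof. exact: leq_trans n3. Qed.
Let mF : measurable_fun setT F. Proof. exact: measurable_continuous (Ck_cont FC). Qed.

Definition off_ball (e : R) z : R := 1 - inb e z.

Lemma off_ball_le1 e z : 0 <= off_ball e z <= 1.
Proof. by rewrite /off_ball /inb; case: ifP; rewrite ?subrr ?subr0 lexx ler01. Qed.

Lemma off_ball_pw e z : 0 < e -> off_ball e z * pw k z <= (1 + e ^- 2) ^+ K * om k z.
Proof.
move=> e0; have c0 : 0 <= (1 + e ^- 2) ^+ K by rewrite exprn_ge0// addr_ge0// invr_ge0 sqr_ge0.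
rewrite /off_ball; have [ze|ze] := leP (enorm z) e.
  by rewrite inb1// subrr mul0r mulr_ge0// ltW// om_gt0.
rewrite inb0// subr0 mul1r /pw /om -exprMn.
have q : e ^+ 2 <= nsq z by rewrite -sqr_enorm lerXn2r ?nnegrE ?enorm_ge0// ltW.
have e2 : 0 < e ^+ 2 by rewrite exprn_gt0.
have q0 : 0 < nsq z by rewrite (lt_le_trans e2).
have q1 : 0 < nsq z + 1 by rewrite addr_gt0.
have i2 : 0 <= e ^- 2 by rewrite invr_ge0 sqr_ge0.
rewrite lerXn2r ?nnegrE ?invr_ge0 ?mulr_ge0 ?invr_ge0 ?addr_ge0 ?(ltW q0)//.
rewrite ler_pdivlMr// mulrC ler_pdivrMr// mulrDl mul1r lerD2l.
by rewrite -(mulVf (lt0r_neq0 e2)) ler_wpM2l.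
Qed.

Lemma measurable_off_ball e : measurable_fun setT (off_ball e).
Proof. by apply: measurable_funB; [exact: measurable_cst|exact: measurable_inb]. Qed.

Lemma trunc_ig e x : 0 < e -> ig mu (fun z => off_ball e z * (F x - F (x - z)) * pw k z).
Proof.
move=> e0; pose A := (1 + e ^- 2) ^+ K; pose B := (2 * (enorm x ^+ 2 + 1)) ^+ K.
have c0 : 0 <= A by rewrite exprn_ge0// addr_ge0// invr_ge0 sqr_ge0.
have mr : measurable_fun setT (fun z => F (x - z)).
  by apply: (measurableT_comp mF); apply: measurable_vecB2; [exact: measurable_cst|exact: measurable_id].
apply: (ig_le (g := fun z => A * (`|F x| * om k z + B * wF k F (x - z)))).
- by apply: igZl; apply: igD; [apply: igZl; exact: ig_om|apply: igZl; apply: ig_reflect; exact: ig_wF].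
- apply: measurable_funM; last exact: measurable_pw.
  by apply: measurable_funM; [exact: measurable_off_ball|apply: measurable_funB => //; exact: measurable_cst].
move=> z; have o01 := off_ball_le1 e z; case/andP: o01 => o0 _; have oz := ltW (@om_gt0 R n k z).
rewrite mulrAC normrM ger0_norm ?mulr_ge0 ?pw_ge0//.
apply: le_trans (ler_wpM2r (normr_ge0 _) (off_ball_pw z e0)) _.
rewrite -/A -mulrA ler_wpM2l//; apply: le_trans (ler_wpM2l oz (ler_normB _ _)) _.
rewrite mulrDr mulrC lerD2l mulrC; have := om_wF k F (- z) (enorm_ge0 x) (lexx _); rewrite omN; exact.
Qed.

(** Averaging over [z] and [- z] replaces [F x - F (x - z)] by half of [sdiff F x z]; [Chalf R n]
    equals [Ch k] for [n = 2 k + 1]. *)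
Lemma halflap_truncE e x : 0 < e ->
  halflap_trunc F x e = Ch k / 2 * \int[mu]_z (off_ball e z * sdiff F x z * pw k z).
Proof.
move=> e0; have i1 := trunc_ig x e0.
have nE : n.+1 = (2 * K)%N by rewrite nk; lia.
have CE : Chalf R n = Ch k.
  by rewrite /Chalf /Ch nk /= (_ : (2 * k)./2 = k)%N ?(_ : ((2 * k).+2)./2 = k.+1)%N//; rewrite /= mul2n doubleK.
have i2 : ig mu (fun y => (if e < enorm (x - y) then 1 else 0) * ((F x - F y) / enorm (x - y) ^+ n.+1)).
  apply: ig_ext (ig_reflect x i1) => y; rewrite subKr /off_ball /inb nE exprM sqr_enorm -exprVn -mulrA.
  by congr (_ * _); rewrite leNgt; case: (e < _); rewrite ?subrr ?subr0.
rewrite /halflap_trunc CE (intRn_integrable i2) -mulrA; congr (_ * _).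
rewrite [LHS](_ : _ = \int[mu]_z (off_ball e z * (F x - F (x - z)) * pw k z)); last first.
  rewrite -(Rint_reflect x i1) /Rintegral; congr fine; apply: eq_integral => y _; congr EFin.
  rewrite subKr /off_ball /inb nE exprM sqr_enorm -exprVn -mulrA.
  by congr (_ * _); rewrite leNgt; case: (e < _); rewrite ?subrr ?subr0.
have oN z : off_ball e (- z) = off_ball e z by rewrite /off_ball /inb enormN.
have pN z : pw k (- z) = pw k z by rewrite /pw nsqN.
have i3 : ig mu (fun z => off_ball e z * (F x - F (x + z)) * pw k z).
  by apply: ig_ext (ig_opp i1) => z; rewrite oN pN opprK.
have e3 : \int[mu]_z (off_ball e z * (F x - F (x + z)) * pw k z) = \int[mu]_z (off_ball e z * (F x - F (x - z)) * pw k z).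
  by rewrite -(Rint_opp i1); apply: eq_Rint => z; rewrite oN pN opprK.
rewrite (eq_Rint_to (f := fun z => off_ball e z * sdiff F x z * pw k z) (g := fun z => off_ball e z * (F x - F (x + z)) * pw k z + off_ball e z * (F x - F (x - z)) * pw k z)); last first.
  by move=> z; rewrite /sdiff; ring.
by rewrite (RintD i3 i1) e3; move: (\int[mu]_z _) => I; field.
Qed.

(** The second difference compensates the singularity, so the principal value is an absolutely
    convergent integral; given convergence, the limit may be computed along [sj]. *)
Lemma halflapE x : cvg (halflap_trunc F x @ at_right 0) -> halflap F x = Ch k / 2 * LI k F x.
Proof.
move=> cv; have sd : @sj R @ \oo --> at_right 0.
  move=> P [e /= e0 He]; have cs : @sj R @ \oo --> (0 : R) by exact: cvg_harmonic.
  have /cvgrPdist_lt /(_ e e0) [N _ HN] := cs.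
  by exists N => // j Nj; apply: He; [exact: HN|exact: sj_gt0].
have c1 : (fun j => halflap_trunc F x (sj j)) @ \oo --> halflap F x := cvg_comp _ _ sd cv.
have [B [G HG]] := wF_dom n3 nk FC Fo (enorm_ge0 x); have [g1 g2 g3] := HG x (lexx _).
have E j : halflap_trunc F x (sj j) = Ch k / 2 * \int[mu]_z (off_ball (sj j) z * sdiff F x z * pw k z).
  by rewrite halflap_truncE ?sj_gt0.
have c2 : (fun j => \int[mu]_z (off_ball (sj j) z * sdiff F x z * pw k z)) @ \oo --> LI k F x.
  have [||j z z0|z z0|_ H] := @Rint_dct0 R n n0 (fun j z => off_ball (sj j) z * sdiff F x z * pw k z) (fun z => sdiff F x z * pw k z) (G x); last exact: H.
  - move=> j; apply: measurable_funM; last exact: measurable_pw.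
    by apply: measurable_funM; [exact: measurable_off_ball|exact: measurable_sdiff].
  - exact: g1.
  - apply: le_trans (g3 z z0); have o01 := off_ball_le1 (sj j) z; case/andP: o01 => o0 o1.
    by rewrite -mulrA normrM (ger0_norm o0) ler_piMl.
  - apply: cvg_near_cst.
    have ez : 0 < enorm z by apply: enorm_gt0.
    have cs : @sj R @ \oo --> (0 : R) by exact: cvg_harmonic.
    have /cvgr0Pnorm_lt /(_ _ ez) := cs; apply: filterS => j; rewrite gtr0_norm ?sj_gt0// => jz.
    by rewrite /off_ball inb0// subr0 mul1r.
have c3 : (fun j => halflap_trunc F x (sj j)) @ \oo --> Ch k / 2 * LI k F x.
  by rewrite (funext E); apply: cvgM; [exact: cvg_cst|exact: c2].
exact: (cvg_unique _ c1 c3).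
Qed.

End principal_value.

(** * Normalising constants *)

Section constants.
Context {R : realType}.

Lemma odd_product k : (\prod_(i < k) (2 * i%:R + 1)) * (2 ^+ k * k`!%:R) = (2 * k)`!%:R :> R.
Proof.
elim: k => [|k IH]; first by rewrite big_ord0 !mul1r muln0 fact0.
rewrite big_ord_recr/= (_ : (2 * k.+1)%N = (2 * k).+2); last by lia.
rewrite !factS !natrM -IH exprS -!natr1 natrM.
by move: (\prod_(i < k) _) (2 ^+ k : R) (k`!%:R : R) (k%:R : R) => p q f c; ring.
Qed.

Lemma sphere_vol_even k : sphere_vol (2 * k) * \prod_(i < k) (2 * i%:R + 1) = 2 * (2 * pi) ^+ k :> R.
Proof.
elim: k => [|k IH]; first by rewrite big_ord0 muln0 expr0 !mulr1.
rewrite (_ : (2 * k.+1)%N = (2 * k).+2); last by lia.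
rewrite big_ord_recr/= exprS.
have c : (2 * k).+1%:R = 2 * k%:R + 1 :> R by rewrite -natr1 natrM.
have c0 : 2 * k%:R + 1 != 0 :> R by rewrite -c pnatr_eq0.
rewrite c [RHS](_ : _ = 2 * pi * (2 * (2 * pi) ^+ k)); last by ring.
rewrite -IH; move: (sphere_vol (2 * k)) (\prod_(i < k) _) (2 * k%:R + 1) c0 (pi : R) => s p d d0 q.
by field.
Qed.

Lemma sphere_vol_odd k : sphere_vol (2 * k).+1 = 2 * pi ^+ k.+1 / k`!%:R :> R.
Proof.
elim: k => [|k IH]; first by rewrite muln0/= expr1 fact0 divr1.
rewrite (_ : (2 * k.+1).+1%N = (2 * k).+3); last by lia.
rewrite [LHS]/= -/(sphere_vol (2 * k).+1) IH factS natrM [pi ^+ k.+2]exprS.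
have c : (2 * k).+2%:R = 2 * k.+1%:R :> R by rewrite -natrM; congr (_%:R); lia.
have k1 : k.+1%:R != 0 :> R by rewrite pnatr_eq0.
have f0 : k`!%:R != 0 :> R by rewrite pnatr_eq0 -lt0n fact_gt0.
by rewrite c; move: (pi ^+ k.+1 : R) (pi : R) (k.+1%:R : R) (k`!%:R : R) k1 f0 => p q d f d0 e0; field; rewrite d0 e0.
Qed.

(** For [j >= 1], the constant in [(- lap)^j (- ln |x|) = chain n j * |x|^(-2 j)] away from the
    origin. *)
Definition chain (n j : nat) : R := \prod_(i < j) (n%:R - 2 - 2 * i%:R) * \prod_(i < j.-1) (2 * i.+1%:R).

Lemma chain1 n : chain n 1 = n%:R - 2.
Proof. by rewrite /chain big_ord_recr !big_ord0/= mul1r mulr1 mulr0 subr0. Qed.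

Lemma chainS n j : chain n j.+2 = chain n j.+1 * (2 * j.+1%:R * (n%:R - 2 * j.+1%:R - 2)).
Proof.
rewrite /chain/= [in LHS]big_ord_recr/= [X in _ * X]big_ord_recr/=.
by move: (\prod_(i < j.+1) _) (\prod_(i < j) _) => a b; ring.
Qed.

Lemma double_product k : \prod_(i < k) (2 * i.+1%:R) = 2 ^+ k * k`!%:R :> R.
Proof.
elim: k => [|k IH]; first by rewrite big_ord0 mul1r.
by rewrite big_ord_recr/= IH exprS factS natrM; ring.
Qed.

(** The right side is [Ch k / (2 k)] with [Ch k = 1 / m0], the factor for which the order-one
    potential in [half_laplacian_inverse] reproduces [F] up to a constant. *)
Lemma constant_odd k : (0 < k)%N ->
  2 / ((2 * k)`!%:R * sphere_vol (2 * k).+1) * chain (2 * k).+1 k = k`!%:R / pi ^+ k.+1 / (2 * k%:R) :> R.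
Proof.
case: k => // j _; rewrite sphere_vol_odd /chain double_product.
have -> : \prod_(i < j.+1) ((2 * j.+1).+1%:R - 2 - 2 * i%:R) = \prod_(i < j.+1) (2 * i%:R + 1) :> R.
  rewrite [RHS](reindex_inj rev_ord_inj)/=; apply: eq_bigr => i _.
  rewrite natrB; last by have := ltn_ord i; lia.
  by rewrite -[(2 * j.+1).+1%:R]natr1 natrM -[j.+1%:R]natr1 -[i.+1%:R]natr1; ring.
rewrite -odd_product exprS factS natrM.
have p0 : \prod_(i < j.+1) (2 * i%:R + 1) != 0 :> R.
  by apply/prodf_neq0 => i _; rewrite gt_eqF// ltr_pwDr// mulr_ge0.
have f0 : j`!%:R != 0 :> R by rewrite pnatr_eq0 -lt0n fact_gt0.
have q0 : pi ^+ j.+2 != 0 :> R by rewrite expf_neq0// gt_eqF// pi_gt0.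
have k1 : j.+1%:R != 0 :> R by rewrite pnatr_eq0.
have t0 : 2 ^+ j != 0 :> R by rewrite expf_neq0.
move: (\prod_(i < j.+1) _) (pi ^+ j.+2 : R) (j`!%:R : R) (j.+1%:R : R) (2 ^+ j : R) p0 f0 q0 k1 t0 => p q f c t p0 f0 q0 k1 t0.
by field; rewrite p0 f0 q0 k1 t0.
Qed.

(** The normalisation cancels the chain of constants and the mass of the fundamental solution, so
    that [n / 2] applications of [- lap] to the potential give back the density. *)
Lemma constant_even j :
  2 / ((2 * j.+2).-1`!%:R * sphere_vol (2 * j.+2)) * (chain (2 * j.+2) j.+1 * (4 * j.+1%:R * j.+2%:R * (pi ^+ j.+2 / j.+2`!%:R))) = 1 :> R.
Proof.
have E : \prod_(i < j.+1) ((2 * j.+2)%:R - 2 - 2 * i%:R) = 2 ^+ j.+1 * j.+1`!%:R :> R.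
  rewrite -double_product [LHS](reindex_inj rev_ord_inj)/=; apply: eq_bigr => i _.
  rewrite natrB; last by have := ltn_ord i; lia.
  by rewrite natrM -[j.+2%:R]natr1 -[j.+1%:R]natr1 -[i.+1%:R]natr1; ring.
pose P : R := \prod_(i < j.+2) (2 * i%:R + 1).
have S1 : sphere_vol (2 * j.+2) * P = 2 * (2 * pi) ^+ j.+2 := sphere_vol_even j.+2.
have S2 : P * (2 ^+ j.+2 * j.+2`!%:R) = (2 * j.+2)`!%:R := odd_product j.+2.
have f0 : j`!%:R != 0 :> R by rewrite pnatr_eq0 -lt0n fact_gt0.
have c0 : j.+1%:R != 0 :> R by rewrite pnatr_eq0.
have d0 : j.+2%:R != 0 :> R by rewrite pnatr_eq0.
have p0 : pi ^+ j.+2 != 0 :> R by rewrite expf_neq0// gt_eqF// pi_gt0.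
have t0 : 2 ^+ j != 0 :> R by rewrite expf_neq0.
have FS : (2 * j.+2).-1`!%:R * sphere_vol (2 * j.+2) = (2 * pi) ^+ j.+2 * 2 ^+ j.+2 * j.+1`!%:R :> R.
  have S3 : 2 * j.+2%:R * (2 * j.+2).-1`!%:R = P * (2 ^+ j.+2 * j.+2`!%:R).
    by rewrite S2 -natrM -natrM; congr (_%:R); rewrite -[in RHS](@prednK (2 * j.+2)) ?factS// prednK.
  apply: (@mulfI _ (2 * j.+2%:R)); first by rewrite mulf_neq0.
  rewrite mulrA S3 [j.+2`!]factS natrM; clear S2 S3; clearbody P; move: S1.
  move: (sphere_vol (2 * j.+2)) P ((2 * pi) ^+ j.+2 : R) (2 ^+ j.+2 : R) (j.+1`!%:R : R) (j.+2%:R : R) => s p q t f d H.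
  by rewrite (_ : p * (t * (d * f)) * s = (s * p) * (t * (d * f))); [rewrite H; ring|ring].
have e1 : 2 ^+ j.+1 = 2 * 2 ^+ j :> R by rewrite exprS.
have e2 : 2 ^+ j.+2 = 2 * (2 * 2 ^+ j) :> R by rewrite !exprS.
have g1 : j.+1`!%:R = j.+1%:R * j`!%:R :> R by rewrite factS natrM.
have g2 : j.+2`!%:R = j.+2%:R * (j.+1%:R * j`!%:R) :> R by rewrite factS natrM g1.
rewrite FS /chain E double_product exprMn e1 e2 g2 g1.
move: (pi ^+ j.+2 : R) (j`!%:R : R) (j.+1%:R : R) (j.+2%:R : R) (2 ^+ j : R) p0 f0 c0 d0 t0 => p f c d t p0 f0 c0 d0 t0.
by field; rewrite p0 f0 c0 d0 t0.
Qed.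

End constants.

(** * Iterated potentials, remainders and the representation formula *)

Section final.
Context {R : realType} {n : nat}.
Hypothesis n3 : (2 < n)%N.
Notation V := 'rV[R]_n.
Notation mu := (@volm R n).
Implicit Types (x y z : V).

Lemma wlapZ (c : R) (h h' : V -> R) : loc_ig h -> loc_ig h' -> wlap h h' -> wlap (fun x => c * h x) (fun x => c * h' x).
Proof.
move=> lh lh' H phi tp; have [r [M [[mp cp bp] [ml cl bl] _]]] := testfun_bounds tp.
have i1 := loc_ig_mul lh ml cl bl; have i2 := loc_ig_mul lh' mp cp bp.
rewrite (eq_Rint_to (f := fun y => c * h y * lap phi y) (g := fun y => c * (h y * lap phi y))); last by move=> y; rewrite mulrA.
rewrite (eq_Rint_to (f := fun y => c * h' y * phi y) (g := fun y => c * (h' y * phi y))); last by move=> y; rewrite mulrA.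
by rewrite (RintZl _ i1) (RintZl _ i2) H// mulrN.
Qed.

Lemma Ck_neglap_pow (u : V -> R) j : smooth u -> forall l, Ck l (neglap_pow j u).
Proof.
move=> us; elim: j => [|j IH] l; first exact: smooth_Ck.
have -> : neglap_pow j.+1 u = fun x => - (\sum_i partial i (partial i (neglap_pow j u)) x) by [].
by apply: CkN; apply: Ck_sum => i; apply: Ck_partial; apply: Ck_partial; exact: IH.
Qed.

Lemma L1_ig (g : V -> R) : measurable_fun setT g -> L1 g -> ig mu g.
Proof.
move=> mg lg; have mg' : measurable_fun setT (fun x => (g x)%:E) by exact/measurable_EFinP.
by have [] := intRn_integral mg' lg.
Qed.

Lemma ig_L1 (g : V -> R) : ig mu g -> L1 g.
Proof.
move=> ig_; have mg := ig_measurable ig_; have /integrableP[_] := ig_.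
rewrite integral_volm//; last by apply/measurable_EFinP; exact: measurableT_comp.
Qed.

Variables u f : V -> R.
Hypothesis us : smooth u.
Hypothesis fi : ig mu f.
Hypothesis fb : forall r : R, exists M : R, 0 <= M /\ forall y, enorm y <= r -> `|f y| <= M.
Variable c : R.

(** [(- lap)^j] of [c] times the logarithmic potential, in closed form as a Riesz potential; the
    identity holds weakly while [2 j < n]. *)
Definition iterated_potential j x : R :=
  if j is i.+1 then c * chain n i.+1 * conv f (sg 0 (- i.+1%:R)) x else c * vlog f x.

Lemma loc_ig_potential j : (2 * j < n)%N -> loc_ig (iterated_potential j).
Proof.
case: j => [|j] jn; apply: loc_igZ; first by have [] := vlog_spec n3 fi fb.
by have [] := conv_spec fi fb (kernel_sg (R := R) n3 jn).
Qed.

Lemma wlap_potential j : (2 * j + 2 < n)%N -> wlap (iterated_potential j) (iterated_potential j.+1).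
Proof.
case: j => [|j] jn.
  have -> : iterated_potential 1 = fun x => c * ((n%:R - 2) * conv f (sg 0 (- 1%:R)) x).
    by apply/funext => x; rewrite /iterated_potential chain1 mulrA.
  have [lv _] := vlog_spec n3 fi fb.
  have lc : loc_ig (conv f (sg 0 (- 1%:R))) by have [] := conv_spec fi fb (kernel_sg (R := R) (j := 1) n3 n3).
  refine (wlapZ c lv (loc_igZ _ lc) (wlap_vlog n3 fi fb)).
have j1 : (2 * j.+1 < n)%N by apply: leq_ltn_trans jn; lia.
have j2 : (2 * j.+2 < n)%N by apply: leq_ltn_trans jn; lia.
have -> : iterated_potential j.+2 = fun x => c * chain n j.+1 * (2 * j.+1%:R * (n%:R - 2 * j.+1%:R - 2) * conv f (sg 0 (- j.+2%:R)) x).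
  by apply/funext => x; rewrite /iterated_potential chainS !mulrA.
apply: wlapZ.
- by have [] := conv_spec fi fb (kernel_sg (R := R) n3 j1).
- by apply: loc_igZ; have [] := conv_spec fi fb (kernel_sg (R := R) n3 j2).
- apply: (wlap_conv fi fb (kernel_sg (R := R) n3 j1) (kernel_sg (R := R) n3 j2)) => psi tp.
  exact: (riesz_power n3 jn tp).
Qed.

Definition remainder j x : R := neglap_pow j u x - iterated_potential j x.

Lemma loc_ig_remainder j : (2 * j < n)%N -> loc_ig (remainder j).
Proof.
move=> jn; apply: loc_igB; last exact: loc_ig_potential.
by apply: loc_ig_cont; exact: (@Ck_cont _ _ 0) (Ck_neglap_pow j us 0).
Qed.

Lemma wlap_remainder j : (2 * j + 2 < n)%N -> wlap (remainder j) (remainder j.+1).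
Proof.
move=> jn; have l (i : nat) : loc_ig (neglap_pow i u) by apply: loc_ig_cont; exact: (@Ck_cont _ _ 0) (Ck_neglap_pow i us 0).
apply: wlapB; [exact: l|exact: l| | | |exact: wlap_potential].
- by apply: loc_ig_potential; apply: leq_ltn_trans jn; lia.
- by apply: loc_ig_potential; apply: leq_ltn_trans jn; lia.
- exact: (wlap_smooth (Ck_neglap_pow j us 2)).
Qed.

(** Parity enters through the last hypothesis, that the last remainder is weakly harmonic: in odd
    dimension it is constant, in even dimension the last potential has the fundamental solution as
    kernel. *)
Lemma representation (m : nat) (D : R) : (1 < m)%N -> (2 * m.-1 < n)%N -> 0 < D -> (forall x, - D <= scal u x) ->
  (forall j, (j < m.-1)%N -> (2 * j + 2 < n)%N) -> wlap (remainder m.-1) (fun=> 0) ->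
  exists P : mpoly.mpoly n R, [/\ ~~ odd (pdeg P), (pdeg P <= n.-1)%N,
    (exists C : R, 0 < C /\ forall x, - C * ln (enorm x + 2) <= peval P x) &
    forall x, u x = c * vlog f x + peval P x].
Proof.
move=> m1 mn D0 sD jn w0.
have [K [K0 uK]] := u_lower_bound n3 (smooth_Ck 2 us) D0 sD.
have uc : continuous u by exact: (@Ck_cont _ _ 0) (smooth_Ck 0 us).
(* Cut off at index [m], so that the sequence ends with 0 as the polyharmonic lemmas require. *)
pose h j := if (j < m)%N then remainder j else fun=> 0.
have h0 x : h 0%N x = u x - c * vlog f x by rewrite /h (ltn_trans _ m1).
have lh j : (j < m)%N -> loc_ig (h j).
  by move=> jm; rewrite /h jm; apply: loc_ig_remainder; apply: leq_ltn_trans mn; lia.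
have wh j : (j < m)%N -> wlap (h j) (h j.+1).
  move=> jm; rewrite /h jm; case: ifPn => jm'; first by apply: wlap_remainder; apply: jn; lia.
  by have -> : j = m.-1 by lia.
have hm y : h m y = 0 by rewrite /h ltnn.
have Ph := polynomial_part n3 fi fb m1 mn uc K0 uK h0 lh wh hm.
have [C [C0 HC]] := polynomial_lower_bound n3 fi fb Ph uc K0 uK h0.
have [P [dP PE]] := Ph; have HP x : - C * ln (enorm x + 2) <= peval P x by rewrite -PE.
exists P; split.
- exact: even_pdeg C0 HP.
- by apply: leq_trans dP _; lia.
- by exists C.
- by move=> x; rewrite -PE h0 addrC subrK.
Qed.

End final.

(** * Odd and even dimensions, and the conclusion *)

Section cases.
Context {R : realType} {n : nat}.
Hypothesis n3 : (2 < n)%N.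
Notation V := 'rV[R]_n.
Notation mu := (@volm R n).
Notation norm_cst := (2 / ((n.-1)`!%:R * sphere_vol n) : R).
Implicit Types (x y z : V).
Variable u : V -> R.
Hypothesis us : smooth u.

Lemma one_plus_pow (q : R) j : 0 <= q -> 1 + q ^+ j.+1 <= (q + 1) ^+ j.+1.
Proof.
move=> q0; elim: j => [|j IH]; first by rewrite !expr1 addrC.
rewrite [leRHS]exprS; apply: le_trans (ler_wpM2l (addr_ge0 q0 ler01) IH).
rewrite [q ^+ j.+2]exprS mulrDl mul1r mulrDr mulr1.
have p0 : 0 <= q ^+ j.+1 by rewrite exprn_ge0.
by move: (q ^+ j.+1) p0 (q * q ^+ j.+1) => p p0 r; lra.
Qed.

Lemma Lhalf_om k (F : V -> R) : n = (2 * k).+1 -> continuous F -> Lhalf F -> ig mu (fun y => F y * om k y).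
Proof.
move=> nk cF lF; have mF := measurable_continuous cF.
have nE : n.+1 = (2 * k.+1)%N by rewrite nk; lia.
have d0 y : 0 < 1 + enorm y ^+ n.+1 by rewrite ltr_pwDl// exprn_ge0// enorm_ge0.
have cd : continuous (fun y : V => 1 + enorm y ^+ n.+1).
  apply: contD; first exact: cont_cst.
  by apply: (cont_comp (g := fun t : R => t ^+ n.+1)); [exact: continuous_enorm|exact: exprn_continuous].
have cg : continuous (fun y => F y * (1 + enorm y ^+ n.+1)^-1).
  apply: contM => // y; apply: (@continuous_comp _ _ _ (fun y : V => 1 + enorm y ^+ n.+1) (fun t : R => t^-1)); first exact: cd.
  by apply: cvgV; [rewrite gt_eqF|exact: cvg_id].
have i1 : ig mu (fun y => F y * (1 + enorm y ^+ n.+1)^-1).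
  apply: L1_ig; first exact: measurable_continuous.
  by rewrite /L1 (_ : (fun x => _) = (fun x => (`|F x| / (1 + enorm x ^+ n.+1))%:E))//; apply/funext => y; rewrite normrM [X in _ * X]gtr0_norm ?invr_gt0.
apply: (ig_le (ig_abs i1)).
  by apply: measurable_funM => //; apply: measurable_continuous; exact: continuous_om.
move=> y; rewrite !normrM ler_wpM2l// (gtr0_norm (om_gt0 k y)) gtr0_norm ?invr_gt0//.
rewrite /om exprVn lef_pV2 ?posrE//; first by rewrite nE exprM sqr_enorm one_plus_pow// nsq_ge0.
by rewrite exprn_gt0// ltr_wpDl ?nsq_ge0.
Qed.

(** Here [m = k + 1]. The remainder of index [k] is [F] minus a normalised order-one potential of
    its half-Laplacian, which is constant by [half_laplacian_inverse]. *)
Lemma odd_case k (D : R) : n = (2 * k).+1 -> 0 < D -> (forall x, - D <= scal u x) ->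
  Lhalf (neglap_pow k u) -> (forall x, cvg (halflap_trunc (neglap_pow k u) x @ at_right 0)) ->
  L1 (halflap (neglap_pow k u)) ->
  [/\ ig mu (halflap (neglap_pow k u)),
    (forall r : R, exists M : R, 0 <= M /\ forall y, enorm y <= r -> `|halflap (neglap_pow k u) y| <= M) &
    exists P : mpoly.mpoly n R, [/\ ~~ odd (pdeg P), (pdeg P <= n.-1)%N,
    (exists C : R, 0 < C /\ forall x, - C * ln (enorm x + 2) <= peval P x) &
    forall x, u x = norm_cst * vlog (halflap (neglap_pow k u)) x + peval P x]].
Proof.
move=> nk D0 sD lF cvF l1; have k0 : (0 < k)%N by move: n3; rewrite nk; lia.
pose F := neglap_pow k u; have FC : Ck 2 F := Ck_neglap_pow k us 2.
have Fo : ig mu (fun y => F y * om k y) by apply: Lhalf_om => //; exact: Ck_cont FC.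
have fE : halflap F = fun x => Ch k / 2 * LI k F x.
  apply/funext => x; refine (halflapE n3 nk FC Fo (cvF x)).
have C0 : 0 < Ch k :> R by exact: Ch_gt0.
have fi : ig mu (halflap F).
  by apply: L1_ig => //; rewrite fE; apply: measurable_funM; [exact: measurable_cst|exact: (measurable_LI n3 nk FC Fo)].
have Li : ig mu (LI k F).
  by apply: ig_ext (igZl (Ch k / 2)^-1 fi) => x; rewrite fE mulKf// gt_eqF// divr_gt0.
have fb (r : R) : exists M : R, 0 <= M /\ forall y, enorm y <= r -> `|halflap F y| <= M.
  have [M [M0 HM]] := LI_bounded n3 nk FC Fo r.
  exists (Ch k / 2 * M); split; first by rewrite mulr_ge0// ltW// divr_gt0.
  have C2 : 0 < Ch k / 2 :> R by rewrite divr_gt0.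
  move=> y yr; rewrite fE normrM (gtr0_norm C2); apply: ler_wpM2l; [exact: ltW|exact: HM].
split => //; apply: (@representation R n n3 u (halflap F) us fi fb norm_cst k.+1 D) => //.
- by rewrite nk/=; lia.
- by move=> j jk; rewrite nk; lia.
have cE : norm_cst * chain n k = Ch k / (2 * k%:R) by rewrite nk; exact: constant_odd.
have kn : (2 * k < n)%N by rewrite nk.
have kk := kernel_sg (R := R) n3 kn.
have convE x : conv (halflap F) (sg 0 (- k%:R)) x = Ch k / 2 * potential k F x.
  have [M [M0 HM]] := LI_bounded n3 nk FC Fo (enorm x + 1).
  have [i1 _] := kernel_section kk Li M0 HM (lexx _).
  by rewrite /potential -(RintZl _ i1) /conv fE; apply: eq_Rint => y; rewrite mulrCA.
have rE x : remainder u (halflap F) norm_cst k x = F x - Ch k / (2 * k%:R) * (Ch k / 2 * potential k F x).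
  by rewrite /remainder -convE -cE; congr (_ - _); case: (k) k0.
have rc x : remainder u (halflap F) norm_cst k x = remainder u (halflap F) norm_cst k 0.
  rewrite !rE; have := half_laplacian_inverse n3 nk FC Fo Li x 0.
  have p0 : pi ^+ k.+1 != 0 :> R by rewrite expf_neq0// gt_eqF// pi_gt0.
  have f0 : k`!%:R != 0 :> R by rewrite pnatr_eq0 -lt0n fact_gt0.
  have kn0 : k%:R != 0 :> R by rewrite pnatr_eq0 -lt0n.
  rewrite /Ch; move: (potential k F x) (potential k F 0) (F x) (F 0) (pi ^+ k.+1 : R) (k`!%:R : R) (k%:R : R) p0 f0 kn0.
  move=> a b c d p f q p0 f0 q0 H.
  have -> : c - f / p / (2 * q) * (f / p / 2 * a) = - (a - 4 * q * (p / f) ^+ 2 * c) / (4 * q * (p / f) ^+ 2).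
    by field; rewrite p0 f0 q0.
  by rewrite H; field; rewrite p0 f0 q0.
rewrite [k.+1.-1]/= (_ : remainder _ _ _ k = fun=> remainder u (halflap F) norm_cst k 0); last exact/funext.
have E (C : R) : (fun y : V => - lap (fun _ : V => C) y) = (fun=> 0).
  by apply/funext => y; rewrite lap_cst oppr0.
by have := wlap_smooth (Ck_cst (n := n) 2 (remainder u (halflap F) norm_cst k 0)); rewrite E.
Qed.

(** Here [m = j + 2 = n / 2]. The last potential has the critical power, so [- lap] of it returns
    the density ([riesz_critical], [constant_even]) and cancels the one coming from [u]. *)
Lemma even_case j (D : R) : n = (2 * j.+2)%N -> 0 < D -> (forall x, - D <= scal u x) ->
  L1 (neglap_pow j.+2 u) ->
  [/\ ig mu (neglap_pow j.+2 u),
    (forall r : R, exists M : R, 0 <= M /\ forall y, enorm y <= r -> `|neglap_pow j.+2 u y| <= M) &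
    exists P : mpoly.mpoly n R, [/\ ~~ odd (pdeg P), (pdeg P <= n.-1)%N,
    (exists C : R, 0 < C /\ forall x, - C * ln (enorm x + 2) <= peval P x) &
    forall x, u x = norm_cst * vlog (neglap_pow j.+2 u) x + peval P x]].
Proof.
move=> nj D0 sD l1; have cf : continuous (neglap_pow j.+2 u) := Ck_cont (Ck_neglap_pow j.+2 us 0).
have fi : ig mu (neglap_pow j.+2 u) by apply: L1_ig => //; exact: measurable_continuous.
have fb (r : R) : exists M : R, 0 <= M /\ forall y, enorm y <= r -> `|neglap_pow j.+2 u y| <= M.
  exact: bounded_on_ball.
split => //; apply: (@representation R n n3 u _ us fi fb norm_cst j.+2 D) => //.
- by rewrite nj/=; lia.
- by move=> i ij; rewrite nj; lia.
have jn : (2 * j.+1 < n)%N by rewrite nj; lia.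
have kk := kernel_sg (R := R) n3 jn.
pose b : R := 4 * j.+1%:R * j.+2%:R * (pi ^+ j.+2 / j.+2`!%:R).
have w1 : wlap (conv (neglap_pow j.+2 u) (sg 0 (- j.+1%:R))) (fun x => b * neglap_pow j.+2 u x).
  have H (psi : V -> R) (tp : testfun psi) := riesz_critical n3 nj tp.
  refine (wlap_conv_dirac fi fb kk H).
have lc := (conv_spec fi fb kk).1.
have lf : loc_ig (neglap_pow j.+2 u) by exact: loc_ig_cont.
have w2 := wlapZ (norm_cst * chain n j.+1) lc (loc_igZ b lf) w1.
have lj : loc_ig (neglap_pow j.+1 u) by apply: loc_ig_cont; exact: Ck_cont (Ck_neglap_pow j.+1 us 0).
have w3 := wlap_smooth (Ck_neglap_pow j.+1 us 2).
have w4 := wlapB lj lf (loc_igZ _ lc) (loc_igZ _ (loc_igZ b lf)) w3 w2.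
have cE : norm_cst * chain n j.+1 * b = 1 by rewrite -mulrA nj; exact: constant_even.
have E : (fun=> 0) = (fun x => neglap_pow j.+2 u x - norm_cst * chain n j.+1 * (b * neglap_pow j.+2 u x)).
  by apply/funext => x; rewrite mulrA cE mul1r subrr.
by rewrite E; exact: w4.
Qed.

Lemma conclude (f : V -> R) (P : mpoly.mpoly n R) : ig mu f ->
  (forall r : R, exists M : R, 0 <= M /\ forall y, enorm y <= r -> `|f y| <= M) ->
  (forall x, u x = norm_cst * vlog f x + peval P x) -> (forall x, Qcurv u x * expR (n%:R * u x) = f x) ->
  forall x, L1 (fun y => ln (enorm y / enorm (x - y)) * (Qcurv u y * expR (n%:R * u y))) /\
    u x = norm_cst * fine (intRn (fun y =>
      (ln (enorm y / enorm (x - y)) * (Qcurv u y * expR (n%:R * u y)))%:E)) + peval P x.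
Proof.
move=> fi fb uE QE x; have il := ig_lk n3 fi fb x.
have E : (fun y => ln (enorm y / enorm (x - y)) * (Qcurv u y * expR (n%:R * u y))) = (fun y => lk x y * f y).
  by apply/funext => y; rewrite QE.
split; first by rewrite E; exact: ig_L1.
have E' : (fun y => (ln (enorm y / enorm (x - y)) * (Qcurv u y * expR (n%:R * u y)))%:E) = (fun y => (lk x y * f y)%:E).
  by apply/funext => y; rewrite QE.
by rewrite E' (intRn_integrable il) uE.
Qed.

End cases.

Theorem theorem1p3 (R : realType) (n : nat) (u : 'rV[R]_n -> R) :
  (3 <= n)%N ->
  smooth u ->
  complete_metric u ->
  finite_total_Q u ->
  (exists C : R, 0 < C /\ forall x, - C <= scal u x) ->
  exists P : mpoly.mpoly n R,
    [/\ ~~ odd (pdeg P), (pdeg P <= n.-1)%N,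
        (exists C' : R, 0 < C' /\ forall x, - C' * ln (enorm x + 2) <= peval P x) &
        forall x : 'rV[R]_n,
          L1 (fun y => ln (enorm y / enorm (x - y)) * (Qcurv u y * expR (n%:R * u y))) /\
          u x = 2 / ((n.-1)`!%:R * sphere_vol n) *
                fine (intRn (fun y =>
                   (ln (enorm y / enorm (x - y)) * (Qcurv u y * expR (n%:R * u y)))%:E))
                + peval P x].
Proof.
move=> n3 us _ [Qd Q1] [D [D0 sD]].
have QE x : Qcurv u x * expR (n%:R * u x) = Qlap u x.
  by rewrite /Qcurv mulrAC -expRD addNr expR0 mul1r.
have l1 : L1 (Qlap u) by rewrite -(funext QE).
case: (boolP (odd n)) => on.
  have nk : n = (2 * n./2).+1 by rewrite mul2n -[LHS]odd_double_half on.
  have QH : Qlap u = halflap (neglap_pow n./2 u) by rewrite /Qlap on.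
  have [lF cvF] := Qd on; rewrite QH in l1.
  have [fi fb [P [P1 P2 P3 P4]]] := odd_case n3 us nk D0 sD lF cvF l1.
  exists P; split => //; apply: (conclude n3 fi fb P4) => x; by rewrite QE QH.
(* An even [n >= 3] is at least 4, so [n / 2] has the form [j + 2]. *)
have nj : n = (2 * (n./2).-2.+2)%N.
  have := odd_double_half n; rewrite (negbTE on) add0n -mul2n => E.
  have : (1 < n./2)%N by move: n3; rewrite -[X in (_ <= X)%N]E; lia.
  by case: (n./2) E => [|[|j]].
have hE : n./2 = (n./2).-2.+2 by rewrite {1}nj mul2n doubleK.
have QH : Qlap u = neglap_pow (n./2).-2.+2 u by rewrite /Qlap (negbTE on) {1}hE.
rewrite QH in l1; have [fi fb [P [P1 P2 P3 P4]]] := even_case n3 us nj D0 sD l1.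
exists P; split => //; apply: (conclude n3 fi fb P4) => x; by rewrite QE QH.
Qed.
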